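(* Let $\alpha,\sigma,\beta$ and, for $b_0\in\mathbb N$, the sets $\Omega$ and $\mathcal K$ be as in the context. There exist $\theta>1$ (not depending on $b_0$) and $B$ such that for every integer $b_0\ge B$ the following holds. Let $\bar\omega\in\Omega^{\mathbb N}$, let $f\in\mathcal L^S_{\bar\omega}\cap\mathcal K$ (so $f$ is infinitely renormalizable of combinatorial type $\bar\omega$), and let $\Lambda$ be the closure of the union of the forward orbits of the two critical values $c_1^-$ and $c_1^+$ of $f$. Then: (1) $\Lambda$ is a Cantor set; (2) $\Lambda$ has Lebesgue measure zero; (3) the Hausdorff dimension of $\Lambda$ is strictly inside $(0,1)$; (4) the complement of the basin of attraction of $\Lambda$ has zero Lebesgue measure.
   Context: Lorenz maps. Fix $\alpha>1$. For $u,v\in[0,1]$, $c\in(0,1)$ let $Q(x)=u\bigl(1-(\frac{c-x}{c})^\alpha\bigr)$ for $x\in[0,c)$ and $Q(x)=1+v\bigl(-1+(\frac{x-c}{1-c})^\alpha\bigr)$ for $x\in(c,1]$. A $C^k$-Lorenz map $f=(u,v,c,\phi,\psi)$ is a map on $[0,1]\setminus\{c\}$ with $f=\phi\circ Q$ on $[0,c)$, $f=\psi\circ Q$ on $(c,1]$, where $\phi,\psi$ are orientation-preserving $C^k$-diffeomorphisms of $[0,1]$ (homeomorphisms if $k=0$). $\mathcal L^k$ is the set of these maps, and $\mathcal L^S\subset\mathcal L^3$ the subset of maps with negative Schwarzian derivative $\frac{D^3f}{Df}-\frac32\bigl(\frac{D^2f}{Df}\bigr)^2<0$. Put $\varepsilon(f)=1-c$,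 $c_1^-=\lim_{x\uparrow c}f(x)$, $c_1^+=\lim_{x\downarrow c}f(x)$ (the critical values); $f$ is nontrivial if $c_1^+<c<c_1^-$ (always assumed unless noted). Renormalization. $f$ is renormalizable if there is an interval $C\subsetneq[0,1]$ properly containing $c$ such that the first-return map $\tilde f$ to $C$ is affinely conjugate to a nontrivial Lorenz map; $C$ is chosen maximal. Let $L,R$ be the left and right components of $C\setminus\{c\}$; then $\tilde f=f^{a+1}$ on $L$ and $\tilde f=f^{b+1}$ on $R$ for some minimal positive integers $a,b$. The renormalization is $\mathcal Rf=h^{-1}\circ\tilde f\circ h$, with $h$ the orientation-preserving affine map of $[0,1]$ onto $C$. $f$ is renormalizable of monotone type $\omega=(0\,1^{a},1\,0^{b})$ if moreover $f^i(L)\subset(c,1)$ for $1\le i\le a$ and $f^j(R)\subset(0,c)$ for $1\le j\le b$. For $\bar\omega=(\omega_0,\omega_1,\dots)$, $f$ is infinitely renormalizable of combinatorial type $\bar\omega$ if $\mathcal R^nf$ is $\omega_n$-renormalizable for all $n\ge0$; the set of such maps in $\mathcal L^S$ is $\mathcal L^S_{\bar\omega}$. The sets $\Omega$, $\mathcal K$. Fix $\sigma\in(0,1)$ such that some integer $a$ satisfies $\alpha+\sigma\le a+1\le2\alpha-\sigma$, and $\beta\in(0,(\sigma/\alpha)^2)$. For $b_0\in\mathbb N$, $\Omega=\{(0\,1^a,1\,0^b):\alpha+\sigma\le a+1\le2\alpha-\sigma,\ b_0\le b\le(1+(\sigma/\alpha)^2-\beta)b_0\}$ ($a,b$ integers),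 and, with $\delta=(1/b_0)^2$, $\mathcal K=\{f\in\mathcal L^1:\alpha^{-b_0/\alpha}\le\varepsilon(f)\le\theta\alpha^{-b_0\sigma/\alpha^2},\ \mathrm{Dist}\,\phi\le\delta,\ \mathrm{Dist}\,\psi\le\delta\}$, where $\mathrm{Dist}\,\phi=\sup_{x,y}\log\frac{D\phi(x)}{D\phi(y)}$. The basin of attraction of $\Lambda$ is the set of $x\in[0,1]$ whose forward orbit is defined for all times and accumulates only on $\Lambda$ (i.e. the distance from $f^n(x)$ to $\Lambda$ tends to $0$). *)

(* Defs.v *)
From HB Require Import structures.
From mathcomp Require Import all_boot all_order all_algebra.
From mathcomp Require Import all_classical all_reals all_analysis.

Set Implicit Arguments.
Unset Strict Implicit.
Unset Printing Implicit Defensive.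

Import Order.TTheory GRing.Theory Num.Theory.
Import numFieldNormedType.Exports.

Local Open Scope classical_set_scope.
Local Open Scope ring_scope.

Section Smoothness.
Context {R : realType}.
Implicit Types (A : set R) (f : R -> R) (k : nat).

(* Derivatives are relative to a set A (one-sided at the end points of an
   interval), so only the values of f on A matter. *)
Definition derivable_in A f (x : R) : Prop :=
  cvg ((f y - f x) / (y - x) @[y --> within A x^']).

Definition derive_in A f (x : R) : R :=
  lim ((f y - f x) / (y - x) @[y --> within A x^']).

Definition derive_in_n k A f : R -> R := iter k (derive_in A) f.

Definition Ck_on k A f : Prop :=
  (forall i, (i < k)%N -> forall x, A x -> derivable_in A (derive_in_n i A f) x)
  /\ (forall i, (i <= k)%N -> {within A, continuous (derive_in_n i A f)}).

(* For k = 0 these are the orientation-preserving homeomorphisms of [0, 1]. *)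
Definition orientation_preserving_diffeo k (phi : R -> R) : Prop :=
  [/\ set_fun `[0, 1] `[0, 1] phi,
      Ck_on k `[0, 1] phi,
      {in `[0, 1] &, {homo phi : x y / x < y}} &
      exists phi' : R -> R,
        [/\ set_fun `[0, 1] `[0, 1] phi', Ck_on k `[0, 1] phi',
            {in `[0, 1], cancel phi phi'} & {in `[0, 1], cancel phi' phi}]].

Definition Dist (phi : R -> R) : \bar R :=
  ereal_sup [set (ln (derive_in `[0, 1] phi x / derive_in `[0, 1] phi y))%:E
            | x in `[0, 1] & y in `[0, 1]].

Definition schwarzian A f (x : R) : R :=
  derive_in_n 3 A f x / derive_in A f x
  - 3 / 2 * (derive_in_n 2 A f x / derive_in A f x) ^+ 2.

End Smoothness.

Section LorenzMaps.
Context {R : realType}.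

Record lorenz := Lorenz {
  lu : R; lv : R; lc : R; lphi : R -> R; lpsi : R -> R }.

Implicit Types (al : R) (f g : lorenz) (C : set R).

Definition ldom f : set R := `[0, 1] `\ lc f.

(* Total extension of the map; only its values on [ldom f] are meaningful,
   in particular the value at the discontinuity [lc f] is never used. *)
Definition lstd al f (x : R) : R :=
  if x < lc f then lu f * (1 - ((lc f - x) / lc f) `^ al)
  else 1 + lv f * (-1 + ((x - lc f) / (1 - lc f)) `^ al).

Definition lmap al f (x : R) : R :=
  if x < lc f then lphi f (lstd al f x) else lpsi f (lstd al f x).

Definition Lk (k : nat) : set lorenz :=
  [set f | [/\ 0 <= lu f <= 1, 0 <= lv f <= 1, 0 < lc f < 1,
               orientation_preserving_diffeo k (lphi f) &
               orientation_preserving_diffeo k (lpsi f)]].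

Definition LS al : set lorenz :=
  [set f | Lk 3 f
         /\ forall x, ldom f x -> schwarzian (ldom f) (lmap al f) x < 0].

Definition leps f : R := 1 - lc f.

Definition crit_left al f : R := lim (lmap al f x @[x --> (lc f)^'-]).
Definition crit_right al f : R := lim (lmap al f x @[x --> (lc f)^'+]).

Definition nontrivial al f : Prop :=
  crit_right al f < lc f < crit_left al f.

(* [n] is the first return time of [x] to C. When C contains [lc f] and x is in
   C minus [lc f], the orbit cannot meet [lc f] before time [n], so that the
   iterates below are those of the partial map. *)
Definition first_return_time al f C (x : R) (n : nat) : Prop :=
  [/\ (0 < n)%N, C (iter n (lmap al f) x) &
      forall m, (0 < m < n)%N -> ~ C (iter m (lmap al f) x)].

(* The first-return map to C = [p, q] is conjugate to the nontrivial Lorenz map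
   [g] by the affine map h from [0, 1] onto [p, q]. *)
Definition return_interval al f (p q : R) g : Prop :=
  let h t := p + (q - p) * t in
  [/\ 0 <= p < lc f, lc f < q <= 1 & ~ (p = 0 /\ q = 1)] /\
  [/\ Lk 0 g, nontrivial al g, h (lc g) = lc f &
      forall t, ldom g t -> exists n : nat,
        first_return_time al f `[p, q] (h t) n
        /\ iter n (lmap al f) (h t) = h (lmap al g t)].

Definition maximal_return_interval al f (p q : R) g : Prop :=
  return_interval al f p q g /\
  forall p' q' g', return_interval al f p' q' g' ->
    `[p, q]%classic `<=` `[p', q'] -> p' = p /\ q' = q.

(* The pair [w = (a, b)] encodes the monotone type (0 1^a, 1 0^b). *)
Definition monotone_renormalization al f (w : nat * nat) g : Prop :=
  exists p q : R,
    [/\ maximal_return_interval al f p q g,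
        (0 < w.1)%N /\ (0 < w.2)%N,
        forall x, p <= x < lc f ->
          first_return_time al f `[p, q] x w.1.+1
          /\ forall i, (1 <= i <= w.1)%N -> lc f < iter i (lmap al f) x < 1 &
        forall x, lc f < x <= q ->
          first_return_time al f `[p, q] x w.2.+1
          /\ forall j, (1 <= j <= w.2)%N -> 0 < iter j (lmap al f) x < lc f].

(* [F n] is the n-th renormalization of [f]. *)
Definition infinitely_renormalizable al (w : nat -> nat * nat) f : Prop :=
  exists F : nat -> lorenz, F 0%N = f /\
    forall n, monotone_renormalization al (F n) (w n) (F n.+1).

Definition LS_type al (w : nat -> nat * nat) : set lorenz :=
  [set f | [/\ LS al f, nontrivial al f & infinitely_renormalizable al w f]].

Definition Omega (al sg be : R) (b0 : nat) : set (nat * nat) :=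
  [set w | al + sg <= w.1.+1%:R <= 2 * al - sg
         /\ b0%:R <= (w.2%:R : R) <= (1 + (sg / al) ^+ 2 - be) * b0%:R].

Definition calK (al sg th : R) (b0 : nat) : set lorenz :=
  [set f | [/\ Lk 1 f,
     al `^ (- (b0%:R / al)) <= leps f
       <= th * al `^ (- (b0%:R * sg / al ^+ 2)),
     (Dist (lphi f) <= ((1 / b0%:R) ^+ 2)%:E)%E &
     (Dist (lpsi f) <= ((1 / b0%:R) ^+ 2)%:E)%E]].

(* The orbit stops if it reaches the discontinuity. *)
Definition forward_orbit al f (x : R) : set R :=
  [set y | exists n : nat, y = iter n (lmap al f) x
         /\ forall m, (m < n)%N -> iter m (lmap al f) x <> lc f].

Definition attractor al f : set R :=
  closure (forward_orbit al f (crit_left al f)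
           `|` forward_orbit al f (crit_right al f)).

Definition basin al f (L : set R) : set R :=
  [set x | [/\ x \in `[0, 1],
     forall n, iter n (lmap al f) x <> lc f &
     edist_inf L (iter n (lmap al f) x) @[n --> \oo] --> 0%E]].

End LorenzMaps.
Arguments lorenz : clear implicits.

Section Fractal.
Context {R : realType}.
Local Open Scope ereal_scope.
Implicit Types (A : set R) (s d : R).

Definition cantor_set A : Prop :=
  [/\ A !=set0, compact A, perfect_set A & totally_disconnected A].

Definition ediam A : \bar R :=
  ereal_sup [set `|x - y|%:E | x in A & y in A].

(* Empty sets contribute 0 for every s, including s = 0. *)
Definition hausdorff_gauge s A : \bar R :=
  if A == set0 then 0 else ediam A `^ s.

Definition hausdorff_content s d A : \bar R :=
  ereal_inf [set \sum_(0 <= i <oo) hausdorff_gauge s (U i)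
            | U in [set U : (set R)^nat |
                A `<=` \bigcup_i U i /\ forall i, ediam (U i) <= d%:E]].

Definition hausdorff_measure s A : \bar R :=
  ereal_sup [set hausdorff_content s d A | d in [set d | (0 < d)%R]].

Definition hausdorff_dim A : \bar R :=
  ereal_inf [set s%:E | s in [set s | (0 <= s)%R /\ hausdorff_measure s A = 0]].

End Fractal.

(* Main.v *)
Require Import Defs.
From mathcomp Require Import all_boot all_order all_algebra.
From mathcomp Require Import all_classical all_reals all_analysis.
From mathcomp Require Import ring lra zify.
Import Order.TTheory GRing.Theory Num.Theory.
Import numFieldNormedType.Exports.
Set Implicit Arguments.
Unset Strict Implicit.
Unset Printing Implicit Defensive.
Local Open Scope classical_set_scope.
Local Open Scope ring_scope.

(* Everything after the first level is derivative free.  Negative Schwarzian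
   derivative makes both branches expand cross-ratios, a property inherited by
   renormalizations, so inverse branches contract cross-ratios and the Koebe
   principle controls their distortion.  Inductively, every renormalization
   g_n = (c_n, g0, g1) is a power-law Lorenz map up to distortion expR (4 / b0^2):
   its branches have the shape of an inverse branch of distortion expR (1 / b0^2)
   composed with the initial power law.  Elementary estimates of one step bound
   1 - c_(n+1) above and below and show that the return interval is so short
   compared to 1 - c_n that Koebe space reproduces the distortion bound.

   The intervals f^i(g0 [P_n, c]), f^i(g1 [c, Q_n]) and C_n = [P_n, Q_n] of level n
   cover the attractor and form a tree whose children are, uniformly in n,
   comparable to and uniformly separated inside their parent.  This gives a Cantor
   set, measure zero and dimension strictly between 0 and 1.

   For the basin, points of one level whose orbit avoids [p, q] return to
   ]q, g1^-1 p[ through finitely many full branches with Koebe space that leave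
   gaps, so they form a null set; an orbit entering all C_n converges to the
   attractor because level n intervals shrink geometrically. *)

(* The cost of lra grows with each inequality in the context: hide all but the listed ones. *)
Ltac hide_hyps := repeat match goal with H : ?P |- _ =>
  lazymatch P with hide _ => fail | _ => idtac end;
  match type of P with Prop => change (hide P) in H end end.
Ltac clra := hide_hyps; lra.
Tactic Notation "lra_on" ne_hyp_list(hs) := revert hs; clra.

(** * Cross-ratios and the Koebe principle *)

(** The constants of [Omega] and [calK] come from one computation. Put ep = 1 - c, lam = c - p, rho
    = (q - c) / ep. Comparing both halves of the return interval with their images gives, up to
    bounded errors, (al - 1) ln lam = a ln ep and al ln rho = - b ln al - ln ep + ln lam. The next
    ep' is about ep rho / lam, hence al ln ep' = - b ln al - (a + 1 - al) ln ep. As sg <= a + 1 - al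
    <= al - sg, the lower bound on ep and b >= b0 return the upper bound on ep'; the upper bound on
    ep and b <= (1 + (sg / al)^2 - be) b0 return the lower one. The errors go into theta in the
    first case and into be b0 in the second. Two obstacles shape the induction. The lower estimate
    of rho requires the right critical value of the next level to stay away from 1, which is
    information about that next level; a crude lower bound on ep' breaks the circle. And distortion
    must not accumulate: lam / ep is exponentially small in b0 while delta = 1 / b0^2 is only
    polynomially small, so Koebe space yields exp delta afresh at each level. *)

Section CrossRatio.
Context {R : realType}.
Implicit Types (a b x y z w : R) (e f : R -> R).

Definition incr_on a b f := forall x y, a <= x -> x < y -> y <= b -> f x < f y.

(** Middle length times total length over the product of the outer lengths. It is invariant under
    Moebius maps, and 1 + cross equals (x2 - x0)(x3 - x1) over the same denominator. *)
Definition cross x0 x1 x2 x3 :=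
  ((x2 - x1) * (x3 - x0)) / ((x1 - x0) * (x3 - x2)).

Definition cross_contracting a b e := forall x0 x1 x2 x3,
  a <= x0 -> x0 < x1 -> x1 < x2 -> x2 < x3 -> x3 <= b ->
  cross (e x0) (e x1) (e x2) (e x3) <= cross x0 x1 x2 x3.

Definition cross_expanding a b e := forall x0 x1 x2 x3,
  a <= x0 -> x0 < x1 -> x1 < x2 -> x2 < x3 -> x3 <= b ->
  cross x0 x1 x2 x3 <= cross (e x0) (e x1) (e x2) (e x3).

(** Bounded distortion without derivatives: difference quotients over any two subintervals differ by
    a factor of at most [K], with denominators cleared. *)
Definition distortion_le (K : R) a b e := forall x y z w,
  a <= x -> x < y -> y <= b -> a <= z -> z < w -> w <= b ->
  (e y - e x) * (w - z) <= K * ((e w - e z) * (y - x)).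

(** Surjectivity onto [f a, f b] stands in for continuity, so branches that are a priori only
    homeomorphisms are composed and inverted without topology. *)
Definition incr_onto a b f := incr_on a b f /\
  forall y, f a <= y <= f b -> exists2 x, a <= x <= b & f x = y.

Definition inv_on a b f y : R := xget a [set x | a <= x <= b /\ f x = y].

Lemma incr_on_le a b f x y : incr_on a b f ->
  a <= x -> x <= y -> y <= b -> f x <= f y.
Proof.
move=> fi ax; rewrite le_eqVlt => /orP[/eqP -> //|xy yb].
exact/ltW/fi.
Qed.

Lemma incr_on_ltE a b f x y : incr_on a b f ->
  a <= x <= b -> a <= y <= b -> (f x < f y) = (x < y).
Proof.
move=> fi /andP[ax xb] /andP[ay yb]; apply/idP/idP => [|xy]; last exact: fi.
by apply: contraTT; rewrite -!leNgt => yx; exact: (incr_on_le fi).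
Qed.

Lemma incr_on_leE a b f x y : incr_on a b f ->
  a <= x <= b -> a <= y <= b -> (f x <= f y) = (x <= y).
Proof. by move=> fi xab yab; rewrite !leNgt (incr_on_ltE fi). Qed.

Lemma incr_on_inj a b f x y : incr_on a b f ->
  a <= x <= b -> a <= y <= b -> f x = f y -> x = y.
Proof.
move=> fi xab yab fxy; apply/eqP; rewrite eq_le.
by rewrite -(incr_on_leE fi xab yab) -(incr_on_leE fi yab xab) fxy lexx.
Qed.

Lemma incr_on_sub a b a' b' f : a <= a' -> b' <= b ->
  incr_on a b f -> incr_on a' b' f.
Proof. by move=> aa bb fi x y a'x xy yb'; apply: fi => //; lra. Qed.

Lemma cross_contracting_sub a b a' b' e : a <= a' -> b' <= b ->
  cross_contracting a b e -> cross_contracting a' b' e.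
Proof. by move=> aa bb ec x0 x1 x2 x3 *; apply: ec => //; lra. Qed.

Lemma distortion_le_sub K a b a' b' e : a <= a' -> b' <= b ->
  distortion_le K a b e -> distortion_le K a' b' e.
Proof. by move=> aa bb ed x y z w *; apply: ed => //; lra. Qed.

Lemma incr_on_comp a b a' b' f g : incr_on a b f ->
  (forall x, a <= x <= b -> a' <= f x <= b') -> incr_on a' b' g ->
  incr_on a b (g \o f).
Proof.
move=> fi fab gi x y ax xy yb /=.
have /andP[? _] : a' <= f x <= b' by apply: fab; lra.
have /andP[_ ?] : a' <= f y <= b' by apply: fab; lra.
by apply: gi => //; apply: fi.
Qed.

Lemma cross_contracting_comp a b a' b' f g : incr_on a b f ->
  (forall x, a <= x <= b -> a' <= f x <= b') ->
  cross_contracting a b f -> cross_contracting a' b' g ->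
  cross_contracting a b (g \o f).
Proof.
move=> fi fab fc gc x0 x1 x2 x3 ? ? ? ? ? /=.
apply: (le_trans _ (fc x0 x1 x2 x3 _ _ _ _ _)) => //.
have /andP[? _] : a' <= f x0 <= b' by apply: fab; lra.
have /andP[_ ?] : a' <= f x3 <= b' by apply: fab; lra.
by apply: gc => //; apply: fi => //; lra.
Qed.

Lemma cross_expanding_comp a b a' b' f g : incr_on a b f ->
  (forall x, a <= x <= b -> a' <= f x <= b') ->
  cross_expanding a b f -> cross_expanding a' b' g ->
  cross_expanding a b (g \o f).
Proof.
move=> fi fab fc gc x0 x1 x2 x3 ? ? ? ? ? /=.
apply: (le_trans (fc x0 x1 x2 x3 _ _ _ _ _)) => //.
have /andP[? _] : a' <= f x0 <= b' by apply: fab; lra.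
have /andP[_ ?] : a' <= f x3 <= b' by apply: fab; lra.
by apply: gc => //; apply: fi => //; lra.
Qed.

Lemma cross_affine p s x0 x1 x2 x3 : 0 < s -> x0 < x1 -> x1 < x2 -> x2 < x3 ->
  cross (p + s * x0) (p + s * x1) (p + s * x2) (p + s * x3)
  = cross x0 x1 x2 x3.
Proof.
move=> s0 h1 h2 h3; rewrite /cross.
have E u v : p + s * u - (p + s * v) = s * (u - v) by ring.
rewrite !E; field; apply/and3P; split; apply/eqP; lra.
Qed.

Lemma cross_le_slope x0 x1 x2 x3 (y0 y1 y2 y3 : R) :
  x0 < x1 -> x1 < x2 -> x2 < x3 -> y0 < y1 -> y1 < y2 -> y2 < y3 ->
  (cross y0 y1 y2 y3 <= cross x0 x1 x2 x3) =
  ((y2 - y1) * (y3 - y0) * ((x1 - x0) * (x3 - x2)) <=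
   (x2 - x1) * (x3 - x0) * ((y1 - y0) * (y3 - y2))).
Proof.
move=> *; rewrite /cross ler_pdivrMr; last by apply: mulr_gt0; lra.
by rewrite mulrAC ler_pdivlMr //; apply: mulr_gt0; lra.
Qed.

Section Koebe.
Variables (S T : R) (e : R -> R).
Hypotheses (ei : incr_on S T e) (ec : cross_contracting S T e).

Let sl x y := (e y - e x) / (y - x).

Let sl_gt0 x y : S <= x -> x < y -> y <= T -> 0 < sl x y.
Proof. by move=> *; rewrite /sl divr_gt0 // subr_gt0 //; apply: ei. Qed.

(** This is the contraction of 1 + cross at z, w, y, t, by the identity (y - z)(t - w) = (y - w)(t -
    z) + (w - z)(t - y), which holds for the image points too. *)
Lemma koebe_slope_outer z w y t : S <= z -> z < w -> w <= y -> y < t -> t <= T ->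
  sl z y * sl w t <= sl z w * sl y t.
Proof.
move=> Sz zw; rewrite le_eqVlt => /orP[/eqP <- //|wy yt tT].
have := ec Sz zw wy yt tT.
have ? : e z < e w by apply: ei; lra.
have ? : e w < e y by apply: ei; lra.
have ? : e y < e t by apply: ei; lra.
rewrite cross_le_slope // => H.
rewrite /sl !mulf_div ler_pdivrMr; last by apply: mulr_gt0; lra.
rewrite mulrAC ler_pdivlMr; last by apply: mulr_gt0; lra.
lra.
Qed.

(** This is the contraction of cross / (1 + cross), an increasing function of the cross-ratio, at z,
    x, y, t. *)
Lemma koebe_slope_inner z x y t : S <= z -> z <= x -> x < y -> y < t -> t <= T ->
  sl x y * sl z t <= sl z y * sl x t.
Proof.
move=> Sz; rewrite le_eqVlt => /orP[/eqP <- //|zx xy yt tT].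
have := ec Sz zx xy yt tT.
have ? : e z < e x by apply: ei; lra.
have ? : e x < e y by apply: ei; lra.
have ? : e y < e t by apply: ei; lra.
rewrite cross_le_slope // => H.
rewrite /sl !mulf_div ler_pdivrMr; last by apply: mulr_gt0; lra.
rewrite mulrAC ler_pdivlMr; last by apply: mulr_gt0; lra.
lra.
Qed.

(** When [z, w] lies to the left of [x, y], space to the right of y suffices. The two slope
    inequalities with t = T reduce the claim to slopes of intervals ending at T, and there moving
    the left end from u to v costs at most (T - u) / (T - v) <= k. This happens twice, whence
    k^2. *)
Lemma koebe_right k x y z w : S <= z -> z <= x -> w <= y -> z < w -> x < y ->
  y < T -> T - z <= k * (T - y) -> (e y - e x) / (y - x) <= k ^+ 2 * ((e w - e z) / (w - z)).
Proof.
move=> Sz zx wy zw xy yT Tk.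
have T0 : 0 < T - y by lra.
have k0 : 0 <= k by rewrite -(pmulr_lge0 _ T0); lra.
have kle u v : z <= u -> u <= v -> v <= y -> sl v T <= k * sl u T.
  move=> zu uv vy; rewrite /sl mulrA ler_pdivrMr; last lra.
  rewrite mulrAC ler_pdivlMr; last lra.
  have E : e u <= e v by apply: (incr_on_le ei); lra.
  have ET : e v < e T by apply: ei; lra.
  apply: (@le_trans _ _ ((e T - e u) * (T - u))).
    by apply: ler_wpM2r; lra.
  rewrite (_ : k * _ * _ = (e T - e u) * (k * (T - v))); last ring.
  apply: ler_wpM2l; first lra.
  have : k * (T - y) <= k * (T - v) by apply: ler_wpM2l; lra.
  lra.
have A := @koebe_slope_outer z w y T Sz zw wy yT (lexx _).
have B := @koebe_slope_inner z x y T Sz zx xy yT (lexx _).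
have h1 := kle w y (ltW zw) wy (lexx _).
have h2 := kle z x (lexx _) zx (ltW xy).
have szT : 0 < sl z T by apply: sl_gt0; lra.
have swT : 0 < sl w T by apply: sl_gt0; lra.
have szw : 0 < sl z w by apply: sl_gt0; lra.
have sxT : 0 < sl x T by apply: sl_gt0; lra.
rewrite -/(sl x y) -/(sl z w) -(ler_pM2r szT) -(ler_pM2r swT).
apply: (@le_trans _ _ (sl z y * sl x T * sl w T)).
  by apply: ler_wpM2r => //; lra.
rewrite mulrAC; apply: (@le_trans _ _ (sl z w * sl y T * sl x T)).
  by apply: ler_wpM2r => //; lra.
rewrite (_ : k ^+ 2 * _ * _ * _ = sl z w * ((k * sl w T) * (k * sl z T))); last ring.
rewrite -mulrA; apply: ler_wpM2l; first lra.
by apply: ler_pM => //; apply: ltW; apply: sl_gt0; lra_on zw wy Sz T0 zx xy.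
Qed.

End Koebe.

Lemma koebe_left S T e k x y z w : incr_on S T e -> cross_contracting S T e ->
  w <= T -> y <= w -> x <= z -> z < w -> x < y -> S < x ->
  w - S <= k * (x - S) ->
  (e y - e x) / (y - x) <= k ^+ 2 * ((e w - e z) / (w - z)).
Proof.
move=> ei ec wT yw xz zw xy Sx Sk.
pose e' t := - e (- t).
have e'i : incr_on (- T) (- S) e'.
  by move=> u v *; rewrite /e' ltrN2; apply: ei; lra.
have e'c : cross_contracting (- T) (- S) e'.
  move=> x0 x1 x2 x3 h0 h1 h2 h3 h4.
  have := ec (- x3) (- x2) (- x1) (- x0) ltac:(lra) ltac:(lra) ltac:(lra) ltac:(lra) ltac:(lra).
  rewrite /cross /e'.
  have E (a b : R) : - a - - b = b - a by ring.
  by rewrite !E; congr (_ <= _); congr (_ / _); ring.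
have := @koebe_right (- T) (- S) e' e'i e'c k (- y) (- x) (- w) (- z)
  ltac:(lra) ltac:(lra) ltac:(lra) ltac:(lra) ltac:(lra) ltac:(lra) ltac:(lra).
have E (a b : R) : - a - - b = b - a by ring.
by rewrite /e' !E !opprK.
Qed.

(** Two intervals whose end points are ordered alike are covered by a one-sided version. If they are
    nested, the slope over the larger one is a weighted mean of slopes over two parts, and each part
    is compared with the smaller one by a one-sided version. *)
Lemma koebe S T A B e k : incr_on S T e -> cross_contracting S T e ->
  S < A -> B < T -> T - A <= k * (T - B) -> B - S <= k * (A - S) ->
  distortion_le (k ^+ 2) A B e.
Proof.
move=> ei ec SA BT Tk Sk x y z w Ax xy yB Az zw wB.
have T0 : 0 < T - B by lra.
have S0 : 0 < A - S by lra.
have [AB|AB] := leP A B; last by lra.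
have k0 : 0 <= k by rewrite -(pmulr_lge0 _ T0); lra.
pose sl x y := (e y - e x) / (y - x).
have Tk' u v : A <= u -> v <= B -> T - u <= k * (T - v).
  move=> Au vB; have : k * (T - B) <= k * (T - v) by apply: ler_wpM2l; lra.
  lra.
have Sk' u v : u <= B -> A <= v -> u - S <= k * (v - S).
  move=> uB Av; have : k * (A - S) <= k * (v - S) by apply: ler_wpM2l; lra.
  lra.
have dE u v : u < v -> e v - e u = sl u v * (v - u).
  by move=> uv; rewrite /sl divfK // subr_eq0 gt_eqF.
have KR x' y' z' w' : A <= z' -> y' <= B -> z' <= x' -> w' <= y' -> z' < w' -> x' < y' ->
    sl x' y' <= k ^+ 2 * sl z' w'.
  move=> *; apply: (@koebe_right S T) => //; try lra.
  by apply: Tk'.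
have KL x' y' z' w' : A <= x' -> w' <= B -> x' <= z' -> y' <= w' -> z' < w' -> x' < y' ->
    sl x' y' <= k ^+ 2 * sl z' w'.
  move=> *; apply: (@koebe_left S T) => //; try lra.
  by apply: Sk'.
suff : sl x y <= k ^+ 2 * sl z w.
  rewrite (dE x y) // (dE z w) // => H.
  rewrite -(mulrA (sl z w)) mulrA -mulrA (mulrC (w - z)).
  by apply: ler_wpM2r => //; apply: mulr_ge0; lra.
have [zx|xz] := leP z x; have [wy|yw] := leP w y.
- exact: KR.
- rewrite -(@ler_pM2r _ (w - z)); last lra.
  have h1 : sl x y <= k ^+ 2 * sl x w by apply: KL => //; lra.
  rewrite -(mulrA _ (sl z w)) -dE //.
  move: zx; rewrite le_eqVlt => /orP[/eqP ->|zx].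
    rewrite (dE x w); last lra.
    by rewrite mulrA; apply: ler_wpM2r; lra.
  have h2 : sl x y <= k ^+ 2 * sl z x by apply: KR => //; lra.
  rewrite (_ : e w - e z = (e w - e x) + (e x - e z)); last ring.
  rewrite (dE x w) ?(dE z x) //; last lra.
  have : sl x y * (w - x) <= k ^+ 2 * sl x w * (w - x) by apply: ler_wpM2r; lra.
  have : sl x y * (x - z) <= k ^+ 2 * sl z x * (x - z) by apply: ler_wpM2r; lra.
  lra.
- rewrite -(@ler_pM2r _ (y - x)); last lra.
  have h1 : sl x z <= k ^+ 2 * sl z w by apply: KL => //; lra.
  have h2 : sl z y <= k ^+ 2 * sl z w by apply: KR => //; lra.
  rewrite -dE //.
  rewrite (_ : e y - e x = (e y - e z) + (e z - e x)); last ring.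
  rewrite (dE z y) ?(dE x z) //; last lra.
  have : sl x z * (z - x) <= k ^+ 2 * sl z w * (z - x) by apply: ler_wpM2r; lra.
  have : sl z y * (y - z) <= k ^+ 2 * sl z w * (y - z) by apply: ler_wpM2r; lra.
  lra.
- by apply: KL => //; lra.
Qed.

Lemma inv_onP a b f y : incr_onto a b f -> f a <= y <= f b ->
  a <= inv_on a b f y <= b /\ f (inv_on a b f y) = y.
Proof.
move=> [_ fs] yab; rewrite /inv_on; case: xgetP => [x _ [? ?] //|H].
have [x xab fx] := fs _ yab.
by case: (H x).
Qed.

Lemma inv_onK a b f x : incr_onto a b f -> a <= x <= b -> inv_on a b f (f x) = x.
Proof.
move=> fb xab; have [fi _] := fb.
have fxab : f a <= f x <= f b.
  by move/andP: xab => [ax xb]; rewrite !(incr_on_le fi) //; lra.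
have [h1 h2] := inv_onP fb fxab.
exact: (incr_on_inj fi h1 xab).
Qed.

Lemma inv_on_incr a b f : incr_onto a b f -> incr_on (f a) (f b) (inv_on a b f).
Proof.
move=> fb x y ax xy yb.
have [h1 h2] := inv_onP (y := x) fb ltac:(lra).
have [h3 h4] := inv_onP (y := y) fb ltac:(lra).
by rewrite -(incr_on_ltE fb.1 h1 h3) h2 h4.
Qed.

Lemma inv_on_cross a b f : incr_onto a b f -> cross_expanding a b f ->
  cross_contracting (f a) (f b) (inv_on a b f).
Proof.
move=> fb fc x0 x1 x2 x3 h0 h1 h2 h3 h4.
have ii := inv_on_incr fb.
have [? {2}<-] := inv_onP (y := x0) fb ltac:(lra).
have [? {2}<-] := inv_onP (y := x1) fb ltac:(lra).
have [? {2}<-] := inv_onP (y := x2) fb ltac:(lra).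
have [? {2}<-] := inv_onP (y := x3) fb ltac:(lra).
by apply: fc; try lra; apply: ii; lra.
Qed.

Lemma incr_onto_comp a b f g : a <= b -> incr_onto a b f ->
  incr_onto (f a) (f b) g -> incr_onto a b (g \o f).
Proof.
move=> ab fb gb; split.
  apply: (incr_on_comp fb.1 _ gb.1) => x /andP[ax xb].
  by rewrite !(incr_on_le fb.1).
move=> y /gb.2[z /fb.2[x xab fx] gz].
by exists x => //=; rewrite fx.
Qed.

(* Two increasing maps onto intervals that agree on [a, b[ agree at b. *)
Lemma incr_onto_end_right a b f g : a < b -> incr_onto a b f -> incr_onto a b g ->
  (forall x, a <= x < b -> f x = g x) -> f b = g b.
Proof.
move=> ab.
wlog suff: f g / incr_onto a b f -> incr_onto a b g ->
    (forall x, a <= x < b -> f x = g x) -> f b < g b -> False.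
  move=> W fb gb E; apply/eqP; rewrite eq_le !leNgt; apply/andP; split;
    apply/negP => H; [apply: (W g f)|apply: (W f g)] => // x xab.
  by rewrite E.
move=> fb gb E lt.
have Ea : f a = g a by apply: E; lra.
have lt1 : f a < f b by apply: fb.1.
have [x xab gx] := gb.2 ((f b + g b) / 2) ltac:(lra).
have [xb|xb] := ltP x b.
  have : f x = g x by apply: E; lra.
  have : f x < f b by apply: fb.1; lra.
  lra.
by move: gx; rewrite (_ : x = b); lra.
Qed.

Lemma incr_onto_end_left a b f g : a < b -> incr_onto a b f -> incr_onto a b g ->
  (forall x, a < x <= b -> f x = g x) -> f a = g a.
Proof.
move=> ab fb gb E.
have flip k : incr_onto a b k -> incr_onto (- b) (- a) (fun x => - k (- x)).
  move=> [ki ks]; split=> [x y *|y].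
    by rewrite ltrN2; apply: ki; lra.
  rewrite !opprK => yab; have [x xab kx] := ks (- y) ltac:(lra).
  by exists (- x); [lra|rewrite opprK kx opprK].
have := @incr_onto_end_right (- b) (- a) _ _ ltac:(lra) (flip _ fb) (flip _ gb).
rewrite !opprK => H; apply: oppr_inj; apply: H => x xab.
by rewrite E //; lra.
Qed.

End CrossRatio.

(** * Convexity and cross-ratio expansion *)

(** [A], [B], [C] are adjacent lengths, [L0], [H1], [H2], [L3] the values of an affine function l at
    the four points, and the [F] are increments of f. The Moebius map with derivative l^-2 has
    increment length / (product of end values). Since 1 + cross = (1 + F21 / F10)(1 + F21 / F32),
    each factor is compared separately. *)
Lemma moebius_comparison {R : realType} (A B C H1 H2 L0 L3 F10 F21 F32 : R) :
  0 < A -> 0 < B -> 0 < C -> 0 < H1 -> 0 < H2 -> 0 < F10 -> 0 < F21 -> 0 < F32 ->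
  B / H2 / H1 <= F21 -> (0 < L3 -> F32 <= C / L3 / H2) -> (0 < L0 -> F10 <= A / L0 / H1) ->
  L0 * B = H1 * (A + B) - H2 * A -> L3 * B = H2 * (B + C) - H1 * C ->
  B * (A + B + C) / (A * C) <= F21 * (F10 + F21 + F32) / (F10 * F32).
Proof.
move=> A0 B0 C0 H10 H20 f1 f2 f3 hF2 hF3 hF1 e0 e3.
have [AN CN H1N H2N] : [/\ A != 0, C != 0, H1 != 0 & H2 != 0] by split; rewrite gt_eqF.
have [f1N f3N] : F10 != 0 /\ F32 != 0 by split; rewrite gt_eqF.
have step (P H H' L F : R) : 0 < P -> 0 < H -> 0 < H' -> 0 < F -> B / H' / H <= F21 ->
    (0 < L -> F <= P / L / H) -> L * B = H * (P + B) - H' * P ->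
    H * (P + B) / (H' * P) <= 1 + F21 / F.
  move=> P0 H0 H'0 F0 h2 h e.
  have HP : 0 < H' * P by rewrite mulr_gt0.
  (* Beyond a zero of the affine function there is no comparison map, but then the factor to be
     dominated is already at most 1. *)
  have [L0'|L0'] := leP L 0.
    have : H * (P + B) / (H' * P) <= 1 by rewrite ler_pdivrMr // mul1r -subr_le0 -e pmulr_lle0.
    by move/le_trans; apply; rewrite lerDl divr_ge0 // ltW.
  have {}h := h L0'.
  have -> : H * (P + B) = H' * P + L * B by rewrite e; ring.
  rewrite mulrDl divff ?gt_eqF // lerD2l ler_pdivlMr // mulrAC ler_pdivrMr //.
  apply: (@le_trans _ _ (L * B * (P / L / H))); first by rewrite ler_pM2l ?mulr_gt0.
  have -> : L * B * (P / L / H) = B / H' / H * (H' * P).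
    by field; rewrite !gt_eqF.
  by rewrite ler_pM2r.
have s1 := step A H1 H2 L0 F10 A0 H10 H20 f1 hF2 hF1 e0.
have hF2' : B / H1 / H2 <= F21 by rewrite mulrAC.
have s3 := step C H2 H1 L3 F32 C0 H20 H10 f3 hF2' hF3 ltac:(rewrite e3; ring).
have P : H1 * (A + B) / (H2 * A) * (H2 * (C + B) / (H1 * C)) <= (1 + F21 / F10) * (1 + F21 / F32).
  by apply: ler_pM => //; rewrite divr_ge0 ?mulr_ge0 ?addr_ge0 // ltW.
have E1 : H1 * (A + B) / (H2 * A) * (H2 * (C + B) / (H1 * C)) = 1 + B * (A + B + C) / (A * C).
  by field; rewrite H1N H2N AN CN.
have E2 : (1 + F21 / F10) * (1 + F21 / F32) = 1 + F21 * (F10 + F21 + F32) / (F10 * F32).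
  by field; rewrite f1N f3N.
by rewrite E1 E2 lerD2l in P.
Qed.

Section ConvexCrossExpanding.
Context {R : realType}.
Variables (a b : R) (f h : R -> R).
Hypotheses (fc : {within `[a, b], continuous f})
  (fd : forall x, a < x < b -> is_derive x 1 f (h x ^- 2))
  (h0 : forall x, a < x < b -> 0 < h x)
  (hconv : forall x y z, a < x -> x < y -> y < z -> z < b ->
    h y * (z - x) <= h x * (z - y) + h z * (y - x)).

Let within_sub (x y : R) (g : R -> R) : {within `[a, b], continuous g} -> a <= x -> y <= b ->
  {within `[x, y], continuous g}.
Proof.
move=> gc ax yb; apply: continuous_subspaceW gc => z /=; rewrite !in_itv /= => /andP[xz zy].
by rewrite (le_trans ax) // (le_trans zy).
Qed.

(* Moebius comparison map: the derivative of x - x1 over l x * l x1 is l x ^ -2 when l is affine. *)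
Lemma derive_moebius (l0 s x1 x : R) : l0 + s * x != 0 -> l0 + s * x1 != 0 ->
  is_derive x 1 (fun y => (y - x1) / (l0 + s * y) / (l0 + s * x1)) ((l0 + s * x) ^- 2).
Proof.
move=> lx lx1.
have d1 : is_derive x 1 (fun y : R => y - x1) 1.
  by apply: is_derive_eq; rewrite subr0.
have d2 : is_derive x 1 (fun y : R => l0 + s * y) s.
  by apply: is_derive_eq; rewrite /GRing.scale /=; ring.
have d3 := @is_deriveV _ (fun y => l0 + s * y) x s 1 lx d2.
have -> : (fun y => (y - x1) / (l0 + s * y) / (l0 + s * x1)) =
  ((fun y => y - x1) * (fun y => (l0 + s * y)^-1) * cst (l0 + s * x1)^-1).
  by apply/funext.
apply: is_derive_eq; rewrite /GRing.scale /= /cst; field.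
by rewrite lx lx1.
Qed.

Lemma increment_le (F G dF dG : R -> R) (x y : R) : x < y ->
  {within `[x, y], continuous F} -> {within `[x, y], continuous G} ->
  (forall z, x < z < y -> is_derive z 1 F (dF z)) ->
  (forall z, x < z < y -> is_derive z 1 G (dG z)) ->
  (forall z, x < z < y -> dF z <= dG z) -> F y - F x <= G y - G x.
Proof.
move=> xy Fc Gc Fd Gd le.
have [z zI E] : exists2 z, z \in `]x, y[ & (G - F) y - (G - F) x = (dG z - dF z) * (y - x).
  apply: (@MVT _ (G - F) (fun z => dG z - dF z)) => //.
    move=> z; rewrite in_itv /= => zI.
    by have := Fd z zI; have := Gd z zI => ? ?; exact: is_deriveB.
  exact: within_continuousB.
have : 0 <= (dG z - dF z) * (y - x).
  by apply: mulr_ge0; [rewrite subr_ge0; apply: le; rewrite in_itv in zI|rewrite subr_ge0 ltW].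
by rewrite -E /= !fctE; lra.
Qed.

Let moebius_within (l0 s x1 x y : R) : (forall z, x <= z <= y -> l0 + s * z != 0) ->
  l0 + s * x1 != 0 ->
  {within `[x, y], continuous (fun z => (z - x1) / (l0 + s * z) / (l0 + s * x1))}.
Proof.
move=> lz lx1; apply: continuous_in_subspaceT => z; rewrite inE /= in_itv /= => zI.
have := derive_moebius (lz z zI) lx1 => -[d _].
exact/differentiable_continuous/derivable1_diffP.
Qed.

Let incr : incr_on a b f.
Proof.
move=> x y ax xy yb.
have [z zI E] : exists2 z, z \in `]x, y[ & f y - f x = h z ^- 2 * (y - x).
  apply: MVT => //; last exact: within_sub.
  move=> z; rewrite in_itv /= => zI; apply: fd; move: zI ax yb; lra.
rewrite -subr_gt0 E mulr_gt0 ?subr_gt0 // invr_gt0 exprn_gt0 //; apply: h0.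
by move: zI; rewrite in_itv /=; move: ax yb; lra.
Qed.

(** By convexity the secant of h through x1 and x2 lies above h between these points and below h
    outside. Hence f grows at least as fast on the middle interval, and at most as fast on the outer
    ones, as the Moebius map whose derivative is secant^-2; Moebius maps preserve the
    cross-ratio. *)
Lemma convex_cross_expanding : cross_expanding a b f.
Proof.
move=> x0 x1 x2 x3 ax0 x01 x12 x23 x3b.
have x1I : a < x1 < b by lra.
have x2I : a < x2 < b by lra.
have h1 := h0 x1I; have h2 := h0 x2I.
pose s := (h x2 - h x1) / (x2 - x1).
pose k := h x1 - s * x1.
have sE : s * (x2 - x1) = h x2 - h x1 by rewrite /s divfK // subr_eq0 gt_eqF.
have l1 : k + s * x1 = h x1 by rewrite /k; ring.
have l2 : k + s * x2 = h x2 by rewrite /k; move: sE; lra.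
have secant x : (k + s * x) * (x2 - x1) = h x1 * (x2 - x) + h x2 * (x - x1).
  have -> : (k + s * x) * (x2 - x1) = h x1 * (x2 - x1) + (x - x1) * (s * (x2 - x1)).
    by rewrite /k; ring.
  by rewrite sE; ring.
have x21 : 0 < x2 - x1 by rewrite subr_gt0.
have in_le x : x1 < x < x2 -> h x <= k + s * x.
  move=> /andP[xl xr]; rewrite -(ler_pM2r x21) secant; apply: hconv => //; lra.
have right_ge x : x2 < x < b -> k + s * x <= h x.
  move=> /andP[xl xr]; rewrite -(ler_pM2r x21) secant.
  have := hconv (x := x1) (y := x2) (z := x) ltac:(lra) x12 xl xr; lra.
have left_ge x : a < x < x1 -> k + s * x <= h x.
  move=> /andP[xl xr]; rewrite -(ler_pM2r x21) secant.
  have := hconv (x := x) (y := x1) (z := x2) xl xr x12 ltac:(lra); lra.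
have lpos x y : 0 < k + s * x -> 0 < k + s * y -> forall z, x <= z <= y -> 0 < k + s * z.
  move=> lx ly z zI; have [s0|s0] := leP 0 s.
    by have : s * x <= s * z by [apply: ler_wpM2l => //; lra]; lra.
  by have : s * y <= s * z by [apply: ler_wnM2l => //; lra]; lra.
have inv2 (u v : R) : 0 < u -> u <= v -> v ^- 2 <= u ^- 2.
  by move=> u0 uv; rewrite lef_pV2 ?posrE ?exprn_gt0 //; [apply: lerXn2r; rewrite ?nnegrE|]; lra_on u0 uv.
have dn x : 0 < k + s * x -> k + s * x != 0 by move=> lx; rewrite gt_eqF.
have l1p : 0 < k + s * x1 by rewrite l1.
have l2p : 0 < k + s * x2 by rewrite l2.
have m0 : 0 < (x2 - x1) / h x2 / h x1 by rewrite !divr_gt0.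
have F21 : (x2 - x1) / h x2 / h x1 <= f x2 - f x1.
  have := @increment_le (fun z => (z - x1) / (k + s * z) / (k + s * x1)) f
    (fun z => (k + s * z) ^- 2) (fun z => h z ^- 2) x1 x2 x12.
  rewrite l1 l2 subrr !mul0r subr0; apply.
  - rewrite -l1; apply: moebius_within; last exact: dn.
    by move=> z zI; apply/dn/(lpos x1 x2).
  - by apply: within_sub => //; lra.
  - by move=> z zI; rewrite -l1; apply: derive_moebius; apply: dn => //; apply: (lpos x1 x2); lra_on l1p l2p zI.
  - by move=> z zI; apply: fd; lra.
  - by move=> z zI; apply: inv2; [apply: h0; lra|exact: in_le].
have F32 : 0 < k + s * x3 -> f x3 - f x2 <= (x3 - x2) / (k + s * x3) / h x2.
  move=> l3; have := @increment_le f (fun z => (z - x2) / (k + s * z) / (k + s * x2))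
    (fun z => h z ^- 2) (fun z => (k + s * z) ^- 2) x2 x3 x23.
  rewrite l2 subrr !mul0r subr0; apply.
  - by apply: within_sub => //; lra.
  - rewrite -l2; apply: moebius_within; last exact: dn.
    by move=> z zI; apply/dn/(lpos x2 x3).
  - by move=> z zI; apply: fd; lra.
  - by move=> z zI; rewrite -l2; apply: derive_moebius; apply: dn => //; apply: (lpos x2 x3); lra_on l2p l3 zI.
  - by move=> z zI; apply: inv2; [apply: (lpos x2 x3); lra_on l2p l3 zI|apply: right_ge; lra_on zI x3b].
have F10 : 0 < k + s * x0 -> f x1 - f x0 <= (x1 - x0) / (k + s * x0) / h x1.
  move=> l0; have := @increment_le f (fun z => (z - x1) / (k + s * z) / (k + s * x1))
    (fun z => h z ^- 2) (fun z => (k + s * z) ^- 2) x0 x1 x01.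
  rewrite l1 subrr !mul0r sub0r -!mulNr opprB; apply.
  - by apply: within_sub => //; lra.
  - rewrite -l1; apply: moebius_within; last exact: dn.
    by move=> z zI; apply/dn/(lpos x0 x1).
  - by move=> z zI; apply: fd; lra.
  - by move=> z zI; rewrite -l1; apply: derive_moebius; apply: dn => //; apply: (lpos x0 x1); lra_on l0 l1p zI.
  - by move=> z zI; apply: inv2; [apply: (lpos x0 x1); lra_on l0 l1p zI|apply: left_ge; lra].
have f01 : f x0 < f x1 by apply: incr; lra.
have f12 : f x1 < f x2 by apply: incr; lra.
have f23 : f x2 < f x3 by apply: incr; lra.
have l0E : (k + s * x0) * (x2 - x1) = h x1 * (x2 - x0) + h x2 * (x0 - x1) := secant x0.
have l3E : (k + s * x3) * (x2 - x1) = h x1 * (x2 - x3) + h x2 * (x3 - x1) := secant x3.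
rewrite /cross.
have E30 : x3 - x0 = (x1 - x0) + (x2 - x1) + (x3 - x2) by ring.
have G30 : f x3 - f x0 = (f x1 - f x0) + (f x2 - f x1) + (f x3 - f x2) by ring.
rewrite E30 G30; apply: (moebius_comparison _ x21 _ h1 h2 _ _ _ F21 F32 F10); rewrite ?subr_gt0 //.
  by rewrite l0E; ring.
by rewrite l3E; ring.
Qed.

End ConvexCrossExpanding.

(** * Null sets *)

Section NullSets.
Context {R : realType}.
Implicit Types (A S : set R) (e : R) (I : nat -> R * R).

(** Countable covers by segments are what trees of intervals produce. [lebesgue_null_negligible] and
    [negligible_lebesgue_null] identify this notion with negligibility; degenerate segments pad
    finite covers. *)
Definition lebesgue_null A := forall e, 0 < e -> exists I,
  [/\ forall i, (I i).1 <= (I i).2,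
      A `<=` \bigcup_i `[(I i).1, (I i).2]%classic &
      (\sum_(0 <= i <oo) ((I i).2 - (I i).1)%:E <= e%:E)%E].

Lemma lebesgue_measure_segment (a b : R) : a <= b ->
  (@lebesgue_measure R) `[a, b]%classic = (b - a)%:E.
Proof.
rewrite lebesgue_measure_itv /= lte_fin le_eqVlt => /orP[/eqP ->|ab].
  by rewrite ltxx subrr.
by rewrite ab EFinN EFinB.
Qed.

Lemma lebesgue_null_negligible A : lebesgue_null A -> (@lebesgue_measure R).-negligible A.
Proof.
move=> nA.
have /choice[F HF] : forall k : nat, exists I, [/\ forall i, (I i).1 <= (I i).2,
    A `<=` \bigcup_i `[(I i).1, (I i).2]%classic &
    (\sum_(0 <= i <oo) ((I i).2 - (I i).1)%:E <= (k.+1%:R^-1)%:E)%E].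
  by move=> k; apply: nA; rewrite invr_gt0.
pose U k := \bigcup_i `[(F k i).1, (F k i).2]%classic.
have mU k : measurable (U k : set (measurableTypeR R)).
  by apply: bigcup_measurable => i _; exact: measurable_itv.
have mB : measurable (\bigcap_k U k : set (measurableTypeR R)).
  by apply: bigcap_measurableType => k _; exact: mU.
have leU k : (@lebesgue_measure R (U k) <= (k.+1%:R^-1)%:E)%E.
  have [h1 _ h3] := HF k; apply: le_trans h3.
  apply: (@le_trans _ _ (\sum_(0 <= i <oo) (@lebesgue_measure R) `[(F k i).1, (F k i).2]%classic)%E).
    apply: measure_sigma_subadditive => //.
  by apply: lee_nneseries => i _ //; rewrite lebesgue_measure_segment.
exists (\bigcap_k U k); split=> //; last by move=> x Ax k _; have [_ h _] := HF k; exact: h.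
apply/eqP; rewrite eq_le measure_ge0 andbT; apply/lee_addgt0Pr => e e0; rewrite add0e.
have [k ke] : exists k : nat, k.+1%:R^-1 <= e.
  exists (Num.trunc e^-1).+1; rewrite -[leRHS]invrK lef_pV2 ?posrE ?invr_gt0 //.
  by apply: ltW; apply: lt_le_trans (truncnS_gt _) _; rewrite ler_nat.
apply: (@le_trans _ _ (@lebesgue_measure R (U k))).
  by apply: le_measure; rewrite ?inE //; exact: bigcap_inf.
by apply: (le_trans (leU k)); rewrite lee_fin.
Qed.

Lemma negligible_lebesgue_null A : (@lebesgue_measure R).-negligible A -> lebesgue_null A.
Proof.
move=> [B [_ B0 AB]] e e0.
have lt : (@lebesgue_measure R B < e%:E)%E by rewrite B0 lte_fin.
move: lt; rewrite /lebesgue_measure /lebesgue_stieltjes_measure /measure_extension /= /mu_ext.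
move=> /ereal_inf_lt[_ [F [mF BF] <-]] lt.
have HF i : exists x : R * R, [/\ x.1 <= x.2, F i `<=` `[x.1, x.2]%classic & (x.2 - x.1)%:E = wlength idfun (F i)].
  have [x _ xF] := mF i.
  have [x12|x12] := ltP x.1 x.2.
    exists x; split; first exact: ltW.
      by rewrite -xF; apply: subset_itv; rewrite bnd_simp.
    by rewrite -xF wlength_itv /= lte_fin x12 EFinB.
  exists (0, 0); split=> //=.
    by rewrite -xF set_itv_ge ?bnd_simp ?ltNge ?x12.
  by rewrite -xF set_itv_ge ?bnd_simp ?ltNge ?x12 // wlength0 subrr.
have [I HI] := choice HF.
exists I; split; first by move=> i; case: (HI i).
  move=> x /AB /BF[i _ Fx]; exists i => //; have [_ h _] := HI i; exact: h.
apply: le_trans (ltW lt); apply: lee_nneseries => i _.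
  by have [h _ _] := HI i; rewrite lee_fin subr_ge0.
by have [_ _ ->] := HI i.
Qed.

Lemma lebesgue_nullS A S : S `<=` A -> lebesgue_null A -> lebesgue_null S.
Proof.
move=> SA nA e e0; have [I [h1 h2 h3]] := nA e e0.
by exists I; split=> // x /SA /h2.
Qed.

Lemma lebesgue_null_bigcup (F : nat -> set R) : (forall n, lebesgue_null (F n)) -> lebesgue_null (\bigcup_n F n).
Proof.
by move=> nF; apply/negligible_lebesgue_null/negligible_bigcup => n; exact: lebesgue_null_negligible.
Qed.

Lemma lebesgue_nullU A S : lebesgue_null A -> lebesgue_null S -> lebesgue_null (A `|` S).
Proof.
move=> nA nS; apply/negligible_lebesgue_null/negligibleU; exact: lebesgue_null_negligible.
Qed.

Lemma lebesgue_null1 (x : R) : lebesgue_null [set x].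
Proof.
apply: negligible_lebesgue_null; exists [set x]; split=> //.
by rewrite lebesgue_measure_set1.
Qed.

(** The points of [S] sent into a segment of length l are at mutual distance at most l / k, so they
    lie in the segment of radius l / k around any one of them. *)
Lemma lebesgue_null_expanding S A (f : R -> R) (k : R) : 0 < k ->
  (forall x y, S x -> S y -> k * `|x - y| <= `|f x - f y|) ->
  (forall x, S x -> A (f x)) -> lebesgue_null A -> lebesgue_null S.
Proof.
move=> k0 fk SA nA e e0.
(* A segment of length l will be traded for one of length 2 l / k. *)
have [I [h1 h2 h3]] := nA (e * k / 2) ltac:(by rewrite divr_gt0 ?mulr_gt0).
pose P i := [set x | S x /\ (I i).1 <= f x <= (I i).2].
pose l i := ((I i).2 - (I i).1) / k.
have l0 i : 0 <= l i by rewrite divr_ge0 ?subr_ge0 // ltW.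
exists (fun i => let x := xget 0 (P i) in (x - l i, x + l i)); split.
- by move=> i /=; have := l0 i; lra.
- move=> x Sx; have [i _ /=] := h2 _ (SA x Sx); rewrite in_itv /= => xi.
  exists i => //=; rewrite in_itv /=; case: xgetP => [y _ [Sy yi]|/(_ x) []]; last by split.
  have : k * `|x - y| <= k * l i.
    apply: (le_trans (fk _ _ Sx Sy)); rewrite /l mulrC divfK ?gt_eqF //.
    by rewrite ler_norml; lra.
  by rewrite ler_pM2l // ler_norml; lra.
- apply: (@le_trans _ _ (\sum_(0 <= i <oo) (2 / k)%:E * ((I i).2 - (I i).1)%:E)%E).
    apply: lee_nneseries => i _ /=; first by rewrite lee_fin; have := l0 i; lra.
    by rewrite -EFinM lee_fin /l; lra.
  rewrite nneseriesZl; last by move=> i _; rewrite lee_fin subr_ge0.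
  apply: (@le_trans _ _ ((2 / k)%:E * (e * k / 2)%:E)%E).
    by apply: lee_wpmul2l => //; rewrite lee_fin divr_ge0 // ltW.
  by rewrite -EFinM lee_fin le_eqVlt; apply/orP; left; apply/eqP; field; rewrite gt_eqF.
Qed.

End NullSets.

(** * Power-law Lorenz maps *)

Section PowerLaw.
Context {R : realType}.
Implicit Types (al s t : R).

(** The tangent inequality of the convex function t^al is Young's inequality for t and s^(al - 1)
    with the conjugate exponents al and al / (al - 1); this includes s = 0 and t = 0. *)
Lemma powR_tangent al s t : 1 < al -> 0 <= s -> 0 <= t ->
  al * s `^ (al - 1) * (t - s) <= t `^ al - s `^ al.
Proof.
move=> al1 s0 t0.
have al0 : 0 < al by lra.
have a1 : 0 < al - 1 by lra.
have aN : al != 0 by rewrite gt_eqF.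
have bN : al - 1 != 0 by rewrite gt_eqF.
have q0 : 0 < al / (al - 1) by rewrite divr_gt0.
have := @conjugate_powR _ t (s `^ (al - 1)) al (al / (al - 1)) t0 (powR_ge0 _ _) al0 q0.
rewrite -powRrM (_ : (al - 1) * (al / (al - 1)) = al); last by field.
rewrite invf_div (_ : al^-1 + (al - 1) / al = 1); last by field.
move=> /(_ erefl) H.
have {H} : al * (t * s `^ (al - 1)) <= t `^ al + (al - 1) * s `^ al.
  have -> : t `^ al + (al - 1) * s `^ al = al * (t `^ al / al + s `^ al * ((al - 1) / al)).
    by field.
  by rewrite ler_pM2l.
have E : s `^ al = s * s `^ (al - 1) by rewrite mulr_powRB1.
by rewrite E; lra.
Qed.

Lemma powR_secant_le al s t : 1 < al -> 0 <= s -> 0 <= t ->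
  t `^ al - s `^ al <= al * t `^ (al - 1) * (t - s).
Proof. by move=> al1 s0 t0; have := powR_tangent al1 t0 s0; lra. Qed.

Lemma powR_le al s t : 0 <= al -> 0 <= s -> s <= t -> s `^ al <= t `^ al.
Proof. by move=> al0 s0 st; apply: ge0_ler_powR; rewrite ?nnegrE //; lra. Qed.

Lemma powR_lt al s t : 0 < al -> 0 <= s -> s < t -> s `^ al < t `^ al.
Proof. by move=> al0 s0 st; apply: gt0_ltr_powR; rewrite ?nnegrE //; lra. Qed.

Lemma powR_le_id al s : 1 <= al -> 0 <= s <= 1 -> s `^ al <= s.
Proof.
move=> al1 /andP[]; rewrite le_eqVlt => /orP[/eqP <- _|s0 s1].
  by rewrite powR0 // gt_eqF //; lra.
by apply: ge1r_powR => //; lra.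
Qed.

Lemma powR_le1 al s : 0 <= al -> 0 <= s <= 1 -> s `^ al <= 1.
Proof. by move=> al0 s01; have := @powR_le al s 1 al0; rewrite powR1; apply; lra. Qed.

Lemma le_of_powR al s t : 0 < al -> 0 <= s -> 0 <= t -> s `^ al <= t `^ al -> s <= t.
Proof.
move=> al0 s0 t0; apply: contraTT; rewrite -!ltNge => ts.
exact: powR_lt.
Qed.

(** This says on increments that [g0] is the power law followed by a map of distortion [D]. Power
    laws are homogeneous, so the property survives affine zooming that fixes the critical point. *)
Definition left_power_slopes al D c m (g0 : R -> R) := forall x y,
  0 <= x -> x <= y -> y <= c ->
  m * (((c - x) / c) `^ al - ((c - y) / c) `^ al) <= g0 y - g0 x
  <= D * m * (((c - x) / c) `^ al - ((c - y) / c) `^ al).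

Definition right_power_slopes al D c m (g1 : R -> R) := forall x y,
  c <= x -> x <= y -> y <= 1 ->
  m * (((y - c) / (1 - c)) `^ al - ((x - c) / (1 - c)) `^ al) <= g1 y - g1 x
  <= D * m * (((y - c) / (1 - c)) `^ al - ((x - c) / (1 - c)) `^ al).

End PowerLaw.

(** The margins 7 / 6 and 7 / 8 are matched: m is at least (7 / 8) / (7 / 6) = 3 / 4, the bound used
    throughout. *)
Record power_lorenz {R : realType} (al D c m m' : R) (g0 g1 : R -> R) : Prop := PowerLorenz {
  pl_al : 1 < al;
  pl_D1 : 1 <= D;
  pl_D : D <= 7 / 6;
  pl_c : 7 / 8 <= c;
  pl_c1 : c < 1;
  pl_g0 : incr_onto 0 c g0;
  pl_g1 : incr_onto c 1 g1;
  pl_g00 : g0 0 = 0;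
  pl_g11 : g1 1 = 1;
  pl_cm_gt : c < g0 c;
  pl_cm_le : g0 c <= 1;
  pl_cp_ge : 0 <= g1 c;
  pl_cp_lt : g1 c < c;
  pl_left : left_power_slopes al D c m g0;
  pl_right : right_power_slopes al D c m' g1 }.

Section Level.
Context {R : realType}.
Variables (al D c m m' : R) (g0 g1 : R -> R).
Hypothesis PL : power_lorenz al D c m m' g0 g1.
Let al1 := pl_al PL. Let D1 := pl_D1 PL. Let D76 := pl_D PL. Let c78 := pl_c PL.
Let c1 := pl_c1 PL. Let g0i := (pl_g0 PL).1. Let g1i := (pl_g1 PL).1.
Let g00 := pl_g00 PL. Let g11 := pl_g11 PL. Let cm_gt := pl_cm_gt PL. Let cm_le := pl_cm_le PL.
Let cp_ge := pl_cp_ge PL. Let cp_lt := pl_cp_lt PL. Let P0 := pl_left PL. Let P1 := pl_right PL.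
Local Notation t x := ((c - x) / c).
Local Notation s x := ((x - c) / (1 - c)).
Local Notation ep := (1 - c).
Local Notation cm := (g0 c).
Local Notation cp := (g1 c).

Ltac lv := have hal1 := al1; have hD1 := D1; have hD76 := D76; have hc78 := c78;
  have hc1 := c1; have hcm := cm_gt; have hcm1 := cm_le; have hcp0 := cp_ge; have hcp := cp_lt.

Let al0 : 0 < al. Proof. lv; lra. Qed.
Let aN : al != 0. Proof. by rewrite gt_eqF. Qed.
Let c0 : 0 < c. Proof. lv; lra. Qed.
Let cN : c != 0. Proof. by rewrite gt_eqF. Qed.
Let ep0 : 0 < ep. Proof. lv; lra. Qed.
Let eN : ep != 0. Proof. by rewrite gt_eqF. Qed.

Let t01 x : 0 <= x <= c -> 0 <= t x <= 1.
Proof. lv; move=> xc; rewrite divr_ge0 /= ?ler_pdivrMr //; lra. Qed.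

Let s01 x : c <= x <= 1 -> 0 <= s x <= 1.
Proof. lv; move=> xc; rewrite divr_ge0 /= ?ler_pdivrMr //; lra. Qed.

Let tc : t c = 0. Proof. by rewrite subrr mul0r. Qed.
Let t0 : t 0 = 1. Proof. by rewrite subr0 divff. Qed.
Let sc : s c = 0. Proof. by rewrite subrr mul0r. Qed.
Let s1 : s 1 = 1. Proof. by rewrite divff. Qed.

Lemma left_slope_bounds : m <= cm <= D * m.
Proof. lv; have := P0 (lexx _) (ltW c0) (lexx _); rewrite tc t0 powR1 powR0 // g00; lra. Qed.

Lemma right_slope_bounds : m' <= 1 - cp <= D * m'.
Proof. lv; have := P1 (lexx _) (ltW c1) (lexx _); rewrite sc s1 powR1 powR0 // g11; lra. Qed.

Lemma left_slope_gt : 3 / 4 <= m.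
Proof.
lv; have := left_slope_bounds => /andP[h1 h2].
have : 7 / 8 < D * m by lra.
have [m0|m0] := leP m 0.
  have : D * m <= 0 by rewrite pmulr_rle0 //; lra.
  lra.
have : D * m <= 7 / 6 * m by rewrite ler_pM2r.
lra.
Qed.

Lemma left_drop x : 0 <= x <= c -> m * t x `^ al <= cm - g0 x <= D * m * t x `^ al.
Proof. lv; move=> xc; have := @P0 x c; rewrite tc powR0 // subr0; apply; lra. Qed.

Lemma right_rise x : c <= x <= 1 -> m' * s x `^ al <= g1 x - cp <= D * m' * s x `^ al.
Proof. lv; move=> xc; have := @P1 c x; rewrite sc powR0 // subr0; apply; lra. Qed.

Lemma right_codrop x : c <= x <= 1 -> m' * (1 - s x `^ al) <= 1 - g1 x.
Proof. lv; move=> xc; have := @P1 x 1; rewrite s1 g11 powR1 => H; have := H ltac:(lra) ltac:(lra) ltac:(lra); lra. Qed.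

(** Heights are measured relative to the critical value cm, before and after the step, so that the
    estimate can be iterated. Since c < cm, the power law variable 1 - x / c is at most 1 - x /
    cm. *)
Lemma left_height_contract x : 0 <= x <= c ->
  1 - g0 x / cm <= D * (1 - x / cm) `^ al.
Proof.
lv; move=> xc; have cm0 : 0 < cm by lra.
have /andP[_ h] := left_drop xc.
have /andP[h1 h2] := left_slope_bounds.
have tle : t x `^ al <= (1 - x / cm) `^ al.
  apply: powR_le; [lra|by case/andP: (t01 xc)|].
  rewrite mulrBl divff // lerD2l lerN2 ler_pdivlMr // mulrAC ler_pdivrMr //.
  by apply: ler_wpM2l; lra.
rewrite -(@ler_pM2r _ cm) // mulrBl mul1r divfK ?gt_eqF //.
apply: (le_trans h).
rewrite -!mulrA ler_pM2l; last lra.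
rewrite mulrC; apply: ler_pM => //; try exact: powR_ge0.
have := left_slope_gt; lra.
Qed.

(** The recursion W' <= D W^al becomes V' <= V^al for V = D^(1 / (al - 1)) W, because 1 + 1 / (al -
    1) = al / (al - 1). *)
Lemma left_height_iter x k : (forall i, (i <= k)%N -> 0 <= iter i g0 x <= c) ->
  D `^ (al - 1)^-1 * (1 - iter k g0 x / cm) <=
  (D `^ (al - 1)^-1 * (1 - x / cm)) `^ (al ^+ k).
Proof.
lv; have cm0 : 0 < cm by lra.
have pos y : 0 <= y <= c -> 0 <= 1 - y / cm.
  by move=> yc; rewrite subr_ge0 ler_pdivrMr //; lra.
have D0 : 0 <= D `^ (al - 1)^-1 by exact: powR_ge0.
elim: k => [|k IH] H.
  by rewrite expr0 powRr1 // mulr_ge0 // pos // (H 0%N).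
have {}IH := IH (fun i ik => H i (leqW ik)).
have Hk := H k (leqnSn k).
rewrite exprSr powRrM.
apply: le_trans (powR_le (ltW al0) _ IH); last by rewrite mulr_ge0 ?pos.
rewrite powRM ?pos // -powRrM.
have -> : (al - 1)^-1 * al = (al - 1)^-1 + 1 by field; apply/eqP; lra.
rewrite powRD; last by rewrite (_ : D != 0) ?implybT // gt_eqF //; lra.
rewrite powRr1; last lra.
by rewrite -mulrA iterS ler_wpM2l // left_height_contract.
Qed.

(** Relative heights decay doubly exponentially, yet stay at least cm - c while the orbit is in
    [0, c]. So an orbit with k steps there starts at relative height near 1, which ln (1 - u) <= - u
    turns into a bound on x. *)
Lemma left_start_small x k : (forall i, (i <= k)%N -> 0 <= iter i g0 x <= c) ->
  x <= - ln (cm - c) / al ^+ k + ln D / (al - 1).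
Proof.
lv; move=> H; have cm0 : 0 < cm by lra.
have H0 := H 0%N (leq0n _); rewrite /= in H0.
have Hk := H k (leqnn _).
have z0 : 0 < cm - c by lra.
have Dp : 0 < D `^ (al - 1)^-1 by rewrite powR_gt0; lra.
have D1' : 1 <= D `^ (al - 1)^-1.
  by have := @ler_powR _ D D1 0 (al - 1)^-1; rewrite powRr0; apply; rewrite invr_ge0; lra.
have W0 : 0 < 1 - x / cm by rewrite subr_gt0 ltr_pdivrMr //; lra.
have Wk : cm - c <= 1 - iter k g0 x / cm.
  rewrite -(@ler_pM2r _ cm) // [leRHS]mulrBl mul1r divfK ?gt_eqF //.
  apply: (@le_trans _ _ ((cm - c) * 1)); last lra.
  by apply: ler_wpM2l; lra.
have akp : 0 < al ^+ k by rewrite exprn_gt0.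
have L : ln (cm - c) <= al ^+ k * (ln D / (al - 1) + ln (1 - x / cm)).
  rewrite (mulrC (ln D)) -ln_powR -lnM ?posrE // -ln_powR ler_ln ?posrE //.
    apply: (le_trans Wk); apply: le_trans (left_height_iter H).
    by apply: ler_peMl => //; lra.
  by rewrite powR_gt0 // mulr_gt0.
have L1 : ln (cm - c) / al ^+ k <= ln D / (al - 1) + ln (1 - x / cm).
  by rewrite ler_pdivrMr // mulrC.
have : ln (1 - x / cm) <= - (x / cm).
  by rewrite le_ln1Dx // ltrNl opprK; lra.
have : x <= x / cm.
  rewrite ler_pdivlMr //; apply: ler_piMr; lra.
rewrite mulNr; lra.
Qed.

(** With z = cm - c and d = c - cp, the two hypotheses give d <= 2 (z / ep)^al and z <= 2 (2 d)^al.
    Composition bounds z by a multiple of (z / ep)^(al^2), and al^2 > 1 prevents z from being too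
    small. *)
Lemma critical_gap : c <= g1 cm -> g0 cp < c ->
  al ^+ 2 * ln ep - (2 * al + 1) * ln 2 <= (al ^+ 2 - 1) * ln (cm - c).
Proof.
lv; move=> h1 h2.
have z0 : 0 < cm - c by lra.
have d0 : 0 < c - cp by lra.
have /andP[m_cm _] := left_slope_bounds.
have /andP[m_cp _] := right_slope_bounds.
have m34 := left_slope_gt.
have L1 : ln (cm - c) <= ln 2 + al * (ln 2 + ln (c - cp)).
  rewrite -lnM ?posrE // -ln_powR -lnM ?posrE ?powR_gt0 ?mulr_gt0 //.
  rewrite ler_ln ?posrE ?mulr_gt0 ?powR_gt0 ?mulr_gt0 //.
  have /andP[_ H] := @left_drop cp ltac:(lra).
  apply: (@le_trans _ _ (cm - g0 cp)); first lra.
  apply: (le_trans H); apply: ler_pM; [by apply: mulr_ge0; lra|exact: powR_ge0| |].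
    have : D * m <= D * 1 by rewrite ler_pM2l; lra.
    lra.
  apply: powR_le; [lra|by apply: divr_ge0; lra|].
  rewrite ler_pdivrMr // -mulrA mulrC -mulrA; apply: ler_peMr; lra.
have L2 : ln (c - cp) <= ln 2 + al * (ln (cm - c) - ln ep).
  rewrite -ln_div ?posrE // -ln_powR -lnM ?posrE ?powR_gt0 ?divr_gt0 //.
  rewrite ler_ln ?posrE ?mulr_gt0 ?powR_gt0 ?divr_gt0 //.
  have /andP[_ H] := @right_rise cm ltac:(lra).
  apply: (@le_trans _ _ (g1 cm - cp)); first lra.
  apply: (le_trans H); apply: ler_wpM2r; first exact: powR_ge0.
  have [m0|m0] := leP m' 0.
    have : D * m' <= 0 by rewrite pmulr_rle0 //; lra.
    lra.
  have : D * m' <= 7 / 6 * m' by rewrite ler_pM2r.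
  lra.
have : al * ln (c - cp) <= al * (ln 2 + al * (ln (cm - c) - ln ep)) by rewrite ler_pM2l.
lra.
Qed.

(** Expansion by al / D in the metric dx / (cm - x): for the pure power law with cm = c the map
    multiplies ln (c - x) by al, up to a constant. In this metric the weights telescope along an
    orbit, and b steps lose only D^b. *)
Lemma left_slope_ge x y : 0 <= x -> x <= y -> y < c ->
  al / D * (y - x) * (cm - g0 y) <= (g0 y - g0 x) * (cm - y).
Proof.
lv; move=> x0 xy yc.
have m34 := left_slope_gt.
have /andP[h1 _] := P0 x0 xy (ltW yc).
have /andP[_ h2] := @left_drop y ltac:(lra).
have /andP[tx0 _] := @t01 x ltac:(lra).
have /andP[ty0 _] := @t01 y ltac:(lra).
have h3 := powR_tangent al1 ty0 tx0.
have p0 : 0 <= t y `^ (al - 1) := powR_ge0 _ _.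
have Et : t x - t y = (y - x) / c by rewrite -mulrBl; congr (_ / _); ring.
have Ey : t y `^ al = t y * t y `^ (al - 1) by rewrite mulr_powRB1.
apply: (@le_trans _ _ (al / D * (y - x) * (D * m * t y `^ al))).
  by apply: ler_wpM2l => //; rewrite !mulr_ge0 // ?invr_ge0; lra.
apply: (@le_trans _ _ (m * (al * t y `^ (al - 1) * (t x - t y)) * (cm - y))); last first.
  apply: ler_wpM2r; first lra.
  by apply: le_trans h1; apply: ler_wpM2l => //; lra.
rewrite Ey Et.
have -> : al / D * (y - x) * (D * m * (t y * t y `^ (al - 1))) =
  (m * (al * t y `^ (al - 1)) * (y - x)) / c * (c - y).
  field; apply/andP; split=> //; apply/eqP; lra.
have -> : m * (al * t y `^ (al - 1) * ((y - x) / c)) * (cm - y) =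
  (m * (al * t y `^ (al - 1)) * (y - x)) / c * (cm - y) by field.
apply: ler_wpM2l; last lra.
by rewrite divr_ge0 ?mulr_ge0 //; lra.
Qed.

Lemma left_iter_ge x y k : 0 <= x -> x <= y ->
  (forall i, (i < k)%N -> 0 <= iter i g0 x /\ iter i g0 y < c) ->
  (al / D) ^+ k * (y - x) * (cm - iter k g0 y) <=
  (iter k g0 y - iter k g0 x) * (cm - y).
Proof.
lv; move=> x0 xy; elim: k => [|k IH] H; first by rewrite expr0 mul1r /=; lra.
have {}IH := IH (fun i ik => H i (leqW ik)).
have [xk yk] := H k (leqnn _).
have xyk : iter k g0 x <= iter k g0 y.
  elim: k {IH} H xk yk => [//|k IHk] H xk yk; rewrite !iterS.
  have [? ?] := H k (leqW (leqnn _)).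
  apply: (incr_on_le g0i) => //; last lra.
  by apply: IHk => // i ik; apply: H; exact: leqW.
rewrite !iterS; set X := iter k g0 x in IH xk xyk *; set Y := iter k g0 y in IH yk xyk *.
have S := left_slope_ge xk xyk yk.
have Y0 : 0 < cm - Y by lra.
have y1 : 0 <= cm - g0 Y.
  by have : g0 Y <= cm by [apply: (incr_on_le g0i); lra]; lra.
have yc : 0 <= cm - y.
  have := H 0%N isT; rewrite /= => -[_ ?]; lra.
rewrite -(@ler_pM2r _ (cm - Y)) //.
have -> : (al / D) ^+ k.+1 * (y - x) * (cm - g0 Y) * (cm - Y) =
  (al / D * (cm - g0 Y)) * ((al / D) ^+ k * (y - x) * (cm - Y)) by rewrite exprS; ring.
apply: (@le_trans _ _ ((al / D * (cm - g0 Y)) * ((Y - X) * (cm - y)))).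
  by apply: ler_wpM2l => //; rewrite mulr_ge0 ?divr_ge0 //; lra.
have -> : (al / D * (cm - g0 Y)) * ((Y - X) * (cm - y)) =
  (al / D * (Y - X) * (cm - g0 Y)) * (cm - y) by ring.
by rewrite [leRHS]mulrAC; apply: ler_wpM2r.
Qed.

(** The power law contracts the distance to c, the metric measures the distance to cm; [F] is the
    price of exchanging them. For the lower bound the exchange goes the favourable way. *)
Lemma left_slope_le F x y : 0 <= x -> x <= y -> y <= c -> cm - x <= F * (c - x) ->
  (g0 y - g0 x) * (cm - x) <= al * D * F * (y - x) * (cm - g0 x).
Proof.
lv; move=> x0 xy yc HF.
have m34 := left_slope_gt.
have /andP[_ h1] := P0 x0 xy yc.
have /andP[h2 _] := @left_drop x ltac:(lra).
have /andP[tx0 _] := @t01 x ltac:(lra).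
have /andP[ty0 _] := @t01 y ltac:(lra).
have h3 := powR_secant_le al1 ty0 tx0.
have p0 : 0 <= t x `^ (al - 1) := powR_ge0 _ _.
have Et : t x - t y = (y - x) / c by rewrite -mulrBl; congr (_ / _); ring.
have Ex : t x `^ al = t x * t x `^ (al - 1) by rewrite mulr_powRB1.
have F0 : 0 <= F.
  rewrite leNgt; apply/negP => Fn; have : F * (c - x) <= 0 by rewrite nmulr_rle0; lra.
  lra.
apply: (@le_trans _ _ (D * m * (al * t x `^ (al - 1) * (t x - t y)) * (F * (c - x)))).
  apply: ler_pM => //; [|lra|].
    by rewrite subr_ge0 (incr_on_le g0i).
  by apply: (le_trans h1); apply: ler_wpM2l => //; apply: mulr_ge0; lra.
rewrite Et.
have -> : D * m * (al * t x `^ (al - 1) * ((y - x) / c)) * (F * (c - x)) =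
  al * D * F * (y - x) * (m * (t x * t x `^ (al - 1))) by field.
rewrite -Ex; apply: ler_wpM2l => //.
by rewrite !mulr_ge0 //; lra.
Qed.

Lemma left_iter_le F x y k : 0 <= x -> x <= y ->
  (forall i, (i < k)%N -> [/\ 0 <= iter i g0 x, iter i g0 y <= c &
     cm - iter i g0 x <= F * (c - iter i g0 x)]) ->
  (iter k g0 y - iter k g0 x) * (cm - x) <=
  (al * D * F) ^+ k * (y - x) * (cm - iter k g0 x).
Proof.
lv; move=> x0 xy; elim: k => [|k IH] H; first by rewrite expr0 mul1r /=; lra.
have {}IH := IH (fun i ik => H i (leqW ik)).
have [xk yk Fk] := H k (leqnn _).
have xyk : iter k g0 x <= iter k g0 y.
  elim: k {IH} H xk yk Fk => [//|k IHk] H xk yk Fk; rewrite !iterS.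
  have [? ? ?] := H k (leqW (leqnn _)).
  apply: (incr_on_le g0i) => //.
  by apply: IHk => // i ik; apply: H; exact: leqW.
rewrite !iterS; set X := iter k g0 x in IH xk xyk Fk *; set Y := iter k g0 y in IH yk xyk *.
have S := left_slope_le xk xyk yk Fk.
have X0 : 0 < cm - X by lra.
have x1 : 0 <= cm - g0 X.
  by have : g0 X <= cm by [apply: (incr_on_le g0i); lra]; lra.
have [_ x0c _] := H 0%N isT; rewrite /= in x0c.
have cx : 0 <= cm - x by lra.
have F0 : 0 <= F.
  rewrite leNgt; apply/negP => Fn; have : F * (c - X) <= 0 by rewrite nmulr_rle0; lra.
  lra.
rewrite -(@ler_pM2r _ (cm - X)) // mulrAC.
apply: (@le_trans _ _ (al * D * F * (Y - X) * (cm - g0 X) * (cm - x))).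
  by apply: ler_wpM2r.
have -> : al * D * F * (Y - X) * (cm - g0 X) * (cm - x) =
  (al * D * F * (cm - g0 X)) * ((Y - X) * (cm - x)) by ring.
have -> : (al * D * F) ^+ k.+1 * (y - x) * (cm - g0 X) * (cm - X) =
  (al * D * F * (cm - g0 X)) * ((al * D * F) ^+ k * (y - x) * (cm - X)) by rewrite exprS; ring.
by apply: ler_wpM2l => //; rewrite !mulr_ge0 //; lra.
Qed.

End Level.

(** * Cantor sets from trees of intervals *)

Section FiniteCovers.
Context {R : realType}.

Lemma nneseries_nth (T : Type) (x0 : T) (s : seq T) (g : T -> \bar R) :
  (forall x, (0 <= g x)%E) -> g x0 = 0%E ->
  (\sum_(0 <= i <oo) g (nth x0 s i) = \sum_(x <- s) g x)%E.
Proof.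
move=> g0 gx0; rewrite (@nneseries_split _ _ 0 (size s)) // add0n eseries0 ?adde0.
  by rewrite (big_nth x0).
by move=> i si _; rewrite nth_default.
Qed.

(** Gaps are required only between consecutive intervals: the outer ones may share an end with the
    parent, as happens at the critical values. *)
Definition spread (kappa lo hi : R) (s : seq (R * R)) :=
  [&& (1 < size s)%N,
    all (fun I => [&& lo <= I.1, I.1 + kappa * (hi - lo) <= I.2 & I.2 <= hi]) s &
    sorted (fun I J : R * R => I.2 + kappa * (hi - lo) <= J.1) s].

Lemma spread_sum kappa lo hi s : 0 < kappa -> lo < hi -> spread kappa lo hi s ->
  \sum_(I <- s) (I.2 - I.1) <= (1 - kappa) * (hi - lo).
Proof.
move=> k0 lh; rewrite /spread; set d := kappa * (hi - lo).
have d0 : 0 < d by rewrite mulr_gt0 ?subr_gt0.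
have H : forall s' I, all (fun I => [&& lo <= I.1, I.1 + d <= I.2 & I.2 <= hi]) (I :: s') ->
    path (fun I J : R * R => I.2 + d <= J.1) I s' ->
    \sum_(J <- I :: s') (J.2 - J.1) <= hi - I.1 - d *+ size s'.
  elim=> [|J s' IH] I /=; first by rewrite big_seq1 => /andP[/and3P[? ? ?] _] _; rewrite mulr0n; lra.
  move=> /andP[/and3P[? ? ?] aJ] /andP[IJ p].
  by have := IH J aJ p; rewrite [X in _ -> X <= _]big_cons mulrS; lra.
case: s => [//|I [//|J s]] /and3P[_ a p].
have := H (J :: s) I a p; rewrite /= mulrS.
have /andP[/and3P[? ? ?] _] := a.
have : 0 <= d *+ size s by rewrite mulrn_wge0 // ltW.
rewrite mulrBl mul1r -/d; lra.
Qed.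

Lemma spread_mem kappa lo hi s I : spread kappa lo hi s -> I \in s ->
  [/\ lo <= I.1, I.1 + kappa * (hi - lo) <= I.2 & I.2 <= hi].
Proof. by move=> /and3P[_ /allP a _] /a /and3P. Qed.

Lemma big_flatten_map (N : Type) (V : nmodType) (f : N -> seq N) (F : N -> V) (s : seq N) :
  \sum_(w <- flatten (map f s)) F w = \sum_(v <- s) \sum_(w <- f v) F w.
Proof. by rewrite big_flatten big_map. Qed.

End FiniteCovers.

Section Tree.
Context {R : realType} (N : eqType).
Variables (ch : nat -> N -> seq N) (root : N).

(** The children depend on the level because names are reused: a node and one of its children may
    have the same name. *)
Fixpoint tree_level n : seq N :=
  if n is m.+1 then flatten [seq ch m v | v <- tree_level m] else [:: root].

Lemma tree_child n v w : v \in tree_level n -> w \in ch n v -> w \in tree_level n.+1.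
Proof. by move=> vn wv; apply/flattenP; exists (ch n v) => //; apply: map_f. Qed.

Lemma tree_sum (F : nat -> N -> R) (th : R) : 0 <= th ->
  (forall n v, v \in tree_level n -> \sum_(w <- ch n v) F n.+1 w <= th * F n v) ->
  forall n, \sum_(v <- tree_level n) F n v <= th ^+ n * F 0%N root.
Proof.
move=> th0 H; elim=> [|n IH]; first by rewrite /= big_seq1 expr0 mul1r.
rewrite /= big_flatten_map exprS -mulrA.
apply: (@le_trans _ _ (\sum_(v <- tree_level n) th * F n v)).
  by rewrite big_seq [leRHS]big_seq; apply: ler_sum => v vn; exact: H.
by rewrite -mulr_sumr; apply: ler_wpM2l.
Qed.

Lemma exp_small (th C e : R) : 0 <= th < 1 -> 0 < e -> 0 <= C -> exists n, th ^+ n * C < e.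
Proof.
move=> /andP[th0 th1] e0 C0.
have C1 : 0 < C + 1 by lra.
have : th ^+ n @[n --> \oo] --> (0 : R) by apply: cvg_expr; rewrite ger0_norm.
move/cvgrPdist_lt => /(_ (e / (C + 1)) ltac:(exact: divr_gt0)) [n _ /(_ n (leqnn _))] /=.
rewrite sub0r normrN ger0_norm ?exprn_ge0 // ltr_pdivlMr // => h; exists n.
by apply: le_lt_trans h; apply: ler_wpM2l; [exact: exprn_ge0|lra].
Qed.

Lemma tree_lebesgue_null (A : set R) (iv : nat -> N -> R * R) (th : R) : 0 <= th < 1 ->
  (forall n v, v \in tree_level n -> (iv n v).1 <= (iv n v).2) ->
  (forall n v, v \in tree_level n ->
    \sum_(w <- ch n v) ((iv n.+1 w).2 - (iv n.+1 w).1) <= th * ((iv n v).2 - (iv n v).1)) ->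
  (forall n x, A x -> exists2 v, v \in tree_level n & (iv n v).1 <= x <= (iv n v).2) ->
  lebesgue_null A.
Proof.
move=> th01 len0 H cov e e0.
have root0 : 0 <= (iv 0%N root).2 - (iv 0%N root).1 by rewrite subr_ge0 (len0 0%N) // mem_seq1.
have [n ne] := exp_small th01 e0 root0.
pose s := map (iv n) (tree_level n).
exists (fun i => nth (0, 0) s i); split.
- move=> i; have [is'|is'] := ltnP i (size s); last by rewrite nth_default.
  by have /mapP[v vn ->] := mem_nth (0, 0) is'; exact: len0.
- move=> x Ax; have [v vn vI] := cov n x Ax.
  have vs : iv n v \in s by exact: map_f.
  by exists (index (iv n v) s) => //=; rewrite nth_index // in_itv.
- rewrite (eq_eseriesr (g := fun i => `|(nth (0, 0) s i).2 - (nth (0, 0) s i).1|%:E)); last first.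
    move=> i _; congr EFin; rewrite ger0_norm // subr_ge0.
    have [is'|is'] := ltnP i (size s); last by rewrite nth_default.
    by have /mapP[v vn ->] := mem_nth (0, 0) is'; exact: len0.
  rewrite (@nneseries_nth _ _ (0, 0) s (fun I => `|I.2 - I.1|%:E)) /=; last 2 first.
  + by move=> I; rewrite lee_fin.
  + by rewrite subrr normr0.
  rewrite sumEFin lee_fin; apply: le_trans (ltW ne).
  have := @tree_sum (fun n v => (iv n v).2 - (iv n v).1) th (proj1 (andP th01)) H n.
  apply: le_trans; rewrite big_map big_seq [leRHS]big_seq; apply: ler_sum => v vn.
  by rewrite ger0_norm // subr_ge0 len0.
Qed.

End Tree.

Section CantorTree.
Context {R : realType} (N : eqType).
Variables (iv : nat -> N -> R * R) (ch : nat -> N -> seq N) (root : N) (L : set R) (kappa : R).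
Local Notation lev := (tree_level ch root).
Hypotheses (kappa0 : 0 < kappa) (iv0 : iv 0%N root = (0, 1)) (Lc : closed L).
Hypothesis sp : forall n v, v \in lev n ->
  spread kappa (iv n v).1 (iv n v).2 (map (iv n.+1) (ch n v)).
Hypothesis cov : forall n x, L x -> exists2 v, v \in lev n & (iv n v).1 <= x <= (iv n v).2.
Hypothesis meets : forall n v, v \in lev n -> exists2 x, L x & (iv n v).1 <= x <= (iv n v).2.

Local Notation len n v := ((iv n v).2 - (iv n v).1).

Lemma tree_len_gt0 n v : v \in lev n -> 0 < len n v.
Proof.
elim: n v => [|n IH] v; first by rewrite mem_seq1 => /eqP ->; rewrite iv0 subr0.
move=> /flattenP[s /mapP[u un ->] vu].
have [_ h _] := spread_mem (sp un) (map_f (iv n.+1) vu).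
have := mulr_gt0 kappa0 (IH u un); lra.
Qed.

Lemma tree_child_sum n v : v \in lev n ->
  \sum_(w <- ch n v) len n.+1 w <= (1 - kappa) * len n v.
Proof.
move=> vn; have l0 := tree_len_gt0 vn; rewrite subr_gt0 in l0.
by have := spread_sum kappa0 l0 (sp vn); rewrite big_map.
Qed.

Lemma tree_child_len n v w : v \in lev n -> w \in ch n v ->
  [/\ kappa * len n v <= len n.+1 w, len n.+1 w <= (1 - kappa) * len n v,
     (iv n v).1 <= (iv n.+1 w).1 & (iv n.+1 w).2 <= (iv n v).2].
Proof.
move=> vn wv; have [h1 h2 h3] := spread_mem (sp vn) (map_f (iv n.+1) wv).
split=> //; first by move: h2; rewrite -lerBrDl.
apply: le_trans (tree_child_sum vn).
rewrite (big_rem w) //= lerDl big_seq; apply: sumr_ge0 => u us.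
by apply/ltW/tree_len_gt0; apply: tree_child vn (mem_rem us).
Qed.

(** The root contains two children and at least one gap, each of length at least kappa. *)
Lemma kappa_le13 : 3 * kappa <= 1.
Proof.
have r0 : root \in lev 0 by rewrite mem_seq1.
have := tree_child_sum r0; have := sp r0; rewrite iv0 subr0 mulr1 => /and3P[].
case E : (ch 0%N root) => [|u [|w s]] // _ _ _ h.
have lu : u \in ch 0%N root by rewrite E mem_head.
have lw : w \in ch 0%N root by rewrite E !inE eqxx orbT.
have [+ _ _ _] := tree_child_len r0 lu; have [+ _ _ _] := tree_child_len r0 lw.
rewrite iv0 subr0 mulr1; move: h; rewrite !big_cons.
have : 0 <= \sum_(j <- s) len 1 j.
  rewrite big_seq; apply: sumr_ge0 => j js; apply/ltW/tree_len_gt0.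
  by apply: tree_child r0 _; rewrite E !inE js !orbT.
lra.
Qed.

Lemma tree_len_le n v : v \in lev n -> len n v <= (1 - kappa) ^+ n.
Proof.
have k13 := kappa_le13; have k0 := kappa0.
elim: n v => [|n IH] v; first by rewrite mem_seq1 => /eqP ->; rewrite iv0 subr0 expr0.
move=> /flattenP[s /mapP[u un ->] vu].
have [_ h _ _] := tree_child_len un vu.
by apply: (le_trans h); rewrite exprS; apply: ler_wpM2l; [lra|exact: IH].
Qed.

Lemma tree_len_ge n v : v \in lev n -> kappa ^+ n <= len n v.
Proof.
elim: n v => [|n IH] v; first by rewrite mem_seq1 => /eqP ->; rewrite iv0 subr0 expr0.
move=> /flattenP[s /mapP[u un ->] vu].
have [h _ _ _] := tree_child_len un vu.
by apply: le_trans h; rewrite exprS; apply: ler_wpM2l; [exact: ltW|exact: IH].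
Qed.

Let th01 : 0 <= 1 - kappa < 1.
Proof. by have := kappa_le13; have := kappa0; lra. Qed.

Lemma cantor_null : lebesgue_null L.
Proof.
apply: (@tree_lebesgue_null _ _ ch root L iv (1 - kappa)) => //.
- by move=> n v /tree_len_gt0; rewrite subr_gt0 => /ltW.
- by move=> n v; exact: tree_child_sum.
Qed.

Lemma cantor_sub01 x : L x -> 0 <= x <= 1.
Proof. by move=> /(cov 0)[v]; rewrite mem_seq1 => /eqP ->; rewrite iv0. Qed.

Lemma lebesgue_null_no_segment (a b : R) (A : set R) : lebesgue_null A -> a < b -> ~ (`[a, b] `<=` A).
Proof.
move=> /lebesgue_null_negligible[B [mB B0 AB]] ab sub.
have : (@lebesgue_measure R `[a, b]%classic <= 0)%E.
  rewrite -B0; apply: le_measure; rewrite ?inE //.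
  exact: subset_trans sub AB.
by rewrite lebesgue_measure_segment ?(ltW ab) // lee_fin subr_le0 leNgt ab.
Qed.

(** Perfect: inside a small node around x, two separated children both carry points of [L], and at
    most one of these is x. Totally disconnected: a component with two points contains a segment,
    which a null set does not. *)
Lemma cantor_tree_cantor : cantor_set L.
Proof.
split.
- have [x Lx _] : exists2 x, L x & (iv 0%N root).1 <= x <= (iv 0%N root).2.
    by apply: meets; rewrite mem_seq1.
  by exists x.
- apply: (subclosed_compact Lc (@segment_compact _ 0 1)) => x /cantor_sub01.
  by rewrite /= in_itv.
- split=> //; rewrite eqEsubset; split.
    by move=> x xl; apply: Lc => U /xl[y [_ Ly Uy]]; exists y.
  move=> x Lx U /nbhs_ballP[e /= e0 eU].
  have [n] := exp_small th01 e0 ler01; rewrite mulr1 => ne.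
  have [v vn vI] := cov n Lx.
  have := sp vn => /and3P[+ _ +].
  case E : (ch n v) => [|u [|w s]] //= _ /andP[uw _].
  have lu : u \in ch n v by rewrite E mem_head.
  have lw : w \in ch n v by rewrite E !inE eqxx orbT.
  have [y Ly yI] := meets (tree_child vn lu).
  have [z Lz zI] := meets (tree_child vn lw).
  have lvl := tree_len_le vn.
  have [_ _ hu1 hu2] := tree_child_len vn lu; have [_ _ hw1 hw2] := tree_child_len vn lw.
  have gap := mulr_gt0 kappa0 (tree_len_gt0 vn).
  have near (t : R) : (iv n v).1 <= t <= (iv n v).2 -> U t.
    by move=> tI; apply: eU; rewrite /ball /= ltr_norml; lra.
  have [yx|yx] := eqVneq y x; last by exists y; split=> //; apply: near; lra.
  exists z; split=> //; last by apply: near; lra.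
  by rewrite gt_eqF // -yx; lra.
- move=> x Lx; rewrite eqEsubset; split; last first.
    by move=> y ->; exact: connected_component_refl.
  move=> y Cy; apply: contrapT => /eqP yx.
  have Cx : connected_component L x x by exact: connected_component_refl.
  have /connected_intervalP ci := @component_connected _ L x.
  have sub : connected_component L x `<=` L by exact: connected_component_sub.
  have [xy|yx'|E] := ltgtP x y; last by move: yx; rewrite E /= eqxx.
  - apply: (lebesgue_null_no_segment cantor_null xy) => z; rewrite /= in_itv /= => zI.
    by apply: sub; exact: ci Cx Cy _ zI.
  - apply: (lebesgue_null_no_segment cantor_null yx') => z; rewrite /= in_itv /= => zI.
    by apply: sub; exact: ci Cy Cx _ zI.
Qed.

End CantorTree.

(** * Hausdorff dimension *)

Section HausdorffBasics.
Context {R : realType}.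
Local Open Scope ereal_scope.
Implicit Types (A U : set R) (s d : R).

Lemma ediam_ge0 A : A !=set0 -> 0 <= ediam A.
Proof.
move=> [x Ax]; apply: ereal_sup_ubound; exists x => //; exists x => //.
by rewrite subrr normr0.
Qed.

Lemma ediam_segment (a b : R) : (a <= b)%R -> ediam `[a, b]%classic = (b - a)%:E.
Proof.
move=> ab; apply/eqP; rewrite eq_le; apply/andP; split.
  apply: ge_ereal_sup => _ [x xI [y yI <-]]; rewrite lee_fin.
  by move: xI yI; rewrite /= !in_itv /= ler_norml => xI yI; lra.
apply: ereal_sup_ubound; exists b; first by rewrite /= in_itv /= ab lexx.
exists a; first by rewrite /= in_itv /= ab lexx.
by rewrite ger0_norm // subr_ge0.
Qed.

Lemma hausdorff_gauge_ge0 s A : 0 <= hausdorff_gauge s A.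
Proof. by rewrite /hausdorff_gauge; case: ifP => // _; exact: poweR_ge0. Qed.

Lemma hausdorff_gauge0 s : hausdorff_gauge s (set0 : set R) = 0.
Proof. by rewrite /hausdorff_gauge eqxx. Qed.

Lemma hausdorff_gauge_segment s (a b : R) : (a <= b)%R ->
  hausdorff_gauge s `[a, b]%classic = ((b - a) `^ s)%:E.
Proof.
move=> ab; rewrite /hausdorff_gauge ifF; first by rewrite ediam_segment // poweR_EFin.
apply/negbTE/set0P; exists a; by rewrite /= in_itv /= lexx ab.
Qed.

Lemma hausdorff_content_ge0 s d A : 0 <= hausdorff_content s d A.
Proof.
apply: le_ereal_inf_tmp => _ [U _ <-]; apply: nneseries_ge0 => i _ _.
exact: hausdorff_gauge_ge0.
Qed.

Lemma hausdorff_measure0P s A : (forall d e, (0 < d)%R -> (0 < e)%R -> hausdorff_content s d A <= e%:E) ->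
  hausdorff_measure s A = 0.
Proof.
move=> H; apply/eqP; rewrite eq_le; apply/andP; split.
  apply: ge_ereal_sup => _ [d d0 <-]; apply/lee_addgt0Pr => e e0; rewrite add0e; exact: H.
apply: (@le_trans _ _ (hausdorff_content s 1 A)); first exact: hausdorff_content_ge0.
by apply: ereal_sup_ubound; exists 1%R => //=; exact: ltr01.
Qed.

End HausdorffBasics.

Section CantorDimension.
Context {R : realType} (N : eqType).
Variables (iv : nat -> N -> R * R) (ch : nat -> N -> seq N) (root : N) (L : set R) (kappa : R).
Local Notation lev := (tree_level ch root).
Hypotheses (kappa0 : 0 < kappa) (iv0 : iv 0%N root = (0, 1)) (Lc : closed L).
Hypothesis sp : forall n v, v \in lev n ->
  spread kappa (iv n v).1 (iv n v).2 (map (iv n.+1) (ch n v)).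
Hypothesis cov : forall n x, L x -> exists2 v, v \in lev n & (iv n v).1 <= x <= (iv n v).2.
Hypothesis meets : forall n v, v \in lev n -> exists2 x, L x & (iv n v).1 <= x <= (iv n v).2.

Local Notation len n v := ((iv n v).2 - (iv n v).1).
Let len0 := tree_len_gt0 kappa0 iv0 sp.
Let k13 : 3 * kappa <= 1 := kappa_le13 kappa0 iv0 sp.
Let lnk : 0 < - ln kappa.
Proof. by rewrite oppr_gt0 ln_lt0 //; have := k13; have := kappa0; lra. Qed.

(** Chosen so that kappa^(- eta) = 1 + kappa. Children are at least kappa times as long as their
    parent, so the sum of the lengths to the power 1 - eta shrinks by (1 - kappa)(1 + kappa) < 1 at
    every level, and the dimension is at most 1 - eta. *)
Let eta := ln (1 + kappa) / - ln kappa.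

Let eta01 : 0 < eta < 1.
Proof.
have h1 := k13; have h0 := kappa0.
have l1 : 0 < ln (1 + kappa) by apply: ln_gt0; lra.
have kk : (1 + kappa) * kappa <= 4 / 3 * (1 / 3) by apply: ler_pM; lra.
have kk0 : 0 < (1 + kappa) * kappa by apply: mulr_gt0; lra.
have : ln ((1 + kappa) * kappa) < 0 by apply: ln_lt0; lra.
rewrite lnM ?posrE; try lra.
have lk := lnk; move=> lt0; rewrite /eta divr_gt0 //= ltr_pdivrMr // mul1r; lra.
Qed.

Let lnkN : ln kappa != 0. Proof. by rewrite lt_eqF //; have := lnk; lra. Qed.

Let kappa_eta : kappa `^ (- eta) = 1 + kappa.
Proof.
have h0 := kappa0; rewrite /powR gt_eqF //.
rewrite (_ : - eta * ln kappa = ln (1 + kappa)); last by rewrite /eta; field; rewrite lnkN.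
by rewrite lnK // posrE; lra.
Qed.

Let level_sum_powR n v : v \in lev n ->
  \sum_(w <- ch n v) len n.+1 w `^ (1 - eta) <= (1 - kappa ^+ 2) * len n v `^ (1 - eta).
Proof.
move=> vn; have l0 := len0 vn; have e01 := eta01; have h0 := kappa0; have h13 := k13.
have lE (x : R) : 0 < x -> x `^ (1 - eta) = x * x `^ (- eta).
  by move=> x0; rewrite powRD ?powRr1 ?(ltW x0) // (gt_eqF x0) implybT.
apply: (@le_trans _ _ (\sum_(w <- ch n v) len n.+1 w * (kappa * len n v) `^ (- eta))).
  rewrite big_seq [leRHS]big_seq; apply: ler_sum => w wv.
  have w0 := len0 (tree_child vn wv).
  rewrite lE //; apply: ler_wpM2l; first exact: ltW.
  have [h _ _ _] := tree_child_len kappa0 iv0 sp vn wv.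
  rewrite !powRN lef_pV2 ?posrE ?powR_gt0 ?mulr_gt0 //.
  by apply: powR_le => //; [lra|rewrite mulr_ge0 // ltW].
rewrite -mulr_suml powRM ?(ltW l0) ?(ltW h0) // kappa_eta.
apply: (@le_trans _ _ ((1 - kappa) * len n v * ((1 + kappa) * len n v `^ (- eta)))).
  apply: ler_wpM2r; last exact: (tree_child_sum kappa0 iv0 sp vn).
  by apply: mulr_ge0; [lra|exact: powR_ge0].
by rewrite lE //; lra.
Qed.

Lemma cantor_dim_lt1 : (hausdorff_dim L < 1)%E.
Proof.
have e01 := eta01; have h0 := kappa0; have h13 := k13.
have k2 : 0 <= 1 - kappa ^+ 2 < 1.
  have : kappa ^+ 2 <= 1 * 1 by rewrite expr2; apply: ler_pM; lra.
  have : 0 < kappa ^+ 2 by rewrite exprn_gt0.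
  lra.
apply: (@le_lt_trans _ _ (1 - eta)%:E); last by rewrite lte_fin; lra.
apply: ereal_inf_lbound; exists (1 - eta) => //; split; first lra.
apply: hausdorff_measure0P => d e d0 e0.
have [n1 n1d] := exp_small (th := 1 - kappa) (C := 1) ltac:(lra) d0 ler01.
have [n2 n2e] := exp_small (C := 1) k2 e0 ler01.
pose n := maxn n1 n2.
have nd : (1 - kappa) ^+ n <= d.
  apply: ltW; apply: le_lt_trans n1d; rewrite mulr1.
  by apply: ler_wiXn2l; rewrite ?leq_maxl //; lra.
have ne : (1 - kappa ^+ 2) ^+ n <= e.
  apply: ltW; apply: le_lt_trans n2e; rewrite mulr1.
  by apply: ler_wiXn2l; rewrite ?leq_maxr //; lra.
pose s := map (fun v => `[(iv n v).1, (iv n v).2]%classic) (lev n).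
have ivle v : v \in lev n -> (iv n v).1 <= (iv n v).2.
  by move=> /len0; rewrite subr_gt0 => /ltW.
apply: (@le_trans _ _ (\sum_(0 <= i <oo) hausdorff_gauge (1 - eta) (nth set0 s i))%E).
  apply: ereal_inf_lbound; exists (fun i => nth set0 s i) => //; split.
    move=> x Lx; have [v vn vI] := cov n Lx.
    have vs : (index v (lev n) < size (lev n))%N by rewrite index_mem.
    exists (index v (lev n)) => //=.
    by rewrite (nth_map root) // nth_index //= in_itv.
  move=> i; have [is'|is'] := ltnP i (size s); last first.
    rewrite nth_default // /ediam (_ : [set _ | _ in _ & _ in _] = set0) ?ereal_sup0 ?leNye //.
    by rewrite -subset0 => _ [x []].
  rewrite size_map in is'; rewrite (nth_map root) //.
  have vn := mem_nth root is'.
  rewrite ediam_segment ?ivle // lee_fin; apply: le_trans nd.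
  exact: (tree_len_le kappa0 iv0 sp vn).
rewrite (@nneseries_nth _ _ set0 s (hausdorff_gauge (1 - eta))); last 2 first.
  by move=> U; exact: hausdorff_gauge_ge0.
  exact: hausdorff_gauge0.
rewrite big_map.
rewrite (eq_big_seq (fun v => (len n v `^ (1 - eta))%:E)); last first.
  by move=> v vn; rewrite hausdorff_gauge_segment // ivle.
rewrite sumEFin lee_fin; apply: le_trans ne.
have := tree_sum (proj1 (andP k2)) level_sum_powR n.
by rewrite iv0 subr0 powR1 mulr1.
Qed.

(** The pair is a node and the unread part of a binary expansion: the leading digit picks one of the
    first two children. *)
Let step (n : nat) (vz : N * R) : N * R :=
  (nth root (ch n vz.1) (nat_of_bool (1 / 2 <= vz.2 :> R)), 2 * vz.2 - (1 / 2 <= vz.2 :> R)%:R).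

Fixpoint code (y : R) n : N * R := if n is m.+1 then step m (code y m) else (root, y).

Let child_bit n v (bt : bool) : v \in lev n -> nth root (ch n v) bt \in ch n v.
Proof.
move=> vn; apply: mem_nth; have := sp vn => /and3P[+ _ _]; rewrite size_map.
by case: bt => //; exact: ltnW.
Qed.

Let codeP y n : 0 <= y <= 1 -> (code y n).1 \in lev n /\ 0 <= (code y n).2 <= 1.
Proof.
move=> yI; elim: n => [|n [vn zI]]; first by rewrite mem_seq1 eqxx.
rewrite /= /step /=; split; first by by apply: (tree_child vn); exact: (child_bit (1 / 2 <= (code y n).2) vn).
by case: (leP (1 / 2) (code y n).2) => h; rewrite ?mulr0n ?mulr1n; lra.
Qed.

Let code_point y := xget 0 [set x | L x /\ forall n, (iv n (code y n).1).1 <= x <= (iv n (code y n).1).2].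

Let code_pointP y : 0 <= y <= 1 ->
  L (code_point y) /\ forall n, (iv n (code y n).1).1 <= code_point y <= (iv n (code y n).1).2.
Proof.
move=> yI; rewrite /code_point; case: xgetP => [x _ //|none]; exfalso.
pose l n := (iv n (code y n).1).1; pose r n := (iv n (code y n).1).2.
have mono n : l n <= l n.+1 /\ r n.+1 <= r n.
  have [vn _] := codeP n yI.
  by have [_ _ ? ?] := tree_child_len kappa0 iv0 sp vn (child_bit (1 / 2 <= (code y n).2) vn).
have lr n : l n <= r n by have [vn _] := codeP n yI; have := len0 vn; rewrite subr_gt0 => /ltW.
have lmono n k : l n <= l (n + k)%N.
  by elim: k => [|k IH]; rewrite ?addn0 // addnS; apply: le_trans IH _; case: (mono (n + k)%N).
have rmono n k : r (n + k)%N <= r n.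
  by elim: k => [|k IH]; rewrite ?addn0 // addnS; apply: le_trans _ IH; case: (mono (n + k)%N).
have lrn n k : l n <= r k.
  apply: (le_trans (lmono n k)); apply: (le_trans (lr (n + k)%N)).
  by rewrite addnC; exact: rmono.
have hs : has_sup (range l).
  by split; [exists (l 0%N); exists 0%N|exists (r 0%N) => _ [n _ <-]; exact: lrn].
pose x := sup (range l).
have xI n : l n <= x <= r n.
  apply/andP; split; first by apply: (ub_le_sup (proj2 hs)); exists n.
  by apply: ge_sup; [exact: (proj1 hs)|move=> _ [k _ <-]; exact: lrn].
refine (none x _); split; last exact: xI.
apply: Lc => U /nbhs_ballP[e /= e0 eU].
have [n] := exp_small (th := 1 - kappa) (C := 1) ltac:(by have := k13; have := kappa0; lra) e0 ler01.
rewrite mulr1 => ne; have [vn _] := codeP n yI.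
have [w Lw wI] := meets vn; exists w; split=> //; apply: eU.
have := tree_len_le kappa0 iv0 sp vn; have := xI n.
by rewrite /ball /= ltr_norml /l /r; lra.
Qed.

(** Chosen so that kappa^s0 = 1 / 2: one level down the tree costs kappa in length and one binary
    digit. *)
Let s0 := ln 2 / - ln kappa.

Let s0_gt0 : 0 < s0.
Proof. by rewrite divr_gt0 // ln_gt0 // ltr1n. Qed.

Let kappa_s0 n : (kappa ^+ n) `^ s0 = 2^-1 ^+ n.
Proof.
have h0 := kappa0; rewrite -powR_mulrn ?(ltW h0) // -powRrM (mulrC n%:R) powRrM.
rewrite (_ : kappa `^ s0 = 2^-1); first by rewrite powR_mulrn ?invr_ge0.
rewrite /powR gt_eqF // (_ : s0 * ln kappa = - ln 2); last by rewrite /s0; field; rewrite lnkN.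
by rewrite expRN lnK // posrE.
Qed.

(** The coding of [0, 1] by points of [L] has an inverse that is Hoelder of exponent s0, so [L] has
    dimension at least s0. *)
Let code_hoelder y y' : 0 <= y <= 1 -> 0 <= y' <= 1 ->
  `|y - y'| <= 2 * `|code_point y - code_point y'| `^ s0.
Proof.
move=> yI yI'; have [_ P] := code_pointP yI; have [_ P'] := code_pointP yI'.
have D n : ((code y n).1 = (code y' n).1 /\ (code y n).2 - (code y' n).2 = 2 ^+ n * (y - y')) \/
    `|y - y'| <= 2 * `|code_point y - code_point y'| `^ s0.
  elim: n => [|n [[E1 E2]|]]; [by left; rewrite /= mul1r| |by right].
  have [vn zI] := codeP n yI; have [_ zI'] := codeP n yI'.
  have [eqb|neqb] := eqVneq (1 / 2 <= (code y n).2) (1 / 2 <= (code y' n).2).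
    left; rewrite /= /step /= eqb -E1; split=> //.
    by rewrite exprS -mulrA -E2; ring.
  right.
  (* At the first differing digit the two points lie in different siblings, separated by a gap,
     while y and y' still agree in n digits and so differ by at most 2^-n. *)
  have gap : kappa ^+ n.+1 <= `|code_point y - code_point y'|.
    have := P n.+1; have := P' n.+1; rewrite /= /step /= -E1.
    have := sp vn => /and3P[sz _ so].
    have sz' := sz; rewrite size_map in sz'.
    have g : (iv n.+1 (nth root (ch n (code y n).1) 0)).2 + kappa * len n (code y n).1 <=
        (iv n.+1 (nth root (ch n (code y n).1) 1)).1.
      by case: (ch n (code y n).1) sz' so => [|u [|w t]] //= _ /andP[].
    have lg : kappa ^+ n.+1 <= kappa * len n (code y n).1.
      rewrite exprS; apply: ler_wpM2l; first exact: ltW.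
      exact: (tree_len_ge kappa0 iv0 sp vn).
    move: neqb; case: (1 / 2 <= (code y n).2); case: (1 / 2 <= (code y' n).2) => //= _ h1 h2.
      by apply: (le_trans _ (ler_norm _)); lra.
    by rewrite distrC; apply: (le_trans _ (ler_norm _)); lra.
  have h2 : 2^-1 ^+ n.+1 <= `|code_point y - code_point y'| `^ s0.
    rewrite -kappa_s0; apply: powR_le; [exact: ltW|by rewrite exprn_ge0 // ltW|exact: gap].
  have h3 : 2 ^+ n * `|y - y'| <= 1.
    rewrite -[X in X * _](ger0_norm (exprn_ge0 n (ler0n R 2))) -normrM -E2 ler_norml; lra.
  have n2 : 0 < 2 ^+ n :> R by rewrite exprn_gt0.
  have h4 : `|y - y'| <= 2^-1 ^+ n by rewrite exprVn -[leRHS]div1r ler_pdivlMr // mulrC.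
  by apply: (le_trans h4); move: h2; rewrite exprS; lra.
have [->|yy'] := eqVneq y y'.
  by rewrite !subrr normr0 mulr_ge0 // powR_ge0.
have d0 : 0 < `|y - y'| by rewrite normr_gt0 subr_eq0.
have [n] := exp_small (th := 2^-1) (C := 1) ltac:(lra) d0 ler01.
rewrite mulr1 => ne; have [[_ E]|//] := D n.
have [_ zI] := codeP n yI; have [_ zI'] := codeP n yI'.
have n2 : 0 < 2 ^+ n :> R by rewrite exprn_gt0.
have : 2 ^+ n * `|y - y'| <= 1.
  rewrite -[X in X * _](ger0_norm (exprn_ge0 n (ler0n R 2))) -normrM -E ler_norml; lra.
by rewrite mulrC -ler_pdivlMr // div1r -exprVn leNgt ne.
Qed.

Lemma cantor_dim_gt0 : (0 < hausdorff_dim L)%E.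
Proof.
apply: (@lt_le_trans _ _ s0%:E); first by rewrite lte_fin.
apply: le_ereal_inf_tmp => _ [t [t0 Ht] <-]; rewrite lee_fin leNgt; apply/negP => ts.
(* Through the coding, a cover of [L] gives a cover of [0, 1] by segments of length 4 diam^s0. As
   diam <= 1 and t < s0, a sum below 1 / 8 would make the total length less than 1 / 2. *)
have : (hausdorff_content t 1 L < (1 / 8)%:E)%E.
  apply: (@le_lt_trans _ _ 0%E); last by rewrite lte_fin; lra.
  by rewrite -Ht; apply: ereal_sup_ubound; exists 1 => //=; exact: ltr01.
move=> /ereal_inf_lt[_ [U [UL Ud] <-] Ulow].
pose V i := [set y | 0 <= y <= 1 /\ U i (code_point y)].
pose d i := if `[< V i !=set0 >] then fine (ediam (U i)) `^ s0 else 0.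
pose J i := `[xget 0 (V i) - 2 * d i, xget 0 (V i) + 2 * d i]%classic.
have d0 i : 0 <= d i by rewrite /d; case: asboolP => // _; exact: powR_ge0.
have finU i : U i !=set0 -> [/\ ediam (U i) \is a fin_num, 0 <= fine (ediam (U i)) <= 1 &
    hausdorff_gauge t (U i) = (fine (ediam (U i)) `^ t)%:E].
  move=> Ui; have e0 := ediam_ge0 Ui.
  have f : ediam (U i) \is a fin_num.
    by rewrite ge0_fin_numE //; apply: le_lt_trans (Ud i) _; exact: ltry.
  split=> //; first by rewrite fine_ge0 // -lee_fin fineK // Ud.
  by rewrite /hausdorff_gauge ifF; [rewrite -{1}(fineK f) poweR_EFin|apply/negbTE/set0P].
have cov01 : `[0, 1]%classic `<=` \bigcup_i J i.
  move=> y; rewrite /= in_itv /= => yI.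
  have [Ly _] := code_pointP yI.
  have [i _ Ui] := UL _ Ly; exists i => //.
  have Viy : V i y by [].
  rewrite /J /d; case: asboolP => [_|]; last by case; exists y.
  case: xgetP => [y' _ [yI' Ui']|/(_ y) //].
  have [f fI _] := finU i (ex_intro _ _ Ui).
  have dist : `|code_point y - code_point y'| <= fine (ediam (U i)).
    rewrite -lee_fin fineK //; apply: ereal_sup_ubound; exists (code_point y) => //.
    by exists (code_point y').
  have h := code_hoelder yI yI'.
  have h2 : `|code_point y - code_point y'| `^ s0 <= fine (ediam (U i)) `^ s0.
    by apply: powR_le => //; exact: ltW.
  have : `|y - y'| <= 2 * fine (ediam (U i)) `^ s0 by lra.
  by rewrite /= in_itv /= ler_norml; lra.
have : ((1 : R)%:E <= (4 : R)%:E * \sum_(0 <= i <oo) hausdorff_gauge t (U i))%E.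
  rewrite -nneseriesZl; last by move=> i _; exact: hausdorff_gauge_ge0.
  have -> : (1 : R)%:E = (@lebesgue_measure R) `[0, 1]%classic.
    by rewrite lebesgue_measure_segment ?ler01 // subr0.
  apply: (@le_trans _ _ (\sum_(0 <= i <oo) (@lebesgue_measure R) (J i))%E).
    by apply: measure_sigma_subadditive => // i; exact: measurable_itv.
  apply: lee_nneseries => i _; [by move=> _; exact: measure_ge0|].
  rewrite lebesgue_measure_segment; last by have := d0 i; lra.
  rewrite (_ : _ - _ = 4 * d i); last ring.
  rewrite EFinM; apply: lee_wpmul2l => //; rewrite /d; case: asboolP => [[y [_ Ui]]|_].
    have [f fI ->] := finU i (ex_intro _ _ Ui).
    rewrite lee_fin; move: (fine _) fI => x /andP[x0 x1].
    move: x0; rewrite le_eqVlt => /orP[/eqP <-|x0].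
      by rewrite powR0 ?gt_eqF // powR_ge0.
    by apply: ger_powR; [rewrite x0|exact: ltW].
  exact: hausdorff_gauge_ge0.
apply/negP; rewrite -ltNge.
apply: (@lt_le_trans _ _ ((4 : R)%:E * (1 / 8 : R)%:E)%E).
  by rewrite lte_pmul2l // lte_fin.
by rewrite -EFinM lee_fin; lra.
Qed.

End CantorDimension.

(** * One renormalization step *)

(** Stated for closed branches: at c the orbits of g0 c and g1 c represent the two one-sided limits,
    and c is an admissible end point of both halves. *)
Record renorm_orbits {R : realType} (c : R) (g0 g1 : R -> R) (a b : nat) (p q : R) : Prop :=
  RenormOrbits {
  ro_a : (0 < a)%N;
  ro_b : (0 < b)%N;
  ro_p : 0 < p < c;
  ro_q : c < q < 1;
  ro_left : forall x i, p <= x <= c -> (i < a)%N -> c < iter i g1 (g0 x) <= 1;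
  ro_right : forall x i, c <= x <= q -> (i < b)%N -> 0 <= iter i g0 (g1 x) < c;
  ro_fix_p : iter a g1 (g0 p) = p;
  ro_crit_left : c < iter a g1 (g0 c) <= q;
  ro_fix_q : iter b g0 (g1 q) = q;
  ro_crit_right : p <= iter b g0 (g1 c) < c }.

Record level_small {R : realType} (al D c : R) (g1 : R -> R) (b : nat) (q : R) : Prop :=
  LevelSmall {
  ls_start : g1 q <= 2^-1 `^ al / 4;
  ls_ep : 1 - c <= 4^-1 `^ al / 2;
  ls_D : D ^+ b <= 2;
  ls_F : (1 + 4 * (1 - c) `^ (1 - al^-1)) ^+ b <= 2 }.

Section PowerSlopes.
Context {R : realType}.
Implicit Types al S T k m : R.

Lemma powR_slope_ge al m S T : 1 < al -> 3 / 4 <= m -> 0 <= S -> S <= 1 -> S <= T ->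
  1 / 4 <= m * S `^ al -> 1 / 4 * (T - S) <= m * (T `^ al - S `^ al).
Proof.
move=> al1 m34 S0 S1 ST h; have d0 : 0 <= T - S by rewrite subr_ge0.
have m0 : 0 <= m by lra.
have h1 := powR_tangent al1 S0 (le_trans S0 ST).
have h2 : S `^ al <= S `^ (al - 1).
  by rewrite -(mulr_powRB1 S0 (p := al)) ?ler_piMl ?powR_ge0 //; lra.
have h3 := ler_wpM2l m0 h1; apply: le_trans h3.
have h4 : 1 / 4 <= m * S `^ (al - 1) by apply: (le_trans h); apply: ler_wpM2l.
rewrite (_ : m * _ = m * S `^ (al - 1) * al * (T - S)); last by ring.
apply: ler_wpM2r => //; apply: (le_trans h4); apply: ler_peMr; lra.
Qed.

Lemma powR_slope_le al k S T : 1 < al -> 0 <= S -> S <= T -> T <= 1 -> 0 <= k -> k <= 2 ->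
  k * (T `^ al - S `^ al) <= 2 * (al * (T - S)).
Proof.
move=> al1 S0 ST T1 k0 k2; have T0 := le_trans S0 ST.
have h1 := powR_secant_le al1 S0 T0.
have h2 : T `^ (al - 1) <= 1 by apply: powR_le1; rewrite ?T0 ?T1 //; lra.
have h3 : al * T `^ (al - 1) * (T - S) <= al * (T - S).
  by apply: ler_wpM2r; [rewrite subr_ge0|apply: ler_piMr => //; lra].
apply: ler_pM => //; last exact: le_trans h1 h3.
by rewrite subr_ge0; apply: powR_le => //; lra.
Qed.

End PowerSlopes.

Section RenormalizationGeometry.
Context {R : realType}.
Variables (al D c m m' : R) (g0 g1 : R -> R) (a b : nat) (p q : R).
Hypothesis PL : power_lorenz al D c m m' g0 g1.
Local Notation t x := ((c - x) / c).
Local Notation s x := ((x - c) / (1 - c)).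
Local Notation ep := (1 - c).
Local Notation cm := (g0 c).
Local Notation cp := (g1 c).
Hypothesis RO : renorm_orbits c g0 g1 a b p q.
Let a0 := ro_a RO. Let b0 := ro_b RO. Let pc := ro_p RO. Let qc := ro_q RO.
Let hA := ro_left RO. Let hB := ro_right RO. Let EA := ro_fix_p RO. Let EA' := ro_crit_left RO.
Let EB := ro_fix_q RO. Let EB' := ro_crit_right RO.

Ltac lv := have hal1 := pl_al PL; have hD1 := pl_D1 PL; have hD76 := pl_D PL; have hc78 := pl_c PL;
  have hc1 := pl_c1 PL; have hcm := pl_cm_gt PL; have hcm1 := pl_cm_le PL;
  have hcp0 := pl_cp_ge PL; have hcp := pl_cp_lt PL; have hpc := pc; have hqc := qc; have hEA := EA'; have hEB := EB'.
Let g0i := (pl_g0 PL).1. Let g1i := (pl_g1 PL).1.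
Let c0 : 0 < c. Proof. lv; lra. Qed.
Let ep0 : 0 < ep. Proof. lv; lra. Qed.

Lemma g1_cm_ge : c <= g1 cm.
Proof.
lv; move: (a) a0 hA EA' => -[|[|n]] // _ h; first by rewrite /=; lra.
by have := h c 1%N ltac:(lra) isT; rewrite /=; lra.
Qed.

Lemma g0_cp_lt : g0 cp < c.
Proof.
lv; move: (b) b0 hB EB' => -[|[|n]] // _ h; first by rewrite /=; lra.
by have := h c 1%N ltac:(lra) isT; rewrite /=; lra.
Qed.

Lemma return_start_small : g1 q <= - ln (cm - c) / al ^+ b.-1 + ln D / (al - 1).
Proof.
lv; apply: (left_start_small PL) => i ib.
have := hB (x := q) (i := i) ltac:(lra); rewrite -(prednK b0) ltnS => /(_ ib); lra.
Qed.

Lemma critical_gap_ln :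
  al ^+ 2 * ln ep - (2 * al + 1) * ln 2 <= (al ^+ 2 - 1) * ln (cm - c).
Proof. exact: (critical_gap PL g1_cm_ge g0_cp_lt). Qed.

Hypothesis LS : level_small al D c g1 b q.
Let hy := ls_start LS. Let hep := ls_ep LS. Let hDb := ls_D LS. Let hFb := ls_F LS.

Lemma g1q_le8 : g1 q <= 1 / 8.
Proof.
lv; apply: (le_trans hy); have : (2^-1 : R) `^ al <= 2^-1 by apply: powR_le_id; lra.
lra.
Qed.

Lemma ep_le8 : ep <= 1 / 8.
Proof.
lv; apply: (le_trans hep); have : (4^-1 : R) `^ al <= 4^-1 by apply: powR_le_id; lra.
lra.
Qed.

Lemma right_slope_ge34 : 3 / 4 <= m' <= 1.
Proof.
lv; have y8 := g1q_le8; have e8 := ep_le8.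
have : cp < g1 q by apply: g1i; lra.
have /andP[h1 h2] := right_slope_bounds PL.
have [m0|m0] := leP m' 0.
  by have : D * m' <= 0 by [rewrite pmulr_rle0 //; lra]; lra.
have : D * m' <= 7 / 6 * m' by rewrite ler_pM2r.
lra.
Qed.

Lemma return_radius_ratio : 0 < s q <= 1 / 2.
Proof.
lv; have y8 := g1q_le8; have e8 := ep_le8; have /andP[m34 _] := right_slope_ge34.
have sq0 : 0 < s q by apply: divr_gt0; lra.
apply/andP; split=> //.
have /andP[h1 _] := right_rise PL (x := q) ltac:(lra).
have pp : 0 <= s q `^ al := powR_ge0 _ _.
have h2 : 3 / 4 * s q `^ al <= m' * s q `^ al by apply: ler_wpM2r.
rewrite (_ : 1 / 2 = 2^-1); last lra.
apply: (@le_of_powR _ al); try lra_on hal1 sq0.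
have := hy; have : 0 <= (2^-1 : R) `^ al := powR_ge0 _ _; lra.
Qed.

Lemma right_codrop_le x : c <= x <= 1 -> 1 - x <= 4 / 3 * ep * (1 - g1 x).
Proof.
lv; move=> xc; have /andP[m34 _] := right_slope_ge34.
have h1 := right_codrop PL xc.
have sx : 0 <= s x <= 1 by rewrite divr_ge0 /= ?ler_pdivrMr; lra_on xc hc1.
have h2 : s x `^ al <= s x by apply: powR_le_id => //; lra.
have h3 : 3 / 4 * (1 - s x) <= 1 - g1 x.
  apply: le_trans h1; apply: ler_pM => //; lra.
have E : 1 - s x = (1 - x) / ep by field; apply/eqP; lra.
by move: h3; rewrite E mulrA ler_pdivrMr //; lra.
Qed.

(** Since g1 cm >= c, the right branch gives 1 - cm <= (4 / 3) ep^2, and ep <= 1 / 8. *)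
Lemma cm_close : 1 - cm <= ep / 6.
Proof.
lv; have e8 := ep_le8; have h := right_codrop_le (x := cm) ltac:(lra).
have g := g1_cm_ge.
have : 4 / 3 * ep * (1 - g1 cm) <= 4 / 3 * ep * ep by apply: ler_wpM2l; lra.
have : ep * ep <= ep * (1 / 8) by apply: ler_wpM2l; lra.
lra.
Qed.

(** g0 p lies above c, within ep of the critical value; the power law then gives (c - p) / c <= 1 /
    4, and 3 / 4 * 7 / 8 exceeds 13 / 20. *)
Lemma return_left_ge : 13 / 20 <= p.
Proof.
lv; have e8 := ep_le8; have m34 := left_slope_gt PL.
have /andP[h1 _] := left_drop PL (x := p) ltac:(lra).
have /andP[h2 _] := hA (x := p) (i := 0%N) ltac:(lra) a0; rewrite /= in h2.
have pp : 0 <= t p `^ al := powR_ge0 _ _.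
have h3 : 3 / 4 * t p `^ al <= m * t p `^ al by apply: ler_wpM2r.
have tp0 : 0 <= t p by apply: divr_ge0; lra.
have : t p <= 4^-1.
  apply: (@le_of_powR _ al) => //; try lra.
  have : 0 <= (4^-1 : R) `^ al := powR_ge0 _ _; have := hep; lra.
rewrite ler_pdivrMr //; lra.
Qed.

(** First the power law of g1 on [c, q], then b steps of expansion in the metric dx / (cm - x). The
    factor 1 / 8 is 1 / 2 * 3 / 4 * 1 / 3, from D^b <= 2, m' >= 3 / 4 and cm - q >= ep / 3. *)
Lemma right_image_ge : al ^+ b * (ep / 8) * s q `^ al <= q - iter b g0 cp.
Proof.
lv; have y8 := g1q_le8; have /andP[m34 _] := right_slope_ge34; have h6 := cm_close.
have /andP[sq0 sq2] := return_radius_ratio.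
have cpq : cp < g1 q by apply: g1i; lra.
have h := @left_iter_ge _ _ _ _ _ _ _ _ PL cp (g1 q) b hcp0 (ltW cpq) _.
have {h} := h (fun i ib => conj (proj1 (andP (hB (x := c) ltac:(lra_on hqc) ib))) (proj2 (andP (hB (x := q) ltac:(lra_on hqc) ib)))).
rewrite EB => h.
have sq : q = c + ep * s q by field; apply/eqP; lra.
have qe : ep / 3 <= cm - q.
  have : ep * s q <= ep * (1 / 2) by apply: ler_wpM2l; lra.
  lra.
have /andP[h1 _] := right_rise PL (x := q) ltac:(lra).
have pp : 0 <= s q `^ al := powR_ge0 _ _.
have h2 : 3 / 4 * s q `^ al <= g1 q - cp by apply: le_trans h1; apply: ler_wpM2r.
have x1 : iter b g0 cp <= q by lra.
have h3 : (q - iter b g0 cp) * (cm - g1 q) <= q - iter b g0 cp.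
  by apply: ler_piMr; lra_on hEB hqc cpq hcp0 hcm1.
apply: le_trans h3; apply: le_trans h.
have ab0 : 0 < al ^+ b by apply: exprn_gt0; lra.
have Db0 : 0 < D ^+ b by apply: exprn_gt0; lra.
rewrite expr_div_n.
have h4 : al ^+ b / 2 <= al ^+ b / D ^+ b by rewrite ler_pM2l // lef_pV2 ?posrE.
rewrite -[leRHS]mulrA (_ : al ^+ b * _ * _ = al ^+ b / 2 * (3 / 4 * s q `^ al * (ep / 3))); last by field.
apply: ler_pM => //; [lra_on ab0|by rewrite !mulr_ge0 //; lra_on hc1|].
by apply: ler_pM => //; lra_on pp hc1.
Qed.

Lemma right_image_le : q - iter b g0 cp <= 16 * al ^+ b * (ep + (c - p)) * s q `^ al.
Proof.
lv; have y8 := g1q_le8; have /andP[m34 m1] := right_slope_ge34; have h6 := cm_close.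
have e8 := ep_le8.
have cpq : cp < g1 q by apply: g1i; lra_on hqc.
(* While g0 x < c, the drop cm - g0 x is at least of order ep, so c - x is at least of order ep^(1 /
   al). Replacing c by cm, at distance at most ep, then has relative cost of order ep^(1 - 1 /
   al). *)
pose F := 1 + 4 * ep `^ (1 - al^-1).
have ml := left_slope_gt PL.
have /andP[ml1 _] := left_slope_bounds PL.
have Fx x : 0 <= x < c -> g0 x < c -> cm - x <= F * (c - x).
  move=> xc gxc.
  have /andP[_ h] := left_drop PL (x := x) ltac:(lra).
  have tx0 : 0 <= t x by apply: divr_ge0; lra_on xc hc78.
  have h1 : ep / 2 <= t x `^ al.
    have pp : 0 <= t x `^ al := powR_ge0 _ _.
    have : D * m * t x `^ al <= 7 / 6 * t x `^ al.
      by apply: ler_wpM2r => //; have : D * m <= 7 / 6 * 1 by [apply: ler_pM; lra_on hD1 ml hD76 ml1 hcm1]; clra.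
    lra_on h gxc h6 hc1.
  have h2 : ep `^ al^-1 / 2 <= t x.
    apply: (@le_of_powR _ al) => //; first lra_on hal1.
      by apply: divr_ge0; [exact: powR_ge0|lra].
    apply: le_trans h1; rewrite powRM ?powR_ge0 ?invr_ge0 //.
    rewrite -powRrM mulVf; last by rewrite gt_eqF; lra_on hal1.
    rewrite powRr1; last lra_on hc1.
    by rewrite (ler_pM2l ep0); apply: powR_le_id; lra_on hal1.
  rewrite (ler_pdivlMr _ _ c0) in h2.
  have e1 : ep = ep `^ (1 - al^-1) * ep `^ al^-1.
    rewrite -powRD ?subrK ?powRr1 ?oner_eq0 //; lra_on hc1.
  have w0 : 0 <= ep `^ (1 - al^-1) := powR_ge0 _ _.
  have v0 : 0 <= ep `^ al^-1 := powR_ge0 _ _.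
  have h3 : ep <= ep `^ (1 - al^-1) * (4 * (c - x)).
    rewrite {1}e1; apply: ler_wpM2l => //.
    have : ep `^ al^-1 / 2 * (1 / 2) <= ep `^ al^-1 / 2 * c by apply: ler_wpM2l; lra_on v0 hc78.
    lra_on h2.
  rewrite /F; lra_on h3 hcm1.
have gx i : (i < b)%N -> g0 (iter i g0 cp) < c.
  move=> ib; rewrite -iterS; move: (ib); rewrite leq_eqVlt => /orP[/eqP ->|ib']; first lra_on hEB.
  by have := hB (x := c) ltac:(lra_on hqc) ib'; clra.
have h : (q - iter b g0 cp) * (cm - cp) <= (al * D * F) ^+ b * (g1 q - cp) * (cm - iter b g0 cp).
  have := @left_iter_le _ _ _ _ _ _ _ _ PL F cp (g1 q) b hcp0 (ltW cpq); rewrite EB; apply=> i ib.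
  have := hB (x := c) ltac:(lra_on hqc) ib; have := hB (x := q) ltac:(lra_on hqc) ib => h1 h2.
  by split; [lra_on h2|lra_on h1|apply: Fx (gx _ ib); lra_on h2].
have /andP[_ h1] := right_rise PL (x := q) ltac:(lra).
have pp : 0 <= s q `^ al := powR_ge0 _ _.
have h2 : g1 q - cp <= 7 / 6 * s q `^ al.
  apply: (le_trans h1); apply: ler_wpM2r => //.
  by have : D * m' <= 7 / 6 * 1 by [apply: ler_pM; lra_on hD1 m34 hD76 m1]; clra.
have ab0 : 0 < al ^+ b by apply: exprn_gt0; lra_on hal1.
have w0 : 0 <= ep `^ (1 - al^-1) := powR_ge0 _ _.
have Fb0 : 0 <= F ^+ b by apply: exprn_ge0; rewrite /F; lra_on w0.
have D0 : 0 < D by lra_on hD1.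
have al0 : 0 < al by lra_on hal1.
have F0 : 0 <= F by rewrite /F; lra_on w0.
have X0 : 0 <= (al * D * F) ^+ b by apply: exprn_ge0; rewrite !mulr_ge0 // ltW.
have DF := ler_pM (exprn_ge0 b (ltW D0)) Fb0 hDb hFb.
have h3 : (al * D * F) ^+ b <= 4 * al ^+ b.
  by rewrite !exprMn -mulrA mulrC; apply: ler_wpM2r; [exact: ltW|rewrite /F; lra_on DF].
have g0q : 0 <= g1 q - cp by rewrite subr_ge0 ltW.
have h4 : (al * D * F) ^+ b * (g1 q - cp) * (cm - iter b g0 cp) <=
    4 * al ^+ b * (7 / 6 * s q `^ al) * (ep + (c - p)).
  apply: ler_pM; [exact: mulr_ge0|lra_on hEB hcm| |lra_on hEB hcm1].
  exact: ler_pM.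
have h5 : (q - iter b g0 cp) * (1 / 2) <= (q - iter b g0 cp) * (cm - cp).
  by apply: ler_wpM2l; [lra_on hEB hqc|lra_on cpq y8 hcm hc78].
have : 0 <= al ^+ b * s q `^ al * (ep + (c - p)).
  by apply: mulr_ge0; [rewrite mulr_ge0 // ltW|lra_on hc1 hpc].
lra_on h h4 h5.
Qed.

Lemma g1_slope_ge x y : c <= x -> x <= y -> y <= 1 -> 1 / 2 <= g1 x ->
  (4 * ep)^-1 * (y - x) <= g1 y - g1 x.
Proof.
move=> cx xy y1 gx; have hal1 := pl_al PL; have e0 := ep0.
have /andP[m34 m1] := right_slope_ge34.
have /andP[h1 _] := pl_right PL cx xy y1.
have xI : c <= x <= 1 by rewrite cx (le_trans xy).
have h2 := right_codrop PL xI.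
have S0 : 0 <= s x by apply: divr_ge0; [rewrite subr_ge0|exact: ltW].
have S1 : s x <= 1 by rewrite ler_pdivrMr // mul1r lerD2r; case/andP: xI.
have ST : s x <= s y by rewrite ler_pM2r ?invr_gt0 // lerD2r.
have h3 : 1 / 4 <= m' * s x `^ al by lra_on h2 m34 gx.
apply: le_trans h1; apply: le_trans (powR_slope_ge hal1 m34 S0 S1 ST h3).
by rewrite -mulrBl opprB addrA subrK le_eqVlt; apply/orP; left; apply/eqP; field; rewrite gt_eqF.
Qed.

Lemma g1_slope_le x y : c <= x -> x <= y -> y <= 1 ->
  g1 y - g1 x <= 2 * al / ep * (y - x).
Proof.
move=> cx xy y1; have hal1 := pl_al PL; have e0 := ep0; have hD1 := pl_D1 PL; have hD := pl_D PL.
have /andP[m34 m1] := right_slope_ge34.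
have /andP[_ h1] := pl_right PL cx xy y1.
have S0 : 0 <= s x by apply: divr_ge0; [rewrite subr_ge0|exact: ltW].
have T1 : s y <= 1 by rewrite ler_pdivrMr // mul1r lerD2r.
have ST : s x <= s y by rewrite ler_pM2r ?invr_gt0 // lerD2r.
have m0 : 0 <= m' by lra_on m34.
have D0 : 0 <= D by lra_on hD1.
have Dm : D * m' <= 2.
  by have : D * m' <= 7 / 6 * 1 by [apply: ler_pM]; clra.
apply: (le_trans h1); apply: (le_trans (powR_slope_le hal1 S0 ST T1 (mulr_ge0 D0 m0) Dm)).
by rewrite -mulrBl opprB addrA subrK le_eqVlt; apply/orP; left; apply/eqP; field; rewrite gt_eqF.
Qed.

Lemma g1_iter_bounds x y k : c <= x -> x <= y ->
  (forall i, (i < k)%N -> [/\ c <= iter i g1 x, iter i g1 y <= 1 & 1 / 2 <= iter i.+1 g1 x]) ->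
  (4 * ep)^-1 ^+ k * (y - x) <= iter k g1 y - iter k g1 x <= (2 * al / ep) ^+ k * (y - x).
Proof.
move=> cx xy; elim: k => [|k IH] H; first by rewrite !expr0 !mul1r /= lexx.
have /andP[{IH} l u] := IH (fun i ik => H i (leqW ik)).
have [xk yk gk] := H k (leqnn _); rewrite iterS in gk.
have e4 : 0 <= (4 * ep)^-1 by rewrite invr_ge0; have := ep0; lra.
have ae : 0 <= 2 * al / ep by apply: divr_ge0; have := ep0; have := pl_al PL; lra.
have xyk : iter k g1 x <= iter k g1 y.
  by rewrite -subr_ge0; apply: le_trans l; rewrite mulr_ge0 ?exprn_ge0 // subr_ge0.
move: e4 ae l u (g1_slope_ge xk xyk yk gk) (g1_slope_le xk xyk yk).
move: ((4 * ep)^-1) (2 * al / ep) => E A e4 ae l u hl hu.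
rewrite !iterS !exprS -!mulrA; apply/andP; split.
  by apply: le_trans hl; apply: ler_wpM2l.
by apply: (le_trans hu); apply: ler_wpM2l.
Qed.

(** The left return map fixes p and sends c into ]c, q], so the image of [p, c] has length between c
    - p and q - p. It arises from the power law of g0 and a steps of g1 with slopes between 1 / (4
    ep) and 2 al / ep. *)
Lemma left_image_bounds :
  (4 * ep)^-1 ^+ a * (3 / 4 * (c - p) `^ al) <= q - p /\
  c - p <= (2 * al / ep) ^+ a * (2 * 2 `^ al * (c - p) `^ al).
Proof.
have hpc := pc; have hc := pl_c PL; have hc1 := pl_c1 PL; have hcm := pl_cm_gt PL.
have hEA := EA'; have hcm1 := pl_cm_le PL; have hal := pl_al PL.
have p2 := return_left_ge.
have gp : g0 p <= cm by apply: (incr_on_le g0i); lra.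
have /andP[gpc _] := hA (x := p) (i := 0%N) ltac:(lra) a0; rewrite /= in gpc.
have := @g1_iter_bounds (g0 p) cm a (ltW gpc) gp _; rewrite EA => H.
have {H} /andP[l u] : (4 * ep)^-1 ^+ a * (cm - g0 p) <= iter a g1 cm - p
    <= (2 * al / ep) ^+ a * (cm - g0 p).
  apply: H => i ia.
  have h1 := hA (x := p) (i := i) ltac:(lra) ia.
  have h2 := hA (x := c) (i := i) ltac:(lra) ia.
  split; [lra|lra|].
  move: (ia); rewrite leq_eqVlt => /orP[/eqP ->|ia']; first by rewrite EA; lra.
  have := hA (x := p) (i := i.+1) ltac:(lra) ia'; lra.
have /andP[h1 h2] := left_drop PL (x := p) ltac:(lra).
have ml := left_slope_gt PL.
have /andP[ml1 _] := left_slope_bounds PL.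
have lam0 : 0 < c - p by lra_on hpc.
have pp : 0 <= (c - p) `^ al := powR_ge0 _ _.
have t1 : (c - p) `^ al <= t p `^ al.
  by apply: powR_le; [lra_on hal|lra_on lam0|]; rewrite (ler_pdivlMr _ _ c0); apply: ler_piMr; lra_on lam0 hc1.
have t2 : t p `^ al <= 2 `^ al * (c - p) `^ al.
  have tp : 0 <= t p by apply: divr_ge0; lra_on lam0 hc.
  rewrite -powRM //; [|exact: ltW]; apply: powR_le => //; first lra_on hal.
  by rewrite (ler_pdivrMr _ _ c0) -mulrA mulrC -mulrA; apply: ler_peMr; lra_on lam0 hc.
have e4 : 0 <= (4 * ep)^-1 ^+ a by rewrite exprn_ge0 // invr_ge0; have := ep0; clra.
have ae : 0 <= (2 * al / ep) ^+ a by rewrite exprn_ge0 //; apply: divr_ge0; have := ep0; lra_on hal.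
split.
  apply: (@le_trans _ _ (iter a g1 cm - p)); last lra.
  apply: le_trans l; apply: ler_wpM2l => //; apply: le_trans h1.
  by apply: ler_pM => //; lra.
apply: (@le_trans _ _ (iter a g1 cm - p)); first lra.
apply: (le_trans u); apply: ler_wpM2l => //; apply: (le_trans h2).
rewrite -(mulrA 2); apply: ler_pM; [|exact: powR_ge0| |exact: t2].
  by apply: mulr_ge0; have := pl_D1 PL; lra_on ml.
have h3 := pl_D PL; have h4 := pl_D1 PL.
have : D * m <= 7 / 6 * 1 by apply: ler_pM; lra_on h3 h4 ml ml1 hcm1.
clra.
Qed.

End RenormalizationGeometry.

(** * Logarithmic size of the two halves of the return interval *)

Section LogEstimates.
Context {R : realType}.
Variables (al D c m m' : R) (g0 g1 : R -> R) (a b : nat) (p q : R).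
Hypothesis PL : power_lorenz al D c m m' g0 g1.
Hypothesis RO : renorm_orbits c g0 g1 a b p q.
Hypothesis LS : level_small al D c g1 b q.
Hypothesis a2 : a%:R <= 2 * al.
Local Notation ep := (1 - c).
Local Notation lam := (c - p).
Local Notation rho := ((q - c) / (1 - c)).

(** A common bound for the constant terms of both [ln_left_ge] and [ln_left_le], generous so that
    one constant, depending on al alone, serves both. *)
Definition geometry_const (al : R) : R :=
  2 * al * ln (2 * al) + (al + 1) * ln 2 + 2 * al * ln 4 + ln 3 + ln 64 + al * ln 2.
Local Notation K := (geometry_const al).

Let ep0 : 0 < ep. Proof. by rewrite subr_gt0; exact: pl_c1 PL. Qed.
Let lam0 : 0 < lam. Proof. by rewrite subr_gt0; case/andP: (ro_p RO). Qed.
Let rho0 : 0 < rho. Proof. by case/andP: (return_radius_ratio PL RO LS). Qed.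
Let al0 : 0 < al. Proof. exact: lt_trans (pl_al PL). Qed.
Let al2 : 0 < 2 * al. Proof. by rewrite mulr_gt0. Qed.
Let ER : q - c = ep * rho. Proof. by rewrite mulrC divfK // gt_eqF. Qed.
Let n2 : 0 < (2 : R). Proof. by []. Qed.

Let lnp (x : R) : 1 <= x -> 0 <= ln x. Proof. exact: ln_ge0. Qed.
Let ln2p : 0 <= ln 2 :> R. Proof. by apply: lnp; rewrite ler1n. Qed.
Let ln3p : 0 <= ln 3 :> R. Proof. by apply: lnp; rewrite ler1n. Qed.
Let ln4p : 0 <= ln 4 :> R. Proof. by apply: lnp; rewrite ler1n. Qed.
Let ln64p : 0 <= ln 64 :> R. Proof. by apply: lnp; rewrite ler1n. Qed.
Let lnap : 0 <= ln (2 * al).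
Proof. by apply: lnp; have := pl_al PL; lra. Qed.

Let ln8 : ln 8 = 3 * ln 2 :> R.
Proof. by rewrite (_ : 8 = 2 ^+ 3) ?lnXn // ?mulr_natl //; ring. Qed.
Let ln64 : ln 64 = 6 * ln 2 :> R.
Proof. by rewrite (_ : 64 = 2 ^+ 6) ?lnXn // ?mulr_natl //; ring. Qed.
Let ln16 : ln 16 = 4 * ln 2 :> R.
Proof. by rewrite (_ : 16 = 2 ^+ 4) ?lnXn // ?mulr_natl //; ring. Qed.
Let ln4 : ln 4 = 2 * ln 2 :> R.
Proof. by rewrite (_ : 4 = 2 ^+ 2) ?lnXn // ?mulr_natl //; ring. Qed.

Lemma ln_left_ge : a%:R * ln ep - K <= (al - 1) * ln lam.
Proof.
have [_ h] := left_image_bounds PL RO LS.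
have : ln lam <= a%:R * (ln (2 * al) - ln ep) + (ln 2 + al * ln 2 + al * ln lam).
  have p0 : 0 < 2 * al / ep by rewrite divr_gt0.
  rewrite -(ln_div al2 ep0) -!ln_powR -lnM ?posrE ?powR_gt0 //.
  rewrite -lnM ?posrE ?mulr_gt0 ?powR_gt0 // -lnM ?posrE ?mulr_gt0 ?powR_gt0 //.
  by rewrite ler_ln ?posrE ?mulr_gt0 ?powR_gt0 // powR_mulrn // ltW.
have : a%:R * ln (2 * al) <= 2 * al * ln (2 * al) by apply: ler_wpM2r.
have : 0 <= 2 * al * ln 4 by rewrite mulr_ge0 // ltW.
have : 0 <= al * ln 2 by rewrite mulr_ge0 // ltW.
rewrite /geometry_const; move: ln2p ln3p ln64p; lra.
Qed.

Lemma ln_left_le : q - p <= 2 * lam -> (al - 1) * ln lam <= a%:R * ln ep + K.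
Proof.
move=> C2; have [h _] := left_image_bounds PL RO LS.
have : - (a%:R * (ln 4 + ln ep)) + (ln 3 - ln 4 + al * ln lam) <= ln 2 + ln lam.
  have p0 : 0 < 4 * ep by rewrite mulr_gt0.
  have q0 : 0 < 3 / 4 :> R by rewrite divr_gt0.
  have i0 : 0 < (4 * ep)^-1 by rewrite invr_gt0.
  have j0 : 0 < (4 * ep)^-1 ^+ a by rewrite exprn_gt0.
  have l0 : 0 < lam `^ al by rewrite powR_gt0.
  have k0 : 0 < 3 / 4 * lam `^ al by rewrite mulr_gt0.
  have : ln ((4 * ep)^-1 ^+ a * (3 / 4 * lam `^ al)) <= ln (2 * lam).
    by rewrite ler_ln ?posrE ?mulr_gt0 //; exact: le_trans C2.
  rewrite (lnM j0 k0) (lnXn _ i0) (lnV p0) (lnM (x := 4) _ ep0) ?posrE //.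
  rewrite (lnM q0 l0) ln_powR ln_div ?posrE // (lnM n2 lam0) mulNrn -(mulr_natl (_ + _) a).
  exact.
have : a%:R * ln 4 <= 2 * al * ln 4 by apply: ler_wpM2r.
have : 0 <= 2 * al * ln (2 * al) by rewrite mulr_ge0 // ltW.
have : 0 <= al * ln 2 by rewrite mulr_ge0 // ltW.
have : 0 <= (al + 1) * ln 2 by rewrite mulr_ge0 // addr_ge0 // ltW.
rewrite /geometry_const; move: ln2p ln3p ln64p ln64 ln4; lra.
Qed.

Let img_ge C : q - p <= C -> al ^+ b * (ep / 8) * rho `^ al <= C.
Proof.
move=> h; apply: (le_trans (right_image_ge PL RO LS)); apply: le_trans h.
by rewrite lerD2l lerN2; case/andP: (ro_crit_right RO).
Qed.

Let ln_img C : 0 < C -> al ^+ b * (ep / 8) * rho `^ al <= C ->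
  b%:R * ln al + ln ep - ln 8 + al * ln rho <= ln C.
Proof.
move=> C0 h.
have e8 : 0 < ep / 8 by rewrite divr_gt0.
have ab : 0 < al ^+ b by rewrite exprn_gt0.
have rp : 0 < rho `^ al by rewrite powR_gt0.
have abe : 0 < al ^+ b * (ep / 8) by rewrite mulr_gt0.
have : ln (al ^+ b * (ep / 8) * rho `^ al) <= ln C by rewrite ler_ln ?posrE ?mulr_gt0.
rewrite (lnM abe rp) (lnM ab e8) (lnXn _ al0) ln_powR [ln (ep / 8)]ln_div ?posrE // -[ln al *+ b]mulr_natl.
by rewrite addrA.
Qed.

Lemma ln_ratio_le_right : q - p <= 2 * (q - c) ->
  (al - 1) * ln rho <= ln 16 - b%:R * ln al.
Proof.
move=> h; have C0 : 0 < 2 * (ep * rho) := mulr_gt0 n2 (mulr_gt0 ep0 rho0).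
have h' : q - p <= 2 * (ep * rho) by rewrite -ER.
have := ln_img C0 (img_ge h').
rewrite (lnM n2 (mulr_gt0 ep0 rho0)) (lnM ep0 rho0).
move: ln8 ln16; lra.
Qed.

Lemma ln_ratio_le_left : q - p <= 2 * lam ->
  al * ln rho <= ln 16 - b%:R * ln al - ln ep + ln lam.
Proof.
move=> h; have C0 : 0 < 2 * lam by rewrite !mulr_gt0.
have := ln_img C0 (img_ge h); rewrite (lnM n2 lam0).
move: ln8 ln16; lra.
Qed.

Lemma ln_image_le X : 0 < X -> lam <= ep -> X <= q - iter b g0 (g1 c) ->
  ln X <= ln 32 + b%:R * ln al + ln ep + al * ln rho.
Proof.
move=> X0 le h.
have ab : 0 < al ^+ b by rewrite exprn_gt0.
have rp : 0 < rho `^ al by rewrite powR_gt0.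
have p1 : 0 < 32 * al ^+ b by rewrite mulr_gt0.
have p2 : 0 < 32 * al ^+ b * ep by rewrite mulr_gt0.
have : ln X <= ln (32 * al ^+ b * ep * rho `^ al).
  rewrite ler_ln ?posrE ?mulr_gt0 //.
  apply: (le_trans h); apply: (le_trans (right_image_le PL RO LS)).
  apply: ler_wpM2r; first exact: powR_ge0.
  have : 16 * al ^+ b * (ep + lam) <= 16 * al ^+ b * (2 * ep).
    by apply: ler_wpM2l; [rewrite mulr_ge0 // ltW|lra].
  lra.
by rewrite (lnM p2 rp) (lnM p1 ep0) (lnM (x := 32) _ ab) ?posrE // (lnXn _ al0) ln_powR -[ln al *+ b]mulr_natl.
Qed.

(** Only the position of the image of c to the left of c enters, which makes the bound crude;
    [ln_ratio_ge_fine] improves it when that image keeps a distance of order lam from q. *)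
Lemma ln_ratio_ge : lam <= ep -> - (ln 32 + b%:R * ln al) <= (al - 1) * ln rho.
Proof.
move=> le; have X0 : 0 < ep * rho := mulr_gt0 ep0 rho0.
have h : ep * rho <= q - iter b g0 (g1 c).
  by rewrite -ER lerD2l lerN2; case/andP: (ro_crit_right RO) => _ /ltW.
have := ln_image_le X0 le h; rewrite (lnM ep0 rho0); lra.
Qed.

Lemma ln_ratio_ge_fine : lam <= ep -> lam / 2 <= q - iter b g0 (g1 c) ->
  ln lam <= ln 64 + b%:R * ln al + ln ep + al * ln rho.
Proof.
move=> le h; have X0 : 0 < lam / 2 by rewrite divr_gt0.
have := ln_image_le X0 le h; rewrite (ln_div lam0 n2).
have -> : ln 64 = ln 32 + ln 2 :> R by rewrite -lnM ?posrE //; congr ln; ring.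
lra.
Qed.

End LogEstimates.

(** * Reproduction of the bounds on the critical point under one renormalization *)

Section LevelStep.
Context {R : realType}.
Implicit Types (al sg be : R).

(** The logarithm of theta: exactly the error terms left over in [next_eps_max], divided by al. It
    is independent of b0. *)
Definition ln_theta al : R := (ln 16 + geometry_const al) / al.

Definition ln_eps_max al sg (b0 : nat) : R := ln_theta al - b0%:R * sg / al ^+ 2 * ln al.

Definition ln_eps_min al (b0 : nat) : R := - (b0%:R / al * ln al).

(** A bound on - ln ep' available before the next critical value is located. It is only linear in
    b0, hence harmless after division by al^(b0 - 1) in [lg_start]. *)
Definition ln_eps_crude al (b0 : nat) : R :=
  ln 2 + (ln 32 + 2 * b0%:R * ln al) / (al - 1) + b0%:R / al * ln al.

Definition delta (b0 : nat) : R := (1 / b0%:R) ^+ 2.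

(** Four factors exp delta: two from the initial diffeomorphism, whose slopes vary by exp (2 delta),
    and two from undoing an inverse branch of distortion exp delta. *)
Definition distortion (b0 : nat) : R := expR (4 * delta b0).

(** All demands on b0. [lg_koebe] creates the Koebe space, [lg_left] makes the left half of the
    return interval dominate, [lg_min] sets the constants against the slack be b0 ln al, and
    [lg_half] and [lg_escape] serve the basin. *)
Record large_b0 al sg be (b0 : nat) : Prop := LargeB0 {
  lg_pos : (1 < b0)%N;
  lg_half : distortion b0 <= 2 - 2 * 2^-1 `^ al;
  lg_escape : distortion b0 * (9 / 16) `^ (al - 1) < 1;
  lg_D : distortion b0 <= 7 / 6;
  lg_Db : distortion b0 ^+ (2 * b0) <= 2;
  lg_ep : expR (ln_eps_max al sg b0) <= 4^-1 `^ al / 2;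
  lg_F : (1 + 4 * expR (ln_eps_max al sg b0) `^ (1 - al^-1)) ^+ (2 * b0) <= 2;
  lg_start : (al ^+ 2 * ln_eps_crude al b0 + (2 * al + 1) * ln 2) / (al ^+ 2 - 1) / al ^+ b0.-1
    + 4 * delta b0 / (al - 1) <= 2^-1 `^ al / 4;
  lg_left : geometry_const al + ln 16 < sg / al * b0%:R * ln al;
  lg_koebe : sg * ln_eps_max al sg b0 + geometry_const al <=
    - ((al - 1) * (ln 16 - ln (delta b0)));
  lg_min : sg * ln_theta al + geometry_const al + ln 64 + al * ln 2 <= be * b0%:R * ln al }.

Section Step.
Variables (al sg be : R) (b0 : nat) (c m m' : R) (g0 g1 : R -> R) (a b : nat) (p q : R).
Hypothesis LG : large_b0 al sg be b0.
Hypotheses (sg01 : 0 < sg < 1) (be0 : 0 < be < (sg / al) ^+ 2).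
Hypothesis OM : Omega al sg be b0 (a, b).
Let D := distortion b0.
Hypothesis PL : power_lorenz al D c m m' g0 g1.
Hypothesis RO : renorm_orbits c g0 g1 a b p q.
Local Notation ep := (1 - c).
Local Notation lam := (c - p).
Local Notation rho := ((q - c) / (1 - c)).
Local Notation K := (geometry_const al).
Local Notation ep' := ((q - c) / (q - p)).
Local Notation A := (ln al).

Let al1 := pl_al PL.
Let al0 : 0 < al. Proof. exact: lt_trans al1. Qed.
Let A0 : 0 < A. Proof. exact: ln_gt0. Qed.
Let alN : al != 0. Proof. by rewrite gt_eqF. Qed.
Let ep0 : 0 < ep. Proof. by rewrite subr_gt0; exact: pl_c1 PL. Qed.
Let bb : (b0 <= b)%N.
Proof. by case: OM => _ /andP[]; rewrite ler_nat. Qed.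
Let sa1 : sg / al < 1.
Proof. by rewrite ltr_pdivrMr // mul1r; move: sg01 al1; lra. Qed.
Let sa2 : (sg / al) ^+ 2 < 1.
Proof. by rewrite expr_lt1 // divr_ge0 // ltW //; case/andP: sg01. Qed.
Let bR : b%:R <= (1 + (sg / al) ^+ 2 - be) * b0%:R.
Proof. by case: OM => _ /andP[]. Qed.
Let b2 : (b <= 2 * b0)%N.
Proof.
rewrite -(ler_nat R) natrM; apply: (le_trans bR); apply: ler_wpM2r => //.
by move: sa2 be0; lra.
Qed.
Let aR : al - 1 + sg <= a%:R <= 2 * al - 1 - sg.
Proof. by case: OM => /= + _; rewrite -natr1; lra. Qed.
Let a2 : a%:R <= 2 * al.
Proof. by move: aR sg01; lra. Qed.
Let D1 : 1 <= D. Proof. exact: pl_D1 PL. Qed.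

Lemma level_small_holds : ln ep <= ln_eps_max al sg b0 -> - ln ep <= ln_eps_crude al b0 ->
  level_small al D c g1 b q.
Proof.
move=> eU eL.
have epU : ep <= expR (ln_eps_max al sg b0) by rewrite -[leLHS]lnK ?posrE // ler_expR.
split.
- apply: le_trans (lg_start LG); apply: (le_trans (return_start_small PL RO)).
  have -> : ln D = 4 * delta b0 by rewrite /D /distortion expRK.
  rewrite lerD2r.
  have a21 : 0 < al ^+ 2 - 1 by rewrite subr_gt0 expr_gt1 // ltW.
  have h := critical_gap_ln PL RO.
  have h1 : - ln (g0 c - c) <= (al ^+ 2 * ln_eps_crude al b0 + (2 * al + 1) * ln 2) / (al ^+ 2 - 1).
    rewrite ler_pdivlMr //.
    have : al ^+ 2 * (- ln ep) <= al ^+ 2 * ln_eps_crude al b0.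
      by apply: ler_wpM2l => //; rewrite exprn_ge0 // ltW.
    by move: h; lra.
  have z0 : 0 <= - ln (g0 c - c).
    rewrite oppr_ge0; apply: ln_le0.
    by have := pl_cm_le PL; have := pl_c PL; lra.
  apply: ler_pM => //; first by rewrite invr_ge0 exprn_ge0 // ltW.
  rewrite lef_pV2 ?posrE ?exprn_gt0 //.
  by apply: ler_weXn2l; [exact: ltW|rewrite -!subn1 leq_sub2r].
- exact: le_trans (lg_ep LG).
- apply: le_trans (lg_Db LG); exact: ler_weXn2l.
- apply: le_trans (lg_F LG).
  have e0 : 0 <= ep `^ (1 - al^-1) := powR_ge0 _ _.
  apply: (@le_trans _ _ ((1 + 4 * ep `^ (1 - al^-1)) ^+ (2 * b0))).
    by apply: ler_weXn2l => //; move: e0; lra.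
  have ai : 0 <= 1 - al^-1 by rewrite subr_ge0 invf_le1 // ltW.
  apply: lerXn2r; rewrite ?nnegrE.
  + by move: e0; lra.
  + by have : 0 <= expR (ln_eps_max al sg b0) `^ (1 - al^-1) := powR_ge0 _ _; lra.
  + by rewrite lerD2l ler_pM2l //; apply: powR_le => //; exact: ltW.
Qed.

Section Scaling.
Hypothesis LS : level_small al D c g1 b q.
Hypotheses (eU : ln ep <= ln_eps_max al sg b0) (eL : ln_eps_min al b0 <= ln ep).
Let lam0 : 0 < lam. Proof. by rewrite subr_gt0; case/andP: (ro_p RO). Qed.
Let rho0 : 0 < rho. Proof. by case/andP: (return_radius_ratio PL RO LS). Qed.
Let Rd0 : 0 < q - c. Proof. by rewrite subr_gt0; case/andP: (ro_q RO). Qed.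
Let ER : q - c = ep * rho. Proof. by rewrite mulrC divfK // gt_eqF. Qed.
Let bA : b0%:R * A <= b%:R * A.
Proof. by apply: ler_wpM2r; [exact: ltW|rewrite ler_nat]. Qed.
Let e0 : ln ep <= 0.
Proof. by apply: ln_le0; have := pl_c PL; lra. Qed.
(* -(a + 1 - al) ln ep is at most (1 - sg/al) b0 ln al. *)
Let aE : (a%:R + 1 - al) * - ln ep <= b0%:R * A - sg / al * b0%:R * A.
Proof.
have : (a%:R + 1 - al) * - ln ep <= (al - sg) * - ln_eps_min al b0.
  by apply: ler_pM; move: aR sg01 e0 eL; lra.
move/le_trans; apply; rewrite /ln_eps_min opprK le_eqVlt; apply/orP; left; apply/eqP.
by field.
Qed.

(** If the right half were longer, the upper bound on rho would not involve lam, and lam <= ep rho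
    would give b ln al <= (a + 1 - al)(- ln ep) + constants. By [aE] the right side falls short of
    b0 ln al by sg / al b0 ln al, contradicting [lg_left]. *)
Lemma right_le_left : q - p <= 2 * lam.
Proof.
rewrite leNgt; apply/negP => C2.
have h1 : q - p <= 2 * (q - c) by move: C2; lra.
have h2 := ln_ratio_le_right PL RO LS h1.
have h3 := ln_left_ge PL RO LS a2.
have : lam <= q - c by move: C2; lra.
rewrite ER => hlr; have er0 : 0 < ep * rho := mulr_gt0 ep0 rho0.
have h4 : ln lam <= ln (ep * rho) by rewrite ler_ln ?posrE.
rewrite (lnM ep0 rho0) in h4.
have h5 : (al - 1) * ln lam <= (al - 1) * (ln ep + ln rho).
  by apply: ler_wpM2l => //; move: al1; lra.
have h6 := lg_left LG.
by move: h2 h3 h5 h6 aE bA; lra.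
Qed.

(** From (al - 1) ln lam <= a ln ep + K and a + 1 - al >= sg, the ratio lam / ep is at most a
    constant times ep^(sg / (al - 1)), exponentially small in b0. The factor 16 is what the Koebe
    ratio consumes later. *)
Lemma left_koebe_small : 16 * lam <= delta b0 * ep.
Proof.
have h1 := ln_left_le PL RO LS a2 right_le_left.
have d0 : 0 < delta b0 by rewrite exprn_gt0 // divr_gt0 // ltr0n (ltnW (lg_pos LG)).
have n16 : 0 < 16 :> R by [].
suff : ln (16 * lam) <= ln (delta b0 * ep) by rewrite ler_ln ?posrE // mulr_gt0.
rewrite (lnM n16 lam0) (lnM d0 ep0).
have h2 : (al - 1) * (ln lam - ln ep) <= sg * ln ep + K.
  have : (a%:R - (al - 1)) * ln ep <= sg * ln ep by apply: ler_wnM2r => //; move: aR; lra.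
  by move: h1; lra.
have h3 : sg * ln ep <= sg * ln_eps_max al sg b0 by apply: ler_wpM2l => //; move: sg01; lra.
have h4 := lg_koebe LG.
have h5 : (al - 1) * (ln lam - ln ep) <= (al - 1) * (ln (delta b0) - ln 16) by move: h2 h3 h4; lra.
by move: h5; rewrite ler_pM2l; [lra|move: al1; lra].
Qed.

Let delta_le1 : delta b0 <= 1.
Proof.
rewrite /delta expr_le1 // ?divr_ge0 // ler_pdivrMr ?ltr0n ?(ltnW (lg_pos LG)) // mul1r.
by rewrite ler1n (ltnW (lg_pos LG)).
Qed.

Lemma left_le_ep : 16 * lam <= ep.
Proof.
apply: (le_trans left_koebe_small); apply: ler_piMl => //; exact: ltW.
Qed.

Let C0 : 0 < q - p. Proof. by move: lam0 Rd0; lra. Qed.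
Let ep'_le : ep' <= (ep * rho) / lam.
Proof.
by rewrite -ER; apply: ler_wpM2l; [exact: ltW|rewrite lef_pV2 ?posrE //; move: Rd0; lra].
Qed.
Let ep'_ge : (ep * rho) / (2 * lam) <= ep'.
Proof.
rewrite -ER; apply: ler_wpM2l; first exact: ltW.
by rewrite lef_pV2 ?posrE ?mulr_gt0 //; exact: right_le_left.
Qed.
Let ln_ep'_le : ln ep' <= ln ep + ln rho - ln lam.
Proof.
have er0 : 0 < ep * rho := mulr_gt0 ep0 rho0.
by rewrite -(lnM ep0 rho0) -(ln_div er0 lam0) ler_ln ?posrE // divr_gt0.
Qed.
Let ln_ep'_ge : ln ep + ln rho - ln lam - ln 2 <= ln ep'.
Proof.
have er0 : 0 < ep * rho := mulr_gt0 ep0 rho0.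
have n2 : 0 < 2 :> R by [].
have l2 : 0 < 2 * lam := mulr_gt0 n2 lam0.
have : ln (ep * rho / (2 * lam)) <= ln ep' by rewrite ler_ln ?posrE // divr_gt0.
by rewrite (ln_div er0 l2) (lnM ep0 rho0) (lnM n2 lam0); lra.
Qed.

(** Eliminating rho and lam gives al ln ep' <= - b ln al + (a + 1 - al)(- ln ep) + constants; [aE]
    and b >= b0 leave - sg / al b0 ln al. *)
Lemma next_eps_max : ln ep' <= ln_eps_max al sg b0.
Proof.
have h1 := ln_ratio_le_left PL RO LS right_le_left.
have h2 := ln_left_ge PL RO LS a2.
have h3 : al * ln ep' <= al * (ln ep + ln rho - ln lam) by rewrite ler_pM2l.
have h4 : al * ln ep' <= ln 16 + K - sg / al * b0%:R * A.
  by move: h1 h2 h3 aE bA; lra.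
rewrite -(@ler_pM2l _ al) //; apply: (le_trans h4).
rewrite /ln_eps_max /ln_theta le_eqVlt; apply/orP; left; apply/eqP; by field.
Qed.

Lemma next_eps_crude : - ln ep' <= ln_eps_crude al b0.
Proof.
have le : lam <= ep by move: left_le_ep lam0; lra.
have h1 := ln_ratio_ge PL RO LS le.
have h2 : ln lam <= ln ep by rewrite ler_ln ?posrE.
have a1 : 0 < al - 1 by move: al1; lra.
have h3 : - ((ln 32 + 2 * b0%:R * A) / (al - 1)) <= ln rho.
  rewrite -mulNr ler_pdivrMr // mulrC (mulrC _ (al - 1)).
  have : b%:R * A <= 2 * b0%:R * A.
    by apply: ler_wpM2r; [exact: ltW|rewrite -natrM ler_nat].
  by move: h1; lra.
have : 0 <= b0%:R / al * A by rewrite !mulr_ge0 ?invr_ge0 //; exact: ltW.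
by rewrite /ln_eps_crude; move: ln_ep'_ge h2 h3; lra.
Qed.

(** The hypothesis says that the right critical value of the next level is at most 1 / 2. The same
    elimination, now with the upper bound on ep and a + 1 - al >= sg, gains (sg / al)^2 b0 ln al,
    which pays for the excess of b over b0 up to the slack be. *)
Lemma next_eps_min : iter b g0 (g1 c) <= p + (q - p) / 2 -> ln_eps_min al b0 <= ln ep'.
Proof.
move=> X; have le : lam <= ep by move: left_le_ep lam0; lra.
have X' : lam / 2 <= q - iter b g0 (g1 c) by move: X Rd0; lra.
have h1 := ln_ratio_ge_fine PL RO LS le X'.
have h2 := ln_left_le PL RO LS a2 right_le_left.
have h3 : al * (ln ep + ln rho - ln lam - ln 2) <= al * ln ep' by rewrite ler_pM2l.
have h4 : sg * - ln_eps_max al sg b0 <= (a%:R + 1 - al) * - ln ep.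
  apply: (@le_trans _ _ (sg * - ln ep)).
    by apply: ler_wpM2l; move: sg01 eU; lra.
  by apply: ler_wpM2r; move: aR e0; lra.
have h5 : b%:R * A <= (1 + (sg / al) ^+ 2 - be) * b0%:R * A.
  by apply: ler_wpM2r => //; exact: ltW.
have h6 := lg_min LG.
rewrite -(@ler_pM2l _ al) // /ln_eps_min.
have -> : al * - (b0%:R / al * A) = - (b0%:R * A) by field.
have E : sg * - ln_eps_max al sg b0 = (sg / al) ^+ 2 * b0%:R * A - sg * ln_theta al.
  by rewrite /ln_eps_max; field.
rewrite E in h4.
by move: h1 h2 h3 h4 h5 h6; lra.
Qed.

End Scaling.
End Step.
End LevelStep.

(** * Inverse branches along towers *)

Section TowerStep.
Context {R : realType}.
Implicit Types (K : R) (e f h : R -> R).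

Record inverse_branch K e : Prop := InverseBranch {
  ib_incr : incr_on 0 1 e;
  ib_range : forall x, 0 <= x <= 1 -> 0 <= e x <= 1;
  ib_cross : cross_contracting 0 1 e;
  ib_dist : distortion_le K 0 1 e }.

(** A setting used twice, with the two branches exchanged. [f] is the original map, [h] the zoom
    onto the return interval of a level, [h'] the affine map of the next level inside it; [A] and
    [B] are the first steps of [f] from the two halves, with return times [l] and [r]. A map e with
    e (g0 y) = f^i (A y) undoes the rest of the return; [J] inverts g1. *)
Variables (K : R) (f h h' A B g0 g1 g0' J : R -> R) (DX DX' DY DYo D' : R -> Prop)
  (l r a : nat) (c : R).
Hypotheses (l0 : (0 < l)%N) (r0 : (0 < r)%N) (a0 : (0 < a)%N).
Hypothesis HA : forall i, (i < l)%N -> exists2 e, inverse_branch K e &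
  forall y, DX y -> e (g0 y) = iter i f (A y).
Hypothesis HA1 : forall y, DX y -> iter l.-1 f (A y) = h (g0 y).
Hypothesis HB : forall i, (i < r)%N -> exists2 e, inverse_branch K e &
  forall z, DY z -> e (g1 z) = iter i f (B z).
Hypothesis HB1 : forall z, DY z -> iter r.-1 f (B z) = h (g1 z).
Hypothesis DYoW : forall z, DYo z -> DY z.
Hypothesis fB : forall z, DYo z -> f (h z) = B z.
Hypothesis orb : forall y, DX' y -> DX y /\ forall s, (s < a)%N -> DYo (iter s g1 (g0 y)).
Hypothesis JK : forall z, DY z -> J (g1 z) = z.
Hypothesis CJ : forall e k, inverse_branch K e -> (k <= a)%N ->
  inverse_branch K (fun t => e (iter k J (h' t))).
Hypothesis conj : forall y, D' y -> DX' (h' y) /\ iter a g1 (g0 (h' y)) = h' (g0' y).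

Let iterJ y s : DX' y -> (s <= a)%N -> iter (a - s) J (iter a g1 (g0 y)) = iter s g1 (g0 y).
Proof.
move=> Dy; move E : (a - s)%N => k; elim: k s E => [|k IH] s E sa.
  by rewrite (_ : s = a) //; apply/eqP; rewrite eqn_leq sa -subn_eq0 E.
have sa' : (s < a)%N by rewrite -subn_gt0 E.
rewrite iterS (IH s.+1) //; last by rewrite subnS E.
by rewrite iterS JK //; apply: DYoW; case: (orb Dy) => _; apply.
Qed.

(** A y is already one step along the orbit, hence the predecessor: l - 1 more steps complete the
    first return, and every later application of g1 takes r steps. *)
Lemma tower_orbit y s : DX' y -> (s <= a)%N ->
  iter (l + s * r).-1 f (A y) = h (iter s g1 (g0 y)).
Proof.
move=> Dy; have [Dx Do] := orb Dy.
elim: s => [|s IH] sa; first by rewrite mul0n addn0 HA1.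
have -> : (l + s.+1 * r).-1 = (r.-1 + (l + s * r).-1.+1)%N by rewrite mulSn; lia.
rewrite iterD iterS IH ?(ltnW sa) //.
rewrite fB; last exact: Do.
by rewrite HB1 //; apply/DYoW/Do.
Qed.

Lemma tower_orbit_mid y s i : DX' y -> (s < a)%N ->
  iter (l + s * r + i) f (A y) = iter i f (B (iter s g1 (g0 y))).
Proof.
move=> Dy sa; have [Dx Do] := orb Dy.
have -> : (l + s * r + i = i + (l + s * r).-1.+1)%N.
  by rewrite prednK ?addn_gt0 ?l0 // addnC.
by rewrite iterD iterS tower_orbit ?(ltnW sa) // fB //; exact: Do.
Qed.

Let split_index i : (i < l + a * r)%N -> (l <= i)%N ->
  exists s k, [/\ (s < a)%N, (k < r)%N & i = (l + s * r + k)%N].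
Proof.
move=> il li; exists ((i - l) %/ r)%N, ((i - l) %% r)%N; split.
- by rewrite ltn_divLR // ltn_subLR.
- by rewrite ltn_mod.
- by rewrite -addnA -divn_eq subnKC.
Qed.

(** Time i falls into one block of the orbit. The remainder of that block is undone by an inverse
    branch of the previous level and the later blocks by a power of [J]; hypothesis [CJ] keeps the
    constant [K]. *)
Lemma tower_branch i : (i < l + a * r)%N -> exists2 e, inverse_branch K e &
  forall y, D' y -> e (g0' y) = iter i f (A (h' y)).
Proof.
move=> il; have [li|li] := leqP l i.
  have [s [k [sa kr ->]]] := split_index il li.
  have [e eK He] := HB kr.
  exists (fun t => e (iter (a - s.+1) J (h' t))); first by apply: CJ => //; exact: leq_subr.
  move=> y /conj[Dy E]; rewrite -E iterJ // tower_orbit_mid // -He //.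
  by apply/DYoW; case: (orb Dy) => _; apply.
have [e eK He] := HA li.
exists (fun t => e (iter a J (h' t))); first by exact: CJ.
move=> y /conj[Dy E]; rewrite -E -(He (h' y)); last by case: (orb Dy).
by rewrite -{1}(subn0 a) iterJ.
Qed.

Lemma tower_return y : D' y -> iter (l + a * r).-1 f (A (h' y)) = h (h' (g0' y)).
Proof. by move=> /conj[Dy <-]; rewrite tower_orbit. Qed.

Hypothesis HA3 : forall i y, (i < l.-1)%N -> DX y -> iter i f (A y) <> c.
Hypothesis HB3 : forall i z, (i < r.-1)%N -> DY z -> iter i f (B z) <> c.
Hypothesis hc : forall z, DYo z -> h z <> c.

Lemma tower_avoid i y : (i < (l + a * r).-1)%N -> D' y -> iter i f (A (h' y)) <> c.
Proof.
move=> il /conj[Dy _]; have [Dx Do] := orb Dy.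
have il' : (i.+1 < l + a * r)%N by rewrite -ltn_predRL.
have [li|li] := leqP l i; last first.
  have [li'|li'] := ltnP i l.-1; first exact: HA3.
  have -> : i = l.-1 by apply/eqP; rewrite eqn_leq li' andbT -ltnS prednK.
  by rewrite HA1 //; apply: hc; apply: (Do 0%N).
have [s [k [sa kr Ei]]] := split_index (ltnW il') li.
rewrite Ei tower_orbit_mid //.
have Ds : DYo (iter s g1 (g0 (h' y))) by exact: Do.
have [kr'|kr'] := ltnP k r.-1; first by apply: HB3 => //; exact: DYoW.
have Ek : k = r.-1 by apply/eqP; rewrite eqn_leq kr' andbT -ltnS prednK.
rewrite Ek HB1; last exact: DYoW.
apply: hc; rewrite -iterS; apply: Do.
(* If s + 1 = a, the time is that of the return itself, when the orbit may be at c; the strict bound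
   on [i] excludes this. *)
rewrite ltn_neqAle sa andbT; apply/eqP => Es.
by move: il'; rewrite Ei Ek -Es mulSn -addnS prednK // -addnA (addnC (s * r)%N) ltnn.
Qed.

End TowerStep.

Section InverseBranches.
Context {R : realType}.
Implicit Types (K p q : R) (e J : R -> R).

(** The composite contracts cross-ratios on the fixed larger interval [S, T], whatever n is, so the
    Koebe space of [p, q] in [S, T] alone determines its distortion. This is why constants do not
    multiply from level to level. *)
Lemma inverse_branch_comp K k S T p q e J n : inverse_branch K e ->
  0 <= S -> S < p -> p < q -> q < T -> T <= 1 -> T - p <= k * (T - q) -> q - S <= k * (p - S) ->
  k ^+ 2 <= K ->
  incr_on S T J -> (forall x, S <= x <= T -> S <= J x <= T) -> cross_contracting S T J ->
  inverse_branch K (fun t => e (iter n J (p + (q - p) * t))).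
Proof.
move=> eB S0 Sp pq qT T1 Tk Sk kK Ji Jm Jc.
have qp0 : 0 < q - p by rewrite subr_gt0.
have [ei em ec ed] := eB.
have ST : forall n, [/\ incr_on S T (iter n J), forall x, S <= x <= T -> S <= iter n J x <= T &
    cross_contracting S T (iter n J)].
  elim=> [|j [i1 m1 c1]]; first by split=> [x y|x|x0 x1 x2 x3] //=.
  split.
  - exact: incr_on_comp i1 m1 Ji.
  - by move=> x xST; rewrite iterS; apply: Jm; apply: m1.
  - exact: cross_contracting_comp i1 m1 c1 Jc.
have [i1 m1 c1] := ST n.
have ei' : incr_on S T e by apply: incr_on_sub ei.
have ec' : cross_contracting S T e by apply: cross_contracting_sub ec.
have Ei : incr_on S T (e \o iter n J) by apply: incr_on_comp i1 m1 ei'.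
have Ec : cross_contracting S T (e \o iter n J) by apply: cross_contracting_comp i1 m1 c1 ec'.
have Ed := koebe Ei Ec Sp qT Tk Sk.
have aff x : 0 <= x <= 1 -> p <= p + (q - p) * x <= q.
  move=> /andP[x0 x1]; rewrite lerDl mulr_ge0 ?(ltW qp0) //=.
  by rewrite -lerBrDl; apply: ler_piMr => //; exact: ltW.
have lt_aff x y : x < y -> p + (q - p) * x < p + (q - p) * y by move=> xy; rewrite ltrD2l ltr_pM2l.
split.
- move=> x y x0 xy y1; apply: Ei; [|exact: lt_aff|].
    by have := aff x; move: x0 xy y1 Sp; clear; lra.
  by have := aff y; move: x0 xy y1 qT; clear; lra.
- move=> x x01; apply: em; have := m1 (p + (q - p) * x); have := aff x x01.
  by move: S0 T1 Sp qT; clear; lra.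
- move=> x0 x1 x2 x3 h0 h1 h2 h3 h4.
  rewrite -(@cross_affine _ p (q - p) x0 x1 x2 x3) //.
  apply: Ec; rewrite ?lt_aff //.
    by have := aff x0; move: h0 h1 h2 h3 h4 Sp; clear; lra.
  by have := aff x3; move: h0 h1 h2 h3 h4 qT; clear; lra.
- move=> x y z w h0 h1 h2 h3 h4 h5.
  have := Ed (p + (q - p) * x) (p + (q - p) * y) (p + (q - p) * z) (p + (q - p) * w).
  have ax : p <= p + (q - p) * x by have := aff x; move: h0 h1 h2; clear; lra.
  have ay : p + (q - p) * y <= q by have := aff y; move: h0 h1 h2; clear; lra.
  have az : p <= p + (q - p) * z by have := aff z; move: h3 h4 h5; clear; lra.
  have aw : p + (q - p) * w <= q by have := aff w; move: h3 h4 h5; clear; lra.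
  move=> /(_ ax (lt_aff _ _ h1) ay az (lt_aff _ _ h4) aw) /=.
  set X := _ - e _; set Y := _ - e _.
  have -> : p + (q - p) * w - (p + (q - p) * z) = (q - p) * (w - z) by ring.
  have -> : p + (q - p) * y - (p + (q - p) * x) = (q - p) * (y - x) by ring.
  have -> : X * ((q - p) * (w - z)) = (q - p) * (X * (w - z)) by ring.
  have -> : k ^+ 2 * (Y * ((q - p) * (y - x))) = (q - p) * (k ^+ 2 * (Y * (y - x))) by ring.
  rewrite ler_pM2l // => H; apply: (le_trans H); apply: ler_wpM2r => //.
  apply: mulr_ge0; last by move: h1; clear; lra.
  rewrite subr_ge0; apply: ltW; apply: (Ei (p + (q - p) * z) (p + (q - p) * w)); [|exact: lt_aff|].
    by move: az Sp; clear; lra.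
  by move: aw qT; clear; lra.
Qed.

End InverseBranches.

(** * Closed branches of a Lorenz map *)

Section OneSidedLimits.
Context {R : realType}.
Implicit Types (a b : R) (f g : R -> R).

Lemma incr_onto_sub a b a' b' f : a <= a' -> a' <= b' -> b' <= b ->
  incr_onto a b f -> incr_onto a' b' f.
Proof.
move=> aa ab bb [fi fs]; split; first exact: incr_on_sub fi.
move=> y yab.
have a'I : a <= a' <= b by move: aa ab bb; clear; lra.
have b'I : a <= b' <= b by move: aa ab bb; clear; lra.
have fa : f a <= f a' by apply: (incr_on_le fi); move: a'I; clear; lra.
have fb : f b' <= f b by apply: (incr_on_le fi); move: b'I; clear; lra.
have [x xab fx] := fs y ltac:(move: yab fa fb; clear; lra).
exists x => //; rewrite -fx in yab.
by rewrite !(incr_on_leE fi) in yab.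
Qed.

Lemma lim_left_incr_onto a b f g : a < b -> incr_onto a b f ->
  (forall x, a <= x < b -> g x = f x) -> lim (g x @[x --> b^'-]) = f b.
Proof.
move=> ab [fi fs] E; apply/cvg_lim => //; apply/cvgrPdist_lt => e e0.
have fab : f a < f b by apply: fi.
pose y := Num.max (f a) (f b - e / 2).
have yI : f a <= y <= f b by rewrite le_max lexx /= ge_max (ltW fab) /= lerBlDr lerDl divr_ge0 // ltW.
have yb : y < f b by rewrite gt_max fab /= ltrBlDr ltrDl divr_gt0.
have [x0 x0I fx0] := fs y yI.
have x0b : x0 < b.
  by rewrite -(incr_on_ltE fi x0I) ?fx0 // ; rewrite (ltW ab) lexx.
near=> x.
have x0x : x0 < x by near: x; exact: nbhs_left_gt.
have xb : x < b by near: x; exact: nbhs_left_lt.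
rewrite E; last by move: x0I x0x xb; clear; lra.
have h1 : f x < f b by apply: fi; move: x0I x0x xb; clear; lra.
have h2 : f x0 < f x by apply: fi; move: x0I x0x xb; clear; lra.
have h3 : f b - e / 2 <= y by rewrite le_max lexx orbT.
rewrite ger0_norm; last by move: h1; clear; lra.
by move: h1 h2 h3 e0; rewrite fx0; clear; lra.
Unshelve. all: by end_near. Qed.

Lemma lim_right_incr_onto a b f g : a < b -> incr_onto a b f ->
  (forall x, a < x <= b -> g x = f x) -> lim (g x @[x --> a^'+]) = f a.
Proof.
move=> ab [fi fs] E; apply/cvg_lim => //; apply/cvgrPdist_lt => e e0.
have fab : f a < f b by apply: fi.
pose y := Num.min (f b) (f a + e / 2).
have yI : f a <= y <= f b by rewrite ge_min lexx /= andbT le_min (ltW fab) /= lerDl divr_ge0 // ltW.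
have yb : f a < y by rewrite lt_min fab /= ltrDl divr_gt0.
have [x0 x0I fx0] := fs y yI.
have x0b : a < x0.
  by rewrite -(incr_on_ltE fi _ x0I) ?fx0 // ; rewrite (ltW ab) lexx.
near=> x.
have x0x : x < x0 by near: x; exact: nbhs_right_lt.
have xb : a < x by near: x; exact: nbhs_right_gt.
rewrite E; last by move: x0I x0x xb; clear; lra.
have h1 : f a < f x by apply: fi; move: x0I x0x xb; clear; lra.
have h2 : f x < f x0 by apply: fi; move: x0I x0x xb; clear; lra.
have h3 : y <= f a + e / 2 by rewrite ge_min lexx orbT.
rewrite ler0_norm; last by move: h1; clear; lra.
by move: h1 h2 h3 e0; rewrite fx0; clear; lra.
Unshelve. all: by end_near. Qed.

(** For maps with u = 0, whose left branch is constant; the critical value must be computed before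
    nontriviality can exclude them. *)
Lemma lim_left_cst a b (k : R) g : a < b -> (forall x, a <= x < b -> g x = k) ->
  lim (g x @[x --> b^'-]) = k.
Proof.
move=> ab E; apply/cvg_lim => //; apply/cvgrPdist_lt => e e0.
near=> x; rewrite E ?subrr ?normr0 //.
have x0x : a < x by near: x; exact: nbhs_left_gt.
have xb : x < b by near: x; exact: nbhs_left_lt.
by rewrite ltW.
Unshelve. all: by end_near. Qed.

Lemma lim_right_cst a b (k : R) g : a < b -> (forall x, a < x <= b -> g x = k) ->
  lim (g x @[x --> a^'+]) = k.
Proof.
move=> ab E; apply/cvg_lim => //; apply/cvgrPdist_lt => e e0.
near=> x; rewrite E ?subrr ?normr0 //.
have x0x : x < b by near: x; exact: nbhs_right_lt.
have xb : a < x by near: x; exact: nbhs_right_gt.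
by rewrite xb ltW.
Unshelve. all: by end_near. Qed.

End OneSidedLimits.

Section ClosedBranches.
Context {R : realType}.
Implicit Types (al : R) (F G : lorenz R).

(** The formula of the map left of c, kept at c as well, where it gives the critical value. *)
Definition left_branch al F (x : R) : R :=
  lphi F (lu F * (1 - ((lc F - x) / lc F) `^ al)).

Definition right_branch al F (x : R) : R :=
  lpsi F (1 + lv F * (-1 + ((x - lc F) / (1 - lc F)) `^ al)).

Lemma lmap_left al F x : x < lc F -> lmap al F x = left_branch al F x.
Proof. by rewrite /lmap /lstd /left_branch => ->. Qed.

Lemma lmap_right al F x : lc F < x -> lmap al F x = right_branch al F x.
Proof. by rewrite /lmap /lstd /right_branch => /ltW; rewrite leNgt => /negPf ->. Qed.

Lemma diffeo_incr_onto k (phi : R -> R) : orientation_preserving_diffeo k phi ->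
  [/\ incr_onto 0 1 phi, phi 0 = 0 & phi 1 = 1].
Proof.
move=> [pf _ pi [phi' [pf' _ K1 K2]]].
have i0 : (0 : R) \in `[0, 1] by rewrite in_itv /= lexx ler01.
have i1 : (1 : R) \in `[0, 1] by rewrite in_itv /= lexx ler01.
have fi : incr_on 0 1 phi.
  by move=> x y x0 xy y1; apply: pi => //; rewrite in_itv /=; move: x0 xy y1; clear; lra.
have inI (y : R) : y \in `[0, 1] -> 0 <= y <= 1 by rewrite in_itv.
have m (y : R) : 0 <= y <= 1 -> 0 <= phi y <= 1 by move=> yI; have := pf y yI; rewrite /= in_itv.
have m' (y : R) : 0 <= y <= 1 -> 0 <= phi' y <= 1 by move=> yI; have := pf' y yI; rewrite /= in_itv.
have p0 : phi 0 = 0.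
  apply/eqP; rewrite eq_le; apply/andP; split; last by case/andP: (m 0 (inI _ i0)).
  have h := m' 0 (inI _ i0); rewrite -[leRHS](K2 _ i0).
  by apply: (incr_on_le fi); move: h; clear; lra.
have p1 : phi 1 = 1.
  apply/eqP; rewrite eq_le; apply/andP; split; first by case/andP: (m 1 (inI _ i1)).
  have h := m' 1 (inI _ i1); rewrite -[leLHS](K2 _ i1).
  by apply: (incr_on_le fi); move: h; clear; lra.
split=> //; split=> // y; rewrite p0 p1 => yI.
by exists (phi' y); [exact: m'|apply: K2; rewrite in_itv].
Qed.

Section Branch.
Variables (al : R) (F : lorenz R) (k : nat).
Hypotheses (al0 : 0 < al) (FL : Lk k F) (FN : nontrivial al F).
Let c01 : 0 < lc F < 1. Proof. by case: FL. Qed.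
Let c0 : 0 < lc F. Proof. by case/andP: c01. Qed.
Let e0 : 0 < 1 - lc F. Proof. by rewrite subr_gt0; case/andP: c01. Qed.
Let phiP : [/\ incr_onto 0 1 (lphi F), lphi F 0 = 0 & lphi F 1 = 1].
Proof. by case: FL => _ _ _ h _; exact: diffeo_incr_onto h. Qed.
Let psiP : [/\ incr_onto 0 1 (lpsi F), lpsi F 0 = 0 & lpsi F 1 = 1].
Proof. by case: FL => _ _ _ _ h; exact: diffeo_incr_onto h. Qed.
Let aN : al != 0. Proof. by rewrite gt_eqF. Qed.

Let rt (y : R) : 0 <= y <= 1 -> (y `^ al^-1) `^ al = y /\ 0 <= y `^ al^-1 <= 1.
Proof.
move=> yI; have ai : 0 <= al^-1 by rewrite invr_ge0 ltW.
split; first by rewrite -powRrM mulVf // powRr1 //; case/andP: yI.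
by rewrite powR_ge0 powR_le1.
Qed.

Lemma left_branch0 : left_branch al F 0 = 0.
Proof. by rewrite /left_branch subr0 divff ?gt_eqF // powR1 subrr mulr0; case: phiP. Qed.

Lemma right_branch1 : right_branch al F 1 = 1.
Proof. by rewrite /right_branch divff ?gt_eqF // powR1 addNr mulr0 addr0; case: psiP. Qed.

Let left_inner : 0 < lu F -> incr_onto 0 (lc F) (fun x => lu F * (1 - ((lc F - x) / lc F) `^ al)).
Proof.
move=> u0; split=> [x y x0 xy yc|y].
  rewrite ltr_pM2l // ltrD2l ltrN2; apply: powR_lt => //.
    by rewrite divr_ge0 //; move: yc c0; lra.
  by rewrite ltr_pM2r ?invr_gt0 // ltrD2l ltrN2.
rewrite subr0 subrr mul0r powR0 // divff ?gt_eqF // powR1 subrr mulr0 subr0 mulr1 => yI.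
have zI : 0 <= 1 - y / lu F <= 1.
  rewrite subr_ge0 ler_pdivrMr // lerBlDr lerDl divr_ge0 //; move: yI u0; lra.
have [E rI] := rt zI.
exists (lc F * (1 - (1 - y / lu F) `^ al^-1)).
  apply/andP; split; first by rewrite mulr_ge0 //; move: rI c0; lra.
  by apply: ler_piMr; move: rI c0; lra.
rewrite (_ : (lc F - _) / lc F = (1 - y / lu F) `^ al^-1); last by field; rewrite gt_eqF.
by rewrite E; field; rewrite gt_eqF.
Qed.

Let right_inner : 0 < lv F -> incr_onto (lc F) 1
  (fun x => 1 + lv F * (-1 + ((x - lc F) / (1 - lc F)) `^ al)).
Proof.
move=> u0; split=> [x y x0 xy yc|y].
  rewrite ltrD2l ltr_pM2l // ltrD2l; apply: powR_lt => //.
    by rewrite divr_ge0 //; move: x0 e0; lra.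
  by rewrite ltr_pM2r ?invr_gt0 // ltrD2r.
rewrite subrr mul0r powR0 // divff ?gt_eqF // powR1 addNr mulr0 !addr0 mulrN1 => yI.
have zI : 0 <= 1 - (1 - y) / lv F <= 1.
  apply/andP; split; first by rewrite subr_ge0 ler_pdivrMr //; move: yI u0; lra.
  by rewrite gerBl divr_ge0 //; move: yI u0; lra.
have [E rI] := rt zI.
exists (lc F + (1 - lc F) * (1 - (1 - y) / lv F) `^ al^-1).
  apply/andP; split; first by rewrite lerDl mulr_ge0 //; move: rI e0; lra.
  rewrite -lerBrDl; apply: ler_piMr; move: rI e0; lra.
rewrite (_ : (_ - lc F) / _ = (1 - (1 - y) / lv F) `^ al^-1); last by field; rewrite gt_eqF.
by rewrite E; field; rewrite gt_eqF.
Qed.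

Let u01 : 0 <= lu F <= 1. Proof. by case: FL. Qed.
Let v01 : 0 <= lv F <= 1. Proof. by case: FL. Qed.

Let left_incr_onto : 0 < lu F -> incr_onto 0 (lc F) (left_branch al F).
Proof.
move=> u0; apply: (incr_onto_comp (ltW c0) (left_inner u0)).
rewrite subr0 subrr mul0r powR0 // divff ?gt_eqF // powR1 subrr mulr0 subr0 mulr1.
by case: phiP => h _ _; apply: incr_onto_sub h => //; case/andP: u01.
Qed.

Let right_incr_onto : 0 < lv F -> incr_onto (lc F) 1 (right_branch al F).
Proof.
move=> v0; have c1 : lc F <= 1 by case/andP: c01 => _ /ltW.
apply: (incr_onto_comp c1 (right_inner v0)).
rewrite subrr mul0r powR0 // divff ?gt_eqF // powR1 addNr mulr0 !addr0 mulrN1.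
by case: psiP => h _ _; apply: incr_onto_sub h => //; move: v01; lra.
Qed.

Let crit_leftE : crit_left al F = left_branch al F (lc F).
Proof.
have [u0|] := ltP 0 (lu F).
  by apply: (@lim_left_incr_onto _ 0) => // [|x /andP[_ xc]]; [exact: left_incr_onto|exact: lmap_left].
move=> un; have uE : lu F = 0 by move: un u01; lra.
apply: (@lim_left_cst _ 0) => // x /andP[_ xc].
by rewrite lmap_left // /left_branch uE !mul0r.
Qed.

Let crit_rightE : crit_right al F = right_branch al F (lc F).
Proof.
have c1 : lc F < 1 by case/andP: c01.
have [u0|] := ltP 0 (lv F).
  by apply: (@lim_right_incr_onto _ _ 1) => // [|x /andP[xc _]]; [exact: right_incr_onto|exact: lmap_right].
move=> un; have uE : lv F = 0 by move: un v01; lra.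
apply: (@lim_right_cst _ _ 1) => // x /andP[xc _].
by rewrite lmap_right // /right_branch uE !mul0r.
Qed.

Lemma lu_gt0 : 0 < lu F.
Proof.
rewrite lt0r; apply/andP; split; last by case/andP: u01.
apply/eqP => uE; case/andP: FN => _; rewrite crit_leftE /left_branch uE mul0r.
by case: phiP => _ -> _ cn; move: c0 cn; lra.
Qed.

Lemma lv_gt0 : 0 < lv F.
Proof.
rewrite lt0r; apply/andP; split; last by case/andP: v01.
apply/eqP => vE; case/andP: FN => + _; rewrite crit_rightE /right_branch vE mul0r addr0.
by case: psiP => _ _ -> cn; move: e0 cn; lra.
Qed.

Record lorenz_pair (c : R) (g0 g1 : R -> R) : Prop := LorenzPair {
  lp_c : 0 < c < 1;
  lp_g0 : incr_onto 0 c g0;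
  lp_g1 : incr_onto c 1 g1;
  lp_g00 : g0 0 = 0;
  lp_g11 : g1 1 = 1;
  lp_cm : c < g0 c <= 1;
  lp_cp : 0 <= g1 c < c }.

Lemma lorenz_pairP : lorenz_pair (lc F) (left_branch al F) (right_branch al F).
Proof.
have := FN; rewrite /nontrivial crit_leftE crit_rightE => /andP[h1 h2].
split=> //.
- exact: left_incr_onto lu_gt0.
- exact: right_incr_onto lv_gt0.
- exact: left_branch0.
- exact: right_branch1.
- rewrite h2 /left_branch subrr mul0r powR0 // subr0 mulr1 /=.
  case: phiP => -[pi _] _ <-.
  by apply: (incr_on_le pi); move: u01; lra.
- rewrite h1 andbT /right_branch subrr mul0r powR0 // addr0 mulrN1.
  case: psiP => -[pi _] <- _.
  by apply: (incr_on_le pi); move: v01; lra.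
Qed.

Lemma crit_leftP : crit_left al F = left_branch al F (lc F).
Proof. exact: crit_leftE. Qed.

Lemma crit_rightP : crit_right al F = right_branch al F (lc F).
Proof. exact: crit_rightE. Qed.

End Branch.
End ClosedBranches.

(** * Negative Schwarzian derivative *)

Section SchwarzianConvex.
Context {R : realType}.
Variables (a b : R) (f1 f2 f3 : R -> R).
Hypotheses (d1 : forall x, a < x < b -> is_derive x 1 f1 (f2 x))
  (d2 : forall x, a < x < b -> is_derive x 1 f2 (f3 x))
  (f10 : forall x, a < x < b -> 0 < f1 x)
  (S0 : forall x, a < x < b -> f3 x / f1 x - 3 / 2 * (f2 x / f1 x) ^+ 2 < 0).

(** The power g^(-1/2). Applied to a derivative Df, it gives the function whose second derivative is
    - 1 / 2 times itself times the Schwarzian of f. *)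
Definition inv_sqrt_derive (g : R -> R) (x : R) : R := expR (- 2^-1 * ln (g x)).
Local Notation h := (inv_sqrt_derive f1).

Let h' x := h x * (- 2^-1 * (f2 x / f1 x)).

Lemma inv_sqrt_deriveK x : a < x < b -> h x ^- 2 = f1 x.
Proof.
move=> xI; rewrite /inv_sqrt_derive -exprVn -expRN -expRM_natl.
rewrite (_ : 2%:R * - (- 2^-1 * ln (f1 x)) = ln (f1 x)); last by field.
by rewrite lnK // posrE f10.
Qed.

Let hd x : a < x < b -> is_derive x 1 h (h' x).
Proof.
move=> xI; have l := is_derive1_ln (f10 xI).
have c1 := @is_derive1_comp _ (@ln R) f1 x _ _ l (d1 xI).
have c2 : is_derive x 1 (fun y => - 2^-1 * ln (f1 y)) (- 2^-1 * ((f1 x)^-1 * f2 x)).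
  have -> : (fun y => - 2^-1 * ln (f1 y)) = (- 2^-1 *: (@ln R \o f1)) by apply/funext.
  exact: is_deriveZ.
have c3 := @is_derive1_comp _ expR (fun y => - 2^-1 * ln (f1 y)) x _ _ (is_derive_expR _) c2.
by rewrite /h' (mulrC (f2 x)).
Qed.

Let hd' x : a < x < b -> is_derive x 1 h'
  (h x * (- 2^-1 * (f3 x / f1 x - 3 / 2 * (f2 x / f1 x) ^+ 2))).
Proof.
move=> xI; have fN : f1 x != 0 by rewrite gt_eqF // f10.
have v := @is_deriveV _ f1 x _ 1 fN (d1 xI).
have m := is_deriveM (d2 xI) v.
have z := @is_deriveZ _ _ _ _ (- 2^-1) _ _ _ m.
have e := is_deriveM (hd xI) z.
apply: (@is_derive_eq _ _ _ _ _ _ _ _ e).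
by rewrite /GRing.scale /= !fctE /h' /GRing.scale /=; field.
Qed.

(** Negative Schwarzian makes h'' positive. The convexity inequality follows by the mean value
    theorem for h on [x, y] and [y, z] and then for h' between the two intermediate points. *)
Lemma schwarzian_convex x y z : a < x -> x < y -> y < z -> z < b ->
  h y * (z - x) <= h x * (z - y) + h z * (y - x).
Proof.
move=> ax xy yz zb.
have cont (g g' : R -> R) s t : (forall w, a < w < b -> is_derive w 1 g (g' w)) -> a < s -> t < b ->
    {within `[s, t], continuous g}.
  move=> gd as' tb; apply: continuous_in_subspaceT => w; rewrite inE /= in_itv /= => wI.
  have [d _] := gd w ltac:(move: wI; lra).
  exact/differentiable_continuous/derivable1_diffP.
have mvt (g g' : R -> R) s t : (forall w, a < w < b -> is_derive w 1 g (g' w)) -> a < s -> s < t -> t < b ->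
    exists2 w, s < w < t & g t - g s = g' w * (t - s).
  move=> gd as' st tb.
  have [|w wI E] := @MVT _ g g' s t st _ (cont _ _ _ _ gd as' tb).
    by move=> w; rewrite in_itv /= => wI; apply: gd; move: wI; lra.
  by exists w.
have [u uI Eu] := mvt h h' x y hd ax xy ltac:(lra).
have [v vI Ev] := mvt h h' y z hd ltac:(lra) yz zb.
have uv : u < v by lra.
have [w wI Ew] := mvt h' _ u v hd' ltac:(lra) uv ltac:(lra).
have pos : 0 <= h' v - h' u.
  rewrite Ew; apply: mulr_ge0; last lra.
  apply: mulr_ge0; first exact: expR_ge0.
  by have := @S0 w ltac:(lra); lra.
have : h' u * ((y - x) * (z - y)) <= h' v * ((y - x) * (z - y)).
  by apply: ler_wpM2r; [apply: mulr_ge0|]; lra.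
have : (h y - h x) * (z - y) = h' u * ((y - x) * (z - y)) by rewrite Eu; ring.
have : (h z - h y) * (y - x) = h' v * ((y - x) * (z - y)) by rewrite Ev; ring.
lra.
Qed.

End SchwarzianConvex.

Lemma schwarzian_cross_expanding {R : realType} (a b : R) (f f1 f2 f3 : R -> R) :
  {within `[a, b], continuous f} ->
  (forall x, a < x < b -> is_derive x 1 f (f1 x)) ->
  (forall x, a < x < b -> is_derive x 1 f1 (f2 x)) ->
  (forall x, a < x < b -> is_derive x 1 f2 (f3 x)) ->
  (forall x, a < x < b -> 0 < f1 x) ->
  (forall x, a < x < b -> f3 x / f1 x - 3 / 2 * (f2 x / f1 x) ^+ 2 < 0) ->
  cross_expanding a b f.
Proof.
move=> fc d0 d1 d2 f10 S0.
apply: (@convex_cross_expanding _ a b f (inv_sqrt_derive f1)) => //.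
- by move=> x xI; rewrite (inv_sqrt_deriveK f10) //; exact: d0.
- by move=> x _; exact: expR_gt0.
- exact: (schwarzian_convex d1 d2 f10 S0).
Qed.

Section RelativeDerivative.
Context {R : realType}.
Implicit Types (A : set R) (f g : R -> R) (x l : R).

Let within_dnbhs A x : nbhs x A -> within A x^' = x^'.
Proof.
move=> Ax; rewrite eqEsubset; split=> P /= H; last by move: H; apply: filterS => y Py _.
rewrite /within /= in H; near=> y.
have Ay : A y by near: y; exact: nbhs_dnbhs.
by move: Ay; near: y.
Unshelve. all: by end_near. Qed.

Let quot_cvg A f x l : nbhs x A ->
  ((f y - f x) / (y - x) @[y --> within A x^'] --> l) <-> is_derive x 1 f l.
Proof.
move=> Ax; rewrite (within_dnbhs Ax); split.
  move=> H; apply/is_derive1_caratheodory.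
  exists (fun y => if y == x then l else (f y - f x) / (y - x)); split.
  - move=> z; case: eqP => [->|/eqP zx]; first by rewrite !subrr mulr0.
    by rewrite divfK // subr_eq0.
  - apply/continuous_withinNx; rewrite eqxx.
    apply: cvg_trans H; apply: near_eq_cvg; near=> y.
    rewrite ifF //; apply/negbTE; near: y; exact: nbhs_dnbhs_neq.
  - by rewrite eqxx.
move=> /is_derive1_caratheodory[g [fg /continuous_withinNx gc gx]].
rewrite gx in gc; apply: cvg_trans gc; apply: near_eq_cvg; near=> y.
rewrite fg mulfK // subr_eq0; near: y; exact: nbhs_dnbhs_neq.
Unshelve. all: by end_near. Qed.

Lemma is_derive_in A f x : nbhs x A -> derivable_in A f x -> is_derive x 1 f (derive_in A f x).
Proof. by move=> Ax; rewrite -(quot_cvg _ _ Ax). Qed.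

Lemma derive_inE A f g x l : nbhs x A -> {near x, f =1 g} -> is_derive x 1 g l ->
  derive_in A f x = l.
Proof.
move=> Ax fg gl.
have fl : is_derive x 1 f l.
  by apply: near_eq_is_derive gl; apply: filterS fg => y ->.
have := (quot_cvg f l Ax).2 fl; rewrite /derive_in (within_dnbhs Ax) => H.
exact/cvg_lim.
Qed.

End RelativeDerivative.

Section LorenzBranchDerivatives.
Context {R : realType}.
Implicit Types (x y : R) (f g : R -> R).

Lemma powR_affine_derive (k be s t : R) x : 0 < s + t * x ->
  is_derive x 1 (fun y => k * (s + t * y) `^ be) (k * (be * t) * (s + t * x) `^ (be - 1)).
Proof.
move=> pos; have d1 : is_derive x 1 (fun y => s + t * y) t.
  by apply: is_derive_eq; rewrite /GRing.scale /=; ring.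
have d2 := @is_derive1_comp _ (@powR R ^~ be) (fun y => s + t * y) x _ _ (is_derive1_powR be pos) d1.
have d3 := @is_deriveZ _ _ _ _ k _ _ _ d2.
by apply: (@is_derive_eq _ _ _ _ _ _ _ _ d3); rewrite /GRing.scale /=; ring.
Qed.

(** Only the existence of three derivatives matters: the hypothesis on the Schwarzian speaks about
    them without any formula, so the third is simply the derivative of f2. *)
Lemma comp_power_derivatives (phi0 phi1 phi2 phi3 : R -> R) (al w k s t a b : R) :
  (forall x, 0 < x < 1 -> is_derive x 1 phi0 (phi1 x)) ->
  (forall x, 0 < x < 1 -> is_derive x 1 phi1 (phi2 x)) ->
  (forall x, 0 < x < 1 -> is_derive x 1 phi2 (phi3 x)) ->
  (forall x, a < x < b -> 0 < s + t * x /\ 0 < w + k * (s + t * x) `^ al < 1) ->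
  exists f1 f2 f3 : R -> R, [/\
    forall x, a < x < b -> is_derive x 1 (fun y => phi0 (w + k * (s + t * y) `^ al)) (f1 x),
    forall x, a < x < b -> is_derive x 1 f1 (f2 x) &
    forall x, a < x < b -> is_derive x 1 f2 (f3 x)].
Proof.
move=> p0 p1 p2 H.
pose Q y := w + k * (s + t * y) `^ al.
pose Q1 y := k * (al * t) * (s + t * y) `^ (al - 1).
pose Q2 y := k * (al * t) * ((al - 1) * t) * (s + t * y) `^ (al - 1 - 1).
pose Q3 y := k * (al * t) * ((al - 1) * t) * ((al - 1 - 1) * t) * (s + t * y) `^ (al - 1 - 1 - 1).
have dQ x : a < x < b -> is_derive x 1 Q (Q1 x).
  move=> /H[pos _]; have d := powR_affine_derive k al pos.
  have e := @is_deriveD _ _ _ _ _ _ _ _ _ (is_derive_cst w x 1) d.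
  by apply: (@is_derive_eq _ _ _ _ _ _ _ _ e); rewrite add0r.
have dQ1 x : a < x < b -> is_derive x 1 Q1 (Q2 x).
  by move=> /H[pos _]; exact: powR_affine_derive.
have dQ2 x : a < x < b -> is_derive x 1 Q2 (Q3 x).
  by move=> /H[pos _]; exact: powR_affine_derive.
have c0 x : a < x < b -> is_derive x 1 (phi0 \o Q) (phi1 (Q x) * Q1 x).
  by move=> xI; have [_ QI] := H x xI; exact: (@is_derive1_comp _ phi0 Q x _ _ (p0 _ QI) (dQ _ xI)).
have c1 x : a < x < b -> is_derive x 1 (phi1 \o Q) (phi2 (Q x) * Q1 x).
  by move=> xI; have [_ QI] := H x xI; exact: (@is_derive1_comp _ phi1 Q x _ _ (p1 _ QI) (dQ _ xI)).
have c2 x : a < x < b -> is_derive x 1 (phi2 \o Q) (phi3 (Q x) * Q1 x).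
  by move=> xI; have [_ QI] := H x xI; exact: (@is_derive1_comp _ phi2 Q x _ _ (p2 _ QI) (dQ _ xI)).
pose f1 := (phi1 \o Q) * Q1.
pose f2 := (phi1 \o Q) * Q2 + (phi2 \o Q) * Q1 * Q1.
exists f1, f2, (fun x => 'D_1 f2 x); split.
- exact: c0.
- move=> x xI; have d := is_deriveM (c1 x xI) (dQ1 x xI).
  apply: (@is_derive_eq _ _ _ _ _ _ _ _ d).
  by rewrite /f2 /GRing.scale /= !fctE /=; ring.
- move=> x xI; suff d : derivable f2 x 1 by exact: DeriveDef.
  have [u1 _] := c1 x xI; have [u2 _] := c2 x xI.
  have [v1 _] := dQ1 x xI; have [v2 _] := dQ2 x xI.
  exact: (derivableD (derivableM u1 v2) (derivableM (derivableM u2 v1) v1)).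
Qed.

Lemma incr_onto_continuous (a b : R) f : incr_onto a b f -> {within `[a, b], continuous f}.
Proof.
move=> [fi fs]; apply: segment_inc_surj_continuous.
  by move=> x y; rewrite !in_itv /= => xI yI; exact: incr_on_leE fi xI yI.
by move=> y /=; rewrite in_itv /= => /fs[x xI <-]; exists x => //=; rewrite in_itv.
Qed.

Lemma diffeo_derivatives k (phi : R -> R) : (2 < k)%N -> orientation_preserving_diffeo k phi ->
  forall i x, (i < 3)%N -> 0 < x < 1 ->
  is_derive x 1 (derive_in_n i `[0, 1] phi) (derive_in_n i.+1 `[0, 1] phi x).
Proof.
move=> k2 [_ [dk _] _ _] i x i3 xI.
have xA : nbhs x (`[0, 1]%classic : set R).
  have xI' : x \in `]0, 1[ by rewrite in_itv.
  by apply: filterS (near_in_itvoo xI') => y /=; rewrite !in_itv /= => /andP[/ltW -> /ltW ->].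
by apply: is_derive_in => //; apply: dk; [exact: leq_trans i3 k2|rewrite /= in_itv /=; lra].
Qed.

(* A zero derivative would make the (junk) value of the Schwarzian 0. *)
Lemma schwarzian_neg_cross_expanding (A : set R) (a b : R) (f F f1 f2 f3 : R -> R) :
  `]a, b[ `<=` A -> (forall x, a < x < b -> F x = f x) -> incr_onto a b f ->
  (forall x, a < x < b -> is_derive x 1 f (f1 x)) ->
  (forall x, a < x < b -> is_derive x 1 f1 (f2 x)) ->
  (forall x, a < x < b -> is_derive x 1 f2 (f3 x)) ->
  (forall x, A x -> schwarzian A F x < 0) -> cross_expanding a b f.
Proof.
move=> abA Ff fo d0 d1 d2 S.
have nb x : a < x < b -> nbhs x `]a, b[%classic.
  move=> xI; have xI' : x \in `]a, b[ by rewrite in_itv.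
  by apply: filterS (near_in_itvoo xI').
have nA x : a < x < b -> nbhs x A.
  by move=> xI; apply: filterS (nb x xI).
have nE (P Q : R -> R) x : (forall y, a < y < b -> P y = Q y) -> a < x < b -> {near x, P =1 Q}.
  by move=> PQ xI; apply: filterS (nb x xI) => y /=; rewrite in_itv /=; exact: PQ.
have D1 x : a < x < b -> derive_in A F x = f1 x.
  by move=> xI; apply: (derive_inE (nA x xI) (nE _ _ _ Ff xI)); exact: d0.
have D2 x : a < x < b -> derive_in_n 2 A F x = f2 x.
  by move=> xI; apply: (derive_inE (nA x xI) (nE _ _ _ D1 xI)); exact: d1.
have D3 x : a < x < b -> derive_in_n 3 A F x = f3 x.
  by move=> xI; apply: (derive_inE (nA x xI) (nE _ _ _ D2 xI)); exact: d2.
have S' x : a < x < b -> f3 x / f1 x - 3 / 2 * (f2 x / f1 x) ^+ 2 < 0.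
  move=> xI; have := S x; rewrite /schwarzian D3 // D2 // D1 //; apply.
  by apply: abA; rewrite /= in_itv.
apply: (schwarzian_cross_expanding _ d0 d1 d2) => //; first exact: incr_onto_continuous.
move=> x xI; rewrite lt0r; apply/andP; split.
  by apply/eqP => E; have := S' x xI; rewrite E invr0 !mulr0 expr0n /= mulr0 subr0 ltxx.
have [dx <-] := d0 x xI.
have fa y z : a < y -> y < z -> z < b -> f y <= f z.
  by move=> *; apply: (incr_on_le fo.1); lra.
have := @is_derive1_caratheodory _ f x ('D_1 f x) => -[+ _].
move=> /(_ (DeriveDef dx erefl))[g [gE gc gx]].
rewrite -gx leNgt; apply/negP => gn.
have : \forall y \near x, g y < 0 by exact: (cvgr_lt _ gc).
have := nb x xI => n1 n2.
have [e /= e0 He] : \forall y \near x, g y < 0 /\ a < y < b.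
  by near=> y; split; near: y => //; apply: filterS n1 => y /=; rewrite in_itv.
have [g1 yI] : g (x + e / 2) < 0 /\ a < x + e / 2 < b.
  by apply: He; rewrite /ball /= opprD addrA subrr sub0r normrN ger0_norm; lra.
have : f x < f (x + e / 2) by apply: fo.1; lra.
rewrite -subr_gt0 gE (_ : x + e / 2 - x = e / 2); last ring.
have e20 : 0 < e / 2 by rewrite divr_gt0.
by rewrite pmulr_lgt0 // => ?; lra.
Unshelve. all: by end_near. Qed.

End LorenzBranchDerivatives.

(** * The initial map: cross-ratio expansion and power-law slopes *)

Section InitialMap.
Context {R : realType}.

Lemma LS_cross_expanding (al : R) (F : lorenz R) : 1 < al -> LS al F -> nontrivial al F ->
  cross_expanding 0 (lc F) (left_branch al F) /\ cross_expanding (lc F) 1 (right_branch al F).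
Proof.
move=> al1 [FL S] FN; have al0 : 0 < al by lra.
have LP := lorenz_pairP al0 FL FN.
have u0 := lu_gt0 al0 FL FN; have v0 := lv_gt0 al0 FL FN.
have [uI vI cI dphi dpsi] := FL.
have c0 : 0 < lc F by lra.
have e0 : 0 < 1 - lc F by lra.
have cN : lc F != 0 by rewrite gt_eqF.
have eN : 1 - lc F != 0 by rewrite gt_eqF.
have pow01 T : 0 < T < 1 -> 0 < T `^ al < 1.
  move=> TI; rewrite powR_gt0; last lra.
  by have := @powR_lt _ al T 1 al0; rewrite powR1; apply; lra.
have prod01 (k T : R) : 0 < k <= 1 -> 0 < T < 1 -> 0 < k * T < 1.
  move=> kI TI; rewrite mulr_gt0; try lra.
  by have : k * T <= 1 * T by [apply: ler_wpM2r; lra]; lra.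
split.
- pose s := 1 : R; pose t := - (lc F)^-1.
  have E x : (lc F - x) / lc F = s + t * x by rewrite /s /t; field.
  have fE : left_branch al F = fun y => lphi F (lu F + (- lu F) * (s + t * y) `^ al).
    by apply/funext => y; rewrite /left_branch -E; congr lphi; ring.
  have [f1 [f2 [f3 [d0 d1 d2]]]] := @comp_power_derivatives _ _ _ _ _ al (lu F) (- lu F) s t 0 (lc F)
    (fun x => @diffeo_derivatives _ 3 _ isT dphi 0 x isT)
    (fun x => @diffeo_derivatives _ 3 _ isT dphi 1 x isT)
    (fun x => @diffeo_derivatives _ 3 _ isT dphi 2 x isT)
    ltac:(move=> x xI; have TI : 0 < (lc F - x) / lc F < 1 by [rewrite divr_gt0 ?ltr_pdivrMr //; lra];
      have := pow01 _ TI; rewrite E in TI *; move=> PI; have := prod01 (lu F) (1 - (s + t * x) `^ al); lra).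
  apply: (@schwarzian_neg_cross_expanding _ (ldom F) 0 (lc F) _ (lmap al F) f1 f2 f3) => //.
  + move=> x /=; rewrite !in_itv /= => xI; split; first by rewrite /= in_itv /=; lra.
    by move=> /= xE; move: xI; rewrite xE ltxx andbF.
  + by move=> x xI; rewrite lmap_left //; lra.
  + exact: lp_g0 LP.
  + by rewrite fE.
- pose s := - lc F / (1 - lc F); pose t := (1 - lc F)^-1.
  have E x : (x - lc F) / (1 - lc F) = s + t * x by rewrite /s /t; field.
  have fE : right_branch al F = fun y => lpsi F (1 - lv F + lv F * (s + t * y) `^ al).
    by apply/funext => y; rewrite /right_branch -E; congr lpsi; ring.
  have [f1 [f2 [f3 [d0 d1 d2]]]] := @comp_power_derivatives _ _ _ _ _ al (1 - lv F) (lv F) s t (lc F) 1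
    (fun x => @diffeo_derivatives _ 3 _ isT dpsi 0 x isT)
    (fun x => @diffeo_derivatives _ 3 _ isT dpsi 1 x isT)
    (fun x => @diffeo_derivatives _ 3 _ isT dpsi 2 x isT)
    ltac:(move=> x xI; have TI : 0 < (x - lc F) / (1 - lc F) < 1 by [rewrite divr_gt0 ?ltr_pdivrMr //; lra];
      have := pow01 _ TI; rewrite E in TI *; move=> PI; have := prod01 (lv F) (1 - (s + t * x) `^ al); lra).
  apply: (@schwarzian_neg_cross_expanding _ (ldom F) (lc F) 1 _ (lmap al F) f1 f2 f3) => //.
  + move=> x /=; rewrite !in_itv /= => xI; split; first by rewrite /= in_itv /=; lra.
    by move=> /= xE; move: xI; rewrite xE ltxx.
  + by move=> x xI; rewrite lmap_right //; lra.
  + exact: lp_g1 LP.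
  + by rewrite fE.
Qed.

(** The chain rule with the differentiable inverse makes the derivative nonzero; monotonicity makes
    it nonnegative. *)
Lemma diffeo_derive_gt0 k (phi : R -> R) x : (0 < k)%N -> orientation_preserving_diffeo k phi ->
  0 < x < 1 -> 0 < derive_in `[0, 1] phi x.
Proof.
move=> k0 dphi xI; have [[fi fs] p0 p1] := diffeo_incr_onto dphi.
have [_ [dk _] _ [phi' [_ [dk' _] K1 _]]] := dphi.
have nb (y : R) : 0 < y < 1 -> nbhs y (`[0, 1]%classic : set R).
  move=> yI; have yI' : y \in `]0, 1[ by rewrite in_itv.
  by apply: filterS (near_in_itvoo yI') => z /=; rewrite !in_itv /= => /andP[/ltW -> /ltW ->].
have d1 : is_derive x 1 phi (derive_in `[0, 1] phi x).
  by apply: is_derive_in (nb x xI) _; apply: (dk 0%N k0); rewrite /= in_itv /=; lra.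
have yI : 0 < phi x < 1 by rewrite -{1}p0 -p1; apply/andP; split; apply: fi; lra.
have d2 : is_derive (phi x) 1 phi' (derive_in `[0, 1] phi' (phi x)).
  by apply: is_derive_in (nb _ yI) _; apply: (dk' 0%N k0); rewrite /= in_itv /=; lra.
have d3 := @is_derive1_comp _ phi' phi x _ _ d2 d1.
have d4 : is_derive x 1 (phi' \o phi) 1.
  apply: near_eq_is_derive (is_derive_id x 1); apply: filterS (nb x xI) => y yI' /=.
  by rewrite K1 //; apply/mem_set.
have E : derive_in `[0, 1] phi' (phi x) * derive_in `[0, 1] phi x = 1.
  by have [_ <-] := d3; have [_ ->] := d4.
have ge0 : 0 <= derive_in `[0, 1] phi x.
  rewrite leNgt; apply/negP => neg.
  have /is_derive1_caratheodory[g [gE gc gx]] := d1.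
  rewrite -gx in neg.
  have n1 : \forall y \near x, g y < 0 by exact: (cvgr_lt _ gc).
  have [e /= e0 He] : \forall y \near x, g y < 0 /\ 0 <= y <= 1.
    by near=> y; split; near: y => //; apply: filterS (nb x xI) => y /=; rewrite in_itv.
  have [g1 zI] : g (x + e / 2) < 0 /\ 0 <= x + e / 2 <= 1.
    by apply: He; rewrite /ball /= opprD addrA subrr sub0r normrN ger0_norm; lra.
  have : phi x < phi (x + e / 2) by apply: fi; lra.
  rewrite -subr_gt0 gE (_ : x + e / 2 - x = e / 2); last ring.
  have e20 : 0 < e / 2 by rewrite divr_gt0.
  by rewrite pmulr_lgt0 // => ?; lra.
rewrite lt0r ge0 andbT; apply/eqP => Z; move: E; rewrite Z mulr0 => /eqP.
by rewrite eq_sym oner_eq0.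
Unshelve. all: by end_near. Qed.

(** Inner derivatives are within exp d, above and below, of the derivative at 1 / 2; dividing the
    latter by exp d gives mu, and exp (2 d) spans the whole range. *)
Lemma Dist_slopes k (phi : R -> R) (d : R) : (0 < k)%N -> orientation_preserving_diffeo k phi ->
  (Dist phi <= d%:E)%E -> exists2 mu, 0 < mu & forall x y, 0 <= x -> x <= y -> y <= 1 ->
  mu * (y - x) <= phi y - phi x <= expR (2 * d) * mu * (y - x).
Proof.
move=> k0 dphi Dd.
have Dln (x y : R) : 0 <= x <= 1 -> 0 <= y <= 1 ->
    ln (derive_in `[0, 1] phi x / derive_in `[0, 1] phi y) <= d.
  move=> xI yI; rewrite -lee_fin; apply: le_trans Dd; apply: ereal_sup_ubound => /=.
  by exists x; rewrite /= ?in_itv //; exists y; rewrite /= ?in_itv.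
clear Dd; have [po p0 p1] := diffeo_incr_onto dphi.
have [_ [dk _] _ _] := dphi.
pose r := derive_in `[0, 1] phi (1 / 2).
have hI : 0 < (1 / 2 : R) < 1 by lra.
have r0 : 0 < r by exact: (diffeo_derive_gt0 k0 dphi).
have cmp (x y : R) : 0 < x < 1 -> 0 < y < 1 ->
    derive_in `[0, 1] phi x <= expR d * derive_in `[0, 1] phi y.
  move=> xI yI; have dx := diffeo_derive_gt0 k0 dphi xI; have dy := diffeo_derive_gt0 k0 dphi yI.
  rewrite -ler_pdivrMr // -[leLHS]lnK ?posrE ?divr_gt0 // ler_expR.
  by apply: Dln; lra.
exists (r / expR d); first by rewrite divr_gt0 ?expR_gt0.
move=> x y x0 xy y1; move: xy; rewrite le_eqVlt => /orP[/eqP ->|xy].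
  by rewrite !subrr !mulr0 lexx.
have [z zI E] : exists2 z, z \in `]x, y[ & phi y - phi x = derive_in `[0, 1] phi z * (y - x).
  apply: MVT => //.
    move=> z; rewrite in_itv /= => zI.
    have zI' : z \in `]0, 1[ by rewrite in_itv /=; lra.
    apply: is_derive_in; last by apply: (dk 0%N k0); rewrite /= in_itv /=; lra.
    by apply: filterS (near_in_itvoo zI') => w /=; rewrite !in_itv /= => /andP[/ltW -> /ltW ->].
  by apply: incr_onto_continuous; apply: incr_onto_sub po => //; exact: ltW.
have zI' : 0 < z < 1 by move: zI; rewrite in_itv /=; lra.
have yx : 0 <= y - x by lra.
rewrite E; apply/andP; split; apply: ler_wpM2r => //.
  by rewrite ler_pdivrMr ?expR_gt0 // mulrC; exact: cmp.
have -> : expR (2 * d) * (r / expR d) = expR d * r.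
  rewrite (_ : 2 * d = d + d); last ring.
  by rewrite expRD; field; rewrite gt_eqF // expR_gt0.
exact: cmp.
Qed.

Lemma initial_power_slopes k (al d : R) (F : lorenz R) : 0 < al -> (0 < k)%N -> Lk k F -> nontrivial al F ->
  (Dist (lphi F) <= d%:E)%E -> (Dist (lpsi F) <= d%:E)%E ->
  (exists2 mu, 0 < mu & left_power_slopes al (expR (2 * d)) (lc F) mu (left_branch al F)) /\
  (exists2 nu, 0 < nu & right_power_slopes al (expR (2 * d)) (lc F) nu (right_branch al F)).
Proof.
move=> al0 k0 FL FN D1 D2; have u0 := lu_gt0 al0 FL FN; have v0 := lv_gt0 al0 FL FN.
have [uI vI cI dphi dpsi] := FL.
have [mu mu0 Hmu] := Dist_slopes k0 dphi D1.
have [nu nu0 Hnu] := Dist_slopes k0 dpsi D2.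
clear D1 D2.
have c0 : 0 < lc F by lra.
have e0 : 0 < 1 - lc F by lra.
split.
- exists (mu * lu F); first exact: mulr_gt0.
  move=> x y x0 xy yc.
  have tI z : 0 <= z <= lc F -> 0 <= (lc F - z) / lc F <= 1.
    by move=> zI; rewrite divr_ge0 /= ?ler_pdivrMr //; lra.
  have := @powR_le1 _ al _ (ltW al0) (tI x ltac:(lra)).
  have ty0 : 0 <= ((lc F - y) / lc F) `^ al by exact: powR_ge0.
  have : ((lc F - y) / lc F) `^ al <= ((lc F - x) / lc F) `^ al.
    apply: powR_le; [exact: ltW|by have := tI y ltac:(lra); lra|].
    by rewrite ler_pM2r ?invr_gt0 //; lra.
  rewrite /left_branch.
  move: (((lc F - x) / lc F) `^ al) (((lc F - y) / lc F) `^ al) ty0 => X Y Y0 YX X1.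
  have := Hmu (lu F * (1 - X)) (lu F * (1 - Y)).
  have -> : lu F * (1 - Y) - lu F * (1 - X) = lu F * (X - Y) by ring.
  rewrite !mulrA -(mulrA _ mu); apply.
  + by apply: mulr_ge0; lra.
  + by apply: ler_wpM2l; lra.
  + by have : lu F * (1 - Y) <= 1 * 1 by [apply: ler_pM; lra]; lra.
- exists (nu * lv F); first exact: mulr_gt0.
  move=> x y x0 xy yc.
  have tI z : lc F <= z <= 1 -> 0 <= (z - lc F) / (1 - lc F) <= 1.
    by move=> zI; rewrite divr_ge0 /= ?ler_pdivrMr //; lra.
  have := @powR_le1 _ al _ (ltW al0) (tI y ltac:(lra)).
  have tx0 : 0 <= ((x - lc F) / (1 - lc F)) `^ al by exact: powR_ge0.
  have : ((x - lc F) / (1 - lc F)) `^ al <= ((y - lc F) / (1 - lc F)) `^ al.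
    apply: powR_le; [exact: ltW|by have := tI x ltac:(lra); lra|].
    by rewrite ler_pM2r ?invr_gt0 //; lra.
  rewrite /right_branch.
  move: (((x - lc F) / (1 - lc F)) `^ al) (((y - lc F) / (1 - lc F)) `^ al) tx0 => X Y X0 XY Y1.
  have := Hnu (1 + lv F * (-1 + X)) (1 + lv F * (-1 + Y)).
  have -> : 1 + lv F * (-1 + Y) - (1 + lv F * (-1 + X)) = lv F * (Y - X) by ring.
  rewrite !mulrA -(mulrA _ nu); apply.
  + by have : lv F * (1 - X) <= 1 * 1 by [apply: ler_pM; lra]; lra.
  + by rewrite lerD2l; apply: ler_wpM2l; lra.
  + by have : 0 <= lv F * (1 - Y) by [apply: mulr_ge0; lra]; lra.
Qed.

End InitialMap.

(** * Renormalization in terms of closed branches *)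

Section Renormalizes.
Context {R : realType}.

Record renormalizes (c : R) (g0 g1 : R -> R) (a b : nat) (p q c' : R) (g0' g1' : R -> R) : Prop :=
  Renormalizes {
  rn_a : (0 < a)%N;
  rn_b : (0 < b)%N;
  rn_p : 0 < p < c;
  rn_q : c < q < 1;
  rn_c : p + (q - p) * c' = c;
  rn_left : forall t, 0 <= t <= c' -> iter a g1 (g0 (p + (q - p) * t)) = p + (q - p) * g0' t;
  rn_right : forall t, c' <= t <= 1 -> iter b g0 (g1 (p + (q - p) * t)) = p + (q - p) * g1' t;
  rn_orbit_left : forall x i, p <= x <= c -> (i < a)%N -> c < iter i g1 (g0 x) <= 1;
  rn_orbit_right : forall x i, c <= x <= q -> (i < b)%N -> 0 <= iter i g0 (g1 x) < c }.

Lemma incr_onto_affine (a b p s : R) : 0 < s -> incr_onto a b (fun t => p + s * t).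
Proof.
move=> s0; split=> [x y _ xy _|y yI]; first by rewrite ltrD2l ltr_pM2l.
exists ((y - p) / s); last by field; rewrite gt_eqF.
by rewrite ler_pdivlMr // ler_pdivrMr //; move: yI; clear; lra.
Qed.

Lemma first_return_unique al (F : lorenz R) C x n m :
  first_return_time al F C x n -> first_return_time al F C x m -> n = m.
Proof.
move=> [n0 Cn Hn] [m0 Cm Hm]; have [nm|mn|E] := ltngtP n m; last exact: E.
  by case: (Hm n _ Cn); rewrite n0 nm.
by case: (Hn m _ Cm); rewrite m0 mn.
Qed.

Section FromDefinition.
Variables (al : R) (F G : lorenz R) (a b : nat).
Hypotheses (al0 : 0 < al) (FL : Lk 0 F) (FN : nontrivial al F).
Local Notation c := (lc F).
Local Notation g0 := (left_branch al F).
Local Notation g1 := (right_branch al F).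
Local Notation f := (lmap al F).
Let LP := lorenz_pairP al0 FL FN.

Let orbit_left_lmap p x : p <= x < c ->
  (forall i, (1 <= i <= a)%N -> c < iter i f x < 1) ->
  forall i, (i <= a)%N -> iter i.+1 f x = iter i g1 (g0 x).
Proof.
move=> /andP[_ xc] H; elim=> [|i IH] ia; first by rewrite /= lmap_left.
rewrite iterS IH ?(ltnW ia) // lmap_right ?iterS // -IH ?(ltnW ia) //.
by case/andP: (H i.+1 ia).
Qed.

Let orbit_right_lmap q x : c < x <= q ->
  (forall i, (1 <= i <= b)%N -> 0 < iter i f x < c) ->
  forall i, (i <= b)%N -> iter i.+1 f x = iter i g0 (g1 x).
Proof.
move=> /andP[xc _] H; elim=> [|i IH] ia; first by rewrite /= lmap_right.
rewrite iterS IH ?(ltnW ia) // lmap_left ?iterS // -IH ?(ltnW ia) //.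
by case/andP: (H i.+1 ia).
Qed.

Let iter_left_onto p : 0 <= p < c ->
  (forall x i, p <= x < c -> (i < a)%N -> c < iter i g1 (g0 x) < 1) ->
  forall i, (i <= a)%N -> incr_onto p c (fun x => iter i g1 (g0 x)) /\
    ((i < a)%N -> c < iter i g1 (g0 c) <= 1).
Proof.
move=> pc H; have /andP[c0 c1] := lp_c LP.
elim=> [|i IH] ia.
  split=> [|_]; last exact: lp_cm LP.
  by apply: incr_onto_sub (lp_g0 LP) => //; move: pc; lra.
have [k_onto kc] := IH (ltnW ia).
have /andP[kc1 kc2] := kc ia.
have /andP[kp1 _] : c < iter i g1 (g0 p) < 1 by apply: H => //; move: pc; lra.
have ko : incr_onto p c (fun x => iter i.+1 g1 (g0 x)).
  apply: (@incr_onto_comp _ p c (fun x => iter i g1 (g0 x)) g1) => //.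
    by move: pc; lra.
  apply: incr_onto_sub (lp_g1 LP) => //; first exact: ltW.
  by apply: (incr_on_le k_onto.1); move: pc; lra.
split=> // ia'.
have /andP[hp _] : c < iter i.+1 g1 (g0 p) < 1 by apply: H => //; move: pc; lra.
apply/andP; split.
  by apply: (lt_trans hp); apply: ko.1; move: pc; lra.
rewrite iterS -[leRHS](lp_g11 LP); apply: (incr_on_le (lp_g1 LP).1) => //.
exact: ltW.
Qed.

Let iter_right_onto q : c < q <= 1 ->
  (forall x i, c < x <= q -> (i < b)%N -> 0 < iter i g0 (g1 x) < c) ->
  forall i, (i <= b)%N -> incr_onto c q (fun x => iter i g0 (g1 x)) /\
    ((i < b)%N -> 0 <= iter i g0 (g1 c) < c).
Proof.
move=> qc H; have /andP[c0 c1] := lp_c LP.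
elim=> [|i IH] ia.
  split=> [|_]; last exact: lp_cp LP.
  by apply: incr_onto_sub (lp_g1 LP) => //; move: qc; lra.
have [k_onto kc] := IH (ltnW ia).
have /andP[kc1 kc2] := kc ia.
have /andP[_ kp1] : 0 < iter i g0 (g1 q) < c by apply: H => //; move: qc; lra.
have ko : incr_onto c q (fun x => iter i.+1 g0 (g1 x)).
  apply: (@incr_onto_comp _ c q (fun x => iter i g0 (g1 x)) g0) => //.
    by move: qc; lra.
  apply: incr_onto_sub (lp_g0 LP) => //; last exact: ltW.
  by apply: (incr_on_le k_onto.1); move: qc; lra.
split=> // ia'.
have /andP[_ hp] : 0 < iter i.+1 g0 (g1 q) < c by apply: H => //; move: qc; lra.
apply/andP; split; last first.
  by apply: lt_trans hp; apply: ko.1; move: qc; lra.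
rewrite iterS -[leLHS](lp_g00 LP); apply: (incr_on_le (lp_g0 LP).1) => //.
exact: ltW.
Qed.

(** Uniqueness of first return times identifies the unspecified time of the affine conjugacy with a
    + 1 or b + 1. The conjugacy, given off the discontinuity, extends to it because increasing
    surjections that agree up to an end point agree there. *)
Lemma monotone_renormalizationP : monotone_renormalization al F (a, b) G ->
  [/\ Lk 0 G, nontrivial al G & exists p q,
    renormalizes c g0 g1 a b p q (lc G) (left_branch al G) (right_branch al G)].
Proof.
move=> [p [q [[RI _] /= [a0 b0] HL HR]]].
have [[pI qI pq] [GL GN hc ret]] := RI.
split=> //; exists p, q.
have LPG := lorenz_pairP al0 GL GN.
have /andP[c0 c1] := lp_c LP; have /andP[c0' c1'] := lp_c LPG.
(* 0 is fixed by the left branch, whereas the image of p must lie to the right of c. *)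
have p0 : 0 < p.
  rewrite lt0r; apply/andP; split; last by case/andP: pI.
  apply/eqP => pE; have [_ /(_ 1%N)] := HL p ltac:(move: pI; lra).
  by rewrite a0 => /(_ erefl) /=; rewrite lmap_left pE // (lp_g00 LP); lra.
have q1 : q < 1.
  rewrite lt_neqAle; apply/andP; split; last by case/andP: qI.
  apply/eqP => qE; have [_ /(_ 1%N)] := HR q ltac:(move: qI; lra).
  by rewrite b0 => /(_ erefl) /=; rewrite lmap_right qE // (lp_g11 LP); lra.
have qp0 : 0 < q - p by move: pI qI; lra.
have OL x i : p <= x < c -> (i <= a)%N -> iter i.+1 f x = iter i g1 (g0 x).
  by move=> xI; have [_ H] := HL x xI; exact: orbit_left_lmap xI H i.
have OR x i : c < x <= q -> (i <= b)%N -> iter i.+1 f x = iter i g0 (g1 x).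
  by move=> xI; have [_ H] := HR x xI; exact: orbit_right_lmap xI H i.
have OLI x i : p <= x < c -> (i < a)%N -> c < iter i g1 (g0 x) < 1.
  by move=> xI ia; rewrite -OL ?(ltnW ia) //; have [_ H] := HL x xI; exact: H.
have ORI x i : c < x <= q -> (i < b)%N -> 0 < iter i g0 (g1 x) < c.
  by move=> xI ia; rewrite -OR ?(ltnW ia) //; have [_ H] := HR x xI; exact: H.
have pc : 0 <= p < c by move: pI; lra.
have qc : c < q <= 1 by move: qI; lra.
have IL := iter_left_onto pc OLI.
have IR := iter_right_onto qc ORI.
have hlt x y : x < y -> p + (q - p) * x < p + (q - p) * y by move=> xy; rewrite ltrD2l ltr_pM2l.
have hle x y : x <= y -> p + (q - p) * x <= p + (q - p) * y by move=> xy; rewrite lerD2l ler_pM2l.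
have h0 : p + (q - p) * 0 = p by ring.
have h1 : p + (q - p) * 1 = q by ring.
have RL t : 0 <= t < lc G -> iter a g1 (g0 (p + (q - p) * t)) = p + (q - p) * left_branch al G t.
  move=> tI; have xI : p <= p + (q - p) * t < c.
    by rewrite -[leLHS]h0 -hc; have /andP[t0 t1] := tI; rewrite hle // hlt.
  have tD : ldom G t.
    by split; [rewrite /= in_itv /=|move=> /= E]; move: tI c1' ; rewrite ?E; lra.
  have [n [Fn E]] := ret t tD.
  have [Fa _] := HL _ xI.
  rewrite (first_return_unique Fn Fa) OL // in E.
  by rewrite E lmap_left //; case/andP: tI.
have RR t : lc G < t <= 1 -> iter b g0 (g1 (p + (q - p) * t)) = p + (q - p) * right_branch al G t.
  move=> tI; have xI : c < p + (q - p) * t <= q.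
    by rewrite -[leRHS]h1 -hc; have /andP[t0 t1] := tI; rewrite hle // hlt.
  have tD : ldom G t.
    by split; [rewrite /= in_itv /=|move=> /= E]; move: tI c0' ; rewrite ?E; lra.
  have [n [Fn E]] := ret t tD.
  have [Fa _] := HR _ xI.
  rewrite (first_return_unique Fn Fa) OR // in E.
  by rewrite E lmap_right //; case/andP: tI.
split=> //.
- by rewrite p0; case/andP: pI.
- by rewrite q1 andbT; case/andP: qI.
- move=> t tI; have [tc|tc] := ltP t (lc G); first by apply: RL; move: tI tc; lra.
  have -> : t = lc G by move: tI tc; lra.
  apply: (@incr_onto_end_right _ 0 (lc G) (fun t => iter a g1 (g0 (p + (q - p) * t)))
    (fun t => p + (q - p) * left_branch al G t)) => //.
    apply: (@incr_onto_comp _ 0 (lc G) (fun t => p + (q - p) * t) (fun x => iter a g1 (g0 x))).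
    + exact: ltW.
    + exact: incr_onto_affine.
    + by rewrite h0 hc; case: (IL a (leqnn _)).
  apply: (@incr_onto_comp _ 0 (lc G) (left_branch al G) (fun x => p + (q - p) * x)).
  + exact: ltW.
  + exact: lp_g0 LPG.
  + exact: incr_onto_affine.
- move=> t tI; have [tc|tc] := ltP (lc G) t; first by apply: RR; move: tI tc; lra.
  have -> : t = lc G by move: tI tc; lra.
  apply: (@incr_onto_end_left _ (lc G) 1 (fun t => iter b g0 (g1 (p + (q - p) * t)))
    (fun t => p + (q - p) * right_branch al G t)) => //.
    apply: (@incr_onto_comp _ (lc G) 1 (fun t => p + (q - p) * t) (fun x => iter b g0 (g1 x))).
    + exact: ltW.
    + exact: incr_onto_affine.
    + by rewrite h1 hc; case: (IR b (leqnn _)).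
  apply: (@incr_onto_comp _ (lc G) 1 (right_branch al G) (fun x => p + (q - p) * x)).
  + exact: ltW.
  + exact: lp_g1 LPG.
  + exact: incr_onto_affine.
- move=> x i xI ia; have [xc|xc] := ltP x c.
    by have /andP[-> /ltW ->] := OLI x i ltac:(move: xI xc; lra) ia.
  have -> : x = c by move: xI xc; lra.
  by have [_] := IL i (ltnW ia); apply.
- move=> x i xI ia; have [xc|xc] := ltP c x.
    by have /andP[/ltW -> ->] := ORI x i ltac:(move: xI xc; lra) ia.
  have -> : x = c by move: xI xc; lra.
  by have [_] := IR i (ltnW ia); apply.
Qed.

End FromDefinition.

Lemma renorm_orbitsP c (g0 g1 : R -> R) a b p q c' g0' g1' :
  lorenz_pair c' g0' g1' -> renormalizes c g0 g1 a b p q c' g0' g1' ->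
  renorm_orbits c g0 g1 a b p q.
Proof.
move=> LP RN; have [a0 b0 pI qI hc L Rt oL oR] := RN.
have /andP[c0 c1] := lp_c LP; have /andP[cm1 cm2] := lp_cm LP; have /andP[cp1 cp2] := lp_cp LP.
have qp0 : 0 < q - p by move: pI qI; clear; lra.
have h0 : p + (q - p) * 0 = p by ring.
have h1 : p + (q - p) * 1 = q by ring.
have hlt x y : x < y -> p + (q - p) * x < p + (q - p) * y by move=> xy; rewrite ltrD2l ltr_pM2l.
have hle x y : x <= y -> p + (q - p) * x <= p + (q - p) * y by move=> xy; rewrite lerD2l ler_pM2l.
have Lc := L c' ltac:(move: c0; clear; lra).
have Rc := Rt c' ltac:(move: c1; clear; lra).
have Lp := L 0 ltac:(move: c0; clear; lra).
have Rq := Rt 1 ltac:(move: c1; clear; lra).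
rewrite hc in Lc Rc; rewrite h0 (lp_g00 LP) h0 in Lp; rewrite h1 (lp_g11 LP) h1 in Rq.
split=> //.
- by rewrite Lc -{1}hc -[leRHS]h1 hlt // hle.
- by rewrite Rc -{1}hc -[leLHS]h0 hlt // hle.
Qed.

End Renormalizes.

Section CrossExpandingRenorm.
Context {R : realType}.
Implicit Types (c p q : R).

Lemma cross_expanding_iter (lo hi lo' hi' : R) (k0 k1 : R -> R) n :
  lo < hi -> incr_on lo hi k0 -> cross_expanding lo hi k0 ->
  incr_on lo' hi' k1 -> cross_expanding lo' hi' k1 ->
  (forall x i, lo <= x <= hi -> (i < n)%N -> lo' <= iter i k1 (k0 x) <= hi') ->
  incr_on lo hi (fun x => iter n k1 (k0 x)) /\ cross_expanding lo hi (fun x => iter n k1 (k0 x)).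
Proof.
move=> lh i0 e0 i1 e1; elim: n => [|n IH] H; first by split.
have [ii ee] := IH (fun x i xI ia => H x i xI (leqW ia)).
split.
  exact: (@incr_on_comp _ lo hi lo' hi' (fun x => iter n k1 (k0 x)) k1 ii (fun x xI => H x n xI (leqnn _)) i1).
exact: (@cross_expanding_comp _ lo hi lo' hi' (fun x => iter n k1 (k0 x)) k1 ii (fun x xI => H x n xI (leqnn _)) ee e1).
Qed.

Lemma cross_expanding_conj (lo hi p s : R) (k g : R -> R) : 0 < s ->
  cross_expanding (p + s * lo) (p + s * hi) k -> incr_on lo hi g ->
  (forall t, lo <= t <= hi -> k (p + s * t) = p + s * g t) -> cross_expanding lo hi g.
Proof.
move=> s0 ke gi E x0 x1 x2 x3 h0 h1 h2 h3 h4.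
have h01 : g x0 < g x1 by apply: gi => //; move: h2 h3 h4; clear; lra.
have h12 : g x1 < g x2 by apply: gi => //; move: h0 h1 h3 h4; clear; lra.
have h23 : g x2 < g x3 by apply: gi => //; move: h0 h1 h2; clear; lra.
rewrite -(@cross_affine _ p s x0 x1 x2 x3) // -(@cross_affine _ p s (g x0)) //.
rewrite -!E; try by move: h0 h1 h2 h3 h4; clear; lra.
apply: ke; rewrite ?lerD2l ?ltrD2l ?ler_pM2l ?ltr_pM2l //.
Qed.

(** Expansion of cross-ratios passes to restrictions, compositions and affine conjugates, so no
    derivative of a renormalization is ever taken. *)
Lemma renormalizes_cross_expanding c (g0 g1 : R -> R) a b p q c' g0' g1' :
  lorenz_pair c g0 g1 -> lorenz_pair c' g0' g1' ->
  renormalizes c g0 g1 a b p q c' g0' g1' ->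
  cross_expanding 0 c g0 -> cross_expanding c 1 g1 ->
  cross_expanding 0 c' g0' /\ cross_expanding c' 1 g1'.
Proof.
move=> LP LP' [a0 b0 pI qI hc L Rt oL oR] E0 E1.
have /andP[c0 c1] := lp_c LP; have /andP[c0' c1'] := lp_c LP'.
have qp0 : 0 < q - p by move: pI qI; clear; lra.
have sub (lo hi lo' hi' : R) k : lo <= lo' -> hi' <= hi -> cross_expanding lo hi k -> cross_expanding lo' hi' k.
  by move=> h h' ke x0 x1 x2 x3 *; apply: ke => //; [exact: le_trans h _|exact: le_trans h'].
split.
- apply: (@cross_expanding_conj 0 c' p (q - p) (fun x => iter a g1 (g0 x))) => //.
  + have -> : p + (q - p) * 0 = p by ring.
    rewrite hc.
    have pc : p < c by case/andP: pI.
    have i0 : incr_on p c g0 by apply: incr_on_sub (lp_g0 LP).1 => //; move: pI; clear; lra.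
    have e0 : cross_expanding p c g0 by apply: sub E0 => //; move: pI; clear; lra.
    apply: (cross_expanding_iter pc i0 e0 (lp_g1 LP).1 E1 _).2 => x i xI ia.
    by have /andP[/ltW -> ->] := oL x i xI ia.
  + exact: (lp_g0 LP').1.
- apply: (@cross_expanding_conj c' 1 p (q - p) (fun x => iter b g0 (g1 x))) => //.
  + have -> : p + (q - p) * 1 = q by ring.
    rewrite hc.
    have cq : c < q by case/andP: qI.
    have i0 : incr_on c q g1 by apply: incr_on_sub (lp_g1 LP).1 => //; move: qI; clear; lra.
    have e0 : cross_expanding c q g1 by apply: sub E1 => //; move: qI; clear; lra.
    apply: (cross_expanding_iter cq i0 e0 (lp_g0 LP).1 E0 _).2 => x i xI ia.
    by have /andP[-> /ltW ->] := oR x i xI ia.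
  + exact: (lp_g1 LP').1.
Qed.

End CrossExpandingRenorm.

(** * Koebe space and transfer of slopes through inverse branches *)

Section BranchSlopes.
Context {R : realType}.

(** Slopes of e lie within a factor K, up and down, of its mean slope e 1 - e 0. Dividing by e
    therefore widens a range of ratio K^2 to K^4. *)
Lemma inverse_branch_slope (K M th u v : R) e : inverse_branch K e -> 1 <= K -> 0 <= th -> 0 < M ->
  0 <= u -> u <= v -> v <= 1 -> M * th <= e v - e u <= K ^+ 2 * M * th ->
  M / (K * (e 1 - e 0)) * th <= v - u <= K ^+ 4 * (M / (K * (e 1 - e 0))) * th.
Proof.
move=> [ei em ec ed] K1 th0 M0 u0 uv v1.
have s0 : 0 < e 1 - e 0 by rewrite subr_gt0; apply: ei.
have K0 : 0 < K by move: K1; clear; lra.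
have KN : K != 0 by rewrite gt_eqF.
have sN : e 1 - e 0 != 0 by rewrite gt_eqF.
move: uv; rewrite le_eqVlt => /orP[/eqP ->|uv] /andP[h1 h2].
  rewrite subrr in h1 h2 *.
  have th00 : th = 0.
    apply/eqP; rewrite eq_le th0 andbT -(pmulr_rle0 _ M0) //.
  by rewrite th00 !mulr0 ?subrr ?lexx.
have d1 := ed u v 0 1 u0 uv v1 (lexx _) ltr01 (lexx _).
have d2 := ed 0 1 u v (lexx _) ltr01 (lexx _) u0 uv v1.
rewrite subr0 mulr1 in d1 d2.
have Ks : 0 < K * (e 1 - e 0) by rewrite mulr_gt0.
apply/andP; split.
  rewrite mulrAC ler_pdivrMr //; apply: (le_trans h1); apply: (le_trans d1).
  by rewrite mulrA mulrC.
have -> : K ^+ 4 * (M / (K * (e 1 - e 0))) * th = K * (K ^+ 2 * M * th) / (e 1 - e 0).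
  by field; apply/andP.
rewrite ler_pdivlMr // mulrC; apply: (le_trans d2).
by rewrite ler_pM2l.
Qed.

End BranchSlopes.

Section Koebe.
Context {R : realType}.
Variables (al sg be : R) (b0 : nat) (c m m' : R) (g0 g1 : R -> R) (a b : nat) (p q : R).
Hypothesis sg01 : 0 < sg < 1.
Hypothesis LG : large_b0 al sg be b0.
Hypothesis OM : Omega al sg be b0 (a, b).
Hypothesis PL : power_lorenz al (distortion b0) c m m' g0 g1.
Hypothesis RO : renorm_orbits c g0 g1 a b p q.
Hypothesis LS : level_small al (distortion b0) c g1 b q.
Hypotheses (eU : ln (1 - c) <= ln_eps_max al sg b0) (eL : ln_eps_min al b0 <= ln (1 - c)).
Hypotheses (E0 : cross_expanding 0 c g0) (E1 : cross_expanding c 1 g1).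

(** The Koebe ratio: k^2 <= exp (16 lam / ep) <= exp delta by [left_koebe_small]. The factor 8 fits
    q - p <= 2 lam and a space of at least ep / 4 to the right of q. *)
Let k := 1 + 8 * ((c - p) / (1 - c)).

Let numbers : [/\ k ^+ 2 <= expR (delta b0), 0 < 1 - c <= 1 / 8,
  13 / 20 <= p < c, c < q & q <= c + (1 - c) / 2] /\
  [/\ q - p <= 2 * (c - p), g1 c < 1 / 8, 1 - g0 c <= (1 - c) / 6,
  k * (1 - c) = 1 - c + 8 * (c - p) & 8 * (c - p) <= k - 1].
Proof.
have e0 : 0 < 1 - c by rewrite subr_gt0; exact: pl_c1 PL.
have e8 : 1 - c <= 1 / 8 := ep_le8 PL RO LS.
have lam0 : 0 < c - p by rewrite subr_gt0; case/andP: (ro_p RO).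
have mu0 : 0 <= (c - p) / (1 - c) by rewrite divr_ge0 // ltW.
have Ek : k * (1 - c) = 1 - c + 8 * (c - p) by rewrite /k mulrDl mul1r -mulrA divfK // gt_eqF.
split; split.
- have ke : k <= expR (8 * ((c - p) / (1 - c))) by exact: expR_ge1Dx.
  apply: (@le_trans _ _ (expR (8 * ((c - p) / (1 - c))) ^+ 2)).
    by apply: lerXn2r; rewrite ?nnegrE ?expR_ge0 //; rewrite /k; move: mu0; lra.
  rewrite -expRM_natl ler_expR mulrA mulrA ler_pdivrMr //.
  have := left_koebe_small LG sg01 OM PL RO LS eU eL; lra.
- by rewrite e0 e8.
- by rewrite (return_left_ge PL RO LS) -subr_gt0.
- by case/andP: (ro_q RO).
- have /andP[_ h] := return_radius_ratio PL RO LS.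
  by move: h; rewrite ler_pdivrMr // => h; move: h; lra.
- exact: right_le_left LG sg01 OM PL RO LS eL.
- have := g1q_le8 PL RO LS; have : g1 c < g1 q.
    by apply: (pl_g1 PL).1; have := ro_q RO; lra.
  lra.
- exact: cm_close PL RO LS.
- exact: Ek.
- rewrite /k addrAC subrr add0r ler_pM2l // ler_pdivlMr // ler_piMr //; [exact: ltW|lra].
Qed.

(** The interval [1 / 4, 1] contains [p, q] with room and is invariant under the inverse of g1,
    which is defined there because g1 c < 1 / 8. *)
Lemma left_inverse_branch e j : inverse_branch (expR (delta b0)) e ->
  inverse_branch (expR (delta b0)) (fun t => e (iter j (inv_on c 1 g1) (p + (q - p) * t))).
Proof.
move=> eB; have [[kK e8 pI qc q2] [C2 cp8 _ kE k8]] := numbers.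
have g1o := pl_g1 PL; have g11 := pl_g11 PL.
have ii := inv_on_incr g1o; have cc := inv_on_cross g1o E1; rewrite g11 in ii cc.
apply: (@inverse_branch_comp _ _ k (1 / 4) 1) => //.
- lra.
- lra.
- lra.
- have : 1 / 2 * (1 - c) * (k - 1) <= (1 - q) * (k - 1) by apply: ler_wpM2r; lra.
  lra.
- have : (p - 1 / 4) * (8 * (c - p)) <= (p - 1 / 4) * (k - 1) by apply: ler_wpM2l; lra.
  have : 2 / 5 * (c - p) <= (p - 1 / 4) * (c - p) by apply: ler_wpM2r; lra.
  lra.
- by apply: incr_on_sub ii => //; lra.
- move=> x xI; have [] := inv_onP (y := x) g1o; first by rewrite g11; lra.
  by move=> h _; lra.
- by apply: cross_contracting_sub cc => //; lra.
Qed.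

(** The inverse of g0 stops at g0 c, within ep / 6 of 1, while q <= c + ep / 2; the end point c + 3
    ep / 4 fits between them and leaves space ep / 4. *)
Lemma right_inverse_branch e j : inverse_branch (expR (delta b0)) e ->
  inverse_branch (expR (delta b0)) (fun t => e (iter j (inv_on 0 c g0) (p + (q - p) * t))).
Proof.
move=> eB; have [[kK e8 pI qc q2] [C2 _ cm6 kE k8]] := numbers.
have g0o := pl_g0 PL; have g00 := pl_g00 PL; have cm1 := pl_cm_le PL.
have ii := inv_on_incr g0o; have cc := inv_on_cross g0o E0; rewrite g00 in ii cc.
apply: (@inverse_branch_comp _ _ k 0 (c + 3 / 4 * (1 - c))) => //.
- lra.
- lra.
- lra.
- lra.
- have : 1 / 4 * (1 - c) * (k - 1) <= (c + 3 / 4 * (1 - c) - q) * (k - 1) by apply: ler_wpM2r; lra.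
  lra.
- have : p * (8 * (c - p)) <= p * (k - 1) by apply: ler_wpM2l; lra.
  have : 2 / 5 * (c - p) <= p * (c - p) by apply: ler_wpM2r; lra.
  lra.
- by apply: incr_on_sub ii => //; lra.
- move=> x xI; have [] := inv_onP (y := x) g0o; first by rewrite g00; lra.
  by move=> h _; lra.
- by apply: cross_contracting_sub cc => //; lra.
Qed.

End Koebe.

(** * The induction over levels *)

Section ZoomedSlopes.
Context {R : realType}.
Variables (K al mu P s c c0 : R) (e g G : R -> R).
Hypotheses (eB : inverse_branch K e) (K1 : 1 <= K) (al0 : 0 < al) (mu0 : 0 < mu) (s0 : 0 < s).
Hypothesis zoom_c : P + s * c = c0.

Let e10 : 0 < e 1 - e 0.
Proof. by rewrite subr_gt0; apply: (ib_incr eB). Qed.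

(** The zoom fixes the critical point, so (c0 - x) / c0 becomes a multiple of (c - y) / c, and the
    al-th power of that multiple goes into the new slope constant. *)
Lemma zoomed_left_slopes : 0 <= P -> 0 < c -> incr_on 0 c g -> g 0 = 0 -> g c <= 1 ->
  (forall y, 0 <= y <= c -> e (g y) = G (P + s * y)) -> left_power_slopes al (K ^+ 2) c0 mu G ->
  left_power_slopes al (K ^+ 4) c (mu * (s * c / c0) `^ al / (K * (e 1 - e 0))) g.
Proof.
move=> P0 c_gt0 gi g00 gc1 eG PS x y x0 xy yc.
have k0 : 0 < s * c / c0 by rewrite divr_gt0 -?zoom_c ?ltr_wpDl ?mulr_gt0.
have c00 : 0 < c0 by rewrite -zoom_c ltr_wpDl ?mulr_gt0.
have xc := le_trans xy yc; have y0 := le_trans x0 xy.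
have xI : 0 <= x <= c by rewrite x0 xc.
have yI : 0 <= y <= c by rewrite yc y0.
have tE z : (c0 - (P + s * z)) / c0 = s * c / c0 * ((c - z) / c).
  by rewrite -{1}zoom_c; field; rewrite !gt_eqF.
have t0 z : 0 <= z <= c -> 0 <= (c - z) / c by move=> /andP[_ zc]; rewrite divr_ge0 ?subr_ge0 // ltW.
have /andP[h1 h2] := PS (P + s * x) (P + s * y) ltac:(by rewrite addr_ge0 // mulr_ge0 // ltW)
  ltac:(by rewrite lerD2l ler_pM2l) ltac:(by rewrite -zoom_c lerD2l ler_pM2l).
rewrite !tE (powRM _ (ltW k0) (t0 x xI)) (powRM _ (ltW k0) (t0 y yI)) -mulrBr -!eG // in h1 h2.
apply: (inverse_branch_slope eB) => //.
- by rewrite subr_ge0; apply: powR_le; rewrite ?(ltW al0) ?t0 // ler_pM2r ?invr_gt0 // lerD2l lerN2.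
- by rewrite mulr_gt0 ?powR_gt0.
- by rewrite -[leLHS]g00; apply: (incr_on_le gi).
- exact: (incr_on_le gi).
- by apply: le_trans gc1; apply: (incr_on_le gi).
- by apply/andP; split; [rewrite -mulrA|move: h2; rewrite !mulrA].
Qed.

Lemma zoomed_right_slopes : P + s <= 1 -> c < 1 -> incr_on c 1 g -> g 1 = 1 -> 0 <= g c ->
  (forall y, c <= y <= 1 -> e (g y) = G (P + s * y)) -> right_power_slopes al (K ^+ 2) c0 mu G ->
  right_power_slopes al (K ^+ 4) c (mu * (s * (1 - c) / (1 - c0)) `^ al / (K * (e 1 - e 0))) g.
Proof.
move=> P1 c_lt1 gi g11 gc0 eG PS x y x0 xy yc.
have e0 : 0 < 1 - c by rewrite subr_gt0.
have e00 : 0 < 1 - c0.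
  by rewrite subr_gt0 -zoom_c (lt_le_trans _ P1) // ltrD2l gtr_pMr.
have k0 : 0 < s * (1 - c) / (1 - c0) by rewrite divr_gt0 ?mulr_gt0.
have x1 := le_trans xy yc; have y0 := le_trans x0 xy.
have xI : c <= x <= 1 by rewrite x0 x1.
have yI : c <= y <= 1 by rewrite yc y0.
have tE z : (P + s * z - c0) / (1 - c0) = s * (1 - c) / (1 - c0) * ((z - c) / (1 - c)).
  by rewrite -{1}zoom_c; field; rewrite !gt_eqF.
have t0 z : c <= z <= 1 -> 0 <= (z - c) / (1 - c) by move=> /andP[zc _]; rewrite divr_ge0 ?subr_ge0 // ltW.
have /andP[h1 h2] := PS (P + s * x) (P + s * y) ltac:(by rewrite -zoom_c lerD2l ler_pM2l)
  ltac:(by rewrite lerD2l ler_pM2l) ltac:(by apply: le_trans P1; rewrite lerD2l ger_pMr).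
rewrite !tE (powRM _ (ltW k0) (t0 x xI)) (powRM _ (ltW k0) (t0 y yI)) -mulrBr -!eG // in h1 h2.
apply: (inverse_branch_slope eB) => //.
- by rewrite subr_ge0; apply: powR_le; rewrite ?(ltW al0) ?t0 // ler_pM2r ?invr_gt0 // lerD2r.
- by rewrite mulr_gt0 ?powR_gt0.
- by apply: (le_trans gc0); apply: (incr_on_le gi).
- exact: (incr_on_le gi).
- by rewrite -[leRHS]g11; apply: (incr_on_le gi).
- by apply/andP; split; [rewrite -mulrA|move: h2; rewrite !mulrA].
Qed.

End ZoomedSlopes.

Section Tower.
Context {R : realType}.
Variables (al sg be : R) (b0 : nat) (c : nat -> R) (g0 g1 : nat -> R -> R) (a b : nat -> nat)
  (p q : nat -> R) (f : R -> R) (mu nu : R).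
Hypotheses (al1 : 1 < al) (sg01 : 0 < sg < 1) (be0 : 0 < be < (sg / al) ^+ 2).
Hypothesis LG : large_b0 al sg be b0.
Hypothesis LP : forall n, lorenz_pair (c n) (g0 n) (g1 n).
Hypothesis RN : forall n, renormalizes (c n) (g0 n) (g1 n) (a n) (b n) (p n) (q n)
  (c n.+1) (g0 n.+1) (g1 n.+1).
Hypothesis OM : forall n, Omega al sg be b0 (a n, b n).
Hypotheses (E0 : cross_expanding 0 (c 0%N) (g0 0%N)) (E1 : cross_expanding (c 0%N) 1 (g1 0%N)).
Hypotheses (mu0 : 0 < mu) (PS0 : left_power_slopes al (expR (2 * delta b0)) (c 0%N) mu (g0 0%N)).
Hypotheses (nu0 : 0 < nu) (PS1 : right_power_slopes al (expR (2 * delta b0)) (c 0%N) nu (g1 0%N)).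
Hypothesis fl : forall x, 0 <= x < c 0%N -> f x = g0 0%N x.
Hypothesis fr : forall x, c 0%N < x <= 1 -> f x = g1 0%N x.
Hypotheses (eps_max0 : ln (1 - c 0%N) <= ln_eps_max al sg b0)
  (eps_min0 : ln_eps_min al b0 <= ln (1 - c 0%N)).

Fixpoint return_times n : nat * nat :=
  if n is m.+1 then
    let: (l, r) := return_times m in ((l + a m * r)%N, (r + b m * l)%N)
  else (1%N, 1%N).

Definition left_time n := (return_times n).1.
Definition right_time n := (return_times n).2.

Fixpoint return_ends n : R * R :=
  if n is m.+1 then
    let: (x, y) := return_ends m in (x + (y - x) * p m, x + (y - x) * q m)
  else (0, 1).

Definition zoom n (t : R) : R := (return_ends n).1 + ((return_ends n).2 - (return_ends n).1) * t.

Lemma left_timeS n : left_time n.+1 = (left_time n + a n * right_time n)%N.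
Proof. by rewrite /left_time /right_time /=; case: return_times. Qed.

Lemma right_timeS n : right_time n.+1 = (right_time n + b n * left_time n)%N.
Proof. by rewrite /left_time /right_time /=; case: return_times. Qed.

Lemma zoomS n t : zoom n.+1 t = zoom n (p n + (q n - p n) * t).
Proof. by rewrite /zoom /=; case: return_ends => x y /=; ring. Qed.

Lemma zoom0 t : zoom 0 t = t.
Proof. by rewrite /zoom /=; ring. Qed.

Lemma left_time_gt0 n : (0 < left_time n)%N.
Proof. by elim: n => // n IH; rewrite left_timeS addn_gt0 IH. Qed.

Lemma right_time_gt0 n : (0 < right_time n)%N.
Proof. by elim: n => // n IH; rewrite right_timeS addn_gt0 IH. Qed.

Let pqn n : 0 < p n < c n /\ c n < q n < 1.
Proof. by split; [exact: rn_p (RN n)|exact: rn_q (RN n)]. Qed.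

Lemma zoom_pos n : 0 < (return_ends n).2 - (return_ends n).1.
Proof.
elim: n => [|n IH] /=; first by rewrite subr0.
move: IH; case: return_ends => x y /= IH.
rewrite (_ : _ - _ = (y - x) * (q n - p n)); last ring.
by apply: mulr_gt0 => //; have := pqn n; lra.
Qed.

Lemma zoom_lt n x y : (zoom n x < zoom n y) = (x < y).
Proof. by rewrite /zoom ltrD2l ltr_pM2l // zoom_pos. Qed.

Lemma zoom_le n x y : (zoom n x <= zoom n y) = (x <= y).
Proof. by rewrite /zoom lerD2l ler_pM2l // zoom_pos. Qed.

Lemma zoom_crit n : zoom n (c n) = c 0%N.
Proof. by elim: n => [|n IH]; rewrite ?zoom0 // zoomS (rn_c (RN n)). Qed.

Lemma zoom_range n x : 0 <= x <= 1 -> 0 <= zoom n x <= 1.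
Proof.
elim: n x => [|n IH] x xI; rewrite ?zoom0 // zoomS; apply: IH.
have := pqn n => -[h1 h2].
have qp : 0 <= q n - p n by lra.
have x0 : 0 <= (q n - p n) * x by apply: mulr_ge0 => //; lra.
have x1 : (q n - p n) * x <= q n - p n by apply: ler_piMr => //; lra.
lra.
Qed.

(** The two avoidance fields are needed because [forward_orbit] stops at the discontinuity: the
    orbits of the critical values must not stop before the return. *)
Record tower_level n : Prop := TowerLevel {
  tl_left : forall i, (i < left_time n)%N -> exists2 e, inverse_branch (expR (delta b0)) e &
    forall y, 0 <= y <= c n -> e (g0 n y) = iter i f (g0 0%N (zoom n y));
  tl_right : forall i, (i < right_time n)%N -> exists2 e, inverse_branch (expR (delta b0)) e &
    forall y, c n <= y <= 1 -> e (g1 n y) = iter i f (g1 0%N (zoom n y));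
  tl_left_return : forall y, 0 <= y <= c n ->
    iter (left_time n).-1 f (g0 0%N (zoom n y)) = zoom n (g0 n y);
  tl_right_return : forall y, c n <= y <= 1 ->
    iter (right_time n).-1 f (g1 0%N (zoom n y)) = zoom n (g1 n y);
  tl_left_avoid : forall i y, (i < (left_time n).-1)%N -> 0 <= y <= c n ->
    iter i f (g0 0%N (zoom n y)) <> c 0%N;
  tl_right_avoid : forall i y, (i < (right_time n).-1)%N -> c n <= y <= 1 ->
    iter i f (g1 0%N (zoom n y)) <> c 0%N }.

Lemma delta_ge0 : 0 <= delta b0 :> R.
Proof. exact: sqr_ge0. Qed.

Lemma tower_level0 : tower_level 0.
Proof.
have K1 : 1 <= expR (delta b0) :> R by rewrite -expR0 ler_expR; exact: delta_ge0.
have idb : inverse_branch (expR (delta b0)) (fun x : R => x).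
  split=> // x y z w *.
  by rewrite mulrC; apply: ler_peMl => //; apply: mulr_ge0; lra.
by split=> // [[|i] // _|[|i] // _|y _|y _]; rewrite ?zoom0 //; exists (fun x => x) => // y _; rewrite zoom0.
Qed.

Lemma tower_levelS n : tower_level n ->
  (forall e j, inverse_branch (expR (delta b0)) e -> inverse_branch (expR (delta b0))
     (fun t => e (iter j (inv_on (c n) 1 (g1 n)) (p n + (q n - p n) * t)))) ->
  (forall e j, inverse_branch (expR (delta b0)) e -> inverse_branch (expR (delta b0))
     (fun t => e (iter j (inv_on 0 (c n) (g0 n)) (p n + (q n - p n) * t)))) ->
  tower_level n.+1.
Proof.
move=> [HA HB HA1 HB1 HA3 HB3] CL CR.
have [a0 bb0 pI qI hc L Rt oL oR] := RN n.
have [cI g0o g1o g00 g11 cmI cpI] := LP n.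
have [cI' _ _ g00' g11' _ _] := LP n.+1.
have l0 := left_time_gt0 n; have r0 := right_time_gt0 n.
pose h' t := p n + (q n - p n) * t.
have qp0 : 0 < q n - p n by lra.
have h'lt x y : x <= y -> h' x <= h' y by move=> xy; rewrite /h' lerD2l ler_pM2l.
have h'0 : h' 0 = p n by rewrite /h'; ring.
have h'1 : h' 1 = q n by rewrite /h'; ring.
have DW1 z : c n < z <= 1 -> c n <= z <= 1 by lra.
have DW0 z : 0 <= z < c n -> 0 <= z <= c n by lra.
have zc z : (zoom n z < c 0%N) = (z < c n) by rewrite -(zoom_crit n) zoom_lt.
have cz z : (c 0%N < zoom n z) = (c n < z) by rewrite -(zoom_crit n) zoom_lt.
have fB1 z : c n < z <= 1 -> f (zoom n z) = g1 0%N (zoom n z).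
  by move=> zI; apply: fr; rewrite cz; have := @zoom_range n z; lra.
have fB0 z : 0 <= z < c n -> f (zoom n z) = g0 0%N (zoom n z).
  by move=> zI; apply: fl; rewrite zc; have := @zoom_range n z; lra.
have orb1 y : p n <= y <= c n -> 0 <= y <= c n /\
    forall s, (s < a n)%N -> c n < iter s (g1 n) (g0 n y) <= 1.
  by move=> yI; split; [lra|move=> s sa; exact: oL].
have orb0 y : c n <= y <= q n -> c n <= y <= 1 /\
    forall s, (s < b n)%N -> 0 <= iter s (g0 n) (g1 n y) < c n.
  by move=> yI; split; [lra|move=> s sa; exact: oR].
have J1 z : c n <= z <= 1 -> inv_on (c n) 1 (g1 n) (g1 n z) = z by exact: inv_onK.
have J0 z : 0 <= z <= c n -> inv_on 0 (c n) (g0 n) (g0 n z) = z by exact: inv_onK.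
have conj1 y : 0 <= y <= c n.+1 -> p n <= h' y <= c n /\ iter (a n) (g1 n) (g0 n (h' y)) = h' (g0 n.+1 y).
  move=> /andP[y0 y1]; split; last by apply: L; rewrite y0.
  by apply/andP; split; [rewrite -h'0 h'lt|rewrite -hc h'lt].
have conj0 y : c n.+1 <= y <= 1 -> c n <= h' y <= q n /\ iter (b n) (g0 n) (g1 n (h' y)) = h' (g1 n.+1 y).
  move=> /andP[y0 y1]; split; last by apply: Rt; rewrite y0.
  by apply/andP; split; [rewrite -hc h'lt|rewrite -h'1 h'lt].
have CL' e k : inverse_branch (expR (delta b0)) e -> (k <= a n)%N ->
  inverse_branch (expR (delta b0)) (fun t => e (iter k (inv_on (c n) 1 (g1 n)) (h' t))) by move=> ? _; exact: CL.
have CR' e k : inverse_branch (expR (delta b0)) e -> (k <= b n)%N ->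
  inverse_branch (expR (delta b0)) (fun t => e (iter k (inv_on 0 (c n) (g0 n)) (h' t))) by move=> ? _; exact: CR.
have zne1 z : c n < z <= 1 -> zoom n z <> c 0%N.
  by move=> /andP[zc1 _] E; move: (cz z); rewrite E zc1 ltxx.
have zne0 z : 0 <= z < c n -> zoom n z <> c 0%N.
  by move=> /andP[_ zc1] E; move: (zc z); rewrite E zc1 ltxx.
split.
- move=> i; rewrite left_timeS => il.
  have [e eB He] := tower_branch l0 r0 a0 HA HA1 HB HB1 DW1 fB1 orb1 J1 CL' conj1 il.
  by exists e => // y yI; rewrite zoomS; exact: He.
- move=> i; rewrite right_timeS => il.
  have [e eB He] := tower_branch r0 l0 bb0 HB HB1 HA HA1 DW0 fB0 orb0 J0 CR' conj0 il.
  by exists e => // y yI; rewrite zoomS; exact: He.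
- move=> y yI; rewrite left_timeS !zoomS.
  exact: (tower_return l0 r0 a0 HA1 HB1 DW1 fB1 orb1 conj1 yI).
- move=> y yI; rewrite right_timeS !zoomS.
  exact: (tower_return r0 l0 bb0 HB1 HA1 DW0 fB0 orb0 conj0 yI).
- move=> i y; rewrite left_timeS zoomS => il yI.
  exact: (tower_avoid l0 r0 a0 HA1 HB1 DW1 fB1 orb1 conj1 HA3 HB3 zne1 il yI).
- move=> i y; rewrite right_timeS zoomS => il yI.
  exact: (tower_avoid r0 l0 bb0 HB1 HA1 DW0 fB0 orb0 conj0 HB3 HA3 zne0 il yI).
Qed.

(** At time 0 an inverse branch satisfies e (g0 n y) = g0 0 (zoom n y): every level is the zoomed
    initial power law seen through one map of distortion exp delta. *)
Lemma tower_power_lorenz n : tower_level n -> ln (1 - c n) <= ln_eps_max al sg b0 ->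
  exists m m', power_lorenz al (distortion b0) (c n) m m' (g0 n) (g1 n).
Proof.
move=> TL eU.
have [/andP[c_gt0 c_lt1] g0o g1o g00 g11 /andP[cm_gt cm_le] /andP[cp_ge cp_lt]] := LP n.
have [e eB He] := tl_left TL (left_time_gt0 n).
have [e' eB' He'] := tl_right TL (right_time_gt0 n).
have al0 : 0 < al by apply: lt_trans al1.
have K1 : 1 <= expR (delta b0) :> R by rewrite -expR0 ler_expR; exact: delta_ge0.
have K2 : expR (2 * delta b0) = expR (delta b0) ^+ 2 :> R by rewrite expRM_natl.
have K4 : distortion b0 = expR (delta b0) ^+ 4 :> R by rewrite /distortion expRM_natl.
have ends : 0 <= (return_ends n).1 /\
    (return_ends n).1 + ((return_ends n).2 - (return_ends n).1) <= 1.
  have := @zoom_range n 0; have := @zoom_range n 1; rewrite /zoom mulr0 mulr1 addr0 !lexx ler01.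
  by move=> /(_ isT)/andP[_ h1] /(_ isT)/andP[h0 _].
have PS0' := PS0; have PS1' := PS1; rewrite K2 in PS0' PS1'.
have L := zoomed_left_slopes eB K1 al0 mu0 (zoom_pos n) (zoom_crit n) ends.1 c_gt0 g0o.1 g00 cm_le
  (fun y yI => He y yI) PS0'.
have Rt := zoomed_right_slopes eB' K1 al0 nu0 (zoom_pos n) (zoom_crit n) ends.2 c_lt1 g1o.1 g11 cp_ge
  (fun y yI => He' y yI) PS1'.
rewrite -K4 in L Rt; do 2 eexists; split=> //; [|exact: lg_D LG| |exact: L|exact: Rt].
  by rewrite K4; exact: exprn_ege1.
have : 1 - c n <= 4^-1 `^ al / 2.
  by apply: le_trans (lg_ep LG); rewrite -[leLHS]lnK ?posrE ?subr_gt0 // ler_expR.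
by have : (4^-1 : R) `^ al <= 4^-1 by [apply: powR_le_id; have := al1; lra]; lra.
Qed.

Lemma tower_cross_expanding n : cross_expanding 0 (c n) (g0 n) /\ cross_expanding (c n) 1 (g1 n).
Proof.
elim: n => [//|n [h0 h1]].
exact: renormalizes_cross_expanding (LP n) (LP n.+1) (RN n) h0 h1.
Qed.

Lemma eps_crude_of_min n : ln_eps_min al b0 <= ln (1 - c n) -> - ln (1 - c n) <= ln_eps_crude al b0.
Proof.
move=> h; have h1 := al1; have A0 : 0 <= ln al by apply: ln_ge0; lra.
have h2 : 0 <= ln 2 :> R by apply: ln_ge0; rewrite ler1n.
have h32 : 0 <= ln 32 :> R by apply: ln_ge0; rewrite ler1n.
have : 0 <= (ln 32 + 2 * b0%:R * ln al) / (al - 1).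
  apply: divr_ge0; last lra.
  by rewrite addr_ge0 // !mulr_ge0.
by move: h; rewrite /ln_eps_min /ln_eps_crude; lra.
Qed.

Record good_level n : Prop := GoodLevel {
  gl_tower : tower_level n;
  gl_max : ln (1 - c n) <= ln_eps_max al sg b0;
  gl_min : ln_eps_min al b0 <= ln (1 - c n) }.

Lemma good_levels n : good_level n.
Proof.
elim: n => [|n [TL eU eL]]; first by split => //; exact: tower_level0.
have [m [m' PL]] := tower_power_lorenz TL eU.
have RO := renorm_orbitsP (LP n.+1) (RN n).
have RO' := renorm_orbitsP (LP n.+2) (RN n.+1).
have LS := level_small_holds LG sg01 be0 (OM n) PL RO eU (eps_crude_of_min eL).
have [h0 h1] := tower_cross_expanding n.
have TL' : tower_level n.+1.
  apply: (tower_levelS TL) => e j.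
    exact: left_inverse_branch sg01 LG (OM n) PL RO LS eU eL h1 e j.
  exact: right_inverse_branch sg01 LG (OM n) PL RO LS eU eL h0 e j.
have qp : q n - p n != 0.
  by rewrite gt_eqF //; have := rn_p (RN n); have := rn_q (RN n); lra.
have Ec : (q n - c n) / (q n - p n) = 1 - c n.+1.
  by rewrite -{1}(rn_c (RN n)); field.
have eU' := next_eps_max LG sg01 (OM n) PL RO LS eL.
have eC' := next_eps_crude LG sg01 be0 (OM n) PL RO LS eU eL.
have eL' := next_eps_min LG sg01 (OM n) PL RO LS eU eL.
rewrite Ec in eU' eC' eL'.
(* [eL'] still asks that the right critical value of level n + 1 be at most 1 / 2. The crude bound
   [eC'] already makes level n + 1 small, so that its g1 q, and with it g1 c, is at most 1 / 8. *)
split=> //; apply: eL'.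
have [m1 [m1' PL']] := tower_power_lorenz TL' eU'.
have LS' := level_small_holds LG sg01 be0 (OM n.+1) PL' RO' eU' eC'.
have h8 := g1q_le8 PL' RO' LS'.
have cq : g1 n.+1 (c n.+1) <= g1 n.+1 (q n.+1).
  by apply: (incr_on_le (lp_g1 (LP n.+1)).1); have := rn_q (RN n.+1); lra.
rewrite -{1}(rn_c (RN n)) (rn_right (RN n)); last by have := lp_c (LP n.+1); lra.
rewrite lerD2l ler_pM2l; last by have := rn_p (RN n); have := rn_q (RN n); lra.
lra.
Qed.

Lemma good_level_facts n : exists m m',
  [/\ power_lorenz al (distortion b0) (c n) m m' (g0 n) (g1 n),
      renorm_orbits (c n) (g0 n) (g1 n) (a n) (b n) (p n) (q n),
      level_small al (distortion b0) (c n) (g1 n) (b n) (q n) & tower_level n].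
Proof.
have [TL eU eL] := good_levels n.
have [m [m' PL]] := tower_power_lorenz TL eU.
have RO := renorm_orbitsP (LP n.+1) (RN n).
exists m, m'; split=> //.
exact: level_small_holds LG sg01 be0 (OM n) PL RO eU (eps_crude_of_min eL).
Qed.

End Tower.

(** * Partition of the return interval *)

Section SpreadLists.
Context {R : realType}.

Lemma spread_mkseq (kappa d lo hi : R) (G : nat -> R * R) n : (1 < n)%N ->
  kappa * (hi - lo) <= d ->
  (forall s, (s < n)%N -> [/\ lo <= (G s).1, (G s).1 + d <= (G s).2 & (G s).2 <= hi]) ->
  (forall s, (s.+1 < n)%N -> (G s).2 + d <= (G s.+1).1) ->
  spread kappa lo hi (mkseq G n).
Proof.
move=> n1 kd H1 H2; apply/and3P; split; first by rewrite size_mkseq.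
  apply/allP => _ /mapP[s + ->]; rewrite mem_iota add0n => /H1[h1 h2 h3].
  by rewrite h1 h3 andbT (le_trans _ h2) // lerD2l.
apply/(sortedP (0, 0)) => s; rewrite size_mkseq => sn.
by rewrite !nth_mkseq ?(ltnW sn) //; apply: le_trans (H2 _ sn); rewrite lerD2l.
Qed.

Lemma spread_le (kappa kappa' lo hi : R) s : lo <= hi -> kappa' <= kappa ->
  spread kappa lo hi s -> spread kappa' lo hi s.
Proof.
move=> lh kk /and3P[s1 /allP s2 s3].
have d : kappa' * (hi - lo) <= kappa * (hi - lo) by apply: ler_wpM2r; rewrite ?subr_ge0.
apply/and3P; split=> //.
  by apply/allP => u /s2/and3P[h1 h2 h3]; apply/and3P; split=> //; apply: le_trans h2; rewrite lerD2l.
by apply: sub_sorted s3 => u v; apply: le_trans; rewrite lerD2l.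
Qed.

(** Distortion K changes the proportion of any length or gap to the whole by a factor of at most
    K. *)
Lemma spread_image (K kappa lo hi : R) (e : R -> R) (s : seq (R * R)) :
  0 < K -> 0 < kappa -> lo < hi -> incr_on lo hi e -> distortion_le K lo hi e ->
  spread kappa lo hi s -> spread (kappa / K) (e lo) (e hi) [seq (e u.1, e u.2) | u <- s].
Proof.
move=> K0 k0 lh ei ed /and3P[s1 s2 s3].
have d0 : 0 < kappa * (hi - lo) by rewrite mulr_gt0 // subr_gt0.
have gap u v : lo <= u -> u + kappa * (hi - lo) <= v -> v <= hi ->
    e u + kappa / K * (e hi - e lo) <= e v.
  move=> lu uv vh; have uv' : u < v by lra.
  have := ed lo hi u v (lexx _) lh (lexx _) lu uv' vh.
  have h1 : (e hi - e lo) * (kappa * (hi - lo)) <= (e hi - e lo) * (v - u).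
    by apply: ler_wpM2l; [rewrite subr_ge0 ltW // ei|lra].
  move=> h2; have := le_trans h1 h2; rewrite !mulrA ler_pM2r ?subr_gt0 // => h3.
  rewrite -lerBrDl -(ler_pM2l K0) (_ : K * _ = (e hi - e lo) * kappa) //.
  by field; rewrite gt_eqF.
apply/and3P; split; first by rewrite size_map.
  apply/allP => _ /mapP[u /(allP s2)/and3P[h1 h2 h3] ->] /=.
  have i12 : u.1 <= u.2 by lra.
  by rewrite !(incr_on_le ei) ?gap //; lra.
case: s s1 s2 s3 => // I s _.
elim: s I => [|J s IH] I //= /andP[/and3P[h1 h2 h3] /andP[/and3P[h4 h5 h6] h]] /andP[IJ p].
rewrite gap //; [|lra|lra].
apply: IH => //=; by rewrite h4 h5 h6.
Qed.

End SpreadLists.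

Lemma subnS_add a s : (s < a)%N -> (a - s.+1 + s = a.-1)%N. Proof. lia. Qed.
Lemma ltn_subnS a s i : (i < a - s.+1)%N -> (i + s < a)%N. Proof. lia. Qed.
Lemma ltn_subn a s i : (i < a - s)%N -> (i + s < a)%N. Proof. lia. Qed.
Lemma len_exponent_left a b s : ((a - s).+1 <= a + b + 3)%N. Proof. lia. Qed.
Lemma len_exponent_right a b s : ((b - s).+1 <= a + b + 3)%N. Proof. lia. Qed.
Lemma gap_exponent_left a b s : (a - s.+1 + 2 <= a + b + 3)%N. Proof. lia. Qed.
Lemma gap_exponent_right a b s : (b - s.+1 + 3 <= a + b + 3)%N. Proof. lia. Qed.
Lemma center_index a b s : (s < (a + b).+1)%N -> (b <= s)%N -> s <> b -> (a + b - s < a)%N.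
Proof. lia. Qed.
Lemma center_indexS a b s : (s.+1 < (a + b).+1)%N -> (a + b - s = (a + b - s.+1).+1)%N.
Proof. lia. Qed.
Lemma right_index a s : (s < a.+1)%N -> s <> 0%N -> (a.+1 - s <= a)%N.
Proof. lia. Qed.
Lemma right_indexS a s : (s.+1 < a.+1)%N -> (a.+1 - s = (a.+1 - s.+1).+1)%N.
Proof. lia. Qed.

Section ReturnPartition.
Context {R : realType}.
Variables (M c : R) (g0 g1 : R -> R) (a b : nat) (p q : R).
Hypotheses (M1 : 1 <= M) (g0i : incr_on 0 c g0) (g1i : incr_on c 1 g1).
Hypothesis RO : renorm_orbits c g0 g1 a b p q.
Hypothesis lip0 : forall x y, 0 <= x -> x <= y -> y <= c -> g0 y - g0 x <= M * (y - x).
Hypothesis lip1 : forall x y, c <= x -> x <= y -> y <= 1 -> g1 y - g1 x <= M * (y - x).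
Hypotheses (cp0 : 0 <= g1 c) (cm1 : g0 c <= 1).
Hypotheses (gap : M^-1 <= p - g1 q) (lenL : M^-1 <= c - p) (lenR : M^-1 <= q - c).

Let M0 : 0 < M. Proof. by have := M1; lra. Qed.
Let Mi : 0 < M^-1. Proof. by rewrite invr_gt0. Qed.

Definition left_orbit s x := iter s g1 (g0 x).
Definition right_orbit s x := iter s g0 (g1 x).
Local Arguments left_orbit : simpl never.
Local Arguments right_orbit : simpl never.
Local Notation L := left_orbit.
Local Notation Rr := right_orbit.

Let lip_iter (lo hi : R) (g : R -> R) : incr_on lo hi g ->
  (forall x y, lo <= x -> x <= y -> y <= hi -> g y - g x <= M * (y - x)) ->
  forall k u v d, iter k g u + d <= iter k g v -> 0 < d ->
  (forall i, (i < k)%N -> lo <= iter i g u <= hi /\ lo <= iter i g v <= hi) ->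
  u + M^-1 ^+ k * d <= v.
Proof.
move=> gi lip; elim=> [|k IH] u v d; first by rewrite expr0 mul1r.
rewrite !iterS => h d0 H; have [hu hv] := H k (leqnn _).
have uv : iter k g u < iter k g v by rewrite -(incr_on_ltE gi) //; lra.
have := lip (iter k g u) (iter k g v) ltac:(lra) ltac:(lra) ltac:(lra) => h2.
rewrite exprSr -mulrA; apply: IH; last by move=> i /leqW; exact: H.
  rewrite -lerBrDl -(ler_pM2l M0) mulrA mulfV ?gt_eqF // mul1r; lra.
by rewrite mulr_gt0.
Qed.

Let left_in s x : p <= x <= c -> (s < a)%N -> c <= L s x <= 1.
Proof. by move=> xI sa; have /andP[/ltW -> ->] := ro_left RO xI sa. Qed.

Let right_in s x : c <= x <= q -> (s < b)%N -> 0 <= Rr s x <= c.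
Proof. by move=> xI sa; have /andP[-> /ltW ->] := ro_right RO xI sa. Qed.

Let pI := ro_p RO. Let qI := ro_q RO.
Let p_in : p <= p <= c. Proof. by have := pI; lra. Qed.
Let c_in : p <= c <= c. Proof. by have := pI; lra. Qed.
Let q_in : c <= q <= q. Proof. by have := qI; lra. Qed.
Let c_in' : c <= c <= q. Proof. by have := qI; lra. Qed.

(** The point on the right is the preimage of p under g1, and g1 q is at distance M^-1 below p; the
    Lipschitz bound of g1 pulls this gap back. *)
Let last_left : q + M^-1 ^+ 2 <= L a.-1 p.
Proof.
have a0 := ro_a RO; have h := left_in p_in (s := a.-1); rewrite prednK // leqnn in h.
have E : g1 (L a.-1 p) = p by rewrite /L -iterS prednK // (ro_fix_p RO).
rewrite expr2.
have := @lip_iter c 1 g1 g1i lip1 1 q (L a.-1 p) M^-1; rewrite expr1; apply => //.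
  by rewrite /= E; have := gap; lra.
by move=> [|//] _; rewrite /= h //; have := qI; lra.
Qed.

Let first_left : L a.-1 p <= g0 p.
Proof.
have a0 := ro_a RO.
have E : L a p = p by exact: (ro_fix_p RO).
have H s : (s < a)%N -> p <= L (a - s.+1)%N p /\ L (a - s)%N p <= L (a - s.+1)%N p.
  elim: s => [|s IH] sa.
    rewrite subn0 E subn1; have := left_in p_in (s := a.-1); rewrite prednK // leqnn.
    by have := pI; move=> ? /(_ isT); lra.
  have [h1 h2] := IH (ltnW sa).
  have lta k : (a - k.+1 < a)%N by rewrite ltn_subrL a0.
  have hs := left_in p_in (lta s.+1).
  have hs' := left_in p_in (lta s).
  split; first by have := pI; lra.
  rewrite -(incr_on_leE g1i) // -!iterS.
  by rewrite (subnSK sa) (subnSK (ltnW sa)).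
have G s : (s < a)%N -> L a.-1 p <= L (a - s.+1)%N p.
  elim: s => [|s IH] sa; first by rewrite subn1.
  by apply: le_trans (IH (ltnW sa)) _; case: (H s.+1 sa).
by have := G a.-1; rewrite prednK // leqnn subnn => /(_ isT).
Qed.

Let last_right : Rr b.-1 q + M^-1 ^+ 3 <= p.
Proof.
have b0 := ro_b RO; have h := right_in q_in (s := b.-1); rewrite prednK // leqnn in h.
have E : g0 (Rr b.-1 q) = q by rewrite /Rr -iterS prednK // (ro_fix_q RO).
rewrite exprS; have := @lip_iter 0 c g0 g0i lip0 1 (Rr b.-1 q) p (M^-1 ^+ 2); rewrite expr1; apply.
- by rewrite /= E; have := last_left; have := first_left; lra.
- exact: exprn_gt0.
- by move=> [|//] _; rewrite /= h //; have := pI; lra.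
Qed.

(** Lengths and gaps are pulled back from the return interval over at most a or b steps; the gaps
    beside that interval start at M^-2 on the right and M^-3 on the left. *)
Let kap := M^-1 ^+ (a + b + 3).

Let kap_le n : (n <= a + b + 3)%N -> kap <= M^-1 ^+ n.
Proof.
by move=> nn; rewrite /kap ler_wiXn2l // ?(ltW Mi) // invf_le1 //.
Qed.

Let kap1 : kap <= M^-1. Proof. by rewrite -[leRHS]expr1 kap_le // addn3. Qed.

Let left_len s : (s <= a)%N -> L s p + kap <= L s c.
Proof.
move=> sa; have := @lip_iter c 1 g1 g1i lip1 (a - s)%N (L s p) (L s c) M^-1.
rewrite -!iterD subnK // -exprSr => H; have {H} := H _ _ _.
have le := kap_le (len_exponent_left a b s).
move=> H; apply: le_trans (H _ Mi _); first by rewrite lerD2l.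
  by rewrite (ro_fix_p RO); have := ro_crit_left RO; have := lenL; lra.
move=> i ia; rewrite -!iterD; by split; apply: left_in => //; exact: ltn_subn.
Qed.

Let right_len s : (s <= b)%N -> Rr s c + kap <= Rr s q.
Proof.
move=> sb; have := @lip_iter 0 c g0 g0i lip0 (b - s)%N (Rr s c) (Rr s q) M^-1.
rewrite -!iterD subnK // -exprSr => H.
have le := kap_le (len_exponent_right a b s).
apply: le_trans (H _ Mi _); first by rewrite lerD2l.
  by rewrite (ro_fix_q RO); have := ro_crit_right RO; have := lenR; lra.
move=> i ia; rewrite -!iterD; by split; apply: right_in => //; exact: ltn_subn.
Qed.

Let left_gap s : (s < a)%N -> L s.+1 c + kap <= L s p.
Proof.
move=> sa; have := @lip_iter c 1 g1 g1i lip1 (a - s.+1)%N (L s.+1 c) (L s p) (M^-1 ^+ 2).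
rewrite -!iterD subnK // -exprD => H.
have le := kap_le (gap_exponent_left a b s).
apply: le_trans (H _ _ _); first by rewrite lerD2l.
- rewrite subnS_add //.
  by have := ro_crit_left RO; have := last_left; rewrite /L; lra.
- exact: exprn_gt0.
- move=> i ia; rewrite -!iterD; by split; apply: left_in => //; [exact: ltn_subn|exact: ltn_subnS].
Qed.

Let right_gap s : (s < b)%N -> Rr s q + kap <= Rr s.+1 c.
Proof.
move=> sb; have := @lip_iter 0 c g0 g0i lip0 (b - s.+1)%N (Rr s q) (Rr s.+1 c) (M^-1 ^+ 3).
rewrite -!iterD subnK // -exprD => H.
have le := kap_le (gap_exponent_right a b s).
apply: le_trans (H _ _ _); first by rewrite lerD2l.
- rewrite subnS_add //.
  by have := ro_crit_right RO; have := last_right; rewrite /Rr; lra.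
- exact: exprn_gt0.
- move=> i ia; rewrite -!iterD; by split; apply: right_in => //; [exact: ltn_subnS|exact: ltn_subn].
Qed.

Let kap0 : 0 < kap. Proof. exact: exprn_gt0. Qed.

Definition left_piece s := (L s p, L s c).
Definition right_piece s := (Rr s c, Rr s q).

(** From left to right: the orbit of [c, q], which increases under g0, then the return interval,
    then the orbit of [p, c], which decreases under g1 and is therefore listed backwards in time. *)
Definition center_pieces s :=
  if (s < b)%N then right_piece s else if s == b then (p, q) else left_piece (a + b - s).
(** What passes through g0: its images of the pieces of [c, q] at times 0 to b - 1, whence the shift
    by one, and its image of [p, c]. The piece at time b lies in the return interval. *)
Definition left_pieces s := if (s < b)%N then right_piece s.+1 else left_piece 0.
Definition right_pieces s := if s == 0%N then right_piece 0 else left_piece (a.+1 - s).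

Let left_rng s : (s <= a)%N -> p <= L s p /\ L s c <= 1.
Proof.
rewrite leq_eqVlt => /orP[/eqP ->|sa].
  by rewrite /L (ro_fix_p RO); have := ro_crit_left RO; have := qI; lra.
by have := left_in p_in sa; have := left_in c_in sa; have := pI; lra.
Qed.

Let right_rng s : (s <= b)%N -> 0 <= Rr s c /\ Rr s q <= q.
Proof.
rewrite leq_eqVlt => /orP[/eqP ->|sb].
  by rewrite /Rr (ro_fix_q RO); have := ro_crit_right RO; have := pI; lra.
by have := right_in q_in sb; have := right_in c_in' sb; have := qI; lra.
Qed.

Lemma center_spread : spread kap 0 1 (mkseq center_pieces (a + b).+1).
Proof.
have a0 := ro_a RO; have b0 := ro_b RO.
apply: (@spread_mkseq _ _ kap) => [||s sn|s sn]; [by rewrite ltnS addn_gt0 a0|by rewrite subr0 mulr1| |].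
  rewrite /center_pieces; case: ltnP => sb.
    by have := right_rng (ltnW sb); have := right_len (ltnW sb); have := qI; move=> ? ? [? ?]; split=> //=; lra.
  case: eqP => sb'.
    by have := pI; have := qI; have := kap1; have := lenL; split=> //=; lra.
  have i' := ltnW (center_index sn sb sb'); have := left_rng i'; have := left_len i'.
  by have := pI; move=> ? ? [? ?]; split=> //=; lra.
rewrite /center_pieces; case: (ltnP s b) => sb.
  case: (ltnP s.+1 b) => sb1; first exact: right_gap.
  have E : s.+1 = b by apply/eqP; rewrite eqn_leq sb sb1.
  rewrite E eqxx; have := last_right; rewrite -E /=.
  by have := kap_le (leq_addl _ 3); lra.
rewrite ltnNge (leqW sb) (gtn_eqF (sb : (b < s.+1)%N)) /=.
case: eqP => sb'.
  rewrite sb' subnS addnK /=.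
  by have := last_left; have := kap_le (leq_trans (leqnSn 2) (leq_addl _ 3)); lra.
rewrite (center_indexS sn); apply: left_gap; rewrite -(center_indexS sn).
exact: ltnW (center_index (ltnW sn) sb sb').
Qed.

Lemma left_spread : spread kap 0 (g0 c) (mkseq left_pieces b.+1).
Proof.
have a0 := ro_a RO; have b0 := ro_b RO.
have h0 : q + M^-1 ^+ 2 <= g0 p by apply: le_trans last_left first_left.
have k2 := kap_le (leq_trans (leqnSn 2) (leq_addl _ 3)).
have pc : g0 p + kap <= g0 c by exact: (left_len (s := 0)).
apply: (@spread_mkseq _ _ kap) => [||s sn|s sn]; [by []| | |].
- rewrite subr0 -[leRHS]mulr1; apply: ler_wpM2l; [exact: ltW kap0|exact: cm1].
- rewrite /left_pieces; case: ltnP => sb; last by rewrite /left_piece /L /=; split=> //=; have := pI; have := qI; have := kap0; lra.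
  by have := right_rng sb; have := right_len sb; have := kap0; move=> ? ? [? ?]; split=> //=; lra.
- rewrite /left_pieces ifT //.
  case: ltnP => sb; first by apply: right_gap.
  have -> : s.+1 = b by apply/eqP; rewrite eqn_leq sb -ltnS sn.
  by rewrite /= /Rr (ro_fix_q RO) /L /=; lra.
Qed.

Lemma right_spread : spread kap (g1 c) 1 (mkseq right_pieces a.+1).
Proof.
have a0 := ro_a RO; have b0 := ro_b RO.
have cq : g1 c + kap <= g1 q by exact: (right_len (s := 0)).
apply: (@spread_mkseq _ _ kap) => [||s sn|s sn]; [by []| | |].
- rewrite -[leRHS]mulr1; apply: ler_wpM2l; [exact: ltW kap0|by have := cp0; lra].
- rewrite /right_pieces; case: eqP => s0.
    by rewrite /right_piece /Rr /=; split=> //=; have := gap; have := pI; have := qI; have := kap0; have := Mi; lra.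
  have i' := right_index sn s0; have := left_rng i'; have := left_len i'.
  by have := kap0; have := gap; have := Mi; move=> ? ? ? ? [? ?]; split=> //=; lra.
- rewrite /right_pieces /=; case: eqP => s0.
    by rewrite s0 subn1 /= /L (ro_fix_p RO) /Rr /=; have := gap; have := kap1; lra.
  by rewrite (right_indexS sn); apply: left_gap; rewrite subSS ltn_subrL lt0n (introN eqP s0) a0.
Qed.

End ReturnPartition.

(** * Orbits avoiding the return interval *)

Section Contractions.
Context {R : realType}.
Implicit Types (lo hi : R) (e : R -> R).

Definition cross_contraction lo hi lo' hi' e :=
  [/\ incr_on lo hi e, forall x, lo <= x <= hi -> lo' <= e x <= hi' & cross_contracting lo hi e].

Lemma cross_contraction_comp lo hi lo1 hi1 lo2 hi2 e e' :
  cross_contraction lo hi lo1 hi1 e -> cross_contraction lo1 hi1 lo2 hi2 e' ->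
  cross_contraction lo hi lo2 hi2 (e' \o e).
Proof.
move=> [i1 r1 c1] [i2 r2 c2]; split.
- exact: incr_on_comp i1 r1 i2.
- by move=> x /r1 /r2.
- exact: cross_contracting_comp i1 r1 c1 c2.
Qed.

Lemma cross_contraction_iter lo hi e n : cross_contraction lo hi lo hi e ->
  cross_contraction lo hi lo hi (iter n e).
Proof.
move=> h; elim: n => [|n IH]; last exact: (cross_contraction_comp IH h).
by split=> // x0 x1 x2 x3.
Qed.

Lemma cross_contraction_sub lo hi lo' hi' lo1 hi1 lo2 hi2 e : lo <= lo1 -> hi1 <= hi ->
  cross_contraction lo hi lo' hi' e -> (forall x, lo1 <= x <= hi1 -> lo2 <= e x <= hi2) ->
  cross_contraction lo1 hi1 lo2 hi2 e.
Proof.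
move=> h1 h2 [i r k] r'; split=> //; first exact: incr_on_sub i.
exact: cross_contracting_sub k.
Qed.

Lemma exists_lower_bound (u : nat -> R) n : (forall s, (s < n)%N -> 0 < u s) ->
  exists2 d, 0 < d & forall s, (s < n)%N -> d <= u s.
Proof.
elim: n => [|n IH] H; first by exists 1.
have [s sn|d d0 dn] := IH; first by apply: H; exact: leqW.
exists (Num.min d (u n)); first by rewrite lt_min d0 H.
move=> s; rewrite ltnS leq_eqVlt => /orP[/eqP ->|sn]; first by rewrite ge_min lexx orbT.
by rewrite ge_min dn.
Qed.

(** An ineffective constant, a minimum over a finite list. It is enough for orbits avoiding one
    return interval, where the level is fixed. *)
Lemma spread_exists (G : nat -> R * R) n lo hi : (1 < n)%N -> lo < hi ->
  (forall s, (s < n)%N -> [/\ lo <= (G s).1, (G s).1 < (G s).2 & (G s).2 <= hi]) ->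
  (forall s, (s.+1 < n)%N -> (G s).2 < (G s.+1).1) ->
  exists2 kappa, 0 < kappa & spread kappa lo hi (mkseq G n).
Proof.
move=> n1 lh H1 H2.
have [|d d0 hd] := @exists_lower_bound (fun s => (G s).2 - (G s).1) n.
  by move=> s /H1[_ ? _]; rewrite subr_gt0.
have [|d' d0' hd'] := @exists_lower_bound (fun s => (G s.+1).1 - (G s).2) n.-1.
  by move=> s sn; rewrite subr_gt0 H2 // -ltn_predRL.
have m0 : 0 < Num.min d d' by rewrite lt_min d0.
exists (Num.min d d' / (hi - lo)); first by rewrite divr_gt0 // subr_gt0.
apply: (@spread_mkseq _ _ (Num.min d d')) => //.
- by rewrite divfK // gt_eqF // subr_gt0.
- move=> s sn; have [h1 h2 h3] := H1 s sn; split=> //.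
  by have := hd s sn; have : Num.min d d' <= d by [rewrite ge_min lexx]; lra.
- move=> s sn; have := hd' s; rewrite ltn_predRL sn => /(_ isT).
  by have : Num.min d d' <= d' by [rewrite ge_min lexx orbT]; lra.
Qed.

End Contractions.

Lemma next_branch_mod a s : (0 < a)%N -> ((s %% a).+1 < a)%N ->
  (s.+1 %% a = (s %% a).+1 /\ s.+1 %/ a = s %/ a)%N.
Proof.
move=> a0 h; have E : s.+1 = (s %/ a * a + (s %% a).+1)%N by rewrite addnS -divn_eq.
by rewrite E modnMDl divnMDl // (modn_small h) (divn_small h) addn0.
Qed.

Lemma next_branch_div a s : (0 < a)%N -> (s %% a).+1 = a ->
  (s.+1 %% a = 0 /\ s.+1 %/ a = (s %/ a).+1)%N.
Proof.
move=> a0 h; have E : s.+1 = ((s %/ a).+1 * a)%N by rewrite mulSn addnC -{3}h addnS -divn_eq.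
by rewrite E modnMl mulnK.
Qed.

Lemma lebesgue_null_preimages (R : realType) (F : R -> R) (c : R) :
  (forall x, 0 <= x <= 1 -> 0 <= F x <= 1) ->
  (forall S, lebesgue_null S -> lebesgue_null [set x | [/\ 0 <= x <= 1, x <> c & S (F x)]]) ->
  forall k S, lebesgue_null S ->
  lebesgue_null [set x | [/\ 0 <= x <= 1, forall i, (i < k)%N -> iter i F x <> c & S (iter k F x)]].
Proof.
move=> FI NF; elim=> [|k IH] S nS; first by apply: lebesgue_nullS nS => x [].
apply: lebesgue_nullS (NF _ (IH S nS)) => x [xI xc Sx]; split=> //; first exact: (xc 0%N).
split; [exact: FI|move=> i ik|by rewrite -iterSr].
by rewrite -iterSr; exact: (xc i.+1).
Qed.

Section ReturnBranches.
Context {R : realType}.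
Variables (c : R) (g0 g1 : R -> R) (a b : nat) (p q : R).
Hypothesis LP : lorenz_pair c g0 g1.
Hypothesis RO : renorm_orbits c g0 g1 a b p q.
Hypotheses (E0 : cross_expanding 0 c g0) (E1 : cross_expanding c 1 g1).
Hypotheses (b1 : (1 < b)%N) (gq : g1 q < p).
Hypothesis up : forall x, 0 < x <= c -> x < g0 x.
Hypothesis down : forall x, c <= x < 1 -> g1 x < x.

Local Notation J := (inv_on c 1 g1).
Local Notation G := (inv_on 0 c g0).
Local Notation rs := (J c).
Local Notation r := (J p).

Let cI := lp_c LP. Let g0o := lp_g0 LP. Let g1o := lp_g1 LP. Let g00 := lp_g00 LP. Let g11 := lp_g11 LP.
Let cmI := lp_cm LP. Let cpI := lp_cp LP. Let pI := ro_p RO. Let qI := ro_q RO.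

Let JP y : g1 c <= y <= 1 -> c <= J y <= 1 /\ g1 (J y) = y.
Proof. by move=> yI; apply: inv_onP => //; rewrite g11. Qed.

Let GP y : 0 <= y <= g0 c -> 0 <= G y <= c /\ g0 (G y) = y.
Proof. by move=> yI; apply: inv_onP => //; rewrite g00. Qed.

Let J_contr : cross_contraction (g1 c) 1 c 1 J.
Proof.
split; last by have := inv_on_cross g1o E1; rewrite g11.
  by have := inv_on_incr g1o; rewrite g11.
by move=> x /JP[].
Qed.

Let G_contr : cross_contraction 0 (g0 c) 0 (g0 c) G.
Proof.
split; last by have := inv_on_cross g0o E0; rewrite g00.
  by have := inv_on_incr g0o; rewrite g00.
by move=> x /GP[h _]; have := cmI; lra.
Qed.

Let J_ge z : c <= z <= 1 -> z <= J z.
Proof.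
move=> zI; have [h E] := JP (y := z) ltac:(have := cpI; lra).
have [J1|J1] := ltP (J z) 1; last lra.
by have := @down (J z) ltac:(lra); rewrite E; lra.
Qed.

Let G_le z : 0 <= z <= g0 c -> G z <= z.
Proof.
move=> zI; have [h E] := GP zI.
have [G0|G0] := ltP 0 (G z); last by lra.
by have := @up (G z) ltac:(lra); rewrite E; lra.
Qed.

Let Jc_contr : cross_contraction c 1 c 1 J.
Proof.
apply: (cross_contraction_sub _ _ J_contr) => //; first by have := cpI; lra.
by move=> x xI; case: (JP (y := x) ltac:(have := cpI; lra)).
Qed.

Let Jj_contr j : cross_contraction c 1 c 1 (iter j J).
Proof. exact: cross_contraction_iter. Qed.

Let Gk_contr k : cross_contraction 0 (g0 c) 0 (g0 c) (iter k G).
Proof. exact: cross_contraction_iter. Qed.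

Local Notation L s x := (iter s g1 (g0 x)).
Local Notation Rr s x := (iter s g0 (g1 x)).

Let J_orbit x s : p <= x <= c -> (s < a)%N -> J (L s.+1 x) = L s x.
Proof. by move=> xI sa; rewrite iterS; apply: inv_onK => //; have /andP[/ltW -> ->] := ro_left RO xI sa. Qed.

Let G_orbit x s : c <= x <= q -> (s < b)%N -> G (Rr s.+1 x) = Rr s x.
Proof. by move=> xI sa; rewrite iterS; apply: inv_onK => //; have /andP[-> /ltW ->] := ro_right RO xI sa. Qed.

Let Jj_orbit x s j : p <= x <= c -> (j + s <= a)%N -> iter j J (L (j + s) x) = L s x.
Proof.
move=> xI; elim: j s => [//|j IH] s js.
by rewrite iterS addSnnS IH -?addSnnS // J_orbit // (leq_trans _ js) // addSn ltnS leq_addl.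
Qed.

Let Gk_orbit x s k : c <= x <= q -> (k + s <= b)%N -> iter k G (Rr (k + s) x) = Rr s x.
Proof.
move=> xI; elim: k s => [//|k IH] s ks.
by rewrite iterS addSnnS IH -?addSnnS // G_orbit // (leq_trans _ ks) // addSn ltnS leq_addl.
Qed.

Let Rr_ge x s : c <= x <= q -> (s <= b)%N -> g1 x <= Rr s x.
Proof.
move=> xI; elim: s => [//|s IH] sb; apply: (le_trans (IH (ltnW sb))); rewrite [leRHS]iterS.
have h := ro_right RO xI sb.
have [h0|h0] := ltP 0 (Rr s x); first by apply/ltW/up; lra.
have -> : Rr s x = 0 by lra.
by rewrite g00.
Qed.

Let cI' : c <= c <= q. Proof. by have := qI; lra. Qed.
Let qI' : c <= q <= q. Proof. by have := qI; lra. Qed.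
Let pI' : p <= p <= c. Proof. by have := pI; lra. Qed.
Let cI2 : p <= c <= c. Proof. by have := pI; lra. Qed.

Let rsI : c < rs < 1 /\ g1 rs = c.
Proof.
have [h E] := JP (y := c) ltac:(have := cpI; have := cI; lra).
have : rs != c by apply/eqP => Ec; move: E; rewrite Ec; have := cpI; lra.
have : rs != 1 by apply/eqP => Ec; move: E; rewrite Ec g11; have := cI; lra.
by move=> /eqP h1 /eqP h2; split=> //; lra.
Qed.

Let rI : q < r < rs /\ g1 r = p.
Proof.
have cp : g1 c <= g1 q by apply: (incr_on_le g1o.1); have := qI; lra.
have [h E] := JP (y := p) ltac:(have := gq; have := pI; have := cI; lra).
have [h2 E2] := rsI; split=> //; apply/andP; split.
  by rewrite -(incr_on_ltE g1o.1) ?E //; have := qI; lra.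
by rewrite -(incr_on_ltE g1o.1) ?E ?E2 //; have := pI; lra.
Qed.

Let right_range j x : (j < a)%N -> c <= x <= rs -> c <= iter j J x <= g0 c.
Proof.
move=> ja xI; have [h _] := rsI; have [ij rj _] := Jj_contr j.
have := rj x ltac:(lra) => /andP[-> _] /=.
apply: (@le_trans _ _ (iter j J rs)); first by apply: (incr_on_le ij); lra.
rewrite -iterSr; have [iS rS _] := Jj_contr j.+1.
have Lc := ro_crit_left RO.
have mono s : (s <= a)%N -> iter s J c <= iter a J c.
  move=> /subnK <-; elim: (a - s)%N => [//|k IH]; apply: (le_trans IH).
  have [_ rk _] := Jj_contr (k + s); rewrite addSn [leRHS]iterS; apply: J_ge; apply: rk.
  by have := cI; lra.
apply: (le_trans (mono _ ja)).
have [ia ra _] := Jj_contr a.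
apply: (@le_trans _ _ (iter a J (L a c))).
  by apply: (incr_on_le ia); have := qI; lra.
by have := Jj_orbit (s := 0) (j := a) cI2; rewrite addn0 => ->.
Qed.

Let left_range k z : (k <= b)%N -> c <= z <= g0 c -> g1 c <= iter k G z <= g0 c.
Proof.
move=> kb zI; have [ik rk _] := Gk_contr k; have := cI; have := cmI => h1 h2.
have := rk z ltac:(lra) => /andP[_ ->]; rewrite andbT.
have Rc := ro_crit_right RO; have pp := pI.
apply: (@le_trans _ _ (iter k G (Rr b c))); last by apply: (incr_on_le ik); lra.
have := Gk_orbit (s := (b - k)%N) (k := k) cI'; rewrite subnKC // => ->; last by [].
by apply: Rr_ge => //; exact: leq_subr.
Qed.

(* The inverse branches of the first return to ]q, r[, indexed from left to right. *)
Definition return_branch s x := J (iter (b - s %/ a) G (iter (s %% a) J x)).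

Let a0 := ro_a RO.

Let branch_k s : (s < b * a)%N -> (0 < b - s %/ a <= b)%N.
Proof. by move=> sn; rewrite subn_gt0 ltn_divLR // sn leq_subr. Qed.

Let G_below k z : (0 < k <= b)%N -> c <= z <= g0 c -> g1 c <= iter k G z <= c.
Proof.
case: k => // k kb zI; have /andP[-> _] := left_range (k := k.+1) ltac:(by case/andP: kb) zI.
have [_ rk _] := Gk_contr k; rewrite iterS; have [|+ _] := GP (y := iter k G z); last by case/andP.
by apply: rk; have := cI; lra.
Qed.

(** The point is the domain: [c, rs] contains [q, r] in its interior and is mapped into itself, so
    all compositions of branches share the same Koebe space around [q, r]. *)
Lemma return_branch_contr s : (s < b * a)%N -> cross_contraction c rs c rs (return_branch s).
Proof.
move=> sn; have kb := branch_k sn; have ja : (s %% a < a)%N by rewrite ltn_mod.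
have [h Er] := rsI.
have step1 : cross_contraction c rs c (g0 c) (iter (s %% a) J).
  by apply: (cross_contraction_sub _ _ (Jj_contr _)) => //; [lra|by move=> x; exact: (right_range ja)].
have step2 : cross_contraction c (g0 c) (g1 c) c (iter (b - s %/ a) G).
  by apply: (cross_contraction_sub _ _ (Gk_contr _)) => //; [have := cI; lra|by move=> x; exact: (G_below kb)].
have step3 : cross_contraction (g1 c) c c rs J.
  apply: (cross_contraction_sub _ _ J_contr) => // [|x xI]; first by have := cI; lra.
  have [iJ rJ _] := J_contr; have cc := cI; have := rJ x ltac:(lra) => /andP[-> _] /=.
  by apply: (incr_on_le iJ); lra.
exact: (cross_contraction_comp step1 (cross_contraction_comp step2 step3)).
Qed.

Let JjL j : (j < a)%N -> iter j J r <= g0 p.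
Proof.
move=> ja; have [h Er] := rI; have [h2 _] := rsI.
have Lp : g1 (L a.-1 p) = p by rewrite -iterS prednK // (ro_fix_p RO).
have La := ro_left RO pI' (i := a.-1); rewrite prednK // leqnn in La.
have Er' : r = L a.-1 p by rewrite -{1}Lp inv_onK //; have := La isT; lra.
have mono s : (s <= a.-1)%N -> iter s J r <= iter a.-1 J r.
  move=> /subnK <-; elim: (a.-1 - s)%N => [//|k IH]; apply: (le_trans IH).
  have [_ rk _] := Jj_contr (k + s); rewrite addSn [leRHS]iterS; apply: J_ge; apply: rk.
  by have := qI; lra.
have ja' : (j <= a.-1)%N by rewrite -ltnS prednK.
apply: (le_trans (mono _ ja')); rewrite Er'.
have := Jj_orbit (s := 0) (j := a.-1) pI'; rewrite addn0 => -> //.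
exact: leq_pred.
Qed.

Let G_p : G (g0 p) = p. Proof. by apply: inv_onK => //; have := pI; lra. Qed.

Lemma return_branch_sub s : (s < b * a)%N ->
  [/\ q <= return_branch s q, return_branch s q < return_branch s r & return_branch s r <= r].
Proof.
move=> sn; have kb := branch_k sn; have ja : (s %% a < a)%N by rewrite ltn_mod.
have [h Er] := rI; have [h2 Er2] := rsI; have qq := qI; have pp := pI; have cc := cI.
have [iJ rJ _] := J_contr; have [ij rj _] := Jj_contr (s %% a).
have [ik rk _] := Gk_contr (b - s %/ a).
have cp : g1 c <= g1 q by apply: (incr_on_le g1o.1); lra.
have Jq : J (g1 q) = q by apply: inv_onK => //; lra.
have qj : q <= iter (s %% a) J q.
  elim: (s %% a)%N => [//|j IH]; apply: (le_trans IH); rewrite [leRHS]iterS; apply: J_ge.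
  by have [_ rj' _] := Jj_contr j; apply: rj'; lra.
have rq := right_range ja (x := q) ltac:(lra).
have rr := right_range ja (x := r) ltac:(lra).
split.
- rewrite -{1}Jq; apply: (incr_on_le iJ) => //.
    apply: (@le_trans _ _ (iter (b - s %/ a) G q)); last by apply: (incr_on_le ik); lra.
    have := Gk_orbit (s := (s %/ a)%N) (k := (b - s %/ a)%N) qI'.
    have sb : (s %/ a <= b)%N by rewrite ltnW // ltn_divLR.
    by rewrite subnK // (ro_fix_q RO) => -> //; exact: Rr_ge.
  by have := G_below kb rq; lra.
- have [ir _ _] := return_branch_contr sn; apply: ir; lra_on qq h.
- have k0 : (0 < b - s %/ a)%N by case/andP: kb.
  apply: (incr_on_le iJ); [by have := G_below kb rr; lra| |lra].
  apply: (@le_trans _ _ (iter (b - s %/ a) G (g0 p))).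
    by apply: (incr_on_le ik); [lra_on rr pp|exact: JjL|apply: (incr_on_le g0o.1); lra_on pp].
  rewrite -(prednK k0) iterSr G_p; elim: (_.-1) => [//|k IH].
  rewrite [leLHS]iterS; apply: le_trans IH; apply: G_le.
  by have [_ rk' _] := Gk_contr k; apply: rk'; have := cmI; lra.
Qed.

(** The gaps are preimages of [p, q]. Within a block they come from r < J q, since p < q; between
    blocks from G (g0 p) = p < q, one application of G earlier. *)
Lemma return_branch_sep s : (s.+1 < b * a)%N -> return_branch s r < return_branch s.+1 q.
Proof.
move=> sn; have kb := branch_k (ltnW sn); have ja : (s %% a < a)%N by rewrite ltn_mod.
have kb' := branch_k sn; have ja' : (s.+1 %% a < a)%N by rewrite ltn_mod.
have [h Er] := rI; have [h2 Er2] := rsI; have qq := qI; have pp := pI; have cc := cI; have cm := cmI.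
have [iJ rJ _] := J_contr.
have rr := right_range ja (x := r) ltac:(lra).
have rq' := right_range ja' (x := q) ltac:(lra).
have gr := G_below kb rr; have gq' := G_below kb' rq'.
have [ik rk _] := Gk_contr (b - s.+1 %/ a).
apply: (iJ); [lra| |lra].
have [h3|h3] := ltnP (s %% a).+1 a.
  have [Em Ed] := next_branch_mod a0 h3; rewrite Ed in ik rk *; rewrite Em in rq' gq' *.
  apply: (ik); [lra| |lra].
  rewrite iterSr; have [ij rj _] := Jj_contr (s %% a); apply: ij; [lra| |].
    have [hJ EJ] := JP (y := q) ltac:(have := cpI; lra).
    by rewrite -(incr_on_ltE g1o.1) ?Er ?EJ //; lra_on pp qq h2 h.
  by have [] := JP (y := q) ltac:(have := cpI; lra) => /andP[].
have h4 : (s %% a).+1 = a by apply/eqP; rewrite eqn_leq h3 ja.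
have [Em Ed] := next_branch_div a0 h4; rewrite Em in rq' gq' *; rewrite /= in rq' gq' *.
have sb : (s %/ a < b)%N by rewrite ltn_divLR // ltnW.
have Ek : (b - s %/ a = (b - s.+1 %/ a).+1)%N by rewrite Ed subnS prednK // subn_gt0.
have [ik' _ _] := Gk_contr (b - s %/ a).
apply: (@le_lt_trans _ _ (iter (b - s %/ a) G (g0 p))).
  by apply: (incr_on_le ik'); [lra_on rr pp|exact: JjL|apply: (incr_on_le g0o.1); lra_on pp].
by rewrite Ek iterSr G_p; apply: ik; lra.
Qed.

Definition lorenz_of (x : R) := if x < c then g0 x else g1 x.
Local Notation F := lorenz_of.

Definition never_returns : set R :=
  [set x | 0 <= x <= 1 /\ forall k, ~ (p <= iter k F x <= q)].

Hypothesis X0 : forall x, 0 < x < c -> ~ (forall k, 0 < iter k g0 x < c).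
Hypothesis X1 : forall x, c < x < 1 -> ~ (forall k, c < iter k g1 x < 1).

Lemma lorenz_of_range x : 0 <= x <= 1 -> 0 <= F x <= 1.
Proof.
have cc := cI; have cm := cmI; have cp := cpI; move=> xI; rewrite /lorenz_of; case: ltP => xc.
  have := incr_on_le g0o.1 (x := 0) (y := x); have := incr_on_le g0o.1 (x := x) (y := c).
  rewrite g00; lra.
have := incr_on_le g1o.1 (x := c) (y := x); have := incr_on_le g1o.1 (x := x) (y := 1).
rewrite g11; lra.
Qed.

Let N_step k x : never_returns x -> never_returns (iter k F x).
Proof.
move=> [xI xN]; split; last by move=> j; rewrite -iterD; exact: xN.
by elim: k => [//|k IH]; exact: lorenz_of_range.
Qed.

Let N_cases x : never_returns x -> 0 <= x < p \/ q < x <= 1.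
Proof.
move=> [xI /(_ 0%N) /= xN].
have [h|h] := ltP x p; [left; lra|right; have [h2|h2] := ltP q x; [lra|case: xN; lra]].
Qed.

Let A : set R := never_returns `&` [set x | q < x < r].

Let N_r x : never_returns x -> q < x -> x <= r -> A x.
Proof.
move=> xN qx xr; split=> //=; rewrite qx lt_neqAle xr andbT /=; apply/eqP => E.
have [_ /(_ 1%N)] := xN; apply; rewrite /= /lorenz_of E; have [h ->] := rI.
by rewrite ifF; have pp := pI; have qq := qI; [lra|apply/negbTE; rewrite -leNgt; lra].
Qed.

Let right_entry x : never_returns x -> q < x < 1 ->
  exists j, [/\ A (iter j F x), iter j J (iter j F x) = x,
    forall i, (i < j)%N -> r < iter i F x & forall i, (i <= j)%N -> iter i F x = iter i g1 x].
Proof.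
move=> xN xI; have qq := qI; have pp := pI; have [h Er] := rI; have [h2 _] := rsI.
have Fg i : (forall j, (j < i)%N -> r < iter j F x) -> iter i F x = iter i g1 x /\ iter i F x < 1.
  elim: i => [|i IH] H; first by rewrite /=; split=> //; lra.
  have [E l1] := IH (fun j ji => H j (leqW ji)); have ri := H i (leqnn _).
  have EF : F (iter i F x) = g1 (iter i F x) by rewrite /lorenz_of ifF //; apply/negbTE; rewrite -leNgt; lra.
  split; first by rewrite !iterS EF E.
  by rewrite iterS EF; have := @down (iter i F x) ltac:(lra); lra.
have [j0 Hj0] : exists j, ~~ (r < iter j F x).
  apply: contrapT => /forallNP H; apply: (X1 (x := x)); first lra.
  have H' j : r < iter j F x by apply/negPn/negP; exact: H.
  by move=> k; have [<- l1] := Fg k (fun j _ => H' j); have := H' k; lra.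
have [j Hj jmin] := ex_minnP (ex_intro (fun j => ~~ (r < iter j F x)) j0 Hj0).
have lo i : (i < j)%N -> r < iter i F x.
  by move=> ij; apply: contraTT ij => /jmin; rewrite -leqNgt.
exists j; split=> //; last first.
- by move=> i ij; apply: (proj1 (Fg i _)) => k ki; apply: lo; exact: leq_trans ij.
- have : (j <= j)%N by []; elim: {-2}j => [//|i IH] ij.
  rewrite iterSr iterS -[RHS](IH (ltnW ij)); congr (iter _ _ _).
  have ri := lo i ij; have [_ l1] := Fg i (fun k ki => lo k (ltn_trans ki ij)).
  rewrite /lorenz_of ifF; last by apply/negbTE; rewrite -leNgt; lra.
  by apply: inv_onK => //; lra.
- rewrite -leNgt in Hj; apply: N_r => //; first exact: N_step.
  case: j Hj jmin lo => [|i] Hj jmin lo; first by case/andP: xI.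
  have ri := lo i (leqnn _); have [_ l1] := Fg i (fun k ki => lo k (leqW ki)).
  have := N_cases (N_step i.+1 xN); rewrite iterS.
  have -> : F (iter i F x) = g1 (iter i F x) by rewrite /lorenz_of ifF //; apply/negbTE; rewrite -leNgt; lra.
  have : g1 r < g1 (iter i F x) by apply: g1o.1; lra.
  by rewrite Er; lra.
Qed.

Let left_entry x : never_returns x -> 0 < x < p ->
  exists k, [/\ (0 < k)%N, q < iter k F x <= g0 p, iter k G (iter k F x) = x,
    forall i, (i < k)%N -> iter i F x < p & forall i, (i <= k)%N -> iter i F x = iter i g0 x].
Proof.
move=> xN xI; have qq := qI; have pp := pI.
have Fg i : (forall j, (j < i)%N -> iter j F x < p) -> iter i F x = iter i g0 x /\ 0 < iter i F x.
  elim: i => [|i IH] H; first by rewrite /=; split=> //; lra.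
  have [E l1] := IH (fun j ji => H j (leqW ji)); have ri := H i (leqnn _).
  have EF : F (iter i F x) = g0 (iter i F x) by rewrite /lorenz_of ifT //; lra.
  split; first by rewrite !iterS EF E.
  by rewrite iterS EF; have := @up (iter i F x) ltac:(lra); lra.
have [j0 Hj0] : exists j, ~~ (iter j F x < p).
  apply: contrapT => /forallNP H; apply: (X0 (x := x)); first lra.
  have H' j : iter j F x < p by apply/negPn/negP; exact: H.
  by move=> k; have [<- l1] := Fg k (fun j _ => H' j); have := H' k; lra.
have [j Hj jmin] := ex_minnP (ex_intro (fun j => ~~ (iter j F x < p)) j0 Hj0).
have lo i : (i < j)%N -> iter i F x < p.
  by move=> ij; apply: contraTT ij => /jmin; rewrite -leqNgt.
rewrite -leNgt in Hj.
case: j Hj jmin lo => [|i] Hj jmin lo; first by move: Hj; rewrite /=; lra.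
have ri := lo i (leqnn _); have [_ l1] := Fg i (fun k ki => lo k (leqW ki)).
exists i.+1; split=> //.
- have := N_cases (N_step i.+1 xN) => -[|/andP[-> _]]; first lra.
  have -> : iter i.+1 F x = g0 (iter i F x) by rewrite iterS {1}/lorenz_of ifT //; lra.
  by apply: (incr_on_le g0o.1); lra.
- have : (i.+1 <= i.+1)%N by []; elim: {-2}i.+1 => [//|k IH] kj.
  rewrite iterSr iterS -[RHS](IH (ltnW kj)); congr (iter _ _ _).
  have rk := lo k kj; have [_ l1'] := Fg k (fun m mk => lo m (ltn_trans mk kj)).
  rewrite /lorenz_of ifT; last lra.
  by apply: inv_onK => //; lra.
- by move=> k ki; apply: (proj1 (Fg k _)) => m mk; apply: lo; exact: leq_trans ki.
Qed.

Let iter_mono (lo hi : R) g x y k : incr_on lo hi g -> x <= y ->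
  (forall i, (i < k)%N -> lo <= iter i g x <= hi /\ lo <= iter i g y <= hi) -> iter k g x <= iter k g y.
Proof.
move=> gi xy; elim: k => [//|k IH] H; have [h1 h2] := H k (leqnn _).
rewrite !iterS; apply: (incr_on_le gi); [by case/andP: h1| |by case/andP: h2].
by apply: IH => i ik; apply: H; exact: leqW.
Qed.

(** The orbit of y drops below p, climbs by g0 for k steps to a point of ]q, g0 p], then descends by
    g1 for j steps into ]q, r[. Comparison with the orbit of g1 q, at q after b steps, gives k <= b;
    comparison with that of g0 p, at r after a - 1 steps, gives j < a. *)
Let A_return y : A y -> exists s y', [/\ (s < b * a)%N, A y' & y = return_branch s y'].
Proof.
move=> [yN yI]; rewrite /= in yI; have qq := qI; have pp := pI; have [h Er] := rI; have [h2 _] := rsI.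
have cc := cI; have cp := cpI.
have EF : F y = g1 y by rewrite /lorenz_of ifF //; apply/negbTE; rewrite -leNgt; lra.
have g1l : g1 q < g1 y by apply: g1o.1; lra.
have g1u : g1 y < p by rewrite -Er; apply: g1o.1; lra.
have cq : g1 c < g1 q by apply: g1o.1; lra.
have yN' : never_returns (g1 y) by rewrite -EF; exact: (N_step 1).
have [k [k0 zI Gk ki kE]] := left_entry yN' ltac:(lra).
have kb : (k <= b)%N.
  rewrite leqNgt; apply/negP => bk; have := ki b bk; rewrite kE; last exact: ltnW.
  have : iter b g0 (g1 q) <= iter b g0 (g1 y).
    apply: (@iter_mono 0 c g0 (g1 q) (g1 y) b g0o.1 (ltW g1l)) => i ib.
    have /andP[-> /ltW ->] := ro_right RO qI' ib; split=> //.
    rewrite -kE ?(ltnW (ltn_trans ib bk)) //.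
    have /N_cases := N_step i yN'; have := ki i (ltn_trans ib bk); lra.
  by rewrite (ro_fix_q RO); lra.
set z := iter k F (g1 y) in zI Gk.
have pc : g0 p < g0 c by apply: g0o.1; lra.
have [j [Aj Jj jr jE]] := right_entry (N_step k yN') ltac:(rewrite -/z; have := cmI; lra).
have ja : (j < a)%N.
  rewrite ltnNge; apply/negP => aj; have aj' : (a.-1 < j)%N by rewrite prednK.
  have := jr _ aj'; rewrite jE; last exact: ltnW.
  have Lp : g1 (L a.-1 p) = p by rewrite -iterS prednK // (ro_fix_p RO).
  have : iter a.-1 g1 z <= L a.-1 p.
    apply: (@iter_mono c 1 g1 z (g0 p) a.-1 g1o.1); first by case/andP: zI.
    move=> i ia; have ia' : (i < a)%N by rewrite (leq_trans ia) // leq_pred.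
    have /andP[/ltW -> ->] := ro_left RO pI' ia'; split=> //.
    have ij : (i < j)%N by exact: ltn_trans ia aj'.
    rewrite -jE; last exact: ltnW.
    have := jr i ij; have /N_cases := N_step i (N_step k yN'); rewrite -/z; lra.
  have -> : L a.-1 p = r.
    rewrite -{2}Lp inv_onK //; have := ro_left RO pI' (i := a.-1); rewrite prednK // leqnn => /(_ isT).
    by move=> /andP[/ltW -> ->].
  by rewrite -/z; lra.
exists ((b - k) * a + j)%N, (iter j F z); split=> //.
  have : ((b - k).+1 * a <= b * a)%N by rewrite leq_mul // ltn_subrL k0 (leq_trans k0 kb).
  by apply: leq_trans; rewrite mulSn addnC ltn_add2r.
rewrite /return_branch divnMDl // (divn_small ja) addn0 modnMDl (modn_small ja) subKn //.
by rewrite Jj Gk inv_onK //; lra.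
Qed.

Let word w x := foldr return_branch x w.

Let word_contr w : all (fun s => s < b * a)%N w -> cross_contraction c rs c rs (word w).
Proof.
elim: w => [_|s w IH] /=; first by split=> // x0 x1 x2 x3.
by move=> /andP[sn /IH h]; exact: (cross_contraction_comp h (return_branch_contr sn)).
Qed.

(** Nodes are words in the return branches, refined on the innermost side. One Koebe constant for
    all words carries the gaps of a single letter to every scale, so each level loses a fixed
    proportion of length. *)
Lemma never_returns_in_null : lebesgue_null A.
Proof.
have [h Er] := rI; have [h2 _] := rsI; have qq := qI.
have n1 : (1 < b * a)%N by rewrite (leq_trans b1) // leq_pmulr.
have qr : q < r by lra.
have [kappa k0 sp] := @spread_exists _ (fun s => (return_branch s q, return_branch s r)) _ q r n1 qr
  return_branch_sub return_branch_sep.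
pose k := Num.max ((rs - q) / (rs - r)) ((r - c) / (q - c)).
have k1 : 1 <= k.
  rewrite /k le_max ler_pdivlMr; last lra.
  by apply/orP; left; lra.
pose K := k ^+ 2; have K0 : 0 < K by rewrite exprn_gt0; lra.
have dist w : all (fun s => s < b * a)%N w -> distortion_le K q r (word w).
  move=> /word_contr[i1 r1 c1]; apply: (@koebe _ c rs) => //; try lra.
    by rewrite -ler_pdivrMr; [rewrite /k le_max lexx|lra].
  by rewrite -ler_pdivrMr; [rewrite /k le_max lexx orbT|lra].
pose ch (n : nat) (w : seq nat) := [seq rcons w s | s <- iota 0 (b * a)].
pose iv (n : nat) w := (word w q, word w r).
have lev n w : w \in tree_level ch [::] n -> all (fun s => s < b * a)%N w.
  elim: n w => [|n IH] w; first by rewrite /= mem_seq1 => /eqP ->.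
  move=> /flattenP[s /mapP[u un ->] /mapP[i]]; rewrite mem_iota /= add0n => ib ->.
  by rewrite all_rcons ib IH.
have qI3 : c <= q <= rs by lra.
have inc n w : w \in tree_level ch [::] n -> incr_on q r (word w).
  by move=> /lev /word_contr[i1 _ _]; apply: incr_on_sub i1; lra.
have sp' n w : w \in tree_level ch [::] n ->
    spread (kappa / K) (iv n w).1 (iv n w).2 (map (iv n.+1) (ch n w)).
  move=> wn; have := spread_image K0 k0 qr (inc n w wn) (dist w (lev n w wn)) sp.
  rewrite /mkseq -map_comp -map_comp /=; congr (spread _ _ _ _); apply: eq_map => s /=.
  by rewrite /iv /word !foldr_rcons.
have kK0 : 0 < kappa / K by rewrite divr_gt0.
have lt0 n w : w \in tree_level ch [::] n -> (iv n w).1 < (iv n w).2.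
  by move=> wn; apply: (inc n w wn).
have sum n w : w \in tree_level ch [::] n ->
    \sum_(u <- ch n w) ((iv n.+1 u).2 - (iv n.+1 u).1) <= (1 - kappa / K) * ((iv n w).2 - (iv n w).1).
  move=> wn; have := spread_sum kK0 (lt0 n w wn) (sp' n w wn); by rewrite big_map.
apply: (@tree_lebesgue_null _ _ ch [::] A iv (1 - kappa / K)).
- have r0 : [::] \in tree_level ch [::] 0%N by rewrite mem_seq1.
  have := sum 0%N _ r0; have l0 := lt0 0%N _ r0.
  have : 0 <= \sum_(u <- ch 0%N [::]) ((iv 1%N u).2 - (iv 1%N u).1).
    rewrite big_seq; apply: sumr_ge0 => u us; rewrite subr_ge0; apply/ltW/lt0.
    exact: (tree_child r0 us).
  move=> s0 s1; have := le_trans s0 s1; rewrite pmulr_lge0 ?subr_gt0 //; lra.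
- by move=> n w /lt0 /ltW.
- exact: sum.
- have P n x : A x -> exists w y, [/\ w \in tree_level ch [::] n, A y & x = word w y].
    elim: n x => [|n IH] x Ax; first by exists [::], x; rewrite mem_seq1.
    have [w [y [wn Ay ->]]] := IH x Ax; have [s [y' [sn Ay' ->]]] := A_return Ay.
    exists (rcons w s), y'; split=> //; last by rewrite /word foldr_rcons.
    apply: (tree_child wn); apply: map_f; by rewrite mem_iota.
  move=> n x /(P n)[w [y [wn [_ /= yI] ->]]]; exists w => //.
  by have i := inc n w wn; rewrite /iv /= !(incr_on_le i) //; lra.
Qed.

Hypothesis NF : forall S, lebesgue_null S ->
  lebesgue_null [set x | [/\ 0 <= x <= 1, x <> c & S (F x)]].

Lemma never_returns_null : lebesgue_null never_returns.
Proof.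
have qq := qI; have pp := pI; have cc := cI; have cm := cmI.
have nS : lebesgue_null (A `|` ([set 0] `|` [set 1])).
  apply: lebesgue_nullU; first exact: never_returns_in_null.
  by apply: lebesgue_nullU; exact: lebesgue_null1.
have := lebesgue_null_bigcup (fun k => lebesgue_null_preimages lorenz_of_range NF k nS).
apply: lebesgue_nullS => x xN.
suff [k Hk] : exists k, (A `|` ([set 0] `|` [set 1])) (iter k F x).
  exists k => //=; split=> //; first by case: xN.
  by move=> i _ E; case: xN => _ /(_ i); apply; rewrite E; lra.
have right_case y : never_returns y -> q < y <= 1 -> exists k, (A `|` ([set 0] `|` [set 1])) (iter k F y).
  move=> yN yI; have [y1|y1] := ltP y 1; last by exists 0%N; right; right => /=; lra.
  by have [j [Aj _ _ _]] := right_entry yN ltac:(lra); exists j; left.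
have [xI|xI] := N_cases xN; last exact: right_case.
have [x0|x0] := ltP 0 x; last by exists 0%N; right; left => /=; lra.
have [k [k0 zI _ _ _]] := left_entry xN ltac:(lra).
have pc : g0 p < g0 c by apply: g0o.1; lra.
have [j Hj] := right_case _ (N_step k xN) ltac:(lra).
by exists (j + k)%N; rewrite iterD.
Qed.

End ReturnBranches.

(** * Escape from both branches and preimages of null sets *)

Section Escape.
Context {R : realType}.
Variables (al D c m m' : R) (g0 g1 : R -> R) (a b : nat) (p q : R).
Hypothesis PL : power_lorenz al D c m m' g0 g1.
Hypothesis RO : renorm_orbits c g0 g1 a b p q.
Hypothesis LS : level_small al D c g1 b q.
Hypotheses (Dh : D <= 2 - 2 * 2^-1 `^ al) (Dk : D * (9 / 16) `^ (al - 1) < 1).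

Let al1 := pl_al PL. Let D1 := pl_D1 PL. Let c78 := pl_c PL. Let c1 := pl_c1 PL.
Let g00 := pl_g00 PL. Let g11 := pl_g11 PL. Let cmg := pl_cm_gt PL. Let cml := pl_cm_le PL.
Local Notation cm := (g0 c).

Let growth x : 0 <= x -> x <= c / 2 -> cm / c * x <= g0 x.
Proof.
move=> x0 xc; have h1 := al1; have h2 := c78; have h3 := D1; have h4 := Dh.
have c0 : 0 < c by lra.
set t := (c - x) / c.
have tE : t = 1 - x / c by rewrite /t mulrBl divff // gt_eqF.
have xc' : 0 <= x / c <= 1 / 2 by rewrite divr_ge0 ?ler_pdivrMr //; lra.
have t0 : 0 <= t by rewrite tE; lra.
have /andP[lo _] := pl_left PL (lexx 0) x0 ltac:(lra).
rewrite subr0 divff ?gt_eqF // powR1 g00 subr0 -/t in lo.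
apply: le_trans lo; have /andP[_ mD] := left_slope_bounds PL.
have m0 : 0 < m by have := left_slope_gt PL; lra.
(* The tangent at t is evaluated at 1 / 2 and at 1; weights s = 2 (1 - t) and 1 - s cancel the
   linear terms and leave the chord bound for the convex power on [1 / 2, 1]. *)
have T1 := powR_tangent h1 t0 (t := 2^-1) ltac:(lra).
have T2 := powR_tangent h1 t0 ler01; rewrite powR1 in T2.
have : D * (1 - t) <= 1 - t `^ al.
  set s := 2 * (1 - t); have s01 : 0 <= s <= 1 by rewrite /s tE; lra.
  have U1 : s * (al * t `^ (al - 1) * (2^-1 - t)) <= s * (2^-1 `^ al - t `^ al) by apply: ler_wpM2l => //; lra.
  have U2 : (1 - s) * (al * t `^ (al - 1) * (1 - t)) <= (1 - s) * (1 - t `^ al) by apply: ler_wpM2l => //; lra.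
  have E : s * (al * t `^ (al - 1) * (2^-1 - t)) + (1 - s) * (al * t `^ (al - 1) * (1 - t)) = 0.
    by rewrite /s; field.
  have U3 : s * (D / 2) <= s * (1 - 2^-1 `^ al) by apply: ler_wpM2l; lra.
  move: U1 U2 U3 E; rewrite /s; lra.
move=> h; apply: (@le_trans _ _ (m * (D * (1 - t)))); last by rewrite ler_pM2l.
rewrite tE (_ : m * _ = D * m * (x / c)); last by ring.
by rewrite mulrAC -mulrA; apply: ler_wpM2r => //; lra.
Qed.

Let kap := D * (9 / 16) `^ (al - 1).

(** Here the relative height W is at most 9 / 16, because c / 2 >= 7 / 16 and cm <= 1, so W^al <= (9
    / 16)^(al - 1) W. *)
Let approach x : c / 2 <= x -> x <= c -> 1 - g0 x / cm <= kap * (1 - x / cm).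
Proof.
move=> xc xc'; have h1 := al1; have h2 := c78; have h3 := D1; have h4 := cmg; have h5 := cml.
have cm0 : 0 < cm by lra.
have W : 0 <= 1 - x / cm <= 9 / 16.
  have : x / cm <= 1 by rewrite ler_pdivrMr //; lra.
  have : 7 / 16 <= x / cm by rewrite ler_pdivlMr //; lra.
  lra.
apply: (le_trans (left_height_contract PL _)); first lra.
have -> : (1 - x / cm) `^ al = (1 - x / cm) `^ (al - 1) * (1 - x / cm).
  have [W0|W0] := ltP 0 (1 - x / cm).
    have nz : (al - 1 + 1 == 0) ==> (1 - x / cm != 0) by rewrite (gt_eqF W0) implybT.
    by have := powRD nz; rewrite subrK (powRr1 (ltW W0)).
  have -> : 1 - x / cm = 0 by lra.
  by rewrite mulr0 powR0 // gt_eqF //; lra.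
rewrite mulrA; apply: ler_wpM2r; first by case/andP: W.
rewrite /kap ler_pM2l; last lra.
by apply: powR_le; lra.
Qed.

Lemma left_branch_above x : 0 < x <= c -> x < g0 x.
Proof.
move=> xI; have h2 := c78; have h4 := cmg; have h5 := cml; have h6 := Dk.
have c0 : 0 < c by lra.
have [xc|xc] := leP x (c / 2).
  apply: lt_le_trans (growth _ xc); last lra.
  by rewrite ltr_pMl ?ltr_pdivlMr //; lra.
have cm0 : 0 < cm by lra.
have := approach (ltW xc) ltac:(lra).
have W : 0 < 1 - x / cm by rewrite subr_gt0 ltr_pdivrMr //; lra.
have : kap * (1 - x / cm) < 1 - x / cm by rewrite gtr_pMl.
move=> k1 k2; have : x / cm < g0 x / cm by lra.
by rewrite ltr_pM2r ?invr_gt0.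
Qed.

(** Up to c / 2 the orbit grows by the factor cm / c > 1; beyond, its distance to cm shrinks
    geometrically, and cm lies above c. *)
Lemma left_branch_escape x : 0 < x < c -> ~ (forall k, 0 < iter k g0 x < c).
Proof.
move=> xI H; have h2 := c78; have h4 := cmg; have h5 := cml; have h6 := Dk.
have c0 : 0 < c by lra. have cm0 : 0 < cm by lra.
have ccm : 0 <= c / cm < 1 by rewrite divr_ge0 ?ltr_pdivrMr //; lra.
have [k0 Hk0] : exists k, c / 2 < iter k g0 x.
  apply: contrapT => /forallNP N.
  have xk k : x <= (c / cm) ^+ k * iter k g0 x.
    elim: k => [|k IH]; first by rewrite mul1r.
    apply: (le_trans IH); rewrite exprSr -mulrA ler_wpM2l ?exprn_ge0 //; first by case/andP: ccm.
    have /andP[u0 _] := H k; have u1 : iter k g0 x <= c / 2 by rewrite leNgt; apply/negP/N.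
    have := growth (ltW u0) u1; rewrite -iterS => h.
    rewrite -(ler_pM2l (_ : 0 < cm / c)) ?divr_gt0 // mulrA.
    by rewrite (_ : cm / c * (c / cm) = 1) ?mul1r //; field; rewrite !gt_eqF.
  have x0 : 0 < x by lra.
  have [k] := exp_small ccm x0 ler01; rewrite mulr1 => hk.
  have := xk k; have /andP[u0 u1] := H k.
  have : (c / cm) ^+ k * iter k g0 x <= (c / cm) ^+ k * 1.
    by rewrite ler_wpM2l ?exprn_ge0 //; [case/andP: ccm|lra].
  lra.
have big i : c / 2 < iter (i + k0) g0 x.
  elim: i => [//|i IH]; apply: (lt_trans IH); rewrite addSn iterS; apply: left_branch_above.
  by have := H (i + k0)%N; lra.
have kap0 : 0 <= kap < 1 by rewrite Dk mulr_ge0 ?powR_ge0 //; have := D1; lra.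
have Wk i : 1 - iter (i + k0) g0 x / cm <= kap ^+ i * 1.
  elim: i => [|i IH].
    by rewrite mul1r lerBlDr lerDl divr_ge0 //; have := H (0 + k0)%N; lra.
  rewrite addSn iterS; have := approach (ltW (big i)) ltac:(have := H (i + k0)%N; lra).
  move/le_trans; apply; rewrite exprS -mulrA ler_wpM2l //; by case/andP: kap0.
have e0 : 0 < 1 - c / cm by lra.
have [i] := exp_small kap0 e0 ler01; have := Wk i; have := H (i + k0)%N => /andP[_ h].
have : iter (i + k0) g0 x / cm < c / cm by rewrite ltr_pM2r ?invr_gt0.
lra.
Qed.

Let right_double x : c <= x -> x <= 1 -> 1 / 2 <= g1 x -> 2 * (1 - x) <= 1 - g1 x.
Proof.
move=> xc x1 gx; have h := g1_slope_ge PL RO LS xc x1 (lexx 1) gx; rewrite g11 in h.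
apply: le_trans h; apply: ler_wpM2r; first lra.
have e8 := ep_le8 PL RO LS; have h1 := c1.
by rewrite -[leLHS]invrK lef_pV2 ?posrE; lra.
Qed.

Lemma right_branch_below x : c <= x < 1 -> g1 x < x.
Proof.
move=> xI; have h2 := c78; have [gx|gx] := leP (1 / 2) (g1 x); last lra.
by have := right_double (x := x) ltac:(lra) ltac:(lra) gx; lra.
Qed.

Lemma right_branch_escape x : c < x < 1 -> ~ (forall k, c < iter k g1 x < 1).
Proof.
move=> xI H; have h2 := c78.
have xk k : 1 - x <= 2^-1 ^+ k * (1 - iter k g1 x).
  elim: k => [|k IH]; first by rewrite mul1r.
  apply: (le_trans IH); rewrite exprSr -mulrA ler_wpM2l ?exprn_ge0 //.
  have := H k; have := H k.+1; rewrite iterS => u1 u0.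
  by have := right_double (x := iter k g1 x) ltac:(lra) ltac:(lra) ltac:(lra); lra.
have x0 : 0 < 1 - x by lra.
have [k] := exp_small (th := 2^-1) ltac:(lra) x0 ler01; rewrite mulr1 => hk.
have := xk k; have := H k => u0.
have : 2^-1 ^+ k * (1 - iter k g1 x) <= 2^-1 ^+ k * 1.
  by rewrite ler_wpM2l ?exprn_ge0 //; lra.
lra.
Qed.

(** Slopes degenerate only at c. On points at relative distance at least 1 / (j + 1) from c each
    branch expands by a fixed factor, and countably many j exhaust the complement of c. *)
Lemma lorenz_null_preimage S : lebesgue_null S ->
  lebesgue_null [set x | [/\ 0 <= x <= 1, x <> c & S (lorenz_of c g0 g1 x)]].
Proof.
move=> nS; have h1 := al1; have h2 := c78; have h3 := c1.
have c0 : 0 < c by lra.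
have m0 : 0 < m by have := left_slope_gt PL; lra.
have m0' : 0 < m' by have := right_slope_ge34 PL RO LS; lra.
pose A j := [set x | [/\ 0 <= x, j.+1%:R^-1 <= (c - x) / c & S (g0 x)]].
pose B j := [set x | [/\ x <= 1, j.+1%:R^-1 <= (x - c) / (1 - c) & S (g1 x)]].
have nA j : lebesgue_null (A j).
  have j0 : 0 < j.+1%:R^-1 :> R by rewrite invr_gt0.
  pose k := m * (al * j.+1%:R^-1 `^ (al - 1)) / c.
  have k0 : 0 < k by rewrite divr_gt0 // !mulr_gt0 ?powR_gt0 //; lra.
  have E x y : A j x -> A j y -> x <= y -> k * (y - x) <= g0 y - g0 x.
    move=> [x0 xj _] [y0 yj _] xy.
    have yc : y <= c by have := lt_le_trans j0 yj; rewrite pmulr_lgt0 ?invr_gt0 //; lra.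
    have /andP[lo _] := pl_left PL x0 xy yc; apply: le_trans lo.
    have ty0 := ltW (lt_le_trans j0 yj); have tx0 := ltW (lt_le_trans j0 xj).
    have T := powR_tangent h1 ty0 tx0.
    rewrite (_ : k * (y - x) = m * (al * j.+1%:R^-1 `^ (al - 1) * ((c - x) / c - (c - y) / c))); last first.
      by rewrite /k; field; rewrite gt_eqF.
    rewrite ler_pM2l //; apply: le_trans T; apply: ler_wpM2r.
      by rewrite subr_ge0 ler_pM2r ?invr_gt0 //; lra.
    by rewrite ler_pM2l; [apply: powR_le; rewrite ?(ltW j0) //; lra|lra].
  apply: (@lebesgue_null_expanding _ _ S g0 k) => // [x y Ax Ay|x []] //.
  wlog xy : x y Ax Ay / x <= y => [H|].
    by have [xy|/ltW xy] := leP x y; [exact: H|rewrite distrC (distrC (g0 x)); exact: H].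
  rewrite distrC (distrC (g0 x)) ger0_norm ?subr_ge0 //.
  exact: le_trans (E x y Ax Ay xy) (ler_norm _).
have nB j : lebesgue_null (B j).
  have j0 : 0 < j.+1%:R^-1 :> R by rewrite invr_gt0.
  have e0 : 0 < 1 - c by lra.
  pose k := m' * (al * j.+1%:R^-1 `^ (al - 1)) / (1 - c).
  have k0 : 0 < k by rewrite divr_gt0 // !mulr_gt0 ?powR_gt0 //; lra.
  have E x y : B j x -> B j y -> x <= y -> k * (y - x) <= g1 y - g1 x.
    move=> [x0 xj _] [y0 yj _] xy.
    have xc : c <= x by have := lt_le_trans j0 xj; rewrite pmulr_lgt0 ?invr_gt0 //; lra.
    have /andP[lo _] := pl_right PL xc xy y0; apply: le_trans lo.
    have ty0 := ltW (lt_le_trans j0 yj); have tx0 := ltW (lt_le_trans j0 xj).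
    have T := powR_tangent h1 tx0 ty0.
    rewrite (_ : k * (y - x) = m' * (al * j.+1%:R^-1 `^ (al - 1) * ((y - c) / (1 - c) - (x - c) / (1 - c)))); last first.
      by rewrite /k; field; rewrite gt_eqF.
    rewrite ler_pM2l //; apply: le_trans T; apply: ler_wpM2r.
      by rewrite subr_ge0 ler_pM2r ?invr_gt0 //; lra.
    by rewrite ler_pM2l; [apply: powR_le; rewrite ?(ltW j0) //; lra|lra].
  apply: (@lebesgue_null_expanding _ _ S g1 k) => // [x y Ax Ay|x []] //.
  wlog xy : x y Ax Ay / x <= y => [H|].
    by have [xy|/ltW xy] := leP x y; [exact: H|rewrite distrC (distrC (g1 x)); exact: H].
  rewrite distrC (distrC (g1 x)) ger0_norm ?subr_ge0 //.
  exact: le_trans (E x y Ax Ay xy) (ler_norm _).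
apply: lebesgue_nullS (lebesgue_nullU (lebesgue_null_bigcup nA) (lebesgue_null_bigcup nB)).
have arch (t : R) : 0 < t -> exists j : nat, j.+1%:R^-1 <= t.
  move=> t0; exists (Num.truncn t^-1); rewrite -[leRHS]invrK lef_pV2 ?posrE ?invr_gt0 //.
  by rewrite ltW // truncnS_gt.
move=> x [xI xc]; rewrite /lorenz_of; case: ltP => xc' Sx.
  have [|j hj] := arch ((c - x) / c); first by rewrite divr_gt0 //; lra.
  by left; exists j => //; split=> //; lra.
have [|j hj] := arch ((x - c) / (1 - c)).
  by rewrite divr_gt0 ?subr_gt0 // lt_neqAle xc' andbT eq_sym; apply/eqP.
by right; exists j => //; split=> //; lra.
Qed.

End Escape.

(** * The attractor and its basin *)

Lemma node_index_end l k a r : (0 < l)%N -> (0 < r)%N -> (k < a)%N ->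
  ((l + k * r).-1.+1 < l + a * r)%N.
Proof. by move=> l0 r0 ka; rewrite prednK ?addn_gt0 ?l0 // ltn_add2l ltn_pmul2r. Qed.

Lemma node_index_mid l k a r i : (k < a)%N -> (i.+1 < r)%N -> ((l + k * r + i).+1 < l + a * r)%N.
Proof.
move=> ka ir; have := leq_mul2r r k.+1 a; rewrite ka orbT mulSn; lia.
Qed.

Lemma node_index_split l a r i : (0 < r)%N -> (i.+1 < l + a * r)%N ->
  [\/ (i.+1 < l)%N, exists2 s, (s < a)%N & i = (l + s * r).-1 |
      exists s k, [/\ (s < a)%N, (k.+1 < r)%N & i = (l + s * r + k)%N]].
Proof.
move=> r0 il; have [li|li] := ltnP i.+1 l; first by constructor 1.
pose s := ((i.+1 - l) %/ r)%N; pose k := ((i.+1 - l) %% r)%N.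
have E : i.+1 = (l + (s * r + k))%N by rewrite -divn_eq subnKC.
have sa : (s < a)%N by rewrite ltn_divLR // ltn_subLR.
have kr : (k < r)%N by rewrite ltn_mod.
case: (posnP k) => k0; first by constructor 2; exists s => //; move: E; rewrite k0 addn0 => <-.
constructor 3; exists s, k.-1; rewrite prednK //; split=> //; lia.
Qed.

Lemma center_index_left a b s : (s < a)%N ->
  [/\ (a + b - s < b)%N = false, (a + b - s == b)%N = false, (a + b - (a + b - s) = s)%N &
      (a + b - s < (a + b).+1)%N].
Proof. by move=> sa; split; lia. Qed.

Lemma right_index_left a s : (s < a)%N ->
  [/\ (a - s == 0)%N = false, (a - (a - s) = s)%N & (a - s < a.+1)%N].
Proof. by move=> sa; split; lia. Qed.

Lemma left_lipschitz (R : realType) (al D c m m' : R) (g0 g1 : R -> R) x y :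
  power_lorenz al D c m m' g0 g1 -> 0 <= x -> x <= y -> y <= c -> g0 y - g0 x <= 2 * al * (y - x).
Proof.
move=> PL x0 xy yc; have al1 := pl_al PL; have c78 := pl_c PL.
have c0 : 0 < c by lra.
have /andP[mcm _] := left_slope_bounds PL.
have Dm : D * m <= 7 / 6.
  have D1 := pl_D1 PL; have D7 := pl_D PL; have cm1 := pl_cm_le PL.
  apply: (@le_trans _ _ (D * 1)); last by rewrite mulr1.
  by apply: ler_wpM2l; lra.
have Dm0 : 0 <= D * m.
  by have D1 := pl_D1 PL; have := left_slope_gt PL; move=> ?; apply: mulr_ge0; lra.
have /andP[_ h] := pl_left PL x0 xy yc; apply: (le_trans h).
have t0 z : 0 <= z <= c -> 0 <= (c - z) / c <= 1.
  by move=> zI; apply/andP; split; [apply: divr_ge0|rewrite ler_pdivrMr]; lra.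
have /andP[tx0 tx1] := t0 x ltac:(lra); have /andP[ty0 ty1] := t0 y ltac:(lra).
have s1 := powR_secant_le al1 ty0 tx0.
have s2 : ((c - x) / c) `^ (al - 1) <= 1 by apply: powR_le1; lra.
have E : (c - x) / c - (c - y) / c = (y - x) / c by rewrite -mulrBl; congr (_ / c); ring.
have yx0 : 0 <= (y - x) / c by apply: divr_ge0; lra.
have s3 : al * ((c - x) / c) `^ (al - 1) * ((c - x) / c - (c - y) / c) <= al * ((y - x) / c).
  rewrite E -mulrA ler_pM2l; last lra.
  by apply: ler_piMl.
apply: (@le_trans _ _ (7 / 6 * (al * ((y - x) / c)))).
  apply: (@le_trans _ _ (7 / 6 * (((c - x) / c) `^ al - ((c - y) / c) `^ al))).
    apply: ler_wpM2r => //; rewrite subr_ge0; apply: powR_le => //; first lra.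
    by rewrite ler_pM2r ?invr_gt0; lra.
  by apply: ler_wpM2l; lra.
have : (y - x) / c <= 8 / 7 * (y - x).
  by rewrite ler_pdivrMr //; have : 7 / 8 * (y - x) <= c * (y - x); [apply: ler_wpM2r; lra|lra].
move=> h8; have : al * ((y - x) / c) <= al * (8 / 7 * (y - x)) by rewrite ler_pM2l; lra.
have : 0 <= al * (y - x) by apply: mulr_ge0; lra.
lra.
Qed.

Lemma edist_inf_cvg0 (R : realType) (L : set R) (u : nat -> R) :
  (forall e, 0 < e -> exists N, forall k, (N <= k)%N -> exists2 y, L y & `|u k - y| < e) ->
  edist_inf L (u k) @[k --> \oo] --> 0%E.
Proof.
move=> H; have ge0 k := edist_inf_ge0 L (u k).
apply/fine_cvgP; split.
  have [N HN] := H 1 ltr01; exists N => // k /= /HN[y Ly uy].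
  rewrite ge0_fin_numE //; apply: (@le_lt_trans _ _ (1 : R)%:E); last exact: ltry.
  apply: (@le_trans _ _ (edist (u k, y))); first by apply: ereal_inf_lbound; exists y.
  exact: edist_fin.
apply/cvgrPdist_lt => e e0; have e2 : 0 < e / 2 by exact: divr_gt0.
have [N HN] := H _ e2; exists N => // k /= /HN[y Ly uy].
have le : (edist_inf L (u k) <= (e / 2)%:E)%E.
  apply: (@le_trans _ _ (edist (u k, y))); first by apply: ereal_inf_lbound; exists y.
  exact: edist_fin.
have f : edist_inf L (u k) \is a fin_num.
  by rewrite ge0_fin_numE //; apply: le_lt_trans le _; exact: ltry.
rewrite sub0r normrN ger0_norm ?fine_ge0 //.
rewrite -lte_fin fineK //; apply: le_lt_trans le _; rewrite lte_fin.
by rewrite ltr_pdivrMr // mulr_natr mulr2n ltrDl.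
Qed.

(** * The tree of level intervals, its attractor and the basin *)

Section TowerNodes.
Context {R : realType}.
Variables (al sg be : R) (b0 : nat) (c : nat -> R) (g0 g1 : nat -> R -> R) (a b : nat -> nat)
  (p q : nat -> R) (f : R -> R) (mu nu : R).
Hypotheses (al1 : 1 < al) (sg01 : 0 < sg < 1) (be0 : 0 < be < (sg / al) ^+ 2).
Hypothesis LG : large_b0 al sg be b0.
Hypothesis LP : forall n, lorenz_pair (c n) (g0 n) (g1 n).
Hypothesis RN : forall n, renormalizes (c n) (g0 n) (g1 n) (a n) (b n) (p n) (q n)
  (c n.+1) (g0 n.+1) (g1 n.+1).
Hypothesis OM : forall n, Omega al sg be b0 (a n, b n).
Hypotheses (E0 : cross_expanding 0 (c 0%N) (g0 0%N)) (E1 : cross_expanding (c 0%N) 1 (g1 0%N)).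
Hypotheses (mu0 : 0 < mu) (PS0 : left_power_slopes al (expR (2 * delta b0)) (c 0%N) mu (g0 0%N)).
Hypotheses (nu0 : 0 < nu) (PS1 : right_power_slopes al (expR (2 * delta b0)) (c 0%N) nu (g1 0%N)).
Hypothesis fl : forall x, 0 <= x < c 0%N -> f x = g0 0%N x.
Hypothesis fr : forall x, c 0%N < x <= 1 -> f x = g1 0%N x.
Hypotheses (eps_max0 : ln (1 - c 0%N) <= ln_eps_max al sg b0)
  (eps_min0 : ln_eps_min al b0 <= ln (1 - c 0%N)).

Local Notation zoom := (zoom p q).
Local Notation lt := (left_time a b).
Local Notation rt := (right_time a b).
Local Notation L n := (left_orbit (g0 n) (g1 n)).
Local Notation Rr n := (right_orbit (g0 n) (g1 n)).

Let GF := good_level_facts al1 sg01 be0 LG LP RN OM E0 E1 mu0 PS0 nu0 PS1 fl fr eps_max0 eps_min0.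
Let GL := good_levels al1 sg01 be0 LG LP RN OM E0 E1 mu0 PS0 nu0 PS1 fl fr eps_max0 eps_min0.

Let TL n : tower_level b0 c g0 g1 a b p q f n. Proof. exact: (gl_tower (GL n)). Qed.

Let RO n : renorm_orbits (c n) (g0 n) (g1 n) (a n) (b n) (p n) (q n).
Proof. by case: (GF n) => m [m' []]. Qed.

Let zc n z : (zoom n z < c 0%N) = (z < c n).
Proof. by rewrite -(zoom_crit RN n) (zoom_lt RN). Qed.

Let cz n z : (c 0%N < zoom n z) = (c n < z).
Proof. by rewrite -(zoom_crit RN n) (zoom_lt RN). Qed.

Let fR n z : c n < z <= 1 -> f (zoom n z) = g1 0%N (zoom n z).
Proof.
move=> /andP[zc0 z1]; apply: fr; rewrite cz zc0.
by have := LP n => -[/andP[c0 _] _ _ _ _ _ _]; have := zoom_range RN n (x := z); lra.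
Qed.

Let fL n z : 0 <= z < c n -> f (zoom n z) = g0 0%N (zoom n z).
Proof.
move=> /andP[zc0 z1]; apply: fl; rewrite zc z1.
by have := LP n => -[/andP[_ c1] _ _ _ _ _ _]; have := zoom_range RN n (x := z); lra.
Qed.

Let orbL n y : p n <= y <= c n -> 0 <= y <= c n /\
  forall s, (s < a n)%N -> c n < iter s (g1 n) (g0 n y) <= 1.
Proof.
by move=> yI; split; [have := ro_p (RO n); lra|move=> s sa; exact: (ro_left (RO n) yI sa)].
Qed.

Let orbR n y : c n <= y <= q n -> c n <= y <= 1 /\
  forall s, (s < b n)%N -> 0 <= iter s (g0 n) (g1 n y) < c n.
Proof.
by move=> yI; split; [have := ro_q (RO n); lra|move=> s sa; exact: (ro_right (RO n) yI sa)].
Qed.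

Let DR n z : c n < z <= 1 -> c n <= z <= 1. Proof. lra. Qed.
Let DL n z : 0 <= z < c n -> 0 <= z <= c n. Proof. lra. Qed.

Lemma left_orbit_zoom n y s : p n <= y <= c n -> (s <= a n)%N ->
  iter (lt n + s * rt n).-1 f (g0 0%N (zoom n y)) = zoom n (L n s y).
Proof.
exact: (tower_orbit (left_time_gt0 a b n) (right_time_gt0 a b n) (ro_a (RO n)) (tl_left_return (TL n))
  (tl_right_return (TL n)) (@DR n) (@fR n) (@orbL n)).
Qed.

Lemma right_orbit_zoom n y s : c n <= y <= q n -> (s <= b n)%N ->
  iter (rt n + s * lt n).-1 f (g1 0%N (zoom n y)) = zoom n (Rr n s y).
Proof.
exact: (tower_orbit (right_time_gt0 a b n) (left_time_gt0 a b n) (ro_b (RO n)) (tl_right_return (TL n))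
  (tl_left_return (TL n)) (@DL n) (@fL n) (@orbR n)).
Qed.

Lemma left_orbit_zoom_mid n y s i : p n <= y <= c n -> (s < a n)%N ->
  iter (lt n + s * rt n + i) f (g0 0%N (zoom n y)) = iter i f (g1 0%N (zoom n (L n s y))).
Proof.
exact: (tower_orbit_mid (left_time_gt0 a b n) (right_time_gt0 a b n) (ro_a (RO n)) (tl_left_return (TL n))
  (tl_right_return (TL n)) (@DR n) (@fR n) (@orbL n)).
Qed.

Lemma right_orbit_zoom_mid n y s i : c n <= y <= q n -> (s < b n)%N ->
  iter (rt n + s * lt n + i) f (g1 0%N (zoom n y)) = iter i f (g0 0%N (zoom n (Rr n s y))).
Proof.
exact: (tower_orbit_mid (right_time_gt0 a b n) (left_time_gt0 a b n) (ro_b (RO n)) (tl_right_return (TL n))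
  (tl_left_return (TL n)) (@DL n) (@fL n) (@orbR n)).
Qed.

(* None is the return interval C_n, Some (inl i) and Some (inr i) are the
   intervals f^i(g0 [P_n, c]) and f^i(g1 [c, Q_n]). *)
Definition node_interval n (v : option (nat + nat)) : R * R :=
  match v with
  | None => (zoom n 0, zoom n 1)
  | Some (inl i) => (iter i f (g0 0%N (zoom n 0)), iter i f (g0 0%N (zoom n (c n))))
  | Some (inr i) => (iter i f (g1 0%N (zoom n (c n))), iter i f (g1 0%N (zoom n 1)))
  end.

(** The last iterate before the return lies inside C_n and is represented by [None], hence the
    strict bound on i + 1; at level 0 only [None] remains. *)
Definition node n (v : option (nat + nat)) : bool :=
  match v with
  | None => true
  | Some (inl i) => (i.+1 < lt n)%N
  | Some (inr i) => (i.+1 < rt n)%N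
  end.

(** The level n + 1 orbit of the right half enters the left branch of level n at times rt + s lt
    with s < b, that of the left half enters the right branch at times lt + s rt with s < a. Adding
    i gives the positions inside a node; the order follows the pieces of the partition from left to
    right. *)
Definition node_child n (v : option (nat + nat)) s : option (nat + nat) :=
  match v with
  | None => if (s < b n)%N then Some (inr (rt n + s * lt n).-1) else
      if s == b n then None else Some (inl (lt n + (a n + b n - s) * rt n).-1)
  | Some (inl i) => if (s < b n)%N then Some (inr (rt n + s * lt n + i)%N) else v
  | Some (inr i) => if s == 0%N then v else Some (inl (lt n + (a n - s) * rt n + i)%N)
  end.

Definition node_degree n (v : option (nat + nat)) : nat :=
  match v with None => (a n + b n).+1 | Some (inl _) => (b n).+1 | Some (inr _) => (a n).+1 end.

Definition node_children n v := mkseq (node_child n v) (node_degree n v).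

Let zoom_ends n : [/\ zoom n.+1 0 = zoom n (p n), zoom n.+1 (c n.+1) = zoom n (c n) &
  zoom n.+1 1 = zoom n (q n)].
Proof.
rewrite !(zoom_crit RN) !zoomS; split=> //; congr (zoom n _); ring.
Qed.

Let p_in n : p n <= p n <= c n. Proof. by have := ro_p (RO n); lra. Qed.
Let c_in n : p n <= c n <= c n. Proof. by have := ro_p (RO n); lra. Qed.
Let q_in n : c n <= q n <= q n. Proof. by have := ro_q (RO n); lra. Qed.
Let c_in' n : c n <= c n <= q n. Proof. by have := ro_q (RO n); lra. Qed.

Lemma center_children n : map (node_interval n.+1) (node_children n None) =
  [seq (zoom n u.1, zoom n u.2) | u <- mkseq (center_pieces (c n) (g0 n) (g1 n) (a n) (b n) (p n) (q n))
     (a n + b n).+1].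
Proof.
have [z0 z1 z2] := zoom_ends n.
rewrite /node_children /mkseq -!map_comp; apply/eq_in_map => s; rewrite mem_iota add0n [node_degree _ _]/= => sn.
rewrite [LHS]/= [RHS]/=.
rewrite /node_child /center_pieces; case: ltnP => sb.
  by rewrite /= z1 z2 !right_orbit_zoom // ltnW.
case: eqP => sb'; first by rewrite /= z0 z2.
have i' := ltnW (center_index sn sb sb').
by rewrite /= z0 z1 !left_orbit_zoom.
Qed.

Lemma left_children n i e : (forall y, 0 <= y <= c n -> e (g0 n y) = iter i f (g0 0%N (zoom n y))) ->
  map (node_interval n.+1) (node_children n (Some (inl i))) =
  [seq (e u.1, e u.2) | u <- mkseq (left_pieces (c n) (g0 n) (g1 n) (b n) (p n) (q n)) (b n).+1].
Proof.
move=> eE; have [z0 z1 z2] := zoom_ends n.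
rewrite /node_children /mkseq -!map_comp; apply/eq_in_map => s; rewrite mem_iota add0n [node_degree _ _]/= => sn.
rewrite [LHS]/= [RHS]/=.
rewrite /node_child /left_pieces; case: ltnP => sb.
  rewrite /= z1 z2 !right_orbit_zoom_mid // -!eE //; apply: DL.
    by case: (orbR (q_in n)) => _; apply.
  by case: (orbR (c_in' n)) => _; apply.
rewrite /= z0 z1 /left_piece /left_orbit /= !eE //.
  by have := c_in n; have := ro_p (RO n); lra.
by have := c_in n; have := ro_p (RO n); lra.
Qed.

Lemma right_children n i e : (forall y, c n <= y <= 1 -> e (g1 n y) = iter i f (g1 0%N (zoom n y))) ->
  map (node_interval n.+1) (node_children n (Some (inr i))) =
  [seq (e u.1, e u.2) | u <- mkseq (right_pieces (c n) (g0 n) (g1 n) (a n) (p n) (q n)) (a n).+1].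
Proof.
move=> eE; have [z0 z1 z2] := zoom_ends n.
rewrite /node_children /mkseq -!map_comp; apply/eq_in_map => s; rewrite mem_iota add0n [node_degree _ _]/= => sn.
rewrite [LHS]/= [RHS]/=.
rewrite /node_child /right_pieces; case: eqP => s0.
  rewrite /= z1 z2 /right_piece /right_orbit /= !eE //.
    by have := q_in n; have := ro_q (RO n); lra.
  by have := q_in n; have := ro_q (RO n); lra.
have sa : (a n - s < a n)%N by rewrite ltn_subrL lt0n (introN eqP s0) (ro_a (RO n)).
rewrite /= z0 z1 !left_orbit_zoom_mid // /left_piece (subSn (sn : (s <= a n)%N)) /left_orbit !iterS -!eE //; apply: DR.
  by case: (orbL (c_in n)) => _; apply.
by case: (orbL (p_in n)) => _; apply.
Qed.

Local Notation lev := (tree_level node_children None).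

Let lt0 n : (0 < lt n)%N. Proof. exact: left_time_gt0. Qed.
Let rt0 n : (0 < rt n)%N. Proof. exact: right_time_gt0. Qed.

Lemma node_childP n v s : node n v -> (s < node_degree n v)%N -> node n.+1 (node_child n v s).
Proof.
have lS := left_timeS a b n; have rS := right_timeS a b n.
case: v => [[i|i]|] /= vn; rewrite ltnS => sn.
- case: ifP => sb /=; rewrite ?lS ?rS; first exact: node_index_mid.
  by rewrite (leq_trans vn) // leq_addr.
- case: eqP => s0 /=; rewrite ?lS ?rS; first by rewrite (leq_trans vn) // leq_addr.
  by apply: node_index_mid => //; rewrite ltn_subrL lt0n (introN eqP s0) (ro_a (RO n)).
- case: ltnP => sb /=; first by rewrite rS node_index_end.
  case: eqP => sb' //=; rewrite lS node_index_end //.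
  exact: center_index.
Qed.

Lemma node_parent n w : node n.+1 w -> exists2 v, node n v & w \in node_children n v.
Proof.
have mem v s : (s < node_degree n v)%N -> node_child n v s \in node_children n v.
  by move=> sn; apply: map_f; rewrite mem_iota.
case: w => [[i|i]|] /= wn.
- rewrite left_timeS in wn.
  have [il|[s sa ->]|[s [k [sa kr ->]]]] := node_index_split (rt0 n) wn.
  + exists (Some (inl i)) => //; have := mem (Some (inl i)) (b n) (leqnn _).
    by rewrite /= ltnn.
  + exists None => //; have [h1 h2 h3 h4] := center_index_left (b n) sa.
    by have := mem None _ h4; rewrite /= h1 h2 h3.
  + exists (Some (inr k)) => //; have [h1 h2 h3] := right_index_left sa.
    by have := mem (Some (inr k)) _ h3; rewrite /= h1 h2.
- rewrite right_timeS in wn.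
  have [il|[s sa ->]|[s [k [sa kr ->]]]] := node_index_split (lt0 n) wn.
  + exists (Some (inr i)) => //; by have := mem (Some (inr i)) 0%N isT.
  + exists None => //; have := mem None s; rewrite /= sa; apply.
    by rewrite ltnS (leq_trans (ltnW sa)) // leq_addl.
  + exists (Some (inl k)) => //; have := mem (Some (inl k)) s; rewrite /= sa; apply.
    exact: ltnW.
- exists None => //; have := mem None (b n); rewrite /= ltnn eqxx; apply.
  by rewrite ltnS leq_addl.
Qed.

Lemma nodeP n v : (v \in lev n) = node n v.
Proof.
elim: n v => [|n IH] v.
  rewrite /= mem_seq1; case: v => [[i|i]|] //=; by rewrite /left_time /right_time /= ltnS ltn0.
apply/idP/idP => [/flattenP[s /mapP[u un ->] /mapP[k + ->]]|/node_parent[u un vu]].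
  by rewrite mem_iota add0n => kd; apply: node_childP; rewrite -?IH.
by apply: tree_child vu; rewrite IH.
Qed.

Let g0P n y : 0 <= y <= c n -> 0 <= g0 n y <= g0 n (c n).
Proof.
have [/andP[c0 c1] [g0i _] _ g00 _ cm _] := LP n => yI.
by have := incr_on_le g0i (x := 0) (y := y); have := incr_on_le g0i (x := y) (y := c n); rewrite g00; lra.
Qed.

Let g1P n y : c n <= y <= 1 -> g1 n (c n) <= g1 n y <= 1.
Proof.
have [/andP[c0 c1] _ [g1i _] _ g11 cm _] := LP n => yI.
by have := incr_on_le g1i (x := y) (y := 1); have := incr_on_le g1i (x := c n) (y := y); rewrite g11; lra.
Qed.

Let cI n : [/\ 0 < c n, c n < 1, c n < g0 n (c n) <= 1 & 0 <= g1 n (c n) < c n].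
Proof. by have [/andP[]] := LP n. Qed.

(** Membership in a level n interval with a witness that can be followed: [f] preserves it as long
    as the orbit does not meet c. *)
Let node_point n x :=
  [\/ exists2 y, 0 <= y <= 1 & x = zoom n y,
      exists i y, [/\ (i.+1 < lt n)%N, 0 <= y <= c n & x = iter i f (g0 0%N (zoom n y))] |
      exists i y, [/\ (i.+1 < rt n)%N, c n <= y <= 1 & x = iter i f (g1 0%N (zoom n y))]].

Let left_point n i y : (i < lt n)%N -> 0 <= y <= c n -> node_point n (iter i f (g0 0%N (zoom n y))).
Proof.
move=> il yI; have [il'|il'] := ltnP i.+1 (lt n); first by constructor 2; exists i, y.
have Ei : i = (lt n).-1 by apply/eqP; rewrite -eqSS prednK // eqn_leq il il'.
constructor 1; exists (g0 n y); last by rewrite Ei (tl_left_return (TL n)).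
by have := g0P yI; have [_ _ h _] := cI n; move: h; lra.
Qed.

Let right_point n i y : (i < rt n)%N -> c n <= y <= 1 -> node_point n (iter i f (g1 0%N (zoom n y))).
Proof.
move=> il yI; have [il'|il'] := ltnP i.+1 (rt n); first by constructor 3; exists i, y.
have Ei : i = (rt n).-1 by apply/eqP; rewrite -eqSS prednK // eqn_leq il il'.
constructor 1; exists (g1 n y); last by rewrite Ei (tl_right_return (TL n)).
by have := g1P yI; have [_ _ _ h] := cI n; move: h; lra.
Qed.

Let node_point_step n x : node_point n x -> x <> c 0%N -> node_point n (f x).
Proof.
case=> [[y yI ->]|[i [y [il yI ->]]]|[i [y [il yI ->]]]] xc.
- have [yc|yc|yc] := ltgtP y (c n); last by case: xc; rewrite yc (zoom_crit RN).
    by rewrite fL; [apply: (left_point (lt0 n))|]; lra.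
  by rewrite fR; [apply: (right_point (rt0 n))|]; lra.
- by rewrite -iterS; exact: left_point.
- by rewrite -iterS; exact: right_point.
Qed.

Lemma node_pointP n x : node_point n x ->
  exists2 v, node n v & (node_interval n v).1 <= x <= (node_interval n v).2.
Proof.
have [c0 c1 hm hp] := cI n; have g00 := lp_g00 (LP n); have g11 := lp_g11 (LP n).
case=> [[y yI ->]|[i [y [il yI ->]]]|[i [y [il yI ->]]]].
- by exists None => //=; rewrite !(zoom_le RN).
- exists (Some (inl i)) => //=.
  have [e eB eE] := tl_left (TL n) (ltnW il).
  have z0 : 0 <= (0 : R) <= c n by rewrite lexx ltW.
  have zC : 0 <= c n <= c n by rewrite lexx ltW.
  by rewrite -!eE // !(incr_on_le (ib_incr eB)) //; have := g0P yI; have := g0P z0; lra.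
- exists (Some (inr i)) => //=.
  have [e eB eE] := tl_right (TL n) (ltnW il).
  have z0 : c n <= c n <= 1 by rewrite lexx ltW.
  have zC : c n <= 1 <= (1 : R) by rewrite (ltW c1) lexx.
  by rewrite -!eE // !(incr_on_le (ib_incr eB)) //; have := g1P yI; have := g1P z0; lra.
Qed.

Let orbit x : set R := [set y | exists n, y = iter n f x /\
  forall m, (m < n)%N -> iter m f x <> c 0%N].

Let orbit_point n k x : node_point n x -> (forall m, (m < k)%N -> iter m f x <> c 0%N) ->
  node_point n (iter k f x).
Proof.
move=> nx; elim: k => [//|k IH] H; rewrite iterS; apply: node_point_step.
  by apply: IH => m mk; apply: H; exact: leqW.
exact: H.
Qed.

Let Lam : set R := closure (orbit (g0 0%N (c 0%N)) `|` orbit (g1 0%N (c 0%N))).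

Lemma node_union_closed (s : seq (option (nat + nat))) n :
  closed [set x | exists2 v, v \in s & (node_interval n v).1 <= x <= (node_interval n v).2].
Proof.
elim: s => [|u s IH].
  rewrite (_ : [set _ | _] = set0); first exact: closed0.
  by rewrite -subset0 => x [v].
rewrite (_ : [set _ | _] = `[(node_interval n u).1, (node_interval n u).2]%classic `|`
    [set x | exists2 v, v \in s & (node_interval n v).1 <= x <= (node_interval n v).2]).
  by apply: closedU => //; exact: itv_closed.
rewrite eqEsubset; split=> x /=.
  move=> [v]; rewrite inE => /orP[/eqP -> vI|vs vI]; first by left; rewrite /= in_itv.
  by right; exists v.
rewrite in_itv /= => -[uI|[v vs vI]]; first by exists u => //; exact: mem_head.
by exists v => //; rewrite inE vs orbT.
Qed.

Let lam_node_point n x : (orbit (g0 0%N (c 0%N)) `|` orbit (g1 0%N (c 0%N))) x -> node_point n x.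
Proof.
have [c0 c1 _ _] := cI n.
have hl := left_point (lt0 n) (y := c n); have hr := right_point (rt0 n) (y := c n).
rewrite !(zoom_crit RN) /= lexx (ltW c0) (ltW c1) in hl hr.
by case=> -[k [-> H]]; apply: orbit_point => //; [exact: hl|exact: hr].
Qed.

Lemma nodes_cover n (x : R) : Lam x ->
  exists2 v, v \in lev n & (node_interval n v).1 <= x <= (node_interval n v).2.
Proof.
move=> Lx; suff : closure [set x | exists2 v, v \in lev n & (node_interval n v).1 <= x <= (node_interval n v).2] x.
  by move/(node_union_closed (s := lev n)).
move=> U /Lx[y [Oy Uy]]; exists y; split=> //.
by have [v vn vI] := node_pointP (lam_node_point n Oy); exists v => //; rewrite nodeP.
Qed.

(** Every node contains an iterate of a critical value: one end of each orbit interval, and for C_n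
    the first return of g0 c. The avoidance fields guarantee that the critical orbit has not stopped
    before. *)
Lemma nodes_meet n v : v \in lev n ->
  exists2 x, Lam x & (node_interval n v).1 <= x <= (node_interval n v).2.
Proof.
have [c0 c1 hm hp] := cI n; have g00 := lp_g00 (LP n); have g11 := lp_g11 (LP n).
have z0 : 0 <= c n <= c n by rewrite lexx ltW.
have z1 : c n <= c n <= 1 by rewrite lexx ltW.
have z2 : 0 <= (0 : R) <= c n by rewrite lexx ltW.
have z3 : c n <= 1 <= (1 : R) by rewrite (ltW c1) lexx.
have Ll i : (i < lt n)%N -> Lam (iter i f (g0 0%N (zoom n (c n)))).
  move=> il; apply: subset_closure; left; exists i; split=> [|m mi]; first by rewrite (zoom_crit RN).
  have := tl_left_avoid (TL n) (i := m) _ z0; rewrite (zoom_crit RN); apply; by rewrite ltn_predRL (leq_ltn_trans mi).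
have Lr i : (i < rt n)%N -> Lam (iter i f (g1 0%N (zoom n (c n)))).
  move=> il; apply: subset_closure; right; exists i; split=> [|m mi]; first by rewrite (zoom_crit RN).
  have := tl_right_avoid (TL n) (i := m) _ z1; rewrite (zoom_crit RN); apply; by rewrite ltn_predRL (leq_ltn_trans mi).
rewrite nodeP; case: v => [[i|i]|] /= vn.
- exists (iter i f (g0 0%N (zoom n (c n)))); first by apply: Ll; exact: ltnW.
  have [e eB eE] := tl_left (TL n) (ltnW vn).
  by rewrite lexx andbT -!eE //; apply: (incr_on_le (ib_incr eB)); lra.
- exists (iter i f (g1 0%N (zoom n (c n)))); first by apply: Lr; exact: ltnW.
  have [e eB eE] := tl_right (TL n) (ltnW vn).
  by rewrite lexx /= -!eE //; apply: (incr_on_le (ib_incr eB)); lra.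
- exists (zoom n (g0 n (c n))).
    by rewrite -(tl_left_return (TL n)) //; apply: Ll; rewrite prednK.
  by rewrite !(zoom_le RN); lra.
Qed.

Let emin : R := expR (ln_eps_min al b0).
Let lmin : R := expR ((2 * al * ln_eps_min al b0 - geometry_const al) / (al - 1)).

Let eps_ge n : emin <= 1 - c n.
Proof.
have [_ c1 _ _] := cI n; rewrite -[leRHS]lnK ?posrE ?subr_gt0 // ler_expR.
exact: (gl_min (GL n)).
Qed.

Let left_len_ge n : lmin <= c n - p n.
Proof.
have [m [m' [PL RO' LS _]]] := GF n; have h := al1.
have l0 : 0 < c n - p n by have := ro_p RO'; lra.
have e0 : ln (1 - c n) <= 0 by apply: ln_le0; have [? _ _ _] := cI n; lra.
have a2 : (a n)%:R <= 2 * al.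
  have [+ _] := OM n; rewrite /= -natr1; have := sg01; lra.
have := ln_left_ge PL RO' LS a2; have := gl_min (GL n) => eL h1.
rewrite -[leRHS]lnK ?posrE // ler_expR ler_pdivrMr; last lra.
rewrite (mulrC _ (al - 1)); apply: le_trans h1; rewrite lerD2r.
apply: (@le_trans _ _ (2 * al * ln (1 - c n))); first by rewrite ler_pM2l //; lra.
by apply: ler_wnM2r.
Qed.

Let right_len_ge n : emin * lmin <= q n - c n.
Proof.
have [c0 c1 _ _] := cI n.+1; have := RN n => -[_ _ pI qI hc _ _ _ _].
have qp : c n - p n <= q n - p n by lra.
have E : q n - c n = (q n - p n) * (1 - c n.+1) by rewrite -{1}hc; ring.
rewrite E mulrC; apply: ler_pM; rewrite ?expR_ge0 ?eps_ge //.
by apply: le_trans qp; exact: left_len_ge.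
Qed.

(** One number dominating, at all levels, the Lipschitz constants of both branches and the inverses
    of the lengths of the two halves and of the gap between g1 q and p. *)
Let bound : R := 2 + 2 * al / emin + lmin^-1 + (emin * lmin)^-1 + 2 * al.

Let bound_facts n : [/\ 1 <= bound,
  forall x y, 0 <= x -> x <= y -> y <= c n -> g0 n y - g0 n x <= bound * (y - x),
  forall x y, c n <= x -> x <= y -> y <= 1 -> g1 n y - g1 n x <= bound * (y - x),
  bound^-1 <= p n - g1 n (q n) &
  bound^-1 <= c n - p n /\ bound^-1 <= q n - c n].
Proof.
have [m [m' [PL RO' LS _]]] := GF n; have h := al1.
have em0 : 0 < emin by exact: expR_gt0.
have lm0 : 0 < lmin by exact: expR_gt0.
have t1 : 0 < 2 * al / emin by rewrite divr_gt0 //; lra.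
have t2 : 0 < lmin^-1 by rewrite invr_gt0.
have t3 : 0 < (emin * lmin)^-1 by rewrite invr_gt0 mulr_gt0.
have inv x : 0 < x -> x^-1 <= bound -> bound^-1 <= x.
  by move=> x0 xb; rewrite -[leRHS]invrK lef_pV2 // posrE ?invr_gt0 // /bound; lra.
have e1 := eps_ge n.
split.
- rewrite /bound; lra.
- move=> x y x0 xy yc; apply: (le_trans (left_lipschitz PL x0 xy yc)).
  by apply: ler_wpM2r; rewrite /bound; lra.
- move=> x y x0 xy yc; apply: (le_trans (g1_slope_le PL RO' LS x0 xy yc)).
  apply: ler_wpM2r; first lra.
  have : 2 * al / (1 - c n) <= 2 * al / emin.
    rewrite ler_pM2l; last lra.
    by rewrite lef_pV2 // posrE; lra.
  by rewrite /bound; lra.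
- have := return_left_ge PL RO' LS; have := g1q_le8 PL RO' LS => h1 h2.
  apply: (@le_trans _ _ (1 / 2)); last lra.
  by apply: inv; [|rewrite div1r invrK /bound]; lra.
- split.
    by apply: le_trans (left_len_ge n); apply: inv => //; rewrite /bound; lra.
  apply: le_trans (right_len_ge n); apply: inv; rewrite ?mulr_gt0 //.
  by rewrite /bound; lra.
Qed.

Lemma node_spread : exists2 kappa, 0 < kappa & forall n v, v \in lev n ->
  spread kappa (node_interval n v).1 (node_interval n v).2
    (map (node_interval n.+1) (node_children n v)).
Proof.
have [N hN] : exists N, forall n, (a n + b n + 3 <= N)%N.
  pose A := Num.truncn (2 * al).
  exists (A + 2 * b0 + 3)%N => n; rewrite leq_add2r leq_add //.
    rewrite truncn_ge_nat; last by have := al1; lra.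
    by have [+ _] := OM n; rewrite /= -natr1; have := sg01; lra.
  rewrite -(ler_nat R) natrM; have [_ /andP[_ /= h]] := OM n; apply: (le_trans h).
  apply: ler_wpM2r => //; have := be0; have : (sg / al) ^+ 2 <= 1; last lra.
  apply: exprn_ile1; first by apply: divr_ge0; have := al1; have := sg01; lra.
  by rewrite ler_pdivrMr; have := al1; have := sg01; lra.
pose K := expR (delta b0) : R.
have K0 : 0 < K by exact: expR_gt0.
have [b1 _ _ _ _] := bound_facts 0%N.
have bi : 0 < bound^-1 <= 1 by rewrite invr_gt0 invf_le1; lra.
have K1 : 1 <= K by rewrite -expR0 ler_expR; exact: delta_ge0.
exists (bound^-1 ^+ N / K).
  by rewrite divr_gt0 // exprn_gt0 //; case/andP: bi.
move=> n v; rewrite nodeP => vn.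
have [_ l0 l1 h1 [h2 h3]] := bound_facts n.
have [cI0 g0i g1i g00 g11 cmI cpI] := LP n.
have kk : bound^-1 ^+ N <= bound^-1 ^+ (a n + b n + 3).
  by rewrite ler_wiXn2l //; case/andP: bi => [/ltW].
have k0 : 0 < bound^-1 ^+ (a n + b n + 3) by rewrite exprn_gt0 //; case/andP: bi.
have down k lo hi s : lo < hi -> spread (bound^-1 ^+ (a n + b n + 3) / K) lo hi s ->
    spread (bound^-1 ^+ N / K) lo hi s.
  move=> lh; apply: spread_le; first exact: ltW.
  by rewrite ler_pM2r ?invr_gt0.
have via e u w s' : incr_on 0 1 e -> distortion_le K 0 1 e -> 0 <= u -> u < w -> w <= 1 ->
    spread (bound^-1 ^+ (a n + b n + 3)) u w s' ->
    spread (bound^-1 ^+ N / K) (e u) (e w) [seq (e v.1, e v.2) | v <- s'].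
  move=> ei ed u0 uw w1 /(spread_image K0 k0 uw (incr_on_sub u0 w1 ei) (distortion_le_sub u0 w1 ed)).
  by apply: down; apply: ei.
case: v vn => [[i|i]|] vn.
- have [e eB eE] := tl_left (TL n) (ltnW vn).
  rewrite (left_children eE) [(node_interval _ _).1]/= [(node_interval _ _).2]/= -!eE ?g00; [|by rewrite (ltW (proj1 (andP cI0))) lexx|by rewrite (ltW (proj1 (andP cI0))) lexx].
  apply: (via e 0 (g0 n (c n))); [exact: ib_incr eB|exact: ib_dist eB|by []|lra|by case/andP: cmI|].
  exact: (left_spread b1 g0i.1 g1i.1 (RO n) l0 l1 (proj2 (andP cmI)) h1 h2 h3).
- have [e eB eE] := tl_right (TL n) (ltnW vn).
  rewrite (right_children eE) [(node_interval _ _).1]/= [(node_interval _ _).2]/= -!eE ?g11; [|lra|lra].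
  apply: (via e (g1 n (c n)) 1); [exact: ib_incr eB|exact: ib_dist eB|by case/andP: cpI|lra|by []|].
  exact: (right_spread b1 g0i.1 g1i.1 (RO n) l0 l1 (proj1 (andP cpI)) h1 h2 h3).
- rewrite center_children [(node_interval _ _).1]/= [(node_interval _ _).2]/=.
  apply: (via (zoom n) 0 1); [|move=> x y z w *|by []|exact: ltr01|by []|].
  + by move=> x y _ xy _; rewrite (zoom_lt RN).
  + have -> : (zoom n y - zoom n x) * (w - z) = (zoom n w - zoom n z) * (y - x).
      by rewrite /zoom; ring.
    by apply: ler_peMl => //; apply: mulr_ge0; rewrite subr_ge0 ?(zoom_le RN) ltW.
  + exact: (center_spread b1 g0i.1 g1i.1 (RO n) l0 l1 h1 h2 h3).
Qed.

Theorem tower_attractor : [/\ cantor_set Lam, lebesgue_null Lam & (0 < hausdorff_dim Lam < 1)%E].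
Proof.
have [kappa k0 sp] := node_spread.
have iv0 : node_interval 0 None = (0, 1) by rewrite /= !zoom0.
have Lc : closed Lam by exact: closed_closure.
split.
- exact: (cantor_tree_cantor k0 iv0 Lc sp nodes_cover nodes_meet).
- exact: (cantor_null k0 iv0 sp nodes_cover).
- rewrite (cantor_dim_gt0 k0 iv0 Lc sp nodes_meet).
  exact: (cantor_dim_lt1 k0 iv0 sp nodes_cover).
Qed.

(** After a visit to C_n the orbit stays in level n intervals, each of which meets the attractor and
    has length at most (1 - kappa)^n. *)
Lemma tower_basin x : (forall k, iter k f x <> c 0%N) ->
  (forall n, exists k, zoom n 0 <= iter k f x <= zoom n 1) ->
  forall e, 0 < e -> exists N, forall k, (N <= k)%N -> exists2 y, Lam y & `|iter k f x - y| < e.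
Proof.
move=> xc xI e e0; have [kappa k0 sp] := node_spread.
have iv0 : node_interval 0 None = (0, 1) by rewrite /= !zoom0.
have th : 0 <= 1 - kappa < 1 by have := kappa_le13 k0 iv0 sp; lra.
have [n] := exp_small th e0 ler01; rewrite mulr1 => ne.
have [K KI] := xI n; exists K => k Kk.
have nK : node_point n (iter K f x).
  have d0 : 0 < zoom n 1 - zoom n 0 by rewrite subr_gt0 (zoom_lt RN).
  constructor 1; exists ((iter K f x - zoom n 0) / (zoom n 1 - zoom n 0)).
    by rewrite divr_ge0 ?ler_pdivrMr //; lra.
  set t := _ / _; have : t * (zoom n 1 - zoom n 0) = iter K f x - zoom n 0 by rewrite divfK // gt_eqF.
  by rewrite /zoom; lra.
have nk : node_point n (iter k f x).
  rewrite -(subnK Kk) iterD; apply: orbit_point => // m _.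
  by rewrite -iterD; exact: xc.
have [v vn vI] := node_pointP nk.
have vl : v \in lev n by rewrite nodeP.
have [y Ly yI] := nodes_meet vl; exists y => //.
have := tree_len_le k0 iv0 sp vl; rewrite ltr_norml; lra.
Qed.

Local Notation F n := (lorenz_of (c n) (g0 n) (g1 n)).

Let level_null n : lebesgue_null (never_returns (c n) (g0 n) (g1 n) (p n) (q n)) /\
  forall S, lebesgue_null S -> lebesgue_null [set x | [/\ 0 <= x <= 1, x <> c n & S (F n x)]].
Proof.
have [m [m' [PL RO' LS _]]] := GF n.
have [h0 h1] := tower_cross_expanding LP RN E0 E1 n.
have NF := lorenz_null_preimage PL RO' LS; split=> //.
have b1 : (1 < b n)%N.
  apply: (leq_trans (lg_pos LG)); rewrite -(ler_nat R); by have [_ /andP[]] := OM n.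
have gq : g1 n (q n) < p n.
  by have := return_left_ge PL RO' LS; have := g1q_le8 PL RO' LS; lra.
apply: (never_returns_null (LP n) RO' h0 h1 b1 gq) => //.
- exact: (left_branch_above PL (lg_half LG) (lg_escape LG)).
- exact: (right_branch_below PL RO' LS).
- exact: (left_branch_escape PL (lg_half LG) (lg_escape LG)).
- exact: (right_branch_escape PL RO' LS).
Qed.

Let iter_lorenz x k : 0 <= x <= 1 -> (forall i, (i < k)%N -> iter i f x <> c 0%N) ->
  iter k f x = iter k (F 0%N) x /\ 0 <= iter k f x <= 1.
Proof.
move=> xI; elim: k => [//|k IH] H.
have [E yI] := IH (fun i ik => H i (leqW ik)); have yc := H k (leqnn _).
have EF : f (iter k f x) = F 0%N (iter k f x).
  rewrite /lorenz_of; case: ltP => h; first by rewrite fl //; lra.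
  by rewrite fr // lt_neqAle eq_sym h andbT; apply/andP; split; [apply/eqP|lra].
rewrite !iterS EF -E; split=> //; exact: (lorenz_of_range (LP 0%N)).
Qed.

(** Orbits of the level n map, zoomed, are subsequences of orbits of [f], so an [f] orbit missing
    C_(n + 1) gives a level n orbit missing [p, q]. *)
Let return_visits n z : 0 <= z <= 1 -> (forall i, iter i f (zoom n z) <> c 0%N) ->
  forall k, exists m, iter m f (zoom n z) = zoom n (iter k (F n) z).
Proof.
move=> zI H; elim=> [|k [m Hm]]; first by exists 0%N.
have wI : 0 <= iter k (F n) z <= 1.
  by elim: (k) => [//|j IH]; rewrite iterS; exact: (lorenz_of_range (LP n)).
have wc : iter k (F n) z <> c n by move=> E; apply: (H m); rewrite Hm E (zoom_crit RN).
rewrite iterS /lorenz_of -/(F n); case: ltP => h.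
  exists ((lt n).-1 + m.+1)%N; rewrite iterD iterS Hm fL; last lra.
  by rewrite (tl_left_return (TL n)) //; lra.
exists ((rt n).-1 + m.+1)%N; rewrite iterD iterS Hm fR; last first.
  by rewrite lt_neqAle eq_sym h andbT; apply/andP; split; [apply/eqP|lra].
by rewrite (tl_right_return (TL n)) //; lra.
Qed.

Let zoom_null n S : lebesgue_null S -> lebesgue_null [set y | exists2 z, S z & y = zoom n z].
Proof.
move=> nS; have d0 : 0 < zoom n 1 - zoom n 0 by rewrite subr_gt0 (zoom_lt RN).
have zd z : zoom n z = zoom n 0 + (zoom n 1 - zoom n 0) * z by rewrite /zoom; ring.
apply: (@lebesgue_null_expanding _ _ S (fun y => (y - zoom n 0) / (zoom n 1 - zoom n 0))
  (zoom n 1 - zoom n 0)^-1) => //; first by rewrite invr_gt0.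
  move=> y y' _ _; rewrite -mulrBl normrM (ger0_norm (x := _^-1)) ?invr_ge0 ?(ltW d0) //.
  by rewrite mulrC; rewrite (_ : y - _ - _ = y - y') //; ring.
move=> _ [z Sz ->]; rewrite (_ : _ / _ = z) // {1}zd; field; rewrite gt_eqF //; lra.
Qed.

Theorem tower_basin_null : lebesgue_null [set x | 0 <= x <= 1 /\
  ~ ((forall k, iter k f x <> c 0%N) /\ edist_inf Lam (iter k f x) @[k --> \oo] --> 0%E)].
Proof.
have [_ NF0] := level_null 0.
have F0 := lorenz_of_range (LP 0%N).
pose T n := [set y | exists2 z, never_returns (c n) (g0 n) (g1 n) (p n) (q n) z & y = zoom n z].
have nT n : lebesgue_null (T n) by apply: zoom_null; case: (level_null n).
have P k S : lebesgue_null S -> _ := @lebesgue_null_preimages _ _ _ F0 NF0 k S.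
have n1 := lebesgue_null_bigcup (fun k => P k _ (lebesgue_null1 (c 0%N))).
have n2 := lebesgue_null_bigcup (fun n => lebesgue_null_bigcup (fun k => P k _ (nT n))).
apply: lebesgue_nullS (lebesgue_nullU n1 n2) => x [xI xB].
have [xc|xc] := pselect (forall k, iter k f x <> c 0%N); last first.
  left; have [k0 Hk0] : exists k, iter k f x == c 0%N.
    by apply: contrapT => /forallNP H; apply: xc => k E; apply: (H k); apply/eqP.
  have [k /eqP Hk kmin] := ex_minnP (ex_intro (fun k => iter k f x == c 0%N) k0 Hk0).
  have lo i : (i < k)%N -> iter i f x <> c 0%N.
    by move=> ik /eqP E; have := kmin i E; rewrite leqNgt ik.
  exists k => //; have It i : (i <= k)%N -> iter i f x = iter i (F 0%N) x.
    by move=> ik; apply: (proj1 (iter_lorenz xI _)) => j ji; apply: lo; exact: leq_trans ik.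
  split=> //; [by move=> i ik; rewrite -It ?(ltnW ik) //; exact: lo|by rewrite /= -It].
right; have It i : iter i f x = iter i (F 0%N) x by apply: (proj1 (iter_lorenz xI _)) => j _.
have [N HN] : exists n, ~ exists k, zoom n 0 <= iter k f x <= zoom n 1.
  apply: contrapT => /forallNP H; apply: xB; split=> //; apply: edist_inf_cvg0.
  by apply: tower_basin => // n; exact: contrapT (H n).
(* The first level never visited is n + 1 for some n, since C_0 is [0, 1]. A visit to C_n then
   places x in a preimage of the null set of level n points that never return. *)
have [N1 nN1 Nmin] := ex_minnP (ex_intro (fun n => `[< ~ exists k, zoom n 0 <= iter k f x <= zoom n 1 >]) N (introT (asboolP _) HN)).
case: N1 nN1 Nmin => [/asboolP h _|n /asboolP h Nmin].
  by case: h; exists 0%N; rewrite !zoom0.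
have [k Hk] : exists k, zoom n 0 <= iter k f x <= zoom n 1.
  apply: contrapT => h'; have := Nmin n (introT (asboolP _) h'); by rewrite ltnn.
exists n => //; exists k => //=; split=> //; first by move=> i _; rewrite -It; exact: xc.
rewrite -It; pose z := (iter k f x - zoom n 0) / (zoom n 1 - zoom n 0).
have d0 : 0 < zoom n 1 - zoom n 0 by rewrite subr_gt0 (zoom_lt RN).
have Ez : iter k f x = zoom n z.
  have : z * (zoom n 1 - zoom n 0) = iter k f x - zoom n 0 by rewrite divfK // gt_eqF.
  by rewrite /zoom; lra.
have zI : 0 <= z <= 1 by rewrite divr_ge0 ?ler_pdivrMr //; lra.
exists z => //; split=> // j jI.
have zc' i : iter i f (zoom n z) <> c 0%N by rewrite -Ez -iterD; exact: xc.
have [m Hm] := return_visits zI zc' j.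
apply: h; exists (m + k)%N; rewrite iterD Ez Hm.
have [-> _ ->] := zoom_ends n; by rewrite !(zoom_le RN).
Qed.

End TowerNodes.

(** * Large parameters *)

Section LargeParameter.
Context {R : realType}.

Definition eventually (P : nat -> Prop) := exists B, forall n, (B <= n)%N -> P n.

Lemma eventually_and (P Q : nat -> Prop) :
  eventually P -> eventually Q -> eventually (fun n => P n /\ Q n).
Proof.
move=> [B HB] [C HC]; exists (maxn B C) => n; rewrite geq_max => /andP[h1 h2].
by split; [exact: HB|exact: HC].
Qed.

Lemma eventually_ge (M : R) : eventually (fun n => M <= n%:R).
Proof.
exists (Num.truncn M).+1 => n h; apply: le_trans (ltW (truncnS_gt M)) _.
by rewrite ler_nat.
Qed.

Lemma ln_le_id (x : R) : 0 < x -> ln x <= x.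
Proof. by move=> x0; have := expR_ge1Dx (ln x); rewrite lnK ?posrE //; lra. Qed.

Lemma eventually_ln_le (e : R) : 0 < e -> eventually (fun n => ln n%:R <= e * n%:R).
Proof.
move=> e0; have [B HB] := eventually_ge (- ln (e / 2) / (e / 2)).
exists B.+1 => n Bn; have n0 : 0 < n%:R :> R by rewrite ltr0n (leq_trans _ Bn).
have h := HB n (ltnW Bn); rewrite ler_pdivrMr in h; last lra.
have e2 : 0 < e / 2 by lra.
have : ln (n%:R * (e / 2)) <= n%:R * (e / 2) by apply: ln_le_id; rewrite mulr_gt0.
by rewrite lnM ?posrE //; lra.
Qed.

Lemma eventually_exp_le (A k e : R) : 0 < k -> 0 < e ->
  eventually (fun n => n%:R * expR (A - k * n%:R) <= e).
Proof.
move=> k0 e0; have [B HB] := eventually_ln_le (e := k / 2) ltac:(lra).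
have [C HC] := eventually_ge ((A - ln e) / (k / 2)).
exists (maxn B C).+1 => n; rewrite gtn_max => /andP[h1 h2].
have n0 : 0 < n%:R :> R by rewrite ltr0n (leq_trans _ h1).
have H1 := HB n (ltnW h1); have := HC n (ltnW h2); rewrite ler_pdivrMr; last lra.
move=> H2; rewrite -{1}(lnK (x := n%:R)) ?posrE // -expRD -[leRHS]lnK ?posrE // ler_expR; lra.
Qed.

Lemma powR_half_lt1 (al x : R) : 0 < al -> 0 < x < 1 -> x `^ al < 1.
Proof.
move=> al0 /andP[x0 x1]; have := powR_lt al0 (ltW x0) x1; by rewrite powR1.
Qed.

Lemma delta_le (n : nat) : (0 < n)%N -> delta n <= n%:R^-1 :> R.
Proof.
move=> n0; rewrite /delta div1r expr2 -[leRHS]mulr1; apply: ler_wpM2l; rewrite ?invr_ge0 //.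
by rewrite invf_le1 ?ltr0n // ler1n.
Qed.

Lemma eventually_delta (k e : R) : 0 < k -> 0 < e -> eventually (fun n => k * delta n <= e).
Proof.
move=> k0 e0; have [B HB] := eventually_ge (k / e).
exists B.+1 => n Bn; have n0 : (0 < n)%N by exact: leq_trans Bn.
have n0' : 0 < n%:R :> R by rewrite ltr0n.
apply: (@le_trans _ _ (k * n%:R^-1)); first by rewrite ler_pM2l // delta_le.
by rewrite ler_pdivrMr // mulrC -ler_pdivrMr // HB // ltnW.
Qed.

Lemma eventually_distortion (e : R) : 0 < e -> eventually (fun n => distortion n <= 1 + e).
Proof.
move=> e0; have l0 : 0 < ln (1 + e) by rewrite ln_gt0; lra.
have [B HB] := @eventually_delta 4 (ln (1 + e)) ltac:(lra) l0; exists B => n /HB h.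
by rewrite /distortion -[leRHS]lnK ?posrE ?ler_expR //; lra.
Qed.

Lemma eventually_affine_le (k A : R) : 0 < k -> eventually (fun n => A <= k * n%:R).
Proof.
by move=> k0; have [B HB] := eventually_ge (A / k); exists B => n /HB; rewrite ler_pdivrMr // mulrC.
Qed.

Lemma eventuallyW (P Q : nat -> Prop) : (forall n, P n -> Q n) -> eventually P -> eventually Q.
Proof. by move=> PQ [B HB]; exists B => n /HB /PQ. Qed.

Lemma eventually_half (al : R) : 1 < al -> eventually (fun n => distortion n <= 2 - 2 * 2^-1 `^ al).
Proof.
move=> al1; have al0 : 0 < al by lra.
have i2 : 0 < 2^-1 :> R by [].
have half : 0 < 1 - 2 * 2^-1 `^ al.
  have h := powR_half_lt1 (al := al - 1) (x := 2^-1) ltac:(lra) ltac:(lra).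
  by rewrite -(mulr_powRB1 (ltW i2) al0); lra.
by apply: eventuallyW (eventually_distortion half) => n; lra.
Qed.

Lemma eventually_escape (al : R) : 1 < al ->
  eventually (fun n => distortion n * (9 / 16) `^ (al - 1) < 1).
Proof.
move=> al1; set k := _ `^ _; have k0 : 0 < k by rewrite powR_gt0.
have k1 : k < 1 by apply: powR_half_lt1; lra.
have e0 : 0 < (1 - k) / (2 * k) by rewrite divr_gt0; lra.
apply: eventuallyW (eventually_distortion e0) => n; rewrite -(ler_pM2r k0).
rewrite mulrDl mul1r (_ : _ / _ * _ = (1 - k) / 2); first lra.
by field; rewrite gt_eqF.
Qed.

(** The left side is exp (8 / n): the square in delta = 1 / n^2 is what beats a number of steps of
    order n. *)
Lemma eventually_distortion_power : eventually (fun n => distortion n ^+ (2 * n) <= 2 :> R).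
Proof.
have ln2 : 0 < ln 2 :> R by rewrite ln_gt0 // ltr1n.
apply: eventuallyW (eventually_and (eventually_affine_le 8 ln2) (eventually_ge 1)) => n [h n1].
have E8 : n%:R * delta n = n%:R^-1 :> R by rewrite /delta; field; rewrite gt_eqF //; lra.
rewrite /distortion -expRM_natl -[leRHS]lnK ?posrE // ler_expR natrM.
rewrite (_ : _ * _ = 8 * (n%:R * delta n)); last ring.
by rewrite E8 ler_pdivrMr //; lra.
Qed.

Section Exponents.
Variables (al sg : R).
Hypotheses (al1 : 1 < al) (sg0 : 0 < sg).

Let s := sg / al ^+ 2 * ln al.
Let A0 : 0 < ln al. Proof. by have h := al1; rewrite ln_gt0. Qed.
Let s0 : 0 < s.
Proof. by rewrite mulr_gt0 // divr_gt0 // exprn_gt0 //; have := al1; lra. Qed.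
Let epsE n : ln_eps_max al sg n = ln_theta al - s * n%:R.
Proof. by rewrite /ln_eps_max /s; ring. Qed.

Lemma eventually_eps_le (e : R) : 0 < e -> eventually (fun n => expR (ln_eps_max al sg n) <= e).
Proof.
move=> e0; apply: eventuallyW (eventually_affine_le (ln_theta al - ln e) s0) => n h.
by rewrite epsE -[leRHS]lnK ?posrE // ler_expR; lra.
Qed.

Lemma eventually_eps_power :
  eventually (fun n => (1 + 4 * expR (ln_eps_max al sg n) `^ (1 - al^-1)) ^+ (2 * n) <= 2).
Proof.
have ia : 0 < 1 - al^-1 by rewrite subr_gt0 invf_lt1 ?al1 //; have := al1; lra.
have s2 : 0 < (1 - al^-1) * s by rewrite mulr_gt0.
have ln28 : 0 < ln 2 / 8 :> R by rewrite divr_gt0 // ln_gt0 // ltr1n.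
apply: eventuallyW (eventually_exp_le ((1 - al^-1) * ln_theta al) s2 ln28) => n h.
rewrite epsE /powR gt_eqF ?expR_gt0 // expRK.
have -> : (1 - al^-1) * (ln_theta al - s * n%:R) = (1 - al^-1) * ln_theta al - (1 - al^-1) * s * n%:R by ring.
move: h; set u := expR _ => h; have u0 : 0 < u by exact: expR_gt0.
have : (1 + 4 * u) ^+ (2 * n) <= expR (4 * u) ^+ (2 * n).
  apply: lerXn2r; rewrite ?nnegrE ?expR_ge0 ?expR_ge1Dx //; lra.
move/le_trans; apply; rewrite -expRM_natl -[leRHS]lnK ?posrE // ler_expR natrM; lra.
Qed.

(** ln delta = - 2 ln n is sublinear, whereas [ln_eps_max] decreases linearly in n. *)
Lemma eventually_koebe K : eventually (fun n => sg * ln_eps_max al sg n + K <=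
  - ((al - 1) * (ln 16 - ln (delta n)))).
Proof.
have k0 : 0 < sg * s / (4 * (al - 1)) by rewrite divr_gt0 // mulr_gt0 //; have := al1; lra.
have ss : 0 < sg * s / 2 by rewrite divr_gt0 // mulr_gt0.
apply: eventuallyW (eventually_and (eventually_ln_le k0) (eventually_and (eventually_ge 1)
  (eventually_affine_le (sg * ln_theta al + K + (al - 1) * ln 16) ss))) => n [h1 [n1 h2]].
have n0 : 0 < n%:R :> R by lra.
have -> : ln (delta n) = - (2 * ln n%:R) :> R.
  by rewrite /delta div1r lnXn ?invr_gt0 // lnV ?posrE // mulr2n; ring.
rewrite epsE; move: h1; rewrite mulrAC ler_pdivlMr; last by rewrite mulr_gt0 //; have := al1; lra.
lra.
Qed.

End Exponents.

Lemma eventually_start (al e : R) : 1 < al -> 0 < e -> eventually (fun n =>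
  (al ^+ 2 * ln_eps_crude al n + (2 * al + 1) * ln 2) / (al ^+ 2 - 1) / al ^+ n.-1
    + 4 * delta n / (al - 1) <= e).
Proof.
move=> al1 e0; have al0 : 0 < al by lra.
have A0 : 0 < ln al by rewrite ln_gt0.
have ln2 : 0 < ln 2 :> R by rewrite ln_gt0 // ltr1n.
have ln32 : 0 <= ln 32 :> R by rewrite ln_ge0 // ler1n.
have a1 : 0 < al - 1 by lra.
set Q := al ^+ 2 - 1.
have Q0 : 0 < Q by rewrite /Q expr2 -[X in _ - X]mulr1 subr_gt0 ltr_pM //; lra.
pose C1 := ln 2 + ln 32 / (al - 1) : R.
pose C2 := (2 / (al - 1) + 1 / al) * ln al.
have crude n : ln_eps_crude al n = C1 + C2 * n%:R.
  by rewrite /ln_eps_crude /C1 /C2; field; rewrite !gt_eqF.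
have C10 : 0 <= C1 by rewrite addr_ge0 ?divr_ge0 // ltW.
have C20 : 0 <= C2 by rewrite mulr_ge0 ?addr_ge0 ?divr_ge0 // ltW.
move: C1 C2 crude C10 C20 => C1 C2 crude C10 C20.
pose C3 := (2 * al + 1) * ln 2; have C30 : 0 < C3 by rewrite mulr_gt0 //; lra.
(* For n >= 1 the affine numerator is at most n times its value at 1; the last factor al turns al^(n
   - 1) into al^n, leaving C n / al^n. *)
pose C := (al ^+ 2 * (C1 + C2) + C3) / Q * al.
have a2 : 0 <= al ^+ 2 * (C1 + C2) by apply: mulr_ge0; [exact: sqr_ge0|exact: addr_ge0].
have C0 : 0 < C by rewrite mulr_gt0 ?divr_gt0 //; lra.
have stC : 0 < e / 2 / C by rewrite !divr_gt0.
have k8 : 0 < 4 / (al - 1) by rewrite divr_gt0.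
have e2 : 0 < e / 2 by rewrite divr_gt0.
apply: eventuallyW (eventually_and (eventually_exp_le 0 A0 stC)
  (eventually_and (eventually_delta k8 e2) (eventually_ge 1))) => n [h7 [h8 n1]].
have n1' : (0 < n)%N by rewrite -(ler_nat R).
have E : al ^+ n.-1 = al ^+ n / al by rewrite -{2}(prednK n1') exprSr mulfK // gt_eqF.
have EX : al ^+ n = expR (ln al * n%:R) by rewrite mulrC expRM_natl lnK.
rewrite crude -/C3; set X := expR (ln al * n%:R) in EX; have X0 : 0 < X by exact: expR_gt0.
rewrite sub0r expRN -/X in h7.
have t1 : (al ^+ 2 * (C1 + C2 * n%:R) + C3) / Q / al ^+ n.-1 <= C * (n%:R / X).
  rewrite E EX (_ : C * _ = (al ^+ 2 * (C1 + C2) + C3) * n%:R / Q / (X / al)); last first.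
    by rewrite /C; field; rewrite !gt_eqF.
  rewrite ler_pM2r ?invr_gt0 ?divr_gt0 // ler_pM2r ?invr_gt0 //.
  have n1'' : 0 <= n%:R - 1 :> R by lra.
  have t : 0 <= al ^+ 2 * C1 * (n%:R - 1) by apply: mulr_ge0 n1''; apply: mulr_ge0 C10; exact: sqr_ge0.
  have t' : 0 <= C3 * (n%:R - 1) by apply: mulr_ge0 n1''; exact: ltW.
  move: t t'; clear; lra.
have t2 : C * (n%:R / X) <= e / 2 by rewrite mulrC -ler_pdivlMr.
have t3 : 4 * delta n / (al - 1) = 4 / (al - 1) * delta n by ring.
by rewrite t3; move: t1 t2 h8; clear; lra.
Qed.

Lemma large_b0_eventually (al sg be : R) : 1 < al -> 0 < sg < 1 -> 0 < be ->
  eventually (large_b0 al sg be).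
Proof.
move=> al1 /andP[sg0 sg1] be0; have al0 : 0 < al by lra.
have A0 : 0 < ln al by rewrite ln_gt0.
have ep0 : 0 < 4^-1 `^ al / 2 :> R by rewrite divr_gt0 // powR_gt0.
have st0 : 0 < 2^-1 `^ al / 4 :> R by rewrite divr_gt0 // powR_gt0.
have be1 : 0 < be * ln al by rewrite mulr_gt0.
have sA : 0 < sg / al * ln al by rewrite mulr_gt0 ?divr_gt0.
have [B HB] := eventually_and (eventually_ge (2 : R)) (eventually_and (eventually_half al1)
  (eventually_and (eventually_escape al1) (eventually_and (@eventually_distortion (1 / 6) ltac:(lra))
  (eventually_and eventually_distortion_power (eventually_and (eventually_eps_le al1 sg0 ep0)
  (eventually_and (eventually_eps_power al1 sg0) (eventually_and (eventually_start al1 st0)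
  (eventually_and (eventually_affine_le (geometry_const al + ln 16 + 1) sA)
  (eventually_and (eventually_koebe al1 sg0 (geometry_const al))
    (eventually_affine_le (sg * ln_theta al + geometry_const al + ln 64 + al * ln 2) be1)))))))))).
exists B => n /HB[h0 [h1 [h2 [h3 [h4 [h5 [h6 [h7 [h8 [h9 h10]]]]]]]]]].
split=> //.
- by rewrite -(ler_nat R).
- by move: h3; clear; lra.
- by move: h8; clear; lra.
- by move: h10; clear; lra.
Qed.

End LargeParameter.

Section Assembly.
Context {R : realType}.

Lemma Lk0 k (f : lorenz R) : Lk k f -> Lk 0 f.
Proof.
have D phi : orientation_preserving_diffeo k phi -> orientation_preserving_diffeo 0 (phi : R -> R).
  have C A g : Ck_on k A g -> Ck_on 0 A (g : R -> R).
    by move=> [_ h]; split=> // i i0; apply: h; exact: leq_trans i0 _.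
  by move=> [h1 h2 h3 [g [h4 h5 h6 h7]]]; split=> //; [exact: C|exists g; split=> //; exact: C].
by move=> [h1 h2 h3 h4 h5]; split=> //; exact: D.
Qed.

Lemma geometry_const_gt0 (al : R) : 1 < al -> 0 < geometry_const al.
Proof.
move=> al1; have l n : (0 < n)%N -> 0 <= ln n%:R :> R by move=> n0; rewrite ln_ge0 // ler1n.
have := ln_ge0 (x := 2 * al) ltac:(lra); have := l 2%N isT; have := l 4%N isT; have := l 3%N isT.
have : 0 < ln 64 :> R by rewrite ln_gt0 // ltr1n.
rewrite /geometry_const => l64 l3 l4 l2 lal.
have t1 : 0 <= 2 * al * ln (2 * al) by apply: mulr_ge0 => //; lra.
have t2 : 0 <= (al + 1) * ln 2 by apply: mulr_ge0 => //; lra.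
have t3 : 0 <= 2 * al * ln 4 by apply: mulr_ge0 => //; lra.
have t4 : 0 <= al * ln 2 by apply: mulr_ge0 => //; lra.
lra.
Qed.

End Assembly.

Theorem theorem5p3 (R : realType) (al sg be : R)
  (hal : 1 < al)
  (hsg : 0 < sg < 1)
  (ha : exists a : nat, al + sg <= a.+1%:R <= 2 * al - sg)
  (hbe : 0 < be < (sg / al) ^+ 2) :
  exists th : R, 1 < th /\
  exists B : nat, forall b0 : nat, (B <= b0)%N ->
  forall w : nat -> nat * nat, (forall n, Omega al sg be b0 (w n)) ->
  forall f : lorenz R, LS_type al w f -> calK al sg th b0 f ->
  let Lam := attractor al f in
  [/\ cantor_set Lam,
      (@lebesgue_measure R).-negligible Lam,
      (0 < hausdorff_dim Lam < 1)%E &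
      (@lebesgue_measure R).-negligible (`[0, 1] `\` basin al f Lam)].
Proof.
have al0 : 0 < al by lra.
have [B HB] := large_b0_eventually hal hsg (proj1 (andP hbe)).
(* This theta turns the upper bound in [calK] into exactly [ln_eps_max], the bound that one
   renormalization reproduces. *)
exists (expR (ln_theta al)); split.
  rewrite -expR0 ltr_expR divr_gt0 // addr_gt0 ?geometry_const_gt0 // ln_gt0 // ltr1n //.
exists B => b0 /HB LG w OM f [fS fN [F [F0 FR]]]; subst f => -[f1 /andP[eL eU] D0 D1] Lam.
have FP n : Lk 0 (F n) /\ nontrivial al (F n).
  elim: n => [|n [h1 h2]]; first by split=> //; exact: Lk0 f1.
  have := FR n; rewrite (surjective_pairing (w n)) => h.
  by have [h3 h4 _] := monotone_renormalizationP al0 h1 h2 h.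
have /choice[pq RN] : forall n, exists pq : R * R, renormalizes (lc (F n)) (left_branch al (F n))
    (right_branch al (F n)) (w n).1 (w n).2 pq.1 pq.2 (lc (F n.+1)) (left_branch al (F n.+1))
    (right_branch al (F n.+1)).
  move=> n; have [h1 h2] := FP n; have := FR n; rewrite {1}(surjective_pairing (w n)) => h.
  by have [_ _ [p [q RNn]]] := monotone_renormalizationP al0 h1 h2 h; exists (p, q).
have LP n : lorenz_pair (lc (F n)) (left_branch al (F n)) (right_branch al (F n)).
  by have [h1 h2] := FP n; exact: (lorenz_pairP al0 h1 h2).
have [c0 c1] : 0 < lc (F 0%N) /\ lc (F 0%N) < 1 by case: f1 => _ _ /andP[].
have e0 : 0 < 1 - lc (F 0%N) by rewrite subr_gt0.
have [E0 E1] := LS_cross_expanding hal fS fN.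
have [[mu mu0 PS0] [nu nu0 PS1]] := initial_power_slopes al0 (ltn0Sn 0) f1 fN D0 D1.
have fl x : 0 <= x < lc (F 0%N) -> lmap al (F 0%N) x = left_branch al (F 0%N) x by move=> /andP[_ /lmap_left ->].
have fr x : lc (F 0%N) < x <= 1 -> lmap al (F 0%N) x = right_branch al (F 0%N) x by move=> /andP[/lmap_right -> _].
have powE (t : R) : al `^ t = expR (t * ln al) by rewrite /powR gt_eqF.
have eps_max0 : ln (1 - lc (F 0%N)) <= ln_eps_max al sg b0.
  rewrite -ler_expR lnK ?posrE //; apply: (le_trans eU).
  by rewrite powE -expRD ler_expR /ln_eps_max mulNr.
have eps_min0 : ln_eps_min al b0 <= ln (1 - lc (F 0%N)).
  by rewrite -ler_expR lnK ?posrE //; apply: le_trans eL; rewrite powE ler_expR /ln_eps_min mulNr.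
have OM' n : Omega al sg be b0 ((w n).1, (w n).2) by rewrite -surjective_pairing.
have [hC hN hH] := tower_attractor hal hsg hbe LG LP RN OM' E0 E1 mu0 PS0 nu0 PS1 fl fr eps_max0 eps_min0.
have hB := tower_basin_null hal hsg hbe LG LP RN OM' E0 E1 mu0 PS0 nu0 PS1 fl fr eps_max0 eps_min0.
have LamE : Lam = closure (forward_orbit al (F 0%N) (left_branch al (F 0%N) (lc (F 0%N))) `|`
    forward_orbit al (F 0%N) (right_branch al (F 0%N) (lc (F 0%N)))).
  by rewrite /Lam /attractor (crit_leftP al0 f1) (crit_rightP al0 f1).
rewrite LamE; split=> //; first exact: lebesgue_null_negligible.
apply/lebesgue_null_negligible/(lebesgue_nullS _ hB) => x [xI xB].
split; first by move: xI; rewrite /= in_itv.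
by move=> [xc xL]; apply: xB; split=> //; rewrite inE.
Qed.
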